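(* Let $(M^8,g,\Phi)$ be a complete, simply connected $\mathrm{Spin}(7)$-manifold with non-zero parallel characteristic torsion, $\nabla^c\mathrm{T}^c=0$, and $\mathfrak{iso}(\mathrm{T}^c)=\mathfrak{u}(2)$. Suppose that the torsion form is of type $II$. Then $M^8$ is isometric to the Riemannian product of $\mathbb{R}$ with an integrable $\mathrm{G}_2$-manifold with parallel characteristic torsion and characteristic holonomy contained in $\mathfrak{u}(2)$.
   Context: On $\mathbb{R}^8$ with oriented orthonormal basis $(e_1,\dots,e_8)$ (vectors and covectors identified, $e_{i_1\ldots i_m}=e_{i_1}\wedge\dots\wedge e_{i_m}$) put $Z=e_{12}+e_{34}+e_{56}$, $D=e_{246}-e_{235}-e_{145}-e_{136}$, $\phi=(Z\wedge e_7+D)\wedge e_8$ and $\Phi=\phi+\ast\phi$. $\mathrm{Spin}(7)\subset\mathrm{SO}(8)$ is the isotropy group of the $4$-form $\Phi$. A $\mathrm{Spin}(7)$-manifold $(M^8,g,\Phi)$ is a Riemannian $8$-manifold with a $4$-form $\Phi$ such that at every point there is an oriented orthonormal frame (adapted frame) in which $\Phi$ has this form. It admits a unique metric connection $\nabla^c$ (the characteristic connection) with totally skew-symmetric torsion $\mathrm{T}^c\in\Lambda^3$ (the characteristic torsion), i.e. $g(\nabla^c_XY,W)=g(\nabla^g_XY,W)+\frac12\mathrm{T}^c(X,Y,W)$ with $\nabla^g$ the Levi-Civita connection, such that $\nabla^c\Phi=0$. $\mathfrak{iso}(\mathrm{T}^c)\leqslant\mathfrak{spin}(7)$ is the isotropy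 algebra of $\mathrm{T}^c$ (at a point, with respect to an adapted frame); equalities and inclusions of subalgebras of $\mathfrak{spin}(7)$ are meant up to conjugation, i.e. for suitable adapted frames. $2$-forms $e_{ij}$ are identified with elements of $\mathfrak{so}(8)$. With $P_5=e_{13}+e_{24}$, $P_6=e_{14}-e_{23}$, $P_7=e_{12}-e_{34}$, $P_8=e_{34}-e_{56}$, the algebra is $\mathfrak{u}(2)=\mathrm{span}(P_7+2P_8,\,P_5,\,P_6,\,P_7)<\mathfrak{su}(3)<\mathfrak{spin}(7)$. Torsion type $II$ (for this isotropy algebra) means that in suitable adapted frames $$\mathrm{T}^c=a_1\Big((Z_1-2Z_2)\wedge e_8+\tfrac74\bar D\Big)+a_2\Big((Z_1-2Z_2)\wedge e_7+\tfrac74 D\Big)+b_1\,(Z_1-2Z_2)\wedge e_7$$ with constants $a_1,a_2,b_1\in\mathbb{R}$, $b_1>0$, where $Z_1=e_{12}+e_{34}$, $Z_2=e_{56}$, $\bar D=-e_{135}+e_{245}+e_{146}+e_{236}$; the condition $\mathfrak{iso}(\mathrm{T}^c)=\mathfrak{u}(2)$ excludes the cases $a_1=0,\ b_1=\frac34a_2$ and $a_1=0,\ b_1=-a_2$. A $\mathrm{G}_2$-manifold is a Riemannian $7$-manifold with a $3$-form $\omega$ that is, in suitable oriented orthonormal frames $(e_1,\dots,e_7)$, equal to $Z\wedge e_7+D$. It is integrable if $d\ast\omega=\vartheta\wedge\ast\omega$ for some $1$-form $\vartheta$; equivalently, there is a (then unique) metric connection with totally skew-symmetric torsion preserving $\omega$,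 called the characteristic connection. Its torsion is the characteristic torsion, called parallel if it is parallel for this connection, and its holonomy algebra is the characteristic holonomy. *)

(* Defs.v *)
From HB Require Import structures.
From mathcomp Require Import all_boot all_order all_fingroup all_algebra.
From mathcomp Require Import all_classical all_reals all_analysis.
Import Order.TTheory GRing.Theory Num.Theory.
Import numFieldNormedType.Exports.

Set Implicit Arguments.
Unset Strict Implicit.
Unset Printing Implicit Defensive.

Local Open Scope classical_set_scope.
Local Open Scope ring_scope.

(* Vectors are row vectors.  A covariant k-tensor is given by its components
    [t I = t(b_(I 0), ..., b_(I (k-1)))] with respect to a basis [b]; frames are
    square matrices whose rows are the frame vectors. *)

Definition cov (R : realType) (n k : nat) : Type :=
  {ffun {ffun 'I_k -> 'I_n} -> R^o}.

Section Algebra.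
Context {R : realType}.

Definition pull m n k (A : 'M[R]_(m, n)) (t : cov R n k) : cov R m k :=
  [ffun I : {ffun 'I_k -> 'I_m} => \sum_(J : {ffun 'I_k -> 'I_n}) (\prod_p A (I p) (J p)) * t J].

Definition alternating n k (t : cov R n k) : Prop :=
  forall (s : 'S_k) (I : {ffun 'I_k -> 'I_n}),
    t [ffun p => I (s p)] = (-1) ^+ s * t I.

Definition wedge n k l (a : cov R n k) (b : cov R n l) : cov R n (k + l) :=
  [ffun I : {ffun 'I_(k + l) -> 'I_n} => (k`! * l`!)%:R^-1 *
    \sum_(s : 'S_(k + l)) (-1) ^+ s
      * a [ffun p => I (s (lshift l p))] * b [ffun q => I (s (rshift k q))]].

(* e_(i_1 ... i_k) = e_(i_1) /\ ... /\ e_(i_k), with indices counted from 1 *)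
Definition e n k (s : k.-tuple nat) : cov R n k :=
  [ffun I : {ffun 'I_k -> 'I_n} => \det (\matrix_(a < k, b < k) ((I a).+1 == tnth s b)%:R)].

(* sign of the sequence I, J as a permutation of 'I_(k + l), and 0 if it is not
   one *)
Definition levi_civita_symbol k l (I : {ffun 'I_k -> 'I_(k + l)})
    (J : {ffun 'I_l -> 'I_(k + l)}) : R :=
  \det (\matrix_(a < k + l, b < k + l)
    ((match fintype.split a with inl p => I p | inr q => J q end) == b)%:R).

(* Hodge star of the metric with Gram matrix m in a positively oriented basis *)
Definition hodge k l (m : 'M[R]_(k + l)) (t : cov R (k + l) k) :
    cov R (k + l) l :=
  [ffun J : {ffun 'I_l -> 'I_(k + l)} => Num.sqrt (\det m) / (k`!)%:R *
    \sum_(I : {ffun 'I_k -> 'I_(k + l)})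
      levi_civita_symbol I J * pull (invmx m) t I].

Definition subst_index n k (I : {ffun 'I_k -> 'I_n}) (p : 'I_k) (j : 'I_n) :
    {ffun 'I_k -> 'I_n} :=
  [ffun q => if q == p then j else I q].

(* Up to a sign that is the same for all A, the derivative at 0 of the action
   of exp(sA) on k-forms, for A in so(n). *)
Definition act n k (A : 'M[R]_n) (t : cov R n k) : cov R n k :=
  [ffun I : {ffun 'I_k -> 'I_n} => \sum_(p < k) \sum_(j < n) A (I p) j * t (subst_index I p j)].

Definition so n : set 'M[R]_n := [set A | A^T = - A].

Definition so_of_form n (t : cov R n 2) : 'M[R]_n :=
  \matrix_(a, b) t [ffun p => tnth [tuple a; b] p].

Definition Z1 n : cov R n 2 := e n [tuple 1; 2]%N + e n [tuple 3; 4]%N.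
Definition Z2 n : cov R n 2 := e n [tuple 5; 6]%N.
Definition Z n : cov R n 2 :=
  e n [tuple 1; 2]%N + e n [tuple 3; 4]%N + e n [tuple 5; 6]%N.
Definition D n : cov R n 3 :=
  e n [tuple 2; 4; 6]%N - e n [tuple 2; 3; 5]%N
  - e n [tuple 1; 4; 5]%N - e n [tuple 1; 3; 6]%N.
Definition Dbar n : cov R n 3 :=
  - e n [tuple 1; 3; 5]%N + e n [tuple 2; 4; 5]%N
  + e n [tuple 1; 4; 6]%N + e n [tuple 2; 3; 6]%N.

Definition g2_form n : cov R n 3 :=
  (wedge (Z n) (e n [tuple 7]%N) : cov R n 3) + D n.

Definition spin7_phi : cov R 8 4 := wedge (g2_form 8) (e 8 [tuple 8]%N).

Definition spin7_form : cov R 8 4 :=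
  spin7_phi + (@hodge 4 4 1%:M spin7_phi : cov R 8 4).

Definition spin7 : set 'M[R]_8 := [set A | so A /\ act A spin7_form = 0].

Definition P5 n : cov R n 2 := e n [tuple 1; 3]%N + e n [tuple 2; 4]%N.
Definition P6 n : cov R n 2 := e n [tuple 1; 4]%N - e n [tuple 2; 3]%N.
Definition P7 n : cov R n 2 := e n [tuple 1; 2]%N - e n [tuple 3; 4]%N.
Definition P8 n : cov R n 2 := e n [tuple 3; 4]%N - e n [tuple 5; 6]%N.

(* Used for n = 8 (inside spin(7)) and for n = 7 (inside g_2). *)
Definition u2 n : {vspace 'M[R]_n} :=
  <<[:: so_of_form (P7 n + 2 *: P8 n)%R; so_of_form (P5 n);
        so_of_form (P6 n); so_of_form (P7 n)]>>%VS.

Definition typeII_form (a1 a2 b1 : R) : cov R 8 3 :=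
  let W := Z1 8 - 2 *: Z2 8 in
  a1 *: ((wedge W (e 8 [tuple 8]%N) : cov R 8 3) + (7 / 4) *: Dbar 8)
  + a2 *: ((wedge W (e 8 [tuple 7]%N) : cov R 8 3) + (7 / 4) *: D 8)
  + b1 *: (wedge W (e 8 [tuple 7]%N) : cov R 8 3).

End Algebra.

Section Smooth.
Context {R : realType} {V W : normedModType R}.

Fixpoint Ck (k : nat) (U : set V) (f : V -> W) : Prop :=
  match k with
  | 0 => forall x, U x -> {for x, continuous f}
  | k'.+1 => (forall x, U x -> differentiable f x) /\
             forall v, Ck k' U (fun x => 'D_v f x)
  end.

(* meant for open U *)
Definition smooth_on (U : set V) (f : V -> W) : Prop := forall k, Ck k U f.

End Smooth.

(* The values of [cmap i] outside [dom i], and of [cinv i] outside the image of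
   [cmap i], are irrelevant. *)
Record atlas (R : realType) (n : nat) := Atlas {
  carrier :> topologicalType;
  chart : Type;
  dom : chart -> set carrier;
  cmap : chart -> carrier -> 'rV[R]_n;
  cinv : chart -> 'rV[R]_n -> carrier }.

Section Manifold.
Context {R : realType} {n : nat}.
Implicit Types M N : atlas R n.

Definition img M (i : chart M) : set 'rV[R]_n := cmap i @` dom i.

Definition trans M (i j : chart M) : 'rV[R]_n -> 'rV[R]_n := cmap j \o cinv i.

Definition overlap M (i j : chart M) : set 'rV[R]_n :=
  cmap i @` (dom i `&` dom j).

Record oriented_manifold M : Prop := {
  manifold_hausdorff : hausdorff_space M;
  manifold_second_countable : @second_countable M;
  dom_open : forall i : chart M, open (dom i);
  img_open : forall i : chart M, open (img i);
  dom_cover : forall p : M, exists i : chart M, dom i p;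
  cmapK : forall (i : chart M) p, dom i p -> cinv i (cmap i p) = p;
  cmap_continuous : forall i : chart M, {in dom i, continuous (cmap i)};
  cinv_continuous : forall i : chart M, {in img i, continuous (cinv i)};
  trans_smooth : forall i j : chart M, smooth_on (overlap i j) (trans i j);
  trans_oriented : forall (i j : chart M) x, overlap i j x ->
    0 < \det ('J (trans i j) x) }.

(* Tensor fields are families of component functions, one per chart, related by
   the classical transformation law; ['J f x] acts on row vectors, so its rows
   are the images of the coordinate vectors. *)
Definition tensor M k := chart M -> 'rV[R]_n -> cov R n k.

Definition tensor_field M k (S : tensor M k) : Prop :=
  (forall i I, smooth_on (img i) (fun x => S i x I : R)) /\
  (forall i j x, overlap i j x ->
     S i x = pull ('J (trans i j) x) (S j (trans i j x))).

Definition form_field M k (S : tensor M k) : Prop :=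
  tensor_field S /\ forall i x, img i x -> alternating (S i x).

Definition metric M := chart M -> 'rV[R]_n -> 'M[R]_n.

Record riemannian M (g : metric M) : Prop := {
  metric_smooth : forall i, smooth_on (img i) (g i);
  metric_sym : forall i x, img i x -> (g i x)^T = g i x;
  metric_pos : forall i x, img i x -> forall v : 'rV[R]_n, v != 0 ->
    0 < (v *m g i x *m v^T) 0 0;
  metric_trans : forall i j x, overlap i j x ->
    g i x = 'J (trans i j) x *m g j (trans i j x) *m ('J (trans i j) x)^T }.

Definition partial (W : normedModType R) (a : 'I_n) (f : 'rV[R]_n -> W) x : W :=
  'D_(delta_mx 0 a) f x.

(* [G i x a b c] is the component along d_c of nabla_(d_a) d_b *)
Definition connection M :=
  chart M -> 'rV[R]_n -> 'I_n -> 'I_n -> 'I_n -> R.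

Definition levi_civita M (g : metric M) : connection M := fun i x a b c =>
  \sum_(l < n) 2^-1 * (partial a (fun y => g i y b l) x
                       + partial b (fun y => g i y a l) x
                       - partial l (fun y => g i y a b) x) * invmx (g i x) l c.

(* g(nabla_X Y, W) = g(nabla^g_X Y, W) + 1/2 T(X, Y, W) *)
Definition skew_connection M (g : metric M) (T : tensor M 3) : connection M :=
  fun i x a b c => levi_civita g i x a b c
    + \sum_(l < n) 2^-1 * T i x [ffun p => tnth [tuple a; b; l] p]
                   * invmx (g i x) l c.

Definition cov_deriv M k (G : connection M) (S : tensor M k) i x (a : 'I_n)
    (I : {ffun 'I_k -> 'I_n}) : R :=
  partial a (fun y => S i y I : R) x
  - \sum_(p < k) \sum_(c < n) G i x a (I p) c * S i x (subst_index I p c).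

Definition parallel M k (G : connection M) (S : tensor M k) : Prop :=
  forall i x, img i x -> forall a I, cov_deriv G S i x a I = 0.

(* T is the (unique) 3-form such that the metric connection with torsion T
   preserves the tensor S defining the G-structure. *)
Definition characteristic_torsion M k (g : metric M) (S : tensor M k)
    (T : tensor M 3) : Prop :=
  form_field T /\ parallel (skew_connection g T) S.

Definition oriented_orthonormal (m E : 'M[R]_n) : Prop :=
  E *m m *m E^T = 1%:M /\ 0 < \det E.

Definition adapted_frame M k (g : metric M) (S : tensor M k) (t : cov R n k)
    i x (E : 'M[R]_n) : Prop :=
  oriented_orthonormal (g i x) E /\ pull E (S i x) = t.

Definition G_structure M k (g : metric M) (S : tensor M k) (t : cov R n k) :
    Prop :=
  form_field S /\
  forall i x, img i x -> exists E, adapted_frame g S t i x E.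

Definition ext_deriv M k (S : tensor M k) : tensor M k.+1 := fun i x =>
  [ffun I : {ffun 'I_k.+1 -> 'I_n} => \sum_(p < k.+1) (-1) ^+ p *
     partial (I p) (fun y => S i y [ffun q => I (lift p q)] : R) x].

Definition geodesic M (G : connection M) (c : R -> M) : Prop :=
  continuous c /\
  forall (i : chart M) t, dom i (c t) ->
    let u := cmap i \o c in
    [/\ derivable u t 1, derivable (derive1 u) t 1 &
        forall k, derive1 (derive1 u) t 0 k
          + \sum_(a < n) \sum_(b < n)
              G i (u t) a b k * derive1 u t 0 a * derive1 u t 0 b = 0].

Definition complete_metric M (g : metric M) : Prop :=
  forall (i : chart M) p (v : 'rV[R]_n), dom i p ->
    exists c : R -> M,
      [/\ geodesic (levi_civita g) c, c 0 = p & derive1 (cmap i \o c) 0 = v].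

(* [transport G i x j y A]: parallel translation along some piecewise smooth
   curve maps the vector with components w at the point x of chart i to the
   vector with components [w *m A] at the point y of chart j.  Such a curve is a
   concatenation of smooth curves that each lie in one chart. *)
Inductive transport M (G : connection M) :
    chart M -> 'rV[R]_n -> chart M -> 'rV[R]_n -> 'M[R]_n -> Prop :=
  | transport_chart i j x : overlap i j x ->
      transport G i x j (trans i j x) ('J (trans i j) x)
  | transport_curve i (u : R -> 'rV[R]_n) (V : R -> 'M[R]_n) :
      smooth_on setT u ->
      (forall t, 0 <= t <= 1 -> img i (u t)) ->
      V 0 = 1%:M ->
      (forall t : R, 0 <= t <= 1 -> is_derive t 1 V
         (- (V t *m \matrix_(b, c) \sum_(a < n) derive1 u t 0 a * G i (u t) a b c))) ->
      transport G i (u 0) i (u 1) (V 1)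
  | transport_comp i x j y k z A B :
      transport G i x j y A -> transport G j y k z B ->
      transport G i x k z (A *m B).

Definition holonomy_group M (G : connection M) i x : set 'M[R]_n :=
  [set A | transport G i x i x A].

(* velocities of the one-parameter subgroups of the holonomy group *)
Definition holonomy_algebra M (G : connection M) i x : set 'M[R]_n :=
  [set B | exists c : R -> 'M[R]_n,
     [/\ c 0 = 1%:M, forall s t, c (s + t) = c s *m c t,
         is_derive (0 : R) 1 c B & forall t, holonomy_group G i x (c t)]].

Definition local_rep M N (f : M -> N) (i : chart M) (j : chart N) :
    'rV[R]_n -> 'rV[R]_n :=
  cmap j \o f \o cinv i.

Definition rep_dom M N (f : M -> N) (i : chart M) (j : chart N) :
    set 'rV[R]_n :=
  cmap i @` (dom i `&` f @^-1` dom j).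

Definition smooth_map M N (f : M -> N) : Prop :=
  continuous f /\ forall i j, smooth_on (rep_dom f i j) (local_rep f i j).

Definition isometric M (g : metric M) N (h : metric N) : Prop :=
  exists (f : M -> N) (f' : N -> M),
    [/\ cancel f f', cancel f' f, smooth_map f, smooth_map f' &
        forall i j x, rep_dom f i j x ->
          let J := 'J (local_rep f i j) x in
          g i x = J *m h j (local_rep f i j x) *m J^T].

End Manifold.

Section SimplyConnected.
Context {R : realType}.

Definition unit_interval : set R := [set t | 0 <= t <= 1].

Definition path_connected (X : topologicalType) : Prop :=
  forall p q : X, exists c : R -> X,
    [/\ {within unit_interval, continuous c}, c 0 = p & c 1 = q].

Definition simply_connected (X : topologicalType) : Prop :=
  path_connected X /\
  forall c : R -> X, {within unit_interval, continuous c} -> c 0 = c 1 ->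
    exists H : R * R -> X,
      [/\ {within unit_interval `*` unit_interval, continuous H},
          forall t, unit_interval t -> H (0, t) = c t,
          forall t, unit_interval t -> H (1, t) = c 0 &
          forall s, unit_interval s -> H (s, 0) = c 0 /\ H (s, 1) = c 0].

End SimplyConnected.

Section Product.
Context {R : realType}.

Definition line : atlas R 1 :=
  @Atlas R 1 (R : topologicalType) unit (fun _ => setT)
    (fun _ t => const_mx t) (fun _ x => x 0 0).

Definition line_metric : metric line := fun _ _ => 1%:M.

Definition prod_atlas m n (M : atlas R m) (N : atlas R n) : atlas R (m + n) :=
  @Atlas R (m + n) (M * N)%type (chart M * chart N)%type
    (fun k => dom k.1 `*` dom k.2)
    (fun k p => row_mx (cmap k.1 p.1) (cmap k.2 p.2))
    (fun k x => (cinv k.1 (lsubmx x), cinv k.2 (rsubmx x))).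

Definition prod_metric m n (M : atlas R m) (N : atlas R n) (g : metric M)
    (h : metric N) : metric (prod_atlas M N) :=
  fun k x => block_mx (g k.1 (lsubmx x)) 0 0 (h k.2 (rsubmx x)).

End Product.

Section Special.
Context {R : realType}.

Definition spin7_manifold (M : atlas R 8) (g : metric M) (Phi : tensor M 4) :
    Prop :=
  [/\ oriented_manifold M, riemannian g & G_structure g Phi spin7_form].

(* iso(T) = u(2), in suitable adapted frames *)
Definition iso_eq_u2 (M : atlas R 8) (g : metric M) (Phi : tensor M 4)
    (T : tensor M 3) : Prop :=
  forall i x, img i x -> exists2 E : 'M[R]_8,
    adapted_frame g Phi spin7_form i x E &
    [set A | spin7 A /\ act A (pull E (T i x)) = 0] = [set A | A \in u2 8].

Definition torsion_typeII (M : atlas R 8) (g : metric M) (Phi : tensor M 4)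
    (T : tensor M 3) : Prop :=
  exists a1 a2 b1 : R, 0 < b1 /\
    forall i x, img i x -> exists2 E : 'M[R]_8,
      adapted_frame g Phi spin7_form i x E &
      pull E (T i x) = typeII_form a1 a2 b1.

Definition g2_manifold (N : atlas R 7) (h : metric N) (omega : tensor N 3) :
    Prop :=
  [/\ oriented_manifold N, riemannian h & G_structure h omega (g2_form 7)].

Definition star3 (N : atlas R 7) (h : metric N) (omega : tensor N 3) :
    tensor N 4 :=
  fun i x => @hodge R 3 4 (h i x) (omega i x).

Definition g2_integrable (N : atlas R 7) (h : metric N) (omega : tensor N 3) :
    Prop :=
  exists2 theta : tensor N 1, form_field theta &
    forall i x, img i x ->
      ext_deriv (star3 h omega) i x
      = (wedge (theta i x) (star3 h omega i x) : cov R 7 5).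

(* In the frame E, the endomorphism [w |-> w *m B] has matrix
   [E *m B *m invmx E]. *)
Definition holonomy_in_u2 (N : atlas R 7) (h : metric N) (omega : tensor N 3)
    (G : connection N) : Prop :=
  forall i x, img i x -> exists2 E : 'M[R]_7,
    adapted_frame h omega (g2_form 7) i x E &
    forall B, holonomy_algebra G i x B -> E *m B *m invmx E \in u2 7.

End Special.

(* Main.v *)
(** The torsion form of type II has a one-dimensional kernel at every point; as
    [T] is parallel and the unit kernel vector satisfies [ins T X = 0], it is
    parallel for the Levi-Civita connection. Monodromy on the simply connected
    [M] gives a global [f] with gradient [X]. Geodesic completeness makes the flow of
    [X] complete; it acts by isometries, so [M] is the product of the line and the
    totally geodesic slice [f = 0], on which [omega] is the contraction of [Phi]
    with [X], [*omega] is the restriction of [Phi], and [T] restricts to the parallel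
    characteristic torsion. Adapted frames are brought to [e8 = X] by an element
    of Spin(7) that centralises u(2) and rotates the planes (e5, e6) and (e7, e8).
    A parallel form satisfies an algebraic formula for its exterior derivative,
    which gives [d*omega = theta /\ *omega] with [theta] a multiple of [*(T /\ omega)].
    Holonomy elements of the slice, extended by zero, kill [Phi] and [T], so
    they lie in u(2). *)
From HB Require Import structures.
From mathcomp Require Import all_boot all_order all_fingroup all_algebra.
From mathcomp Require Import all_classical all_reals all_analysis.
From mathcomp Require Import ring lra.
Require Import Defs.
Import Order.TTheory GRing.Theory Num.Theory.
Import numFieldNormedType.Exports.

Set Implicit Arguments.
Unset Strict Implicit.
Unset Printing Implicit Defensive.

Local Open Scope classical_set_scope.
Local Open Scope ring_scope.

(** The hypotheses [hiso] and [htype] provide two adapted frames at each point, possibly different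
    and unrelated from point to point. The field is extracted from a fact that refers to no frame:
    the kernel of [T] is a line. This holds because [(a2 + b1, a1)] is non-zero; otherwise [T] would
    be a multiple of [D], which su(3) kills, and su(3) has too many independent elements to be
    conjugate into the span of four matrices. A unit kernel vector is defined up to sign, and a
    potential up to sign and an additive constant; continuing germs of potentials along paths
    settles both ambiguities at once. Integral curves of [X] come from completeness, since a
    geodesic that starts along a parallel field stays tangent to it. The weight of the analysis is
    thus in smooth dependence on the initial point, proved by explicit estimates for any given
    family of integral curves. Identities between explicit forms in dimensions 7 and 8 are decided
    by evaluating integer components on increasing index lists. *)

Local Notation midx k n := {ffun 'I_k -> 'I_n}.
Local Notation bv := (delta_mx 0).

(** * Finite differentiability [Ck]: algebra, composition, inverses, Jacobians *)

Section Calculus.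
Context {R : realType}.
Implicit Types V W : normedModType R.

Lemma is_diff_eps V W (f : V -> W) x (L : {linear V -> W}) :
  continuous L ->
  (forall e, 0 < e -> \forall h \near (0 : V), `|f (h + x) - f x - L h| <= e * `|h|) ->
  is_diff x f L.
Proof.
move=> cL fL.
have H : f \o shift x = cst (f x) + L +o_ 0 id.
  apply/eqaddoP => e e0; have := fL e e0; apply: filterS => h.
  by rewrite -addrA -opprD.
have dE := diff_unique cL H.
by apply: DiffDef => //; apply/diff_locallyP; rewrite dE.
Qed.

Lemma diff_epsP V W (f : V -> W) x : differentiable f x ->
  forall e, 0 < e -> \forall h \near (0 : V), `|f (h + x) - f x - 'd f x h| <= e * `|h|.
Proof.
move=> /diff_locally H e e0; move/eqaddoP: H => /(_ e e0); apply: filterS => h.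
by rewrite /= -[X in `|X| <= _]/(f (h + x) - (f x + 'd f x h)) opprD addrA.
Qed.

Lemma near_eq_is_diff V W (f g : V -> W) x :
  (\near x, f x = g x) -> differentiable f x -> is_diff x g ('d f x).
Proof.
move=> fg df; apply: is_diff_eps; first exact: diff_continuous.
move=> e e0; have := diff_epsP df e0.
have : \forall h \near (0 : V), f (h + x) = g (h + x).
  have := fg; rewrite (near_shift 0 x) /=.
  by apply: filterS => h; rewrite subr0.
apply: filterS2 => h <-; by rewrite (nbhs_singleton fg).
Qed.

Lemma near_eq_differentiable V W (f g : V -> W) x :
  (\near x, f x = g x) -> differentiable f x -> differentiable g x.
Proof. by move=> fg /(near_eq_is_diff fg) []. Qed.

Lemma open_near (V : topologicalType) (U : set V) (P : V -> Prop) x :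
  open U -> U x -> (forall y, U y -> P y) -> \near x, P x.
Proof. by move=> oU Ux UP; apply: filterS UP _; exact: open_nbhs_nbhs. Qed.

Lemma eq_Ck V W k (U : set V) (f g : V -> W) : open U ->
  (forall x, U x -> f x = g x) -> Ck k U f -> Ck k U g.
Proof.
move=> oU; elim: k f g => [|k IH] f g fg /= => [fc x Ux|[fd fk]].
  have nfg : \near x, f x = g x by apply: (open_near oU Ux).
  rewrite /prop_for /continuous_at -(fg _ Ux); apply: cvg_trans (fc x Ux).
  by apply: near_eq_cvg.
split=> [x Ux|v].
  by apply: near_eq_differentiable (fd x Ux); apply: (open_near oU Ux).
apply: IH (fk v) => x Ux.
by apply: near_eq_derive; apply: (open_near oU Ux).
Qed.

Lemma CkS V W k (U : set V) (f : V -> W) : Ck k.+1 U f -> Ck k U f.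
Proof.
elim: k f => [|k IH] f [fd fk] /=.
  by move=> x Ux; apply: differentiable_continuous; apply: fd.
by split=> // v; apply: IH.
Qed.

Lemma sub_Ck V W k (U U' : set V) (f : V -> W) : U' `<=` U -> Ck k U f -> Ck k U' f.
Proof.
move=> UU; elim: k f => [|k IH] f /= => [fc x /UU/fc //|[fd fk]].
by split=> [x /UU/fd//|v]; apply: IH.
Qed.

(** Each clause of [Ck] concerns the function at single points of the set, never its restriction, so
    [U'] may be any set that contains the point. *)
Lemma Ck_locally V W k (U : set V) (f : V -> W) :
  (forall x, U x -> exists2 U' : set V, U' x & Ck k U' f) -> Ck k U f.
Proof.
elim: k f => [|k IH] f Uf /=.
  by move=> x /Uf[U' U'x]; apply.
split=> [x /Uf[U' U'x [fd _]]|v]; first exact: fd.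
apply: IH => x /Uf[U' U'x [_ fk]]; exists U' => //; exact: fk.
Qed.

Lemma Ck_cst V W k (U : set V) (c : W) : Ck k U (cst c).
Proof.
elim: k c => [|k IH] c /=; first by move=> x _; apply: cst_continuous.
split=> [x _|v]; first exact: differentiable_cst.
by rewrite (_ : (fun x => _) = cst 0) //; apply/funext => x; rewrite derive_cst.
Qed.

Lemma Ck_lin V W k (U : set V) (L : {linear V -> W}) : continuous L -> Ck k U L.
Proof.
move=> cL; case: k => [x _|k] /=; first exact: cL.
split=> [x _|v]; first exact: linear_differentiable.
rewrite (_ : (fun x => _) = cst (L v)); first exact: Ck_cst.
apply/funext => x; rewrite deriveE ?diff_lin //; exact: linear_differentiable.
Qed.

Lemma CkD V W k (U : set V) (f g : V -> W) : open U ->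
  Ck k U f -> Ck k U g -> Ck k U (f \+ g).
Proof.
move=> oU; elim: k f g => [|k IH] f g /=.
  by move=> fc gc x Ux; apply: continuousD; [exact: fc|exact: gc].
move=> [fd fk] [gd gk]; split=> [x Ux|v].
  by apply: differentiableD; [exact: fd|exact: gd].
apply: (eq_Ck oU _ (IH _ _ (fk v) (gk v))) => x Ux /=.
by rewrite deriveD //; apply: diff_derivable; [exact: fd|exact: gd].
Qed.

Lemma CkM V k (U : set V) (f g : V -> R) : open U ->
  Ck k U f -> Ck k U g -> Ck k U (fun x => f x * g x).
Proof.
move=> oU; elim: k f g => [|k IH] f g /=.
  by move=> fc gc x Ux; apply: continuousM; [exact: fc|exact: gc].
move=> fC gC; have [fd fk] := fC; have [gd gk] := gC.
split=> [x Ux|v]; first by apply: differentiableM; [exact: fd|exact: gd].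
have := CkD oU (IH _ _ (CkS fC) (gk v)) (IH _ _ (CkS gC) (fk v)).
apply: (eq_Ck oU) => x Ux /=.
by rewrite (@deriveM _ _ f g) //; apply: diff_derivable; [exact: fd|exact: gd].
Qed.

Lemma Ck_sum V W k (U : set V) I (r : seq I) (P : pred I) (f : I -> V -> W) : open U ->
  (forall i, P i -> Ck k U (f i)) -> Ck k U (fun x => \sum_(i <- r | P i) f i x).
Proof.
move=> oU fC; elim: r => [|i r IH].
  by under eq_fun do rewrite big_nil; exact: Ck_cst.
under eq_fun do rewrite big_cons; case Pi: (P i) => //.
by apply: CkD => //; exact: fC.
Qed.

Lemma Ck_prod V k (U : set V) I (r : seq I) (P : pred I) (f : I -> V -> R) : open U ->
  (forall i, P i -> Ck k U (f i)) -> Ck k U (fun x => \prod_(i <- r | P i) f i x).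
Proof.
move=> oU fC; elim: r => [|i r IH].
  by under eq_fun do rewrite big_nil; exact: Ck_cst.
under eq_fun do rewrite big_cons; case Pi: (P i) => //.
by apply: CkM => //; exact: fC.
Qed.

Lemma CkZ V k (U : set V) (c : R) (f : V -> R) : open U ->
  Ck k U f -> Ck k U (fun x => c * f x).
Proof. by move=> oU fC; apply: CkM => //; exact: Ck_cst. Qed.

Lemma CkN V k (U : set V) (f : V -> R) : open U ->
  Ck k U f -> Ck k U (fun x => - f x).
Proof. by move=> oU /(CkZ (-1) oU); apply: eq_Ck => // x _; rewrite mulN1r. Qed.

Lemma CkB V k (U : set V) (f g : V -> R) : open U ->
  Ck k U f -> Ck k U g -> Ck k U (fun x => f x - g x).
Proof. by move=> oU fC gC; apply: CkD => //; exact: CkN. Qed.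

Lemma CkV V k (U : set V) (f : V -> R) : open U -> (forall x, U x -> f x != 0) ->
  Ck k U f -> Ck k U (fun x => (f x)^-1).
Proof.
move=> oU f0; elim: k => [|k IH] /=.
  by move=> fc x Ux; apply: continuousV; [exact: f0|exact: fc].
move=> fC; have [fd fk] := fC; have fV := IH (CkS fC).
split=> [x Ux|v]; first by apply: differentiableV; [exact: fd|exact: f0].
have := CkN oU (CkM oU (CkM oU fV fV) (fk v)).
apply: (eq_Ck oU) => x Ux /=.
rewrite deriveV ?f0 //; last by apply: diff_derivable; exact: fd.
by rewrite -exprVn expr2 scaleNr.
Qed.

Lemma mx_normr_ge m n (A : 'M[R]_(m, n)) i j : `|A i j| <= `|A|.
Proof.
rewrite [leRHS]/Num.Def.normr /= mx_normrE.
exact: (le_bigmax _ (fun ij => `|A ij.1 ij.2|) (i, j)).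
Qed.

Lemma mx_normr_le m n (A : 'M[R]_(m, n)) (c : R) : 0 <= c ->
  (forall i j, `|A i j| <= c) -> `|A| <= c.
Proof. by move=> c0 Ac; rewrite [leLHS]/Num.Def.normr /= mx_normrE; apply: bigmax_le => // i _. Qed.

Lemma mx_normr_lt m n (A : 'M[R]_(m, n)) (c : R) : 0 < c ->
  (forall i j, `|A i j| < c) -> `|A| < c.
Proof. by move=> c0 Ac; rewrite [ltLHS]/Num.Def.normr /= mx_normrE; apply/bigmax_ltP; split. Qed.

Lemma linear_continuous_rV n W (L : {linear 'rV[R]_n -> W}) : continuous L.
Proof.
rewrite (_ : (L : _ -> _) = (fun v => \sum_i v 0 i *: L (bv i))); last first.
  apply/funext => v; rewrite {1}(row_sum_delta v) linear_sum.
  by apply: eq_bigr => i _; rewrite linearZ.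
apply: continuous_big => [|i _]; first exact: add_continuous.
move=> v; apply: continuousZr_tmp; exact: coord_continuous.
Qed.

Lemma linear_bound n W (L : {linear 'rV[R]_n -> W}) c :
  (forall i, `|L (bv i)| <= c) -> forall v, `|L v| <= n%:R * c * `|v|.
Proof.
move=> Lc v; rewrite {1}(row_sum_delta v) linear_sum.
apply: le_trans (ler_norm_sum _ _ _) _.
rewrite -mulrA mulr_natl -[X in _ *+ X]card_ord -sumr_const.
apply: ler_sum => i _; rewrite linearZ normrZ mulrC.
by apply: ler_pM => //; exact: mx_normr_ge.
Qed.

(** A quadratic remainder is below [e * |h|] once [|h| < e / (|C| + 1)]. This is the form in which
    potentials and flow maps are shown to be differentiable, their remainders being estimated
    explicitly. *)
Lemma is_diff_quad V W (f : V -> W) x (L : {linear V -> W}) r C : continuous L ->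
  0 < r -> (forall h, `|h| < r -> `|f (x + h) - f x - L h| <= C * `|h| ^+ 2) ->
  is_diff x f L.
Proof.
move=> cL r0 fC; apply: is_diff_eps => // e e0.
have D0 : 0 < `|C| + 1 by rewrite ltr_pwDr.
near=> h.
have hr : `|h| < r by near: h; apply: nbhs0_lt.
have he : `|h| < e / (`|C| + 1) by near: h; apply: nbhs0_lt; rewrite divr_gt0.
rewrite [h + x]addrC; apply: le_trans (fC h hr) _.
rewrite expr2 mulrA ler_wpM2r //.
apply: (@le_trans _ _ ((`|C| + 1) * `|h|)).
  by rewrite ler_wpM2r // (le_trans (ler_norm _)) // lerDl.
by rewrite mulrC -ler_pdivlMr // ltW.
Unshelve. all: by end_near. Qed.

Lemma differentiable_mxP V m n (f : V -> 'M[R]_(m, n)) x :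
  differentiable f x <-> forall i j, differentiable (fun y => f y i j) x.
Proof.
split=> [fd i j|fd].
  by apply: (@differentiable_comp _ _ _ _ f (fun A : 'M[R]_(m, n) => (A i j : R))) => //; exact: differentiable_coord.
rewrite (_ : f = \sum_i \sum_j (fun y => f y i j *: delta_mx i j)).
  elim/big_ind: _ => [||i _]; [exact: differentiable_cst|by move=> f1 f2 h1 h2; apply: differentiableD|].
  elim/big_ind: _ => [||j _]; [exact: differentiable_cst|by move=> f1 f2 h1 h2; apply: differentiableD|].
  exact: differentiableZl.
apply/funext => y; rewrite [LHS]matrix_sum_delta fct_sumE; apply: eq_bigr => i _.
by rewrite fct_sumE.
Qed.

Lemma derive_mxE V m n (f : V -> 'M[R]_(m, n)) x v i j : differentiable f x ->
  ('D_v f x) i j = 'D_v (fun y => f y i j) x.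
Proof. by move=> fd; rewrite derive_mx ?mxE //; exact: diff_derivable. Qed.

Lemma continuous_mxP (T : topologicalType) m n (f : T -> 'M[R]_(m, n)) (x : T) :
  {for x, continuous f} <-> forall i j, {for x, continuous (fun y => f y i j)}.
Proof.
split=> [fc i j|fc].
  by apply: (@continuous_comp _ _ _ f (fun A : 'M[R]_(m, n) => (A i j : R))) => //; exact: coord_continuous.
rewrite (_ : f = (fun y => \sum_i \sum_j f y i j *: delta_mx i j)).
  apply: cvg_big => [|i _]; first exact: add_continuous.
  apply: cvg_big => [|j _]; first exact: add_continuous.
  by apply: cvgZr_tmp; exact: fc.
by apply/funext => y; rewrite [LHS]matrix_sum_delta.
Qed.

Lemma Ck_mxP V k (U : set V) m n (f : V -> 'M[R]_(m, n)) : open U ->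
  Ck k U f <-> forall i j, Ck k U (fun x => f x i j).
Proof.
move=> oU; elim: k f => [|k IH] f /=.
  split=> [fc i j x Ux|fc x Ux]; first by move/continuous_mxP: (fc x Ux).
  by apply/continuous_mxP => i j; exact: fc.
split=> [[fd fk] i j|fC].
  split=> [x /fd/differentiable_mxP//|v].
  move: (fk v) => /IH/(_ i j); apply: eq_Ck => // x Ux.
  by rewrite derive_mxE //; exact: fd.
have fd x : U x -> differentiable f x.
  by move=> Ux; apply/differentiable_mxP => i j; have [+ _] := fC i j; apply.
split=> // v; apply/IH => i j; have [_ /(_ v)] := fC i j.
by apply: eq_Ck => // x Ux; rewrite derive_mxE //; exact: fd.
Qed.

Lemma derive_comp V n W (f : V -> 'rV[R]_n) (g : 'rV[R]_n -> W) x v :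
  differentiable f x -> differentiable g (f x) ->
  'D_v (g \o f) x = 'D_('D_v f x) g (f x).
Proof.
move=> fd gd; have fgd := differentiable_comp fd gd.
by rewrite (deriveE _ fgd) (deriveE _ fd) (deriveE _ gd) diff_comp.
Qed.

Lemma derive_rV n W (g : 'rV[R]_n -> W) x v : differentiable g x ->
  'D_v g x = \sum_i v 0 i *: 'D_(bv i) g x.
Proof.
move=> gd; rewrite deriveE // {1}(row_sum_delta v) linear_sum.
by apply: eq_bigr => i _; rewrite linearZ deriveE.
Qed.

(** The chain rule writes a derivative of [g \o f] as a sum of products of a coordinate derivative
    of [f] and a partial derivative of [g] composed with [f]. The induction hypothesis, stated for
    all [g], covers the latter. *)
Lemma Ck_comp V n k (U : set V) (O : set 'rV[R]_n) (f : V -> 'rV[R]_n)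
    (g : 'rV[R]_n -> R) : open U -> open O -> (forall x, U x -> O (f x)) ->
  Ck k U f -> Ck k O g -> Ck k U (g \o f).
Proof.
move=> oU oO UO; elim: k g => [|k IH] g /=.
  move=> fc gc x Ux; apply: continuous_comp; first exact: fc.
  by apply: gc; exact: UO.
move=> fC gC; have [fd fk] := fC; have [gd gk] := gC.
split=> [x Ux|v]; first by apply: differentiable_comp; [exact: fd|apply/gd/UO].
have : Ck k U (fun x => \sum_i ('D_v f x) 0 i * ('D_(bv i) g \o f) x).
  apply: Ck_sum => // i _; apply: CkM => //.
    by move/(Ck_mxP _ _ oU): (fk v).
  by apply: IH => //; exact: CkS.
apply: eq_Ck => // x Ux.
rewrite derive_comp; [|exact: fd|by apply/gd/UO].
by rewrite derive_rV //; apply/gd/UO.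
Qed.

Lemma Ck_comp_mx V n k (U : set V) (O : set 'rV[R]_n) (f : V -> 'rV[R]_n) p q
    (g : 'rV[R]_n -> 'M[R]_(p, q)) : open U -> open O -> (forall x, U x -> O (f x)) ->
  Ck k U f -> Ck k O g -> Ck k U (g \o f).
Proof.
move=> oU oO UO fC gC; apply/Ck_mxP => // i j.
by apply: (Ck_comp oU oO UO fC (g := fun x => g x i j)); move/Ck_mxP: gC; exact.
Qed.

Lemma Ck_mulmx V k (U : set V) m n p (f : V -> 'M[R]_(m, n)) (g : V -> 'M[R]_(n, p)) :
  open U -> Ck k U f -> Ck k U g -> Ck k U (fun x => f x *m g x).
Proof.
move=> oU /(Ck_mxP _ _ oU) fC /(Ck_mxP _ _ oU) gC; apply/Ck_mxP => // i j.
by under eq_fun do rewrite mxE; apply: Ck_sum => // l _; apply: CkM.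
Qed.

Lemma Ck_tr V k (U : set V) m n (f : V -> 'M[R]_(m, n)) :
  open U -> Ck k U f -> Ck k U (fun x => (f x)^T).
Proof.
move=> oU /(Ck_mxP _ _ oU) fC; apply/Ck_mxP => // i j.
by under eq_fun do rewrite mxE.
Qed.

Lemma Ck_det V k (U : set V) n (f : V -> 'M[R]_n) :
  open U -> Ck k U f -> Ck k U (fun x => \det (f x)).
Proof.
move=> oU /(Ck_mxP _ _ oU) fC; apply: Ck_sum => // s _.
by apply: CkM => //; [exact: Ck_cst|exact: Ck_prod].
Qed.

Lemma Ck_adj V k (U : set V) n (f : V -> 'M[R]_n) :
  open U -> Ck k U f -> Ck k U (fun x => \adj (f x)).
Proof.
move=> oU /(Ck_mxP _ _ oU) fC; apply/Ck_mxP => // i j.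
under eq_fun do rewrite mxE; apply: CkM => //; first exact: Ck_cst.
by apply: Ck_det => //; apply/Ck_mxP => // a b; under eq_fun do rewrite !mxE.
Qed.

Lemma Ck_invmx V k (U : set V) n (f : V -> 'M[R]_n) :
  open U -> (forall x, U x -> f x \in unitmx) ->
  Ck k U f -> Ck k U (fun x => invmx (f x)).
Proof.
move=> oU fu fC.
have : Ck k U (fun x => (\det (f x))^-1 *: \adj (f x)).
  apply/Ck_mxP => // i j; under eq_fun do rewrite mxE; apply: CkM => //.
    apply: CkV => //; last exact: Ck_det.
    by move=> x /fu; rewrite unitmxE unitfE.
  by move: i j; apply/Ck_mxP => //; exact: Ck_adj.
by apply: eq_Ck => // x /fu fx; rewrite /invmx fx.
Qed.

Lemma jacobianE m n (f : 'rV[R]_m -> 'rV[R]_n) x i j : differentiable f x ->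
  ('J f x) i j = 'D_(bv i) (fun y => f y 0 j) x.
Proof.
move=> fd; rewrite -derive_mxE // deriveEjacobian //.
by rewrite -rowE [RHS]mxE.
Qed.

Lemma Ck_jacobian k m n (U : set 'rV[R]_m) (f : 'rV[R]_m -> 'rV[R]_n) : open U ->
  Ck k.+1 U f -> Ck k U (fun x => 'J f x).
Proof.
move=> oU [fd fk]; apply/Ck_mxP => // i j.
have := fk (bv i) => /(Ck_mxP _ _ oU)/(_ 0 j).
apply: eq_Ck => // x Ux; rewrite jacobianE; last exact: fd.
by rewrite derive_mxE //; exact: fd.
Qed.

Lemma jacobian_comp m n p (f : 'rV[R]_m -> 'rV[R]_n) (g : 'rV[R]_n -> 'rV[R]_p) x :
  differentiable f x -> differentiable g (f x) ->
  'J (g \o f) x = 'J f x *m 'J g (f x).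
Proof.
move=> fd gd; apply/row_matrixP => i; rewrite !rowE mulmxA.
by rewrite -(deriveEjacobian _ (differentiable_comp fd gd)) derive_comp // (deriveEjacobian _ fd) (deriveEjacobian _ gd).
Qed.

End Calculus.

(** * One real variable: continuation along segments, mean value and Gronwall bounds *)

Section OneDim.
Context {R : realType}.
Implicit Types (W : normedModType R).

(** Connectedness of the segment as an induction principle: the local hypothesis makes both the set
    where [P] holds and its complement relatively open. It drives the continuation arguments along
    curves. *)
Lemma segment_ind (P : R -> Prop) (a b : R) :
  (forall t, a <= t <= b -> exists2 e, 0 < e & forall s s', a <= s <= b -> a <= s' <= b ->
     `|s - t| < e -> `|s' - t| < e -> P s -> P s') ->
  forall s t, a <= s <= b -> a <= t <= b -> P s -> P t.
Proof.
move=> loc s t sab tab Ps.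
have C := @segment_connected R a b.
pose B := [set x | a <= x <= b /\ P x].
have inI x : `[a, b]%classic x <-> (a <= x <= b) by rewrite /= in_itv.
have inI' := fun x => proj2 (inI x).
suff : B = `[a, b]%classic.
  by move=> BE; have : B t by [rewrite BE; exact: inI'|]; case.
apply: C; first by exists s.
  exists ([set x | a <= x <= b -> P x]^°); first exact: open_interior.
  apply/seteqP; split=> x /= [].
    move=> xab Px; split; first exact: inI'.
    have [e e0 He] := loc x xab.
    apply/nbhs_ballP; exists e => // y; rewrite /ball /= => xy yab.
    by apply: (He x y) => //; rewrite ?subrr ?normr0 // distrC.
  by move=> /inI xab /interior_subset /= /(_ xab) Px.
exists (~` [set x | a <= x <= b -> ~ P x]^°).
  by rewrite closedC; exact: open_interior.
apply/seteqP; split=> x /= [].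
  move=> xab Px; split; first exact: inI'.
  by move=> /interior_subset /= /(_ xab).
move=> /inI xab nx; split=> //; apply: contrapT => nPx; apply: nx.
have [e e0 He] := loc x xab.
apply/nbhs_ballP; exists e => // y; rewrite /ball /= => xy yab Py; apply: nPx.
by apply: (He y x) => //; rewrite ?subrr ?normr0 // distrC.
Qed.

Lemma real_ind (P : R -> Prop) :
  (forall t, exists2 e, 0 < e & forall s s',
     `|s - t| < e -> `|s' - t| < e -> P s -> P s') ->
  forall s t, P s -> P t.
Proof.
move=> loc s t; apply: (@segment_ind P (Num.min s t) (Num.max s t)).
- by move=> x _; have [e e0 He] := loc x; exists e => // y z _ _; exact: He.
- by rewrite ge_min le_max lexx.
- by rewrite ge_min le_max lexx !orbT.
Qed.

Lemma is_derive_comp n W (u : R -> 'rV[R]_n) (g : 'rV[R]_n -> W) (t : R) (du : 'rV[R]_n) :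
  is_derive t 1 u du -> differentiable g (u t) ->
  is_derive t 1 (g \o u) ('D_du g (u t)).
Proof.
move=> [ud <-] gd; have ud' : differentiable u t by apply/derivable1_diffP.
apply: DeriveDef; first by apply/derivable1_diffP; exact: differentiable_comp.
by rewrite derive_comp.
Qed.

Lemma is_derive_mx m n (u : R -> 'M[R]_(m, n)) (t v : R) (du : 'M[R]_(m, n)) i j :
  is_derive t v u du -> is_derive t v (fun s => u s i j) (du i j).
Proof.
move=> [ud <-]; have := ud => /derivable_mxP/(_ i j) udij; apply: DeriveDef => //.
by rewrite derive_mx // mxE.
Qed.

Lemma is_derive_mxI m n (u : R -> 'M[R]_(m, n)) (t v : R) (du : 'M[R]_(m, n)) :
  (forall i j, is_derive t v (fun s => u s i j) (du i j)) -> is_derive t v u du.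
Proof.
move=> ud; have ud' : derivable u t v.
  by apply/derivable_mxP => i j; have [] := ud i j.
apply: DeriveDef => //; rewrite derive_mx //; apply/matrixP => i j; rewrite mxE.
by have [] := ud i j.
Qed.

Lemma is_derive_quadP m n (u : R -> 'M[R]_(m, n)) (t : R) (c : 'M[R]_(m, n)) (r C : R) : 0 < r ->
  (forall s, `|s| < r -> `|u (t + s) - u t - s *: c| <= C * `|s| ^+ 2) ->
  is_derive t 1 u c.
Proof.
move=> r0 uC.
have lin : linear (fun s : R => s *: c) by move=> a s s'; rewrite scalerDl scalerA.
pose LM := GRing.isLinear.Build _ _ _ _ _ lin.
pose L : {linear R -> 'M[R]_(m, n)} := HB.pack (fun s : R => s *: c) LM.
have [d e] : is_diff t u L.
  apply: (@is_diff_quad _ _ _ u t L r C) => //; exact: scalel_continuous.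
apply: DeriveDef; first exact: diff_derivable.
by rewrite deriveE // e /= scale1r.
Qed.

Lemma is_derive_line n W (F : 'rV[R]_n -> W) (x w : 'rV[R]_n) (s : R) :
  differentiable F (x + s *: w) ->
  is_derive s 1 (fun s => F (x + s *: w)) ('D_w F (x + s *: w)).
Proof.
move=> Fd; apply: (@is_derive_comp n W (fun s => x + s *: w) F s w) => //.
apply: (@is_derive_quadP _ _ _ _ _ 1 0) => // h _.
by rewrite scalerDl opprD addrACA subrr add0r [s *: w + _]addrC addrK subrr normr0 mul0r.
Qed.

Lemma mvt_real (f df : R -> R) (s t C : R) :
  (forall r, Num.min s t <= r <= Num.max s t -> is_derive r 1 f (df r)) ->
  (forall r, Num.min s t <= r <= Num.max s t -> `|df r| <= C) ->
  `|f t - f s| <= C * `|t - s|.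
Proof.
wlog st : s t / s <= t.
  move=> H; case: (leP s t) => [st|/ltW ts] h1 h2.
    by apply: H => //; rewrite ?(min_l st) ?(max_r st) in h1 h2 *.
  by rewrite distrC [`|t - s|]distrC; apply: H; rewrite // (min_l ts) (max_r ts).
rewrite (min_l st) (max_r st) => fd dfC.
have [] := @MVT_segment R f df s t st.
- by move=> x; rewrite in_itv /= => /andP[h1 h2]; apply: fd; rewrite !ltW.
- apply: derivable_within_continuous => x; rewrite in_itv /= => xst.
  by have [] := fd x xst.
move=> c; rewrite in_itv /= => cst ->.
by rewrite normrM ler_wpM2r // dfC.
Qed.

Lemma mvt_mx m n (u du : R -> 'M[R]_(m, n)) (s t C : R) :
  (forall r, Num.min s t <= r <= Num.max s t -> is_derive r 1 u (du r)) ->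
  (forall r, Num.min s t <= r <= Num.max s t -> `|du r| <= C) ->
  `|u t - u s| <= C * `|t - s|.
Proof.
move=> ud duC.
have C0 : 0 <= C.
  apply: le_trans (duC s _); first exact: normr_ge0.
  by rewrite ge_min le_max lexx.
apply: mx_normr_le => [|i j]; first by rewrite mulr_ge0.
rewrite !mxE; apply: (@mvt_real (fun s => u s i j) (fun s => du s i j)) => r rst.
  by apply: is_derive_mx; exact: ud.
by apply: le_trans (duC r rst); exact: mx_normr_ge.
Qed.

Lemma between_lt (s t r d : R) : `|s| < d -> `|t| < d ->
  Num.min s t <= r <= Num.max s t -> `|r| < d.
Proof.
move=> sd td /andP[]; rewrite ge_min le_max !ltr_norml in sd td * => h1 h2.
by case/orP: h1 => h1; case/orP: h2 => h2; lra.
Qed.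

Lemma between0 (t r : R) : Num.min 0 t <= r <= Num.max 0 t -> `|r| <= `|t|.
Proof.
move=> /andP[]; rewrite ge_min le_max ler_norml => h1 h2.
have [t0|t0] := leP 0 t; [rewrite ger0_norm//|rewrite ltr0_norm//];
by case/orP: h1 => h1; case/orP: h2 => h2; lra.
Qed.

Lemma derive_continuous m n (u : R -> 'M[R]_(m, n)) (t : R) (du : 'M[R]_(m, n)) :
  is_derive t 1 u du -> {for t, continuous u}.
Proof. by move=> [/derivable1_diffP/differentiable_continuous]. Qed.

(** Let [S] be the maximum of [|u|] on [[-|t|, |t|]]. The mean value inequality gives
    [S <= |u 0| + (L * S + C) * d], and [L * d <= 1/2] absorbs the term in [S]. On so short an
    interval the exponential factor is replaced by 2. *)
Lemma gronwall m n (u du : R -> 'M[R]_(m, n)) (d L C : R) : 0 <= L -> 0 <= C -> 2 * L * d <= 1 ->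
  (forall t : R, `|t| < d -> is_derive t 1 u (du t)) ->
  (forall t : R, `|t| < d -> `|du t| <= L * `|u t| + C) ->
  forall t : R, `|t| < d -> `|u t| <= 2 * (`|u 0| + C * d).
Proof.
move=> L0 C0 Ld ud duL t td.
have d0 : 0 < d by apply: le_lt_trans td.
have ab : - `|t| <= `|t| by rewrite -subr_ge0 opprK addr_ge0.
have ltd r : `|r| <= `|t| -> `|r| < d by move=> h; exact: le_lt_trans td.
have cu : {within `[- `|t|, `|t|], continuous (fun s => `|u s|)}.
  apply: continuous_in_subspaceT => x; rewrite inE /= in_itv /= => xt.
  apply: continuous_comp; last exact: norm_continuous.
  by apply: derive_continuous (ud x _); apply: ltd; rewrite ler_norml.
have [c cI cmax] := EVT_max ab cu.
move: cI; rewrite in_itv /= => cI; have ct : `|c| <= `|t| by rewrite ler_norml.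
set S := `|u c| in cmax.
have tS : `|u t| <= S.
  by apply: cmax; rewrite in_itv /= lerNl ler_norm -normrN ler_norm.
have SL : S <= `|u 0| + (L * S + C) * d.
  have {1}-> : S = `|u 0 + (u c - u 0)| by rewrite addrC subrK.
  apply: le_trans (ler_normD _ _) _; rewrite lerD2l.
  apply: le_trans (_ : (L * S + C) * `|c - 0| <= _).
    apply: (@mvt_mx m n u du) => r /between0 rc.
      by apply: ud; apply: ltd; exact: le_trans ct.
    apply: le_trans (duL r _) _; first by apply: ltd; exact: le_trans ct.
    rewrite lerD2r ler_wpM2l //; apply: cmax; rewrite in_itv /= -ler_norml.
    exact: le_trans ct.
  rewrite subr0 ler_wpM2l //; last by apply: ltW; exact: ltd.
  by rewrite addr_ge0 // mulr_ge0 // normr_ge0.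
apply: le_trans tS _.
have : 2 * L * d * S <= S by rewrite ler_piMl // /S normr_ge0.
by rewrite mulrDl in SL; lra.
Qed.

Lemma limit_le (A B C r : R) : 0 < r ->
  (forall h, 0 < h < r -> A <= B + C * h) -> A <= B.
Proof.
move=> r0 H; apply/ler_addgt0Pl => e e0.
pose D := `|C| + 1; have D0 : 0 < D by rewrite ltr_pwDr.
pose h := Num.min (r / 2) (e / D).
have h0 : 0 < h by rewrite lt_min !divr_gt0.
have hr : h < r by rewrite gt_min ltr_pdivrMr // ltr_pMr // ltr1n.
apply: le_trans (H h _) _; first by rewrite h0.
rewrite addrC lerD2r; apply: (@le_trans _ _ (D * h)).
  by rewrite ler_wpM2r ?(ltW h0) // (le_trans (ler_norm _)) // lerDl.
by rewrite mulrC -ler_pdivlMr // ge_min lexx orbT.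
Qed.

(** The limit is taken along positive [h]; the Cauchy estimate then carries it, with its rate, to
    every small non-zero [h]. *)
Lemma cauchy_rate n (f : R -> 'rV[R]_n) (A r : R) : 0 <= A -> 0 < r ->
  (forall h h', 0 < `|h| < r -> 0 < `|h'| < r -> `|f h - f h'| <= A * (`|h| + `|h'|)) ->
  exists l, forall h, 0 < `|h| < r -> `|f h - l| <= A * `|h|.
Proof.
move=> A0 r0 fA.
have cf : cvg (f x @[x --> 0^'+]).
  apply/cauchy_cvgP/cauchy_exP => e e0.
  pose D := A + 1; have D0 : 0 < D by rewrite ltr_pwDr.
  pose h := Num.min (r / 2) (e / (2 * D)).
  have h0 : 0 < h by rewrite lt_min !divr_gt0 // mulr_gt0.
  have hr : h < r by rewrite gt_min ltr_pdivrMr // ltr_pMr // ltr1n.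
  exists (f h); rewrite /fmap /= ; near=> k.
  have k0 : 0 < k by near: k; exact: nbhs_right_gt.
  have kh : k < h by near: k; exact: nbhs_right_lt.
  rewrite -ball_normE /ball_ /=.
  apply: le_lt_trans (fA _ _ _ _) _; rewrite ?gtr0_norm ?h0 ?k0 ?(lt_trans kh) //.
  apply: (@le_lt_trans _ _ (A * (2 * h))).
    by rewrite ler_wpM2l // mulr2n mulrDl mul1r lerD2l ltW.
  apply: (@lt_le_trans _ _ (D * (2 * h))); first by rewrite ltr_pM2r ?ltrDl // mulr_gt0.
  by rewrite mulrA [D * 2]mulrC [2 * D * h]mulrC -ler_pdivlMr ?mulr_gt0 // ge_min lexx orbT.
move/cvg_ex: cf => [l fl]; exists l => h hr.
apply/ler_addgt0Pl => e e0.
pose D := A + 1; have D0 : 0 < D by rewrite ltr_pwDr.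
near (0 : R)^'+ => k.
have k0 : 0 < k by near: k; exact: nbhs_right_gt.
have kr : k < r by near: k; exact: nbhs_right_lt.
have ke : k < e / 2 / D by near: k; apply: nbhs_right_lt; rewrite !divr_gt0.
have fk : `|l - f k| < e / 2.
  by near: k; move/cvgrPdist_lt: fl; apply; rewrite divr_gt0.
rewrite -(subrKA (f k)); apply: le_trans (ler_normD _ _) _.
rewrite [`|f k - l|]distrC.
have : `|f h - f k| <= A * (`|h| + `|k|) by apply: fA => //; rewrite gtr0_norm // k0.
have : k * D < e / 2 by rewrite -ltr_pdivlMr.
rewrite [`|k|]gtr0_norm // /D; nra.
Unshelve. all: by end_near. Qed.

End OneDim.

(** * Uniform second-order bounds on a ball *)

Section Tame.
Context {R : realType}.

(** One constant [K] bounds the field, its differential, the Lipschitz constants of both and the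
    second-order Taylor remainder, so the estimates on flows carry a single constant. *)
Definition tame n (F : 'rV[R]_n -> 'rV[R]_n) (x0 : 'rV[R]_n) (rho K : R) : Prop :=
  [/\ forall x, `|x - x0| < rho -> differentiable F x,
      forall x, `|x - x0| < rho -> `|F x| <= K,
      forall x v, `|x - x0| < rho -> `|'D_v F x| <= K * `|v|,
      forall x y, `|x - x0| < rho -> `|y - x0| < rho ->
        `|F x - F y| <= K * `|x - y| &
      forall x y, `|x - x0| < rho -> `|y - x0| < rho ->
        (forall v, `|'D_v F x - 'D_v F y| <= K * `|v| * `|x - y|) /\
        `|F y - F x - 'D_(y - x) F x| <= K * `|y - x| ^+ 2].

Lemma deriveZ_dir n m (F : 'rV[R]_n -> 'rV[R]_m) (x v : 'rV[R]_n) (a : R) : differentiable F x ->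
  'D_(a *: v) F x = a *: 'D_v F x.
Proof. by move=> Fd; rewrite !deriveE // linearZ. Qed.

Lemma deriveD_dir n m (F : 'rV[R]_n -> 'rV[R]_m) (x v w : 'rV[R]_n) : differentiable F x ->
  'D_(v + w) F x = 'D_v F x + 'D_w F x.
Proof. by move=> Fd; rewrite !deriveE // linearD. Qed.

Lemma deriveB_dir n m (F : 'rV[R]_n -> 'rV[R]_m) (x v w : 'rV[R]_n) : differentiable F x ->
  'D_(v - w) F x = 'D_v F x - 'D_w F x.
Proof. by move=> Fd; rewrite !deriveE // linearB. Qed.

Lemma dist_convex n (x0 x y : 'rV[R]_n) (rho t : R) : `|x - x0| < rho -> `|y - x0| < rho ->
  0 <= t <= 1 -> `|x + t *: (y - x) - x0| < rho.
Proof.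
move=> xr yr /andP[t0 t1].
have -> : x + t *: (y - x) - x0 = (1 - t) *: (x - x0) + t *: (y - x0).
  by apply/rowP => i; rewrite !mxE; ring.
apply: le_lt_trans (ler_normD _ _) _; rewrite !normrZ !ger0_norm ?subr_ge0 //.
set a := `|x - x0| in xr *; set b := `|y - x0| in yr *.
have [->|tn] := eqVneq t 0; first by rewrite subr0 mul1r mul0r addr0.
have tp : 0 < t by rewrite lt_neqAle eq_sym tn.
have : t * b < t * rho by rewrite ltr_pM2l.
have : (1 - t) * a <= (1 - t) * rho by rewrite ler_wpM2l ?subr_ge0 // ltW.
lra.
Qed.

Lemma seg01 (r : R) : Num.min 0 1 <= r <= Num.max 0 1 -> 0 <= r <= 1.
Proof. by rewrite min_l // max_r. Qed.

Lemma lip_of_derive n m (F : 'rV[R]_n -> 'rV[R]_m) (x0 : 'rV[R]_n) (rho K : R) :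
  (forall x, `|x - x0| < rho -> differentiable F x) ->
  (forall x v, `|x - x0| < rho -> `|'D_v F x| <= K * `|v|) ->
  forall x y, `|x - x0| < rho -> `|y - x0| < rho -> `|F x - F y| <= K * `|x - y|.
Proof.
move=> Fd FK x y xr yr.
pose u (t : R) := F (x + t *: (y - x)); pose du (t : R) := 'D_(y - x) F (x + t *: (y - x)).
have inr (r : R) : Num.min 0 1 <= r <= Num.max 0 1 -> `|x + r *: (y - x) - x0| < rho.
  by move=> /seg01; exact: dist_convex.
have := @mvt_mx R 1 m u du 0 1 (K * `|x - y|).
rewrite /u scale1r scale0r addr0 subr0 normr1 mulr1 (_ : x + (y - x) = y) 1?[`|F y - _|]distrC; last by rewrite addrC subrK.
apply => r /inr xrr; first by apply: is_derive_line; exact: Fd.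
by rewrite [`|x - y|]distrC; apply: FK.
Qed.

Lemma ler_sum_term n (a : 'I_n -> R) i : (forall j, 0 <= a j) -> a i <= \sum_j a j.
Proof. by move=> a0; rewrite (bigD1 i) //= lerDl sumr_ge0. Qed.

Lemma tame_exists n (F : 'rV[R]_n -> 'rV[R]_n) (Om : set 'rV[R]_n) x0 : open Om ->
  Om x0 -> Ck 2 Om F -> exists rho K, [/\ 0 < rho, 0 < K,
    forall x, `|x - x0| < rho -> Om x & tame F x0 rho K].
Proof.
move=> oO Ox0 FC.
have F0 : Ck 0 Om F by do 2 apply: CkS.
have F1 i : Ck 0 Om ('D_(bv i) F)
  by have h : Ck 1 Om ('D_(bv i) F) := FC.2 _; exact: CkS h.
have F2 i j : Ck 0 Om ('D_(bv j) ('D_(bv i) F)).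
  by have [_ /(_ (bv i))[_]] := FC; apply.
pose K1 : R := 1 + `|F x0| + \sum_i `|'D_(bv i) F x0|
   + \sum_i \sum_j `|'D_(bv j) ('D_(bv i) F) x0|.
have S1 i : `|'D_(bv i) F x0| <= \sum_i `|'D_(bv i) F x0|.
  exact: (@ler_sum_term n (fun i => `|'D_(bv i) F x0|)).
have S2 i j : `|'D_(bv j) ('D_(bv i) F) x0| <=
    \sum_i \sum_j `|'D_(bv j) ('D_(bv i) F) x0|.
  apply: le_trans (@ler_sum_term n
    (fun i => \sum_j `|'D_(bv j) ('D_(bv i) F) x0|) i _).
    by apply: (@ler_sum_term n (fun j => `|'D_(bv j) ('D_(bv i) F) x0|)).
  by move=> k; apply: sumr_ge0.
have P1 : 0 <= \sum_i `|'D_(bv i) F x0| by apply: sumr_ge0 => i _; exact: normr_ge0.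
have P2 : 0 <= \sum_i \sum_j `|'D_(bv j) ('D_(bv i) F) x0|.
  by apply: sumr_ge0 => i _; apply: sumr_ge0 => j _; exact: normr_ge0.
have bnd (m : nat) (g : 'rV[R]_n -> 'rV[R]_m) : Ck 0 Om g -> `|g x0| <= K1 - 1 ->
    \forall x \near x0, `|g x| <= K1.
  move=> gc g0; have /cvgrPdist_lt/(_ 1 ltr01) := gc x0 Ox0; apply: filterS => x gx.
  have -> : g x = g x0 - (g x0 - g x) by rewrite opprB addrC subrK.
  by apply: le_trans (ler_normB _ _) _; lra.
have B0 : \forall x \near x0, `|F x| <= K1 by apply: bnd => //; rewrite /K1; lra.
have B1 : \forall x \near x0, forall i, `|'D_(bv i) F x| <= K1.
  have H i : \forall x \near x0, `|'D_(bv i) F x| <= K1.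
    by apply: bnd => //; have := S1 i; have := normr_ge0 (F x0); rewrite /K1; lra.
  exact: filter_forall H.
have B2 : \forall x \near x0, forall i j, `|'D_(bv j) ('D_(bv i) F) x| <= K1.
  have H i : \forall x \near x0, forall j, `|'D_(bv j) ('D_(bv i) F) x| <= K1.
    have H j : \forall x \near x0, `|'D_(bv j) ('D_(bv i) F) x| <= K1.
      by apply: bnd => //; have := S2 i j; have := normr_ge0 (F x0); rewrite /K1; lra.
    exact: filter_forall H.
  exact: filter_forall H.
have BO : \forall x \near x0, Om x by apply: open_nbhs_nbhs.
have K1p : 1 <= K1 by have := normr_ge0 (F x0); rewrite /K1; lra.
have [rho rho0 Hrho] : exists2 rho : R, 0 < rho & forall x, `|x - x0| < rho ->
    [/\ Om x, `|F x| <= K1, forall i, `|'D_(bv i) F x| <= K1 &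
        forall i j, `|'D_(bv j) ('D_(bv i) F) x| <= K1].
  have /nbhs_ballP[e e0 He] : nbhs x0 [set x | [/\ Om x, `|F x| <= K1,
      forall i, `|'D_(bv i) F x| <= K1 &
      forall i j, `|'D_(bv j) ('D_(bv i) F) x| <= K1]].
    by near=> x; split; near: x.
  by exists e => // x xr; apply: He; rewrite -ball_normE /ball_ /= distrC.
have Fd x : `|x - x0| < rho -> differentiable F x.
  by move=> /Hrho[Ox _ _ _]; have [+ _] := FC; apply.
have Dd i x : `|x - x0| < rho -> differentiable ('D_(bv i) F) x.
  by move=> /Hrho[Ox _ _ _]; have [_ /(_ (bv i))[+ _]] := FC; apply.
have n1 : 1 <= n%:R + 1 :> R by rewrite lerDr ler0n.
have n0 : 0 <= n%:R :> R by rewrite ler0n.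
(* [K1] bounds [F] and its partial derivatives of orders one and two near [x0]. Passing to arbitrary
   directions costs a factor [n] for each order, and [(n + 1) ^ 2] dominates 1, [n] and [n ^ 2]. *)
pose K : R := (n%:R + 1) ^+ 2 * K1.
have KK : n%:R * K1 <= K by rewrite /K; nra.
have KKK : n%:R * (n%:R * K1) <= K by rewrite /K; nra.
have K1K : K1 <= K by rewrite /K; nra.
have H1 x v : `|x - x0| < rho -> `|'D_v F x| <= K * `|v|.
  move=> xr; have [_ _ h _] := Hrho x xr.
  rewrite (deriveE _ (Fd x xr)); apply: (@le_trans _ _ (n%:R * K1 * `|v|)); last first.
    by rewrite ler_wpM2r.
  by apply: linear_bound => i; rewrite -(deriveE _ (Fd x xr)).
have H2 i x v : `|x - x0| < rho -> `|'D_v ('D_(bv i) F) x| <= n%:R * K1 * `|v|.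
  move=> xr; have [_ _ _ h] := Hrho x xr.
  rewrite (deriveE _ (Dd i x xr)).
  by apply: linear_bound => j; rewrite -(deriveE _ (Dd i x xr)).
have H3 x y v : `|x - x0| < rho -> `|y - x0| < rho ->
    `|'D_v F x - 'D_v F y| <= K * `|v| * `|x - y|.
  move=> xr yr; rewrite (derive_rV v (Fd x xr)) (derive_rV v (Fd y yr)) -sumrB.
  apply: le_trans (ler_norm_sum _ _ _) _.
  apply: (@le_trans _ _ (\sum_(i < n) `|v| * (n%:R * K1 * `|x - y|))); last first.
    rewrite sumr_const card_ord -[leLHS]mulr_natl [leLHS](_ : _ = n%:R * (n%:R * K1) * (`|v| * `|x - y|)); last by ring.
    by rewrite -[leRHS]mulrA ler_wpM2r // mulr_ge0.
  apply: ler_sum => i _; rewrite -scalerBr normrZ; apply: ler_pM => //.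
    exact: mx_normr_ge.
  by apply: (lip_of_derive (Dd i) (H2 i)).
exists rho, K; split=> //; first by apply: lt_le_trans K1K; lra.
  by move=> x /Hrho[].
split=> //.
- by move=> x /Hrho[_ h _ _]; apply: le_trans h K1K.
- exact: lip_of_derive.
- move=> x y xr yr; split; first by move=> v; apply: H3.
  (* The Taylor remainder is the increment of [u] over [0, 1], and the derivative of [u] is a
     difference of first derivatives of [F], already of size [K * |y - x| ^ 2]. *)
  pose u (t : R) := F (x + t *: (y - x)) - t *: 'D_(y - x) F x.
  pose du (t : R) := 'D_(y - x) F (x + t *: (y - x)) - 'D_(y - x) F x.
  have inr (r : R) : Num.min 0 1 <= r <= Num.max 0 1 -> `|x + r *: (y - x) - x0| < rho.
    by move=> /seg01; exact: dist_convex.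
  have e1 : u 1 - u 0 = F y - F x - 'D_(y - x) F x.
    rewrite /u !scale1r !scale0r subr0 addr0 [x + (y - x)]addrC subrK.
    have ac (a b c : 'rV[R]_n) : a - b - c = a - c - b by rewrite addrAC.
    exact: ac.
  rewrite -e1; have := @mvt_mx R 1 n u du 0 1 (K * `|y - x| ^+ 2).
  rewrite subr0 normr1 mulr1.
  apply => r rr.
    apply: is_deriveB; first by apply: is_derive_line; exact: Fd (inr r rr).
    apply: (@is_derive_quadP R 1 n _ r _ 1 0) => // s _.
    by rewrite scalerDl [r *: _ + _]addrC addrK subrr normr0 mul0r.
  apply: le_trans (H3 _ _ _ (inr r rr) xr) _.
  have /seg01/andP[r0 r1] := rr.
  rewrite [x + _]addrC addrK normrZ ger0_norm //.
  have : 0 <= K * `|y - x| ^+ 2 by rewrite mulr_ge0 //; lra.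
  rewrite expr2; set a := `|y - x| => Kaa; nra.
Unshelve. all: by end_near. Qed.

End Tame.

Lemma subr_cross (R : realType) m n (A A' B B' : 'M[R]_(m, n)) :
  A - A' = (B - B') + ((A - B) - (A' - B')).
Proof. by apply/matrixP => i j; rewrite !mxE; ring. Qed.

(** * Differentiability of a flow in time and initial point *)

Section FlowStep.
Context {R : realType} (n : nat) (F : 'rV[R]_n -> 'rV[R]_n) (x0 : 'rV[R]_n) (rho K d r : R).
Context (phi : R -> 'rV[R]_n -> 'rV[R]_n).
Context (Ft : tame F x0 rho K) (K0 : 0 < K) (Kd : 4 * K * d <= 1) (d0 : 0 < d).
Context (phi0 : forall p, `|p - x0| < r -> phi 0 p = p)
  (phiB : forall p (t : R), `|p - x0| < r -> `|t| < d -> `|phi t p - x0| < rho)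
  (phiD : forall p (t : R), `|p - x0| < r -> `|t| < d -> is_derive t 1 (phi ^~ p) (F (phi t p))).

Let Fd x : `|x - x0| < rho -> differentiable F x.
Proof. by have [h _ _ _ _] := Ft; exact: h. Qed.

Lemma flow_lip p p' (t : R) : `|p - x0| < r -> `|p' - x0| < r -> `|t| < d ->
  `|phi t p - phi t p'| <= 2 * `|p - p'|.
Proof.
move=> pr pr' td.
have := @gronwall R 1 n (fun t => phi t p - phi t p')
  (fun t => F (phi t p) - F (phi t p')) d K 0 (ltW K0) (lexx _).
rewrite mul0r addr0 phi0 // phi0 //; apply=> //.
- by have := d0; have := Kd; have := K0; nra.
- by move=> s sd; apply: is_deriveB; exact: phiD.
- move=> s sd; rewrite addr0; have [_ _ _ h _] := Ft; apply: h; exact: phiB.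
Qed.

(** Difference quotient in the initial point, followed as a curve in time. It solves the variational
    equation up to an error of order [h], which is [diffquot_lin]. *)
Definition diffquot (h : R) (p v : 'rV[R]_n) (t : R) : 'rV[R]_n :=
  h^-1 *: (phi t (p + h *: v) - phi t p).

Lemma diffquot_bound h p v t : h != 0 -> `|p - x0| < r -> `|p + h *: v - x0| < r ->
  `|t| < d -> `|diffquot h p v t| <= 2 * `|v|.
Proof.
move=> h0 pr phr td; rewrite /diffquot normrZ normfV.
rewrite ler_pdivrMl ?normr_gt0 //; apply: le_trans (flow_lip phr pr td) _.
by rewrite addrC addKr normrZ; lra.
Qed.

Lemma diffquot_derive h p v (t : R) : h != 0 -> `|p - x0| < r -> `|p + h *: v - x0| < r ->
  `|t| < d -> is_derive t 1 (diffquot h p v)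
    (h^-1 *: (F (phi t (p + h *: v)) - F (phi t p))).
Proof. move=> h0 pr phr td; apply: is_deriveZ; apply: is_deriveB; exact: phiD. Qed.

Lemma diffquot_lin h p v (t : R) : h != 0 -> `|p - x0| < r -> `|p + h *: v - x0| < r ->
  `|t| < d ->
  `|h^-1 *: (F (phi t (p + h *: v)) - F (phi t p)) - 'D_(diffquot h p v t) F (phi t p)|
    <= 4 * K * `|h| * `|v| ^+ 2.
Proof.
move=> h0 pr phr td; have [_ _ _ _ H] := Ft.
have [_ {}H] := H _ _ (phiB pr td) (phiB phr td).
rewrite /diffquot deriveZ_dir; last by apply/Fd/phiB.
rewrite -scalerBr normrZ normfV ler_pdivrMl ?normr_gt0 //.
apply: le_trans H _.
have := flow_lip phr pr td; rewrite [p + _ - p]addrC addKr normrZ.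
set a := `|_ - _|; have : 0 <= a by exact: normr_ge0.
move=> a0 ah; have : a ^+ 2 <= (2 * (`|h| * `|v|)) ^+ 2.
  by rewrite ler_sqr // nnegrE mulr_ge0 // mulr_ge0.
by have := K0; nra.
Qed.

Lemma diffquot0 h p v : h != 0 -> `|p - x0| < r -> `|p + h *: v - x0| < r ->
  diffquot h p v 0 = v.
Proof.
move=> h0 pr phr; rewrite /diffquot phi0 // phi0 // addrC addKr scalerA mulVf //.
by rewrite scale1r.
Qed.

(** The two quotients solve the same linear equation up to errors of orders [h] and [h'], and both
    start at [v], so Gronwall bounds their distance. *)
Lemma diffquot_cauchy h h' p v (t : R) : h != 0 -> h' != 0 -> `|p - x0| < r ->
  `|p + h *: v - x0| < r -> `|p + h' *: v - x0| < r -> `|t| < d ->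
  `|diffquot h p v t - diffquot h' p v t| <= 2 * `|v| ^+ 2 * (`|h| + `|h'|).
Proof.
move=> h0 h0' pr phr phr' td.
pose C := 4 * K * `|v| ^+ 2 * (`|h| + `|h'|).
have C0 : 0 <= C by rewrite /C !mulr_ge0 // ?ltW // addr_ge0.
have := @gronwall R 1 n (fun t => diffquot h p v t - diffquot h' p v t)
  (fun t => h^-1 *: (F (phi t (p + h *: v)) - F (phi t p)) -
            h'^-1 *: (F (phi t (p + h' *: v)) - F (phi t p))) d K C (ltW K0) C0.
rewrite (diffquot0 h0 pr phr) (diffquot0 h0' pr phr') subrr normr0 add0r => H.
apply: le_trans (H _ _ _ t td) _.
- by have := d0; have := Kd; have := K0; nra.
- by move=> s sd; apply: is_deriveB; exact: diffquot_derive.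
- move=> s sd; have [_ _ h1 _ _] := Ft.
  have L1 := diffquot_lin h0 pr phr sd; have L2 := diffquot_lin h0' pr phr' sd.
  have := h1 _ (diffquot h p v s - diffquot h' p v s) (phiB pr sd).
  rewrite (deriveB_dir _ _ (Fd (phiB pr sd))).
  move: L1 L2; set A := h^-1 *: _; set A' := h'^-1 *: _.
  set B := 'D_(diffquot h p v s) F _; set B' := 'D_(diffquot h' p v s) F _ => L1 L2 L3.
  rewrite (subr_cross A A' B B').
  apply: le_trans (ler_normD _ _) _; apply: lerD => //.
  apply: le_trans (ler_normB _ _) _; apply: le_trans (lerD L1 L2) _.
  by rewrite (_ : _ + _ = C) //; rewrite /C; ring.
- rewrite /C; have := Kd; have : 0 <= `|v| ^+ 2 * (`|h| + `|h'|).
    by rewrite mulr_ge0 // addr_ge0.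
  move=> a0 k1; rewrite [leLHS](_ : _ = 2 * (4 * K * d * (`|v| ^+ 2 * (`|h| + `|h'|)))); last by ring.
  by rewrite -[leRHS]mulrA ler_wpM2l // ler_piMl.
Qed.

Lemma admissible p v : `|p - x0| < r ->
  exists2 s : R, 0 < s & forall h, `|h| < s -> `|p + h *: v - x0| < r.
Proof.
move=> pr; have v1 : 0 < `|v| + 1 by rewrite ltr_wpDl.
exists ((r - `|p - x0|) / (`|v| + 1)); first by rewrite divr_gt0 // subr_gt0.
move=> h; rewrite ltr_pdivlMr // => hs.
rewrite addrAC; apply: le_lt_trans (ler_normD _ _) _; rewrite normrZ.
by have := normr_ge0 h; have := normr_ge0 v; nra.
Qed.

(** The candidate [q] for the derivative in the initial point is the limit of the difference
    quotients, so the given flow itself produces the solution of the variational equation. The rate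
    is asserted for every admissible step bound [s], not just for the one from which the limit was
    chosen. *)
Lemma flow_variation : exists q : R -> 'rV[R]_n -> 'rV[R]_n -> 'rV[R]_n,
  forall t p v s, `|t| < d -> `|p - x0| < r -> 0 < s ->
    (forall h, `|h| < s -> `|p + h *: v - x0| < r) ->
    forall h, 0 < `|h| < s -> `|diffquot h p v t - q t p v| <= 2 * `|v| ^+ 2 * `|h|.
Proof.
have ex (z : R * 'rV[R]_n * 'rV[R]_n) : exists l, `|z.1.1| < d -> `|z.1.2 - x0| < r ->
    exists2 s, 0 < s & forall h, 0 < `|h| < s ->
     `|diffquot h z.1.2 z.2 z.1.1 - l| <= 2 * `|z.2| ^+ 2 * `|h|.
  case: z => [[t p] v] /=.
  have [td|] := pselect (`|t| < d); last by exists 0.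
  have [pr|] := pselect (`|p - x0| < r); last by exists 0.
  have [s s0 hs] := admissible v pr.
  have [|h h'|l hl] := @cauchy_rate R n (fun h => diffquot h p v t) (2 * `|v| ^+ 2) s _ s0.
  - by rewrite mulr_ge0.
  - move=> /andP[h0 h1] /andP[h0' h1']; apply: diffquot_cauchy => //; try exact: hs.
      by rewrite -normr_gt0.
    by rewrite -normr_gt0.
  - by exists l => _ _; exists s.
have [q qP] := choice ex.
exists (fun t p v => q (t, p, v)) => t p v s td pr s0 hs h /andP[h0 h1].
have [s' s'0 H] := qP (t, p, v) td pr; rewrite /= in H.
apply: (@limit_le R _ _ (4 * `|v| ^+ 2) (Num.min s s')); first by rewrite lt_min s0.
move=> k /andP[k0]; rewrite lt_min => /andP[k1 k2].
rewrite -(subrKA (diffquot k p v t)); apply: le_trans (ler_normD _ _) _.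
have nk : `|k| = k by rewrite gtr0_norm.
have := H k; rewrite nk k0 k2 => /(_ isT) H1.
have hn : h != 0 by rewrite -normr_gt0.
have kn : k != 0 by rewrite gt_eqF.
have ks : `|k| < s by rewrite nk.
have := diffquot_cauchy hn kn pr (hs h h1) (hs k ks) td.
by rewrite nk; nra.
Qed.

Context (q : R -> 'rV[R]_n -> 'rV[R]_n -> 'rV[R]_n).
Context (qP : forall t p v s, `|t| < d -> `|p - x0| < r -> 0 < s ->
    (forall h, `|h| < s -> `|p + h *: v - x0| < r) ->
    forall h, 0 < `|h| < s -> `|diffquot h p v t - q t p v| <= 2 * `|v| ^+ 2 * `|h|).

Let small_step p v : `|p - x0| < r -> exists2 s : R, 0 < s & forall h, 0 < h < s ->
  [/\ h != 0, `|p + h *: v - x0| < r &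
     forall t, `|t| < d -> `|diffquot h p v t - q t p v| <= 2 * `|v| ^+ 2 * h].
Proof.
move=> pr; have [s s0 hs] := admissible v pr; exists s => // h /andP[h0 h1].
have nh : `|h| = h by rewrite gtr0_norm.
split; [by rewrite gt_eqF|by apply: hs; rewrite nh|] => t td.
by have := qP td pr s0 hs (h := h); rewrite nh h0 h1; apply.
Qed.

Lemma variation0 p v : `|p - x0| < r -> q 0 p v = v.
Proof.
move=> pr; have [s s0 H] := small_step v pr.
apply/eqP; rewrite -subr_eq0 -normr_le0.
apply: (@limit_le R _ _ (2 * `|v| ^+ 2) s) => // h /H[h0 phr].
by rewrite add0r distrC => /(_ 0); rewrite normr0 diffquot0 //; apply.
Qed.

Lemma variation_bound (t : R) p v : `|t| < d -> `|p - x0| < r -> `|q t p v| <= 2 * `|v|.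
Proof.
move=> td pr; have [s s0 H] := small_step v pr.
apply: (@limit_le R _ _ (2 * `|v| ^+ 2) s) => // h /H[h0 phr] /(_ t td) H1.
have -> : q t p v = diffquot h p v t - (diffquot h p v t - q t p v).
  by rewrite opprB addrC subrK.
apply: le_trans (ler_normB _ _) _; apply: lerD => //.
exact: diffquot_bound.
Qed.

Let near0 (t s : R) : `|t| < d -> `|s| < d - `|t| -> `|t + s| < d.
Proof. by move=> td st; apply: le_lt_trans (ler_normD _ _) _; lra. Qed.

Let between_shift (t s x : R) : `|t| < d -> `|s| < d - `|t| ->
  Num.min 0 s <= x <= Num.max 0 s -> `|t + x| < d.
Proof. by move=> td st /between0 xs; apply: near0 => //; exact: le_lt_trans st. Qed.

Lemma is_derive_shift_rV m (u : R -> 'rV[R]_m) (t s : R) (du : 'rV[R]_m) :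
  is_derive (t + s) 1 u du -> is_derive s 1 (fun s => u (t + s)) du.
Proof.
move=> [ud ue].
have E : (fun h : R => h^-1 *: (((fun s => u (t + s)) \o shift s) (h *: (1 : R)) - u (t + s)))
       = (fun h => h^-1 *: ((u \o shift (t + s)) (h *: (1 : R)) - u (t + s))).
  by apply/funext => h /=; rewrite addrCA.
by apply: DeriveDef; [rewrite /derivable E|rewrite /derive E].
Qed.

Lemma flow_time_lip (t s : R) p : `|t| < d -> `|s| < d - `|t| -> `|p - x0| < r ->
  `|phi (t + s) p - phi t p| <= K * `|s|.
Proof.
move=> td st pr.
have := @mvt_mx R 1 n (fun s => phi (t + s) p) (fun s => F (phi (t + s) p)) 0 s K.
rewrite addr0 subr0; apply => x xs; have tx := between_shift td st xs.
  by apply: (@is_derive_shift_rV _ (phi ^~ p)); exact: phiD.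
by have [_ h _ _ _] := Ft; apply: h; exact: phiB.
Qed.

(** [q] solves the variational equation. Since differentiation in time is not exchanged with the
    limit in [h], the increment of a quotient over the time [s] is estimated by a term quadratic in
    [s] plus terms that vanish with [h]; [limit_le] removes the latter. *)
Lemma variation_derive (t : R) p v : `|t| < d -> `|p - x0| < r ->
  is_derive t 1 (fun t => q t p v) ('D_(q t p v) F (phi t p)).
Proof.
move=> td pr; have [_ HF HDF Hlip H] := Ft.
have dt : 0 < d - `|t| by rewrite subr_gt0.
apply: (@is_derive_quadP R 1 n _ t _ (d - `|t|) (4 * K ^+ 2 * `|v|)) => // s st.
have tsd := near0 td st.
have [s1 s10 Hs] := small_step v pr.
set Dq := 'D_(q t p v) F (phi t p).
apply: (@limit_le R _ _ (4 * `|v| ^+ 2 + `|s| * (K * (2 * `|v| ^+ 2)) + 4 * K * `|v| ^+ 2 * `|s|) s1) => // h hs.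
have [h0 phr Hh] := Hs h hs; have hn : `|h| = h by case/andP: hs => ? _; rewrite gtr0_norm.
(* The increment of the quotient minus its expected linear part. Its derivative is small by the
   Lipschitz bounds on [F], on the differential of [F] and on the flow in time. *)
pose w x := diffquot h p v (t + x) - x *: 'D_(diffquot h p v t) F (phi t p).
have W : `|w s - w 0| <= (4 * K ^+ 2 * `|v| * `|s| + 4 * K * `|v| ^+ 2 * h) * `|s|.
  have := @mvt_mx R 1 n w (fun x => h^-1 *: (F (phi (t + x) (p + h *: v)) - F (phi (t + x) p))
      - 'D_(diffquot h p v t) F (phi t p)) 0 s.
  rewrite subr0; apply => x xs; have tx := between_shift td st xs; have xs' := between0 xs.
    apply: is_deriveB; first by apply: is_derive_shift_rV; exact: diffquot_derive.
    apply: (@is_derive_quadP R 1 n _ x _ 1 0) => // y _.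
    by rewrite scalerDl [x *: _ + _]addrC addrK subrr normr0 mul0r.
  have L1 := diffquot_lin h0 pr phr tx; rewrite hn in L1.
  have xd : `|x| < d - `|t| by apply: le_lt_trans st.
  have L2 : `|diffquot h p v (t + x) - diffquot h p v t| <= 2 * K * `|v| * `|x|.
    have := @mvt_mx R 1 n (fun y => diffquot h p v (t + y)) (fun x => h^-1 *: (F (phi (t + x) (p + h *: v)) - F (phi (t + x) p))) 0 x (2 * K * `|v|).
    rewrite subr0 addr0; apply => y yx; have ty := between_shift td xd yx.
      by apply: is_derive_shift_rV; exact: diffquot_derive.
    rewrite normrZ normfV ler_pdivrMl ?normr_gt0 //.
    apply: le_trans (Hlip _ _ (phiB phr ty) (phiB pr ty)) _.
    have := flow_lip phr pr ty; rewrite [p + _ - p]addrC addKr normrZ => L.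
    rewrite [leRHS](_ : _ = K * (2 * (`|h| * `|v|))); last by ring.
    by rewrite ler_wpM2l // ltW.
  have L3 := flow_time_lip td xd pr.
  have L4 := HDF _ (diffquot h p v (t + x) - diffquot h p v t) (phiB pr tx).
  have [L5 _] := H _ _ (phiB pr tx) (phiB pr td).
  have {}L5 := L5 (diffquot h p v t).
  rewrite (deriveB_dir _ _ (Fd (phiB pr tx))) in L4.
  have L6 := diffquot_bound h0 pr phr td.
  set A := h^-1 *: _ in L1 *; set B := 'D_(diffquot h p v (t + x)) F _ in L1 L4.
  set B' := 'D_(diffquot h p v t) F (phi (t + x) p) in L4 L5.
  set B'' := 'D_(diffquot h p v t) F (phi t p) in L5 *.
  have -> : A - B'' = (A - B) + (B - B') + (B' - B'') by rewrite subrKA subrKA.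
  apply: le_trans (ler_normD _ _) _; apply: le_trans (lerD (ler_normD _ _) (lexx _)) _.
  have K0' := ltW K0.
  have M1 : `|B - B'| <= 2 * K ^+ 2 * `|v| * `|s|.
    apply: le_trans L4 _; apply: (@le_trans _ _ (K * (2 * K * `|v| * `|x|))).
      by rewrite ler_wpM2l.
    rewrite [leLHS](_ : _ = 2 * K ^+ 2 * `|v| * `|x|); last by ring.
    by rewrite ler_wpM2l // !mulr_ge0 // sqr_ge0.
  have M2 : `|B' - B''| <= 2 * K ^+ 2 * `|v| * `|s|.
    apply: le_trans L5 _; apply: (@le_trans _ _ (K * (2 * `|v|) * (K * `|x|))).
      apply: ler_pM => //; first by rewrite mulr_ge0.
      by rewrite ler_wpM2l.
    rewrite [leLHS](_ : _ = 2 * K ^+ 2 * `|v| * `|x|); last by ring.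
    by rewrite ler_wpM2l // !mulr_ge0 // sqr_ge0.
  clear - L1 M1 M2.
  apply: le_trans (lerD (lerD L1 M1) M2) _.
  rewrite le_eqVlt; apply/orP; left; apply/eqP; ring.
have H1 := Hh _ tsd; have H2 := Hh _ td.
have H3 : `|'D_(diffquot h p v t) F (phi t p) - Dq| <= K * (2 * `|v| ^+ 2 * h).
  rewrite -(deriveB_dir _ _ (Fd (phiB pr td))).
  apply: le_trans (HDF _ _ (phiB pr td)) _.
  by rewrite ler_wpM2l // ltW.
set q1 := q (t + s) p v in H1 *; set q0 := q t p v in H2 *.
have E : q1 - q0 - s *: Dq = (w s - w 0) - (diffquot h p v (t + s) - q1)
    + (diffquot h p v t - q0) + s *: ('D_(diffquot h p v t) F (phi t p) - Dq).
  rewrite /w addr0 scale0r subr0 scalerBr.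
  move: (diffquot h p v (t + s)) (diffquot h p v t) ('D_(diffquot h p v t) F (phi t p)).
  by move=> a b c; apply/matrixP => i j; rewrite !mxE; ring.
rewrite E; apply: le_trans (ler_normD _ _) _; apply: le_trans (lerD (ler_normD _ _) (lexx _)) _.
apply: le_trans (lerD (lerD (ler_normB _ _) (lexx _)) (lexx _)) _.
rewrite normrZ.
have H3' : `|s| * `|'D_(diffquot h p v t) F (phi t p) - Dq| <= `|s| * (K * (2 * `|v| ^+ 2 * h)).
  by rewrite ler_wpM2l.
clear - W H1 H2 H3'.
apply: le_trans (lerD (lerD (lerD W H1) H2) H3') _.
rewrite le_eqVlt; apply/orP; left; apply/eqP; ring.
Qed.

Lemma variation_linear (t : R) p (a : R) v w : `|t| < d -> `|p - x0| < r ->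
  q t p (a *: v + w) = a *: q t p v + q t p w.
Proof.
move=> td pr; apply/eqP; rewrite -subr_eq0 -normr_le0.
have := @gronwall R 1 n (fun t => q t p (a *: v + w) - (a *: q t p v + q t p w))
  (fun t => 'D_(q t p (a *: v + w)) F (phi t p) - (a *: 'D_(q t p v) F (phi t p) + 'D_(q t p w) F (phi t p)))
  d K 0 (ltW K0) (lexx _).
rewrite !variation0 // subrr normr0 mul0r addr0 mulr0; apply => //.
- by have := d0; have := Kd; have := K0; nra.
- move=> s sd; apply: is_deriveB; first exact: variation_derive.
  by apply: is_deriveD; [apply: is_deriveZ|]; exact: variation_derive.
- move=> s sd; rewrite addr0; have [_ _ h _ _] := Ft.
  have Fds := Fd (phiB pr sd).
  rewrite -(deriveZ_dir _ _ Fds) -(deriveD_dir _ _ Fds) -(deriveB_dir _ _ Fds).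
  exact: h (phiB pr sd).
Qed.

Definition flow_domain : set 'rV[R]_(1 + n) :=
  [set z | `|lsubmx z 0 0| < d /\ `|rsubmx z - x0| < r].

Definition flow_map (z : 'rV[R]_(1 + n)) : 'rV[R]_n := phi (lsubmx z 0 0) (rsubmx z).

(** The remainder splits into three: moving the initial point at the fixed time [t + s], changing
    [q] between the times [t] and [t + s], and moving along the orbit of [p]. Each is quadratic in
    the displacement. *)
Lemma flow_map_diff z : flow_domain z -> differentiable flow_map z /\
  forall v, 'D_v flow_map z = lsubmx v 0 0 *: F (flow_map z)
     + q (lsubmx z 0 0) (rsubmx z) (rsubmx v).
Proof.
move=> [td pr]; set t := lsubmx z 0 0 in td *; set p := rsubmx z in pr *.
have lin : linear (fun v : 'rV[R]_(1 + n) => lsubmx v 0 0 *: F (phi t p) + q t p (rsubmx v)).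
  move=> a u v; rewrite [in q _ _ _]linearP variation_linear //.
  have -> : lsubmx (a *: u + v) 0 0 = a * lsubmx u 0 0 + lsubmx v 0 0 by rewrite linearP !mxE.
  transitivity (a *: (lsubmx u 0 0 *: F (phi t p) + q t p (rsubmx u))
     + (lsubmx v 0 0 *: F (phi t p) + q t p (rsubmx v))); last by [].
  by rewrite scalerDr scalerA scalerDl addrACA.
pose LM := GRing.isLinear.Build _ _ _ _ _ lin.
pose L : {linear 'rV[R]_(1 + n) -> 'rV[R]_n} := HB.pack
  (fun v : 'rV[R]_(1 + n) => lsubmx v 0 0 *: F (phi t p) + q t p (rsubmx v)) LM.
have K0' := ltW K0.
have [_ HF HDF Hlip H] := Ft.
pose e := Num.min (d - `|t|) ((r - `|p - x0|) / 2).
have e0 : 0 < e by rewrite lt_min subr_gt0 td divr_gt0 // subr_gt0.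
suff [dz ez] : is_diff z flow_map L.
  by split=> // v; rewrite deriveE // ez.
apply: (@is_diff_quad R _ _ flow_map z L e (2 + 2 * K + K ^+ 2)) => //.
  exact: linear_continuous_rV.
move=> h he; set s := lsubmx h 0 0; set w := rsubmx h.
have sh : `|s| <= `|h|.
  rewrite /s mxE; exact: mx_normr_ge.
have wh : `|w| <= `|h|.
  by apply: mx_normr_le => // i j; rewrite mxE; exact: mx_normr_ge.
have sd : `|s| < d - `|t|.
  by apply: le_lt_trans sh _; apply: lt_le_trans he _; rewrite ge_min lexx.
have wd : `|w| < (r - `|p - x0|) / 2.
  by apply: le_lt_trans wh _; apply: lt_le_trans he _; rewrite ge_min lexx orbT.
have tsd := near0 td sd.
(* The bound 2 leaves the step 1 strictly inside the admissible range; the rate of [q] is used below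
   at [h = 1]. *)
have adm k : `|k| < 2 -> `|p + k *: w - x0| < r.
  move=> k2; rewrite addrAC; apply: le_lt_trans (ler_normD _ _) _; rewrite normrZ.
  apply: (@le_lt_trans _ _ (`|p - x0| + 2 * `|w|)); last by lra.
  by rewrite lerD2l ler_wpM2r // ltW.
have pw : `|p + w - x0| < r by rewrite -[w]scale1r; apply: adm; rewrite normr1 ltr1n.
have -> : flow_map (z + h) = phi (t + s) (p + w).
  by rewrite /flow_map /p /w -linearD; congr (phi _ _); rewrite /t /s !mxE.
rewrite /= -/(flow_map z) {1}/flow_map -/t -/p -/s -/w.
have E1 : `|phi (t + s) (p + w) - phi (t + s) p - q (t + s) p w| <= 2 * `|w| ^+ 2.
  have := qP tsd pr (ltr0Sn R 1) adm (h := 1).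
  rewrite normr1 ltr01 ltr1n /= /diffquot invr1 !scale1r mulr1; exact.
have E2 : `|q (t + s) p w - q t p w| <= 2 * K * `|w| * `|s|.
  have := @mvt_mx R 1 n (fun s => q (t + s) p w) (fun s => 'D_(q (t + s) p w) F (phi (t + s) p)) 0 s (2 * K * `|w|).
  rewrite addr0 subr0; apply => x xs; have tx := between_shift td sd xs.
    by apply: (@is_derive_shift_rV _ (fun t => q t p w)); exact: variation_derive.
  apply: le_trans (HDF _ _ (phiB pr tx)) _.
  rewrite [leRHS](_ : _ = K * (2 * `|w|)); last by ring.
  by rewrite ler_wpM2l //; exact: variation_bound.
have E3 : `|phi (t + s) p - phi t p - s *: F (phi t p)| <= K ^+ 2 * `|s| * `|s|.
  have := @mvt_mx R 1 n (fun s => phi (t + s) p - s *: F (phi t p)) (fun s => F (phi (t + s) p) - F (phi t p)) 0 s (K ^+ 2 * `|s|).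
  rewrite addr0 scale0r !subr0 addrAC; apply => x xs; have tx := between_shift td sd xs.
    apply: is_deriveB; first by apply: (@is_derive_shift_rV _ (phi ^~ p)); exact: phiD.
    apply: (@is_derive_quadP R 1 n _ x _ 1 0) => // y _.
    by rewrite scalerDl [x *: _ + _]addrC addrK subrr normr0 mul0r.
  apply: le_trans (Hlip _ _ (phiB pr tx) (phiB pr td)) _.
  have xd : `|x| < d - `|t| by apply: le_lt_trans sd; exact: between0.
  have xs' := between0 xs.
  rewrite expr2 -mulrA ler_wpM2l //; apply: le_trans (flow_time_lip td xd pr) _.
  by rewrite ler_wpM2l.
have -> : phi (t + s) (p + w) - phi t p - (s *: F (phi t p) + q t p w) =
   (phi (t + s) (p + w) - phi (t + s) p - q (t + s) p w) + (q (t + s) p w - q t p w)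
   + (phi (t + s) p - phi t p - s *: F (phi t p)).
  move: (phi (t + s) (p + w)) (phi (t + s) p) (q (t + s) p w) (q t p w) (phi t p) (s *: F _).
  by move=> a b c a' b' c'; apply/matrixP => i j; rewrite !mxE; ring.
apply: le_trans (ler_normD _ _) _; apply: le_trans (lerD (ler_normD _ _) (lexx _)) _.
have hh := normr_ge0 h.
have F1 : `|w| ^+ 2 <= `|h| ^+ 2 by rewrite !expr2; apply: ler_pM.
have F2 : `|w| * `|s| <= `|h| ^+ 2 by rewrite expr2; apply: ler_pM.
have F3 : `|s| * `|s| <= `|h| ^+ 2 by rewrite expr2; apply: ler_pM.
apply: le_trans (lerD (lerD E1 E2) E3) _.
rewrite [leRHS]mulrDl [X in _ <= X + _]mulrDl; apply: lerD; first apply: lerD.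
- by rewrite ler_wpM2l.
- by rewrite -mulrA ler_wpM2l // mulr_ge0.
- by rewrite -mulrA ler_wpM2l // sqr_ge0.
Qed.

End FlowStep.

(** * Smoothness of flows to all orders *)

Section FlowSmooth.
Context {R : realType}.

Lemma pos_min n (P : 'I_n -> R -> Prop) :
  (forall i a b, 0 < a -> a <= b -> P i b -> P i a) ->
  (forall i, exists2 a, 0 < a & P i a) -> exists2 a, 0 < a & forall i, P i a.
Proof.
elim: n P => [|n IH] P mon ex; first by exists 1 => // -[].
have [a a0 Pa] := ex ord0.
have [b b0 Pb] := IH (fun i => P (lift ord0 i)) (fun i => mon _) (fun i => ex _).
exists (Num.min a b); first by rewrite lt_min a0.
move=> i; case: (unliftP ord0 i) => [j|] ->.
  by apply: mon (Pb j); rewrite ?lt_min ?a0 // ge_min lexx orbT.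
by apply: mon Pa; rewrite ?lt_min ?a0 // ge_min lexx.
Qed.

(** The field on the doubled space whose flow is the flow of [F] together with its derivative in the
    initial point: (p, v) moves to (phi t p, q t p v). *)
Definition variational n (F : 'rV[R]_n -> 'rV[R]_n) (z : 'rV[R]_(n + n)) : 'rV[R]_(n + n) :=
  row_mx (F (lsubmx z)) ('D_(rsubmx z) F (lsubmx z)).

Lemma continuous_lsubmx m n1 n2 : continuous (@lsubmx R m n1 n2).
Proof. by move=> A; exact: differentiable_continuous (differentiable_lsubmx A). Qed.

Lemma continuous_rsubmx m n1 n2 : continuous (@rsubmx R m n1 n2).
Proof. by move=> A; exact: differentiable_continuous (differentiable_rsubmx A). Qed.

Lemma Ck_lsubmx (V : normedModType R) k (U : set V) m n1 n2 (f : V -> 'M[R]_(m, n1 + n2)) :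
  open U -> Ck k U f -> Ck k U (fun x => lsubmx (f x)).
Proof. by move=> oU /(Ck_mxP _ _ oU) fC; apply/Ck_mxP => // i j; under eq_fun do rewrite mxE. Qed.

Lemma Ck_rsubmx (V : normedModType R) k (U : set V) m n1 n2 (f : V -> 'M[R]_(m, n1 + n2)) :
  open U -> Ck k U f -> Ck k U (fun x => rsubmx (f x)).
Proof. by move=> oU /(Ck_mxP _ _ oU) fC; apply/Ck_mxP => // i j; under eq_fun do rewrite mxE. Qed.

Lemma Ck_row_mx (V : normedModType R) k (U : set V) m n1 n2 (f : V -> 'M[R]_(m, n1))
    (g : V -> 'M[R]_(m, n2)) : open U -> Ck k U f -> Ck k U g ->
  Ck k U (fun x => row_mx (f x) (g x)).
Proof.
move=> oU /(Ck_mxP _ _ oU) fC /(Ck_mxP _ _ oU) gC; apply/Ck_mxP => // i j.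
by under eq_fun do rewrite mxE; case: (fintype.split j).
Qed.

Lemma Ck_id (V : normedModType R) k (U : set V) : Ck k U id.
Proof. by apply: (@Ck_lin R V V k U idfun) => x. Qed.

Lemma Ck_derive_pair n m k (Om : set 'rV[R]_n) (F : 'rV[R]_n -> 'rV[R]_m) : open Om ->
  Ck k.+1 Om F ->
  Ck k (lsubmx @^-1` Om) (fun z : 'rV[R]_(n + n) => 'D_(rsubmx z) F (lsubmx z)).
Proof.
move=> oO FC; have oO' : open ((@lsubmx R 1 n n) @^-1` Om).
  by apply: open_comp => // z _; exact: continuous_lsubmx.
have [Fd Fk] := FC; apply/Ck_mxP => // i j.
have : Ck k (lsubmx @^-1` Om) (fun z : 'rV[R]_(n + n) =>
   \sum_l rsubmx z 0 l * ('D_(bv l) F (lsubmx z)) 0 j).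
  apply: Ck_sum => // l _; apply: CkM => //.
    have := Ck_rsubmx oO' (@Ck_id _ k (lsubmx @^-1` Om)) => /(Ck_mxP _ _ oO').
    exact.
  have := Fk (bv l) => /(Ck_mxP _ _ oO) => /(_ 0 j) h.
  apply: (Ck_comp oO' oO _ _ h) => //.
  exact: Ck_lsubmx (@Ck_id _ _ _).
apply: eq_Ck => // z Oz; rewrite (derive_rV (rsubmx z)); last exact: Fd.
by rewrite ord1 summxE; apply: eq_bigr => l _; rewrite !mxE.
Qed.

Lemma Ck_variational n k (Om : set 'rV[R]_n) (F : 'rV[R]_n -> 'rV[R]_n) : open Om ->
  Ck k.+1 Om F -> Ck k (lsubmx @^-1` Om) (variational F).
Proof.
move=> oO FC; have oO' : open ((@lsubmx R 1 n n) @^-1` Om).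
  by apply: open_comp => // z _; exact: continuous_lsubmx.
apply: Ck_row_mx => //; last exact: Ck_derive_pair.
apply: (Ck_comp_mx oO' oO (f := @lsubmx R 1 n n)) => //.
  exact: Ck_lsubmx (@Ck_id _ _ _).
exact: CkS.
Qed.

Lemma open_flow_domain n (x0 : 'rV[R]_n) d r : open (flow_domain x0 d r).
Proof.
rewrite (_ : flow_domain x0 d r = [set z : 'rV[R]_(1 + n) | `|lsubmx z 0 0| < d] `&`
  [set z | `|rsubmx z - x0| < r]) //; apply: openI.
  rewrite (_ : mkset _ = (fun z : 'rV[R]_(1 + n) => `|lsubmx z 0 0|) @^-1` [set t | t < d]) //.
  apply: open_comp; last exact: open_lt.
  move=> z _; apply: continuous_comp; last exact: norm_continuous.
  apply: (@continuous_comp _ _ _ (@lsubmx R 1 1 n) (fun A : 'M[R]_(1, 1) => A 0 0)).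
    exact: continuous_lsubmx.
  exact: coord_continuous.
rewrite (_ : mkset _ = (fun z : 'rV[R]_(1 + n) => `|rsubmx z - x0|) @^-1` [set t | t < r]) //.
apply: open_comp; last exact: open_lt.
move=> z _; apply: continuous_comp; last exact: norm_continuous.
apply: continuousB; last exact: cst_continuous.
exact: continuous_rsubmx.
Qed.

Definition solves n (F : 'rV[R]_n -> 'rV[R]_n) (phi : R -> 'rV[R]_n -> 'rV[R]_n)
    (x0 : 'rV[R]_n) (rho d r : R) : Prop :=
  forall p, `|p - x0| < r -> phi 0 p = p /\
    forall t : R, `|t| < d -> `|phi t p - x0| < rho /\ is_derive t 1 (phi ^~ p) (F (phi t p)).

(** Induction on [k], for all dimensions and all fields at once. A directional derivative of the
    flow map combines [F] along the flow with the vectors [q t p (bv i)]; these are components of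
    the flow of [variational F] started at (p, bv i), to which the induction hypothesis applies. The
    size [a] is chosen before [phi], so the result holds for any family of solutions that stays in
    the ball. *)
Theorem flow_Ck k n (F : 'rV[R]_n -> 'rV[R]_n) (Om : set 'rV[R]_n) x0 :
  open Om -> Om x0 -> smooth_on Om F ->
  exists2 a, 0 < a & forall phi (d r : R), 0 < d -> d <= a -> r <= a -> solves F phi x0 a d r ->
    Ck k (flow_domain x0 d r) (flow_map phi).
Proof.
elim: k n F Om x0 => [|k IH] n F Om x0 oO Ox0 Fs.
  have [rho [K [rho0 K0 HO Ft]]] := tame_exists oO Ox0 (Fs 2%N).
  exists (Num.min rho (1 / (4 * K))); first by rewrite lt_min rho0 divr_gt0 // mulr_gt0.
  move=> phi d r d0; rewrite le_min => /andP[d1 d2] r1 phiP.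
  have Kd : 4 * K * d <= 1 by rewrite mulrC -ler_pdivlMr // mulr_gt0.
  have phi0 p : `|p - x0| < r -> phi 0 p = p by move=> /phiP[].
  have phiB p (t : R) : `|p - x0| < r -> `|t| < d -> `|phi t p - x0| < rho.
    move=> /phiP[_ H] /H[h _]; apply: lt_le_trans h _; by rewrite ge_min lexx.
  have phiD p (t : R) : `|p - x0| < r -> `|t| < d -> is_derive t 1 (phi ^~ p) (F (phi t p)).
    by move=> /phiP[_ H] /H[_].
  have [q qP] := flow_variation Ft K0 Kd d0 phi0 phiB phiD.
  move=> z Wz; apply: differentiable_continuous.
  by have [] := flow_map_diff Ft K0 Kd d0 phi0 phiB phiD qP Wz.
have [rho [K [rho0 K0 HO Ft]]] := tame_exists oO Ox0 (Fs 2%N).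
have [a1 a10 H1] := IH n F Om x0 oO Ox0 Fs.
have oO' : open ((@lsubmx R 1 n n) @^-1` Om).
  by apply: open_comp => // z _; exact: continuous_lsubmx.
have Fs' : smooth_on (lsubmx @^-1` Om) (variational F).
  by move=> l; apply: Ck_variational => //; exact: Fs.
(* The doubled flow starts near [(x0, bv i)] and has to stay in a ball of radius [b]. Its first
   component stays within [a <= b / 4]; the second starts within [b / 4] and moves by at most
   [4 * K * |t|], again below [b / 4] when [|t| < b / (16 * K)]. *)
pose P (i : 'I_n) (a : R) := exists2 b, a <= b / 4 /\ a <= b / (16 * K) &
  forall psi (d r : R), 0 < d -> d <= b -> r <= b ->
    solves (variational F) psi (row_mx x0 (bv i)) b d r ->
    Ck k (flow_domain (row_mx x0 (bv i)) d r) (flow_map psi).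
have [a2 a20 H2] : exists2 a, 0 < a & forall i, P i a.
  apply: pos_min => [i a b a0 ab [c [bc1 bc2] Hc]|i].
    by exists c => //; split; exact: le_trans ab _.
  have [|b b0 Hb] := IH _ (variational F) _ (row_mx x0 (bv i)) oO' _ Fs'.
    by rewrite /= row_mxKl.
  exists (Num.min (b / 4) (b / (16 * K))); last first.
    by exists b => //; rewrite !ge_min !lexx orbT.
  by rewrite lt_min !divr_gt0 // mulr_gt0.
pose a : R := Num.min (Num.min rho (1 / (4 * K))) (Num.min (Num.min 1 a1) a2).
have a0 : 0 < a by rewrite !lt_min rho0 a10 a20 ltr01 divr_gt0 // mulr_gt0.
have [aK arho aa1 aa2 a_1] : [/\ a <= 1 / (4 * K), a <= rho, a <= a1, a <= a2 & a <= 1].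
  by split; rewrite /a !ge_min lexx ?orbT.
exists a => // phi d r d0 da ra phiP.
have Kd : 4 * K * d <= 1.
  by rewrite mulrC -ler_pdivlMr; [exact: le_trans aK|exact: mulr_gt0].
have phi0 p : `|p - x0| < r -> phi 0 p = p by move=> /phiP[].
have phiB p (t : R) : `|p - x0| < r -> `|t| < d -> `|phi t p - x0| < rho.
  by move=> /phiP[_ H] /H[h _]; exact: lt_le_trans arho.
have phiD p (t : R) : `|p - x0| < r -> `|t| < d -> is_derive t 1 (phi ^~ p) (F (phi t p)).
  by move=> /phiP[_ H] /H[_].
have [q qP] := flow_variation Ft K0 Kd d0 phi0 phiB phiD.
have dz z := @flow_map_diff R n F x0 rho K d r phi Ft K0 Kd d0 phi0 phiB phiD q qP z.
split=> [z Wz|v]; first by have [] := dz z Wz.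
have oW := @open_flow_domain n x0 d r.
have phiC : Ck k (flow_domain x0 d r) (flow_map phi).
  apply: H1 => //; [exact: le_trans aa1|exact: le_trans aa1|].
  move=> p /phiP[h1 h2]; split=> // t /h2[h3 h4]; split=> //; exact: lt_le_trans aa1.
have qC i : Ck k (flow_domain x0 d r) (fun z => q (lsubmx z 0 0) (rsubmx z) (bv i)).
  have [b [ab1 ab2] Hb] := H2 i.
  have b0 : 0 < b.
    have : 0 < b / 4 by apply: lt_le_trans ab1.
    by rewrite pmulr_lgt0.
  pose psi (t : R) (z : 'rV[R]_(n + n)) := row_mx (phi t (lsubmx z)) (q t (lsubmx z) (rsubmx z)).
  have sub (z : 'rV[R]_(n + n)) : `|z - row_mx x0 (bv i)| < r ->
      `|lsubmx z - x0| < r /\ `|rsubmx z - bv i| < r.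
    have r0 : `|z - row_mx x0 (bv i)| < r -> 0 < r by apply: le_lt_trans.
    move=> zr; split; apply: mx_normr_lt (r0 zr) _ => u w.
      apply: le_lt_trans zr.
      have := mx_normr_ge (z - row_mx x0 (bv i)) u (lshift n w).
      by rewrite [(z - _) _ _]mxE [(- row_mx _ _) _ _]mxE row_mxEl [(lsubmx z - x0) _ _]mxE [lsubmx z _ _]mxE [(- x0) _ _]mxE.
    apply: le_lt_trans zr.
    have := mx_normr_ge (z - row_mx x0 (bv i)) u (rshift n w).
    by rewrite [(z - _) _ _]mxE [(- row_mx _ _) _ _]mxE row_mxEr [(rsubmx z - _) _ _]mxE [rsubmx z _ _]mxE [(- delta_mx _ _) _ _]mxE.
  have S : solves (variational F) psi (row_mx x0 (bv i)) b d r.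
    move=> z /sub[zl zr]; split.
      rewrite /psi phi0 // (variation0 d0 phi0 qP) //; exact: hsubmxK.
    move=> t td; split; last first.
      apply: is_derive_mxI => u w; rewrite /psi /variational.
      under eq_fun do rewrite mxE; rewrite mxE row_mxKl row_mxKr.
      case: (fintype.split w) => w'; apply: is_derive_mx.
        exact: phiD.
      exact: (variation_derive Ft K0 Kd d0 phi0 phiB phiD qP).
    have pa : `|phi t (lsubmx z) - x0| < a by have [_ /(_ t td)[]] := phiP _ zl.
    have nv : `|rsubmx z| <= 2.
      rewrite -[rsubmx z](subrK (bv i)); apply: le_trans (ler_normD _ _) _.
      have : `|bv i : 'rV[R]_n| <= 1.
        by apply: mx_normr_le => // u w; rewrite mxE; case: (_ && _); rewrite ?normr1 ?normr0.
      by lra.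
    have qv : `|q t (lsubmx z) (rsubmx z) - rsubmx z| <= K * 4 * `|t|.
      have := @mvt_mx R 1 n (fun t => q t (lsubmx z) (rsubmx z))
         (fun t => 'D_(q t (lsubmx z) (rsubmx z)) F (phi t (lsubmx z))) 0 t (K * 4).
      rewrite (variation0 d0 phi0 qP) // subr0; apply => x /between0 xt.
        have xd := le_lt_trans xt td.
        exact: (variation_derive Ft K0 Kd d0 phi0 phiB phiD qP).
      have xd := le_lt_trans xt td; have [_ _ h _ _] := Ft.
      apply: le_trans (h _ _ (phiB _ _ zl xd)) _; rewrite ler_pM2l //.
      by have := variation_bound Ft K0 Kd d0 phi0 phiB phiD qP (rsubmx z) xd zl; lra.
    have Kt : K * 4 * `|t| < b / 4.
      apply: (@lt_le_trans _ _ (K * 4 * (b / (16 * K)))).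
        rewrite ltr_pM2l ?mulr_gt0 //; apply: lt_le_trans td _.
        exact: le_trans (le_trans da aa2) ab2.
      by rewrite le_eqVlt; apply/orP; left; apply/eqP; field; rewrite gt_eqF.
    rewrite /psi opp_row_mx add_row_mx.
    apply: mx_normr_lt => // u w; rewrite mxE; case: (fintype.split w) => w'.
      apply: le_lt_trans (mx_normr_ge _ _ _) _; apply: lt_le_trans pa _.
      by apply: le_trans aa2 _; apply: le_trans ab1 _; lra.
    apply: le_lt_trans (mx_normr_ge _ _ _) _.
    rewrite -(subrKA (rsubmx z)); apply: le_lt_trans (ler_normD _ _) _.
    have : r <= b / 4 by apply: le_trans ra _; exact: le_trans ab1.
    by lra.
  have bb : a2 <= b by apply: le_trans ab1 _; lra.
  have db : d <= b by apply: le_trans da _; exact: le_trans bb.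
  have rb : r <= b by apply: le_trans ra _; exact: le_trans bb.
  have := Hb psi d r d0 db rb S.
  pose io (z : 'rV[R]_(1 + n)) : 'rV[R]_(1 + (n + n)) :=
    row_mx (lsubmx z) (row_mx (rsubmx z) (bv i)).
  have ioC : Ck k (flow_domain x0 d r) io.
    apply: Ck_row_mx => //; first exact: Ck_lsubmx (@Ck_id _ _ _).
    apply: Ck_row_mx => //; first exact: Ck_rsubmx (@Ck_id _ _ _).
    exact: Ck_cst.
  have ioW z : flow_domain x0 d r z -> flow_domain (row_mx x0 (bv i)) d r (io z).
    move=> [h1 h2]; split; rewrite /io ?row_mxKl ?row_mxKr //.
    rewrite opp_row_mx add_row_mx subrr; apply: mx_normr_lt => [|u w].
      by apply: le_lt_trans h2.
    rewrite mxE; case: (fintype.split w) => w'.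
      by apply: le_lt_trans h2; exact: mx_normr_ge.
    by rewrite mxE normr0; apply: le_lt_trans h2.
  move=> /(Ck_comp_mx oW (@open_flow_domain _ _ _ _) ioW ioC)/(Ck_rsubmx oW).
  apply: eq_Ck => // z Wz /=; rewrite /flow_map /psi /io !row_mxKl !row_mxKr.
  by rewrite row_mxKl.
have : Ck k (flow_domain x0 d r) (fun z => lsubmx v 0 0 *: F (flow_map phi z)
   + \sum_i rsubmx v 0 i *: q (lsubmx z 0 0) (rsubmx z) (bv i)).
  apply: CkD => //.
    apply/Ck_mxP => // u w; under eq_fun do rewrite mxE; apply: CkZ => //.
    move: u w; apply/Ck_mxP => //; apply: (Ck_comp_mx oW oO (f := flow_map phi)) => //.
    by move=> z [td pr]; apply: HO; exact: phiB.
  apply: Ck_sum => // i _; apply/Ck_mxP => // u w; under eq_fun do rewrite mxE.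
  by apply: CkZ => //; move: u w; apply/Ck_mxP.
apply: eq_Ck => // z Wz; have [_ ->] := dz z Wz; congr (_ + _).
have [td pr] := Wz.
have lin : linear (q (lsubmx z 0 0) (rsubmx z)).
  by move=> b u w; exact: (variation_linear Ft K0 Kd d0 phi0 phiB phiD qP).
pose LM := GRing.isLinear.Build _ _ _ _ _ lin.
pose L : {linear 'rV[R]_n -> 'rV[R]_n} := HB.pack (q (lsubmx z 0 0) (rsubmx z)) LM.
rewrite -[RHS]/(L (rsubmx v)) [in RHS](row_sum_delta (rsubmx v)) linear_sum.
by apply: eq_bigr => i _; rewrite linearZ.
Qed.

End FlowSmooth.

(** * Symmetry of second derivatives *)

Section Schwarz.
Context {R : realType}.

Lemma is_derive_lineR n (F : 'rV[R]_n -> R) (x w : 'rV[R]_n) (s : R) :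
  differentiable F (x + s *: w) ->
  is_derive s 1 (fun s : R => F (x + s *: w)) ('D_w F (x + s *: w)).
Proof. exact: is_derive_line. Qed.

Lemma is_deriveM_cst (c s : R) : is_derive s 1 (fun s : R => s * c) c.
Proof.
have := @is_deriveM _ _ (id : R -> R) (cst c) s 1 1 0 _ _.
by rewrite scaler0 add0r /GRing.scale /= mulr1; apply.
Qed.

(** The mean value inequality is applied in the direction [v] and then, to the resulting derivative,
    in the direction [w]. The second difference itself is symmetric in [v] and [w], hence so is the
    mixed derivative that it approximates. *)
Lemma second_difference n (f : 'rV[R]_n -> R) (U : set 'rV[R]_n) x v w : open U -> U x ->
  Ck 2 U f -> forall e, 0 < e -> \forall s \near 0^'+,
  `|f (x + s *: v + s *: w) - f (x + s *: v) - f (x + s *: w) + f x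
     - s ^+ 2 * 'D_w ('D_v f) x| <= e * s ^+ 2.
Proof.
move=> oU Ux [fd fk] e e0; set c := 'D_w ('D_v f) x.
have [fdd fkk] := fk v.
have /nbhs_ballP[r r0 Hr] : \forall y \near x, U y /\ `|'D_w ('D_v f) y - c| <= e.
  near=> y; split; first by near: y; exact: open_nbhs_nbhs.
  rewrite distrC; near: y; move/cvgrPdist_le: (fkk w x Ux); exact.
pose d := r / (`|v| + `|w| + 1).
have vw0 : 0 < `|v| + `|w| + 1 by rewrite ltr_wpDl // addr_ge0.
have d0 : 0 < d by rewrite divr_gt0.
have inb (a b s : R) : 0 < s -> s < d -> 0 <= a <= s -> 0 <= b <= s ->
    ball x r (x + a *: v + b *: w).
  move=> s0 sd /andP[a0 a1] /andP[b0 b1].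
  rewrite -ball_normE /ball_ /= -addrA opprD addNKr normrN.
  apply: le_lt_trans (ler_normD _ _) _; rewrite !normrZ !ger0_norm //.
  have : s * (`|v| + `|w| + 1) < r by rewrite -ltr_pdivlMr.
  by have := normr_ge0 v; have := normr_ge0 w; nra.
near=> s.
have s0 : 0 < s by near: s; exact: nbhs_right_gt.
have sd : s < d by near: s; exact: nbhs_right_lt.
have mm : (Num.min 0 s = 0) * (Num.max 0 s = s).
  by rewrite min_l ?max_r // ltW.
have hss : 0 <= s <= s by rewrite lexx (ltW s0).
have hs0 : 0 <= (0 : R) <= s by rewrite lexx (ltW s0).
pose G a := f (x + a *: v + s *: w) - f (x + a *: v) - a * (s * c).
have HG : `|G s - G 0| <= e * s * `|s - 0|.
  apply: (@mvt_real R G (fun a => 'D_v f (x + a *: v + s *: w) - 'D_v f (x + a *: v) - s * c)).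
    move=> a; rewrite !mm => ha.
    have U1 : U (x + a *: v + s *: w).
      by have [] := Hr _ (@inb a s s s0 sd ha hss).
    have U2 : U (x + a *: v).
      by have := Hr _ (@inb a 0 s s0 sd ha hs0); rewrite scale0r addr0 => -[].
    apply: is_deriveB; last exact: is_deriveM_cst.
    apply: is_deriveB; last by apply: is_derive_lineR; exact: fd.
    have := @is_derive_lineR n f (x + s *: w) v a.
    rewrite addrAC; under eq_fun do rewrite addrAC.
    by apply; exact: fd.
  move=> a; rewrite !mm => ha.
  pose K b := 'D_v f (x + a *: v + b *: w) - b * c.
  have HK : `|K s - K 0| <= e * `|s - 0|.
    apply: (@mvt_real R K (fun b => 'D_w ('D_v f) (x + a *: v + b *: w) - c)).
      move=> b; rewrite !mm => hb; apply: is_deriveB; last exact: is_deriveM_cst.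
      apply: (@is_derive_lineR n ('D_v f)); apply: fdd.
      by have [] := Hr _ (@inb a b s s0 sd ha hb).
    move=> b; rewrite !mm => hb.
    by have [] := Hr _ (@inb a b s s0 sd ha hb).
  move: HK; rewrite /K scale0r addr0 mul0r !subr0 (gtr0_norm s0).
  by rewrite addrAC.
have -> : e * s ^+ 2 = e * s * `|s - 0| by rewrite subr0 (gtr0_norm s0) expr2 mulrA.
apply: le_trans HG; rewrite le_eqVlt; apply/orP; left; apply/eqP; congr `|_|.
rewrite /G !scale0r !addr0 mul0r; ring.
Unshelve. all: by end_near. Qed.

Lemma close_to_both (a b c d p q s e : R) : 0 < s ->
  `|a - b - c + d - s ^+ 2 * p| <= e / 2 * s ^+ 2 ->
  `|a - c - b + d - s ^+ 2 * q| <= e / 2 * s ^+ 2 -> `|p - q| <= e + 0.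
Proof.
move=> s0 H1 H2; have s2 : 0 < s ^+ 2 by rewrite exprn_gt0.
rewrite addr0 -(ler_pM2r s2) -[in leLHS](gtr0_norm s2) -normrM.
have -> : (p - q) * s ^+ 2 = (a - c - b + d - s ^+ 2 * q) - (a - b - c + d - s ^+ 2 * p) by ring.
by apply: le_trans (ler_normB _ _) _; rewrite [e in leRHS]splitr mulrDl; exact: lerD.
Qed.

Lemma schwarz n (f : 'rV[R]_n -> R) (U : set 'rV[R]_n) x v w : open U -> U x ->
  Ck 2 U f -> 'D_w ('D_v f) x = 'D_v ('D_w f) x.
Proof.
move=> oU Ux fC; apply/eqP; rewrite -subr_eq0 -normr_le0.
apply/ler_addgt0Pl => e e0.
have e2 : 0 < e / 2 by rewrite divr_gt0.
have N1 := @second_difference n f U x v w oU Ux fC _ e2.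
have N2 := @second_difference n f U x w v oU Ux fC _ e2.
have [s [[s0 H1] H2]] := filter_ex (filterI (filterI (nbhs_right_gt (0 : R)) N1) N2).
rewrite /= in s0.
rewrite [x + s *: w + _]addrAC in H2.
have := @close_to_both (f (x + s *: v + s *: w)) (f (x + s *: v)) (f (x + s *: w)) (f x)
  ('D_w ('D_v f) x) ('D_v ('D_w f) x) s e s0.
apply; [exact: H1|exact: H2].
Qed.

End Schwarz.

(** * Poincare lemma on a ball *)

Section Poincare.
Context {R : realType}.

Definition dot n (u v : 'rV[R]_n) : R := \sum_k u 0 k * v 0 k.

Lemma dotC n (u v : 'rV[R]_n) : dot u v = dot v u.
Proof. by apply: eq_bigr => k _; rewrite mulrC. Qed.

Lemma dotDl n (u v w : 'rV[R]_n) : dot (u + v) w = dot u w + dot v w.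
Proof. by rewrite /dot -big_split; apply: eq_bigr => k _; rewrite mxE mulrDl. Qed.

Lemma dotZl n a (u w : 'rV[R]_n) : dot (a *: u) w = a * dot u w.
Proof. by rewrite /dot mulr_sumr; apply: eq_bigr => k _; rewrite mxE mulrA. Qed.

Lemma dotDr n (u v w : 'rV[R]_n) : dot w (u + v) = dot w u + dot w v.
Proof. by rewrite dotC dotDl !(dotC _ w). Qed.

Lemma dotZr n a (u w : 'rV[R]_n) : dot w (a *: u) = a * dot w u.
Proof. by rewrite dotC dotZl dotC. Qed.

Lemma dotNl n (u w : 'rV[R]_n) : dot (- u) w = - dot u w.
Proof. by rewrite -scaleN1r dotZl mulN1r. Qed.

Lemma dot_le n (u v : 'rV[R]_n) : `|dot u v| <= n%:R * (`|u| * `|v|).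
Proof.
apply: le_trans (ler_norm_sum _ _ _) _.
rewrite mulr_natl -[X in _ *+ X]card_ord -sumr_const; apply: ler_sum => i _.
by rewrite normrM; apply: ler_pM => //; exact: mx_normr_ge.
Qed.

Lemma dot_continuous n (v : 'rV[R]_n) : continuous (fun z => dot z v : R).
Proof.
have lin : linear (fun z : 'rV[R]_n => dot z v : R).
  by move=> a u w; rewrite dotDl dotZl.
pose LM := GRing.isLinear.Build _ _ _ _ _ lin.
exact: (@linear_continuous_rV R n R (HB.pack (fun z : 'rV[R]_n => dot z v : R) LM)).
Qed.

Lemma is_derive_dot n (u : R -> 'rV[R]_n) (t : R) du (v : 'rV[R]_n) : is_derive t 1 u du ->
  is_derive t 1 (fun s => dot (u s) v) (dot du v).
Proof.
move=> ud.
have H k : is_derive t 1 (fun s => u s 0 k * v 0 k) (du 0 k * v 0 k).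
  have uk := is_derive_mx 0 k ud.
  have := @is_deriveM _ _ (fun s => u s 0 k) (cst (v 0 k)) t 1 (du 0 k) 0 uk _.
  by rewrite scaler0 add0r /GRing.scale /= [v 0 k * _]mulrC; apply.
have := @is_derive_sum _ _ _ n (fun k s => u s 0 k * v 0 k) t 1 (fun k => du 0 k * v 0 k) H.
by rewrite (_ : \sum_i _ = (fun s => dot (u s) v)) //; apply/funext => s; rewrite fct_sumE.
Qed.

(** The integral starts at -1 and the domain ends at 2, so that 0 and 1 are interior points and have
    two-sided derivatives. *)
Lemma antiderivative01 (g : R -> R) : continuous g ->
  exists2 A : R -> R, A 0 = 0 & forall t : R, 0 <= t <= 1 -> is_derive t 1 A (g t).
Proof.
move=> gc.
pose F x := (\int[lebesgue_measure]_(t in `[(-1 : R), x]) g t)%R.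
have ig : lebesgue_measure.-integrable `[(-1 : R), 2] (EFin \o g).
  apply: continuous_compact_integrable; first exact: segment_compact.
  by apply: continuous_subspaceT => x; exact: gc.
exists (fun x => F x - F 0); first by rewrite subrr.
move=> t /andP[t0 t1].
have [] := @continuous_FTC1_closed R g (-1) t 2 _ ig _ (gc t); [lra|lra|].
rewrite -/F => d e; have Fd : is_derive t 1 F (g t).
  by apply: DeriveDef; [exact: d|rewrite -derive1E].
have := @is_deriveB _ _ _ F (cst (F 0)) t 1 (g t) 0 Fd _.
by rewrite subr0; apply.
Qed.

(** The potential is the integral of [al] along the ray from [x0]. Its differential is found by
    comparing the antiderivatives along the rays to [x] and to [x + w]: by closedness, [t] times the
    value of [al] on [w] is the first-order part of their difference, and the rest is quadratic in
    [w]. *)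
Lemma poincare n (al : 'rV[R]_n -> 'rV[R]_n) (x0 : 'rV[R]_n) (rho K : R) :
  tame al x0 rho K -> 0 < K ->
  (forall x, `|x - x0| < rho -> forall v w, dot ('D_v al x) w = dot ('D_w al x) v) ->
  exists h : 'rV[R]_n -> R, forall x, `|x - x0| < rho ->
    differentiable h x /\ forall v, 'D_v h x = dot (al x) v.
Proof.
move=> [ald alB alD alL alT] K0 clo.
(* Clamping the parameter to [0, 1] makes the integrand continuous on the whole line while the point
   of the ray stays in the ball. *)
pose cl := (cst 0 : R -> R^o) \max ((id : R -> R^o) \min (cst 1 : R -> R^o)).
have clc : continuous cl.
  move=> t; apply: continuous_max; first exact: cst_continuous.
  by apply: continuous_min; [by move=> A; exact|exact: cst_continuous].
have cl01 t : 0 <= cl t <= 1.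
  by rewrite /cl /= le_max lexx /= ge_max ler01 ge_min lexx orbT.
have clE t : 0 <= t <= 1 -> cl t = t.
  by move=> /andP[t0 t1]; rewrite /cl /= min_l // max_r.
pose g x t := dot (al (x0 + cl t *: (x - x0))) (x - x0).
have seg x t : `|x - x0| < rho -> 0 <= t <= 1 -> `|x0 + t *: (x - x0) - x0| < rho.
  by move=> xr t01; apply: dist_convex => //; rewrite subrr normr0; exact: le_lt_trans xr.
have gc x : `|x - x0| < rho -> continuous (g x).
  move=> xr t.
  have E : g x = (fun z => dot z (x - x0)) \o al \o (fun t => x0 + cl t *: (x - x0)) by [].
  rewrite E; apply: continuous_comp.
    apply: continuousD; first exact: cst_continuous.
    by apply: continuousZr_tmp; exact: clc.
  apply: continuous_comp.
    by apply: differentiable_continuous; apply: ald; apply: seg.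
  exact: dot_continuous.
have ex x : exists A : R -> R, `|x - x0| < rho -> A 0 = 0 /\ forall t : R, 0 <= t <= 1 ->
    is_derive t 1 A (dot (al (x0 + t *: (x - x0))) (x - x0)).
  have [xr|] := pselect (`|x - x0| < rho); last by exists (cst 0).
  have [A A0 AD] := antiderivative01 (gc x xr); exists A => _; split=> // t t01.
  by have := AD t t01; rewrite /g clE.
have [A AP] := choice ex.
exists (fun x => A x 1) => x xr.
have lin : linear (fun v : 'rV[R]_n => dot (al x) v : R).
  by move=> a u v; rewrite dotDr dotZr.
pose LM := GRing.isLinear.Build _ _ _ _ _ lin.
pose L : {linear 'rV[R]_n -> R} := HB.pack (fun v : 'rV[R]_n => dot (al x) v : R) LM.
suff [dz ez] : is_diff x (fun x => A x 1) L by split=> // v; rewrite deriveE // ez.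
pose C := n%:R * K * (2 * rho) + n%:R * K.
apply: (@is_diff_quad R _ _ _ x L (rho - `|x - x0|) C).
- exact: linear_continuous_rV.
- by rewrite subr_gt0.
move=> w wr; rewrite /=.
have xwr : `|x + w - x0| < rho.
  by rewrite addrAC; apply: le_lt_trans (ler_normD _ _) _; lra.
have [A0 AD] := AP x xr; have [A0' AD'] := AP _ xwr.
set u := x - x0 in xr AD wr *.
have uw : x + w - x0 = u + w by rewrite addrAC.
have uwr : `|u + w| < rho by rewrite -uw.
rewrite uw in AD'.
pose F t := A (x + w) t - A x t - t * dot (al (x0 + t *: u)) w.
pose dF t := dot (al (x0 + t *: (u + w))) (u + w) - dot (al (x0 + t *: u)) u -
   (dot (al (x0 + t *: u)) w + t * dot ('D_u al (x0 + t *: u)) w).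
have rho0 : 0 < rho by exact: le_lt_trans xr.
have := @mvt_real R F dF 0 1 (C * `|w| ^+ 2).
have -> : F 1 - F 0 = A (x + w) 1 - A x 1 - dot (al x) w.
  by rewrite /F A0 A0' scale1r mul1r mul0r !subr0 /u addrC [x0 + _]addrC subrK addrC.
rewrite subr0 normr1 mulr1; apply=> t /seg01 t01; have t01' := t01; case/andP: t01' => t0 t1.
  have dat : differentiable al (x0 + t *: u) by apply: ald; exact: seg.
  apply: is_deriveB.
    by apply: is_deriveB; [exact: AD'|exact: AD].
  have h1 := is_derive_dot w (is_derive_line dat).
  have := @is_deriveM _ _ (id : R -> R) _ t 1 1 _ _ h1.
  by rewrite /GRing.scale /= mulr1 addrC; apply.
have yr := seg x t xr t01.
have ywr : `|x0 + t *: (u + w) - x0| < rho by rewrite -uw; exact: seg.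
set y := x0 + t *: u in yr *; set y' := x0 + t *: (u + w) in ywr *.
have yy : y' - y = t *: w.
  by rewrite /y' /y scalerDr; apply/rowP => i; rewrite !mxE; ring.
have [_ Ty] := alT y y' yr ywr; rewrite yy in Ty.
have Dw := alD y w yr.
(* Closedness replaces the derivative of [al] along [u] paired with [w] by the derivative along [w]
   paired with [u]. The terms linear in [w] then combine into a Taylor remainder of [al]. *)
have -> : dF t = dot (al y' - al y - 'D_(t *: w) al y) (u + w) + t * dot ('D_w al y) w.
  rewrite /dF -/y -/y' deriveZ_dir; last exact: ald.
  rewrite (clo y yr u w); move: (al y) (al y') ('D_w al y) => a b c.
  rewrite !(dotDl, dotNl, dotDr, dotZl); ring.
apply: le_trans (ler_normD _ _) _; rewrite /C mulrDl; apply: lerD.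
  apply: le_trans (dot_le _ _) _.
  rewrite -!mulrA ler_wpM2l // mulrA [leRHS](_ : _ = K * `|w| ^+ 2 * (2 * rho)); last by ring.
  apply: ler_pM => //; last by lra.
  apply: le_trans Ty _; rewrite normrZ ger0_norm // ler_wpM2l ?(ltW K0) //.
  rewrite exprMn ler_piMl ?sqr_ge0 //; rewrite expr_le1 //.
rewrite normrM ger0_norm //; apply: (@le_trans _ _ (1 * `|dot ('D_w al y) w|)).
  by rewrite ler_wpM2r.
rewrite mul1r; apply: le_trans (dot_le _ _) _.
by rewrite -!mulrA ler_wpM2l // expr2 mulrA ler_wpM2r.
Qed.

End Poincare.

Lemma near0_norm (R : realType) (V : normedModType R) (d : R) : 0 < d ->
  \forall k \near (0 : V), `|k| < d.
Proof. exact: nbhs0_lt. Qed.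

(** * Implicit function theorem for a scalar equation *)

Section Implicit.
Context {R : realType} (n : nat) (G : 'rV[R]_(n + 1) -> R) (Om : set 'rV[R]_(n + 1)).
Context (y0 : 'rV[R]_n) (t0 r rho : R).

Definition pt (y : 'rV[R]_n) (t : R) : 'rV[R]_(n + 1) := row_mx y t%:M.
Definition vert : 'rV[R]_(n + 1) := pt 0 1.

Lemma ptD y y' t t' : pt (y + y') (t + t') = pt y t + pt y' t'.
Proof. by rewrite /pt add_row_mx raddfD. Qed.

Lemma ptZ a y t : pt (a *: y) (a * t) = a *: pt y t.
Proof. by rewrite /pt scale_row_mx scale_scalar_mx. Qed.

Lemma pt_vert y t s : pt y (t + s) = pt y t + s *: vert.
Proof. by rewrite /vert -ptZ scaler0 mulr1 -ptD addr0. Qed.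

Lemma pt_norm y t : `|pt y t| <= `|y| + `|t|.
Proof.
apply: mx_normr_le => [|i j]; first by rewrite addr_ge0.
rewrite /pt mxE; case: (fintype.split j) => k; first by rewrite ler_wpDr // mx_normr_ge.
by rewrite !ord1 mxE eqxx mulr1n ler_wpDl.
Qed.

Lemma Ck_pt (V : normedModType R) k (U : set V) (f : V -> 'rV[R]_n) (g : V -> R) : open U ->
  Ck k U f -> Ck k U g -> Ck k U (fun x => pt (f x) (g x)).
Proof.
move=> oU fC gC; apply: Ck_row_mx => //; apply/Ck_mxP => // i j.
by under eq_fun do rewrite !ord1 mxE eqxx mulr1n.
Qed.

Context (oOm : open Om) (r0 : 0 < r) (rho0 : 0 < rho) (Gs : smooth_on Om G).
Context (box : forall y t, `|y - y0| < r -> `|t - t0| <= rho -> Om (pt y t)).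
Context (Gpos : forall y t, `|y - y0| < r -> `|t - t0| <= rho -> 0 < 'D_vert G (pt y t)).
Context (Gneg : forall y, `|y - y0| < r -> G (pt y (t0 - rho)) < 0 < G (pt y (t0 + rho))).

Let Gd y t : `|y - y0| < r -> `|t - t0| <= rho -> differentiable G (pt y t).
Proof. by move=> yr tr; have [h _] := Gs 1%N; apply: h; exact: box. Qed.

Lemma is_derive_vert y (t : R) : `|y - y0| < r -> `|t - t0| <= rho ->
  is_derive t 1 (fun t : R => G (pt y t)) ('D_vert G (pt y t)).
Proof.
move=> yr tr; have -> : pt y t = pt y 0 + t *: vert by rewrite -pt_vert add0r.
have -> : (fun t => G (pt y t)) = (fun t => G (pt y 0 + t *: vert)).
  by apply/funext => s; rewrite -pt_vert add0r.
by apply: is_derive_lineR; rewrite -pt_vert add0r; exact: Gd.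
Qed.

Lemma implicit_incr y s t : `|y - y0| < r -> `|s - t0| <= rho -> `|t - t0| <= rho -> s < t ->
  G (pt y s) < G (pt y t).
Proof.
move=> yr sr tr st.
have inr (x : R) : s <= x <= t -> `|x - t0| <= rho.
  by move: sr tr; rewrite !ler_norml => /andP[? ?] /andP[? ?] /andP[? ?]; lra.
have [] := @MVT_segment R (fun t => G (pt y t)) (fun t => 'D_vert G (pt y t)) s t (ltW st).
- move=> x; rewrite in_itv /= => /andP[h1 h2]; apply: is_derive_vert => //.
  by apply: inr; rewrite !ltW.
- apply: derivable_within_continuous => x; rewrite in_itv /= => xst.
  by have [] := is_derive_vert yr (inr x xst).
move=> c; rewrite in_itv /= => cst e; rewrite -subr_gt0 e mulr_gt0 ?subr_gt0 //.
by apply: Gpos => //; exact: inr.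
Qed.

Lemma implicit_exists : exists eta : 'rV[R]_n -> R, forall y, `|y - y0| < r ->
  [/\ `|eta y - t0| < rho, G (pt y (eta y)) = 0 &
     forall t, `|t - t0| < rho -> G (pt y t) = 0 -> t = eta y].
Proof.
have ex y : exists t, `|y - y0| < r -> `|t - t0| < rho /\ G (pt y t) = 0.
  have [yr|] := pselect (`|y - y0| < r); last by exists 0.
  have /andP[n1 p1] := Gneg yr.
  have ab : t0 - rho <= t0 + rho by rewrite lerBlDr -addrA lerDl addr_ge0 // ltW.
  have [||t tI tG] := @IVT R (fun t => G (pt y t)) (t0 - rho) (t0 + rho) 0 ab.
  - apply: derivable_within_continuous => x; rewrite in_itv /= => xst.
    have xr : `|x - t0| <= rho by rewrite ler_distl.
    by have [] := @is_derive_vert y x yr xr.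
  - by rewrite ge_min le_max (ltW n1) (ltW p1) orbT.
  exists t => _; split=> //; move: tI; rewrite in_itv /= => /andP[h1 h2].
  rewrite ltr_distl; apply/andP; split; rewrite lt_neqAle ?h1 ?h2 andbT; apply/eqP => E.
    by move: n1; rewrite E tG ltxx.
  by move: p1; rewrite -E tG ltxx.
have [eta etaP] := choice ex; exists eta => y yr; have [h1 h2] := etaP y yr.
split=> // t tr tG; apply/eqP; case: ltgtP => // lt.
  by have := implicit_incr yr (ltW tr) (ltW h1) lt; rewrite tG h2 ltxx.
by have := implicit_incr yr (ltW h1) (ltW tr) lt; rewrite tG h2 ltxx.
Qed.

Context (eta : 'rV[R]_n -> R).
Context (etaP : forall y, `|y - y0| < r ->
  [/\ `|eta y - t0| < rho, G (pt y (eta y)) = 0 &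
     forall t, `|t - t0| < rho -> G (pt y t) = 0 -> t = eta y]).

Definition iball : set 'rV[R]_n := [set y | `|y - y0| < r].

Lemma open_iball : open iball.
Proof.
have -> : iball = ball y0 r.
  by rewrite -ball_normE /ball_; apply/seteqP; split=> y /=; rewrite distrC.
exact: ball_open.
Qed.

Lemma continuous_pt (t : R) : continuous (fun y => pt y t).
Proof.
move=> y; apply: (@Ck_pt _ 0 setT id (cst t)) => //; [exact: openT|exact: Ck_id|exact: Ck_cst].
Qed.

(** Monotonicity in the vertical variable turns the signs of [G] on the levels [eta y + d] and
    [eta y - d], which persist near [y], into bounds on [eta]. *)
Lemma implicit_continuous (y : 'rV[R]_n) : iball y -> {for y, continuous eta}.
Proof.
move=> yr; have [e1 e2 _] := etaP yr.
rewrite /prop_for /continuous_at; apply/(@cvgrPdist_lt _ _ _ (nbhs (y : 'rV[R]_n))) => e e0.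
pose d := Num.min (e / 2) ((rho - `|eta y - t0|) / 2).
have d0 : 0 < d by rewrite lt_min !divr_gt0 // subr_gt0.
have de : d < e by rewrite gt_min ltr_pdivrMr // ltr_pMr // ltr1n.
have dr (s : R) : `|s| <= d -> `|eta y + s - t0| < rho.
  move=> sd; rewrite addrAC; apply: le_lt_trans (ler_normD _ _) _.
  apply: le_lt_trans (_ : `|eta y - t0| + (rho - `|eta y - t0|) / 2 < _); last by lra.
  by rewrite lerD2l (le_trans sd) // /d ge_min lexx orbT.
have nd : `|d| = d by rewrite gtr0_norm.
have G1 : 0 < G (pt y (eta y + d)).
  rewrite -e2; apply: implicit_incr => //; last by rewrite ltrDl.
    exact: ltW.
  by apply/ltW/dr; rewrite nd.
have G2 : G (pt y (eta y - d)) < 0.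
  rewrite -e2; apply: implicit_incr => //; last by rewrite ltrBlDr ltrDl.
    by apply/ltW/dr; rewrite normrN nd.
  exact: ltW.
have Gc (t : R) : `|t - t0| < rho -> {for y, continuous (fun y => G (pt y t))}.
  move=> tr; apply: continuous_comp; first exact: continuous_pt.
  by apply: differentiable_continuous; apply: Gd => //; exact: ltW.
have N1 : \forall z \near y, 0 < G (pt z (eta y + d)).
  have h : `|eta y + d - t0| < rho by apply: dr; rewrite nd.
  exact: (Gc _ h _ (open_nbhs_nbhs (conj (open_gt (y := 0)) G1))).
have N2 : \forall z \near y, G (pt z (eta y - d)) < 0.
  have h : `|eta y - d - t0| < rho by apply: dr; rewrite normrN nd.
  exact: (Gc _ h _ (open_nbhs_nbhs (conj (open_lt (y := 0)) G2))).
have N3 : \forall z \near y, iball z by apply: open_nbhs_nbhs; split => //; exact: open_iball.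
near=> z.
have zr : iball z by near: z.
have [z1 z2 _] := etaP zr.
apply: le_lt_trans de; rewrite ler_distl; apply/andP; split.
  rewrite leNgt; apply/negP => lt.
  have G1z : 0 < G (pt z (eta y + d)) by near: z.
  have /(implicit_incr zr (ltW (dr d _)) (ltW z1)) : eta y + d < eta z by lra.
  by rewrite nd lexx z2 => /(_ isT) /(lt_trans G1z); rewrite ltxx.
rewrite leNgt; apply/negP => lt.
have G2z : G (pt z (eta y - d)) < 0 by near: z.
have /(implicit_incr zr (ltW z1) (ltW (dr (- d) _))) : eta z < eta y - d by lra.
by rewrite normrN nd lexx z2 => /(_ isT) /lt_trans/(_ G2z); rewrite ltxx.
Unshelve. all: by end_near. Qed.

(** The first-order expansion of [G] between two points of the graph, at both of which [G] vanishes,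
    is solved for the increment of [eta]. *)
Lemma implicit_diff (y : 'rV[R]_n) : iball y -> differentiable eta y /\
  forall v, 'D_v eta y = - ('D_(pt v 0) G (pt y (eta y)) / 'D_vert G (pt y (eta y))).
Proof.
move=> yr; have [e1 e2 _] := etaP yr; set z := pt y (eta y).
have Gdz : differentiable G z by apply: Gd => //; exact: ltW.
set c := 'D_vert G z; have c0 : 0 < c by apply: Gpos => //; exact: ltW.
have lin : linear (fun v : 'rV[R]_n => - ('D_(pt v 0) G z / c) : R).
  move=> a u v; rewrite !deriveE // -[in LHS](addr0 (0 : R)) ptD -[in LHS](mulr0 a) ptZ.
  by rewrite linearP mulr0 /= /GRing.scale /= mulrDl opprD mulrN mulrA.
pose LM := GRing.isLinear.Build _ _ _ _ _ lin.
pose L : {linear 'rV[R]_n -> R} := HB.pack (fun v : 'rV[R]_n => - ('D_(pt v 0) G z / c) : R) LM.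
suff [dz ez] : is_diff y eta L by split=> // v; rewrite deriveE // ez.
have cL : continuous L by exact: linear_continuous_rV.
have [M M0 HM] := linear_lipschitz cL.
apply: is_diff_eps => // e e0.
(* The first bound lets half of [c * |ka - L k|] absorb the error in the unknown increment. The
   second, with [M] a Lipschitz constant of [L], makes what remains at most [e * |k|]. *)
pose e' := Num.min (c / 2) (e * c / (2 * (M + 1))).
have M1 : 0 < M + 1 by rewrite ltr_wpDl // ltW.
have e'0 : 0 < e' by rewrite lt_min !divr_gt0 ?mulr_gt0.
have /nbhs_ballP[d /= d0 Hd] := diff_epsP Gdz e'0.
have {}Hd h : `|h| < d -> `|G (h + z) - G z - 'd G z h| <= e' * `|h|.
  by move=> hd; apply: Hd; rewrite -ball_normE /ball_ /= sub0r normrN.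
have N1 : \forall k \near (0 : 'rV[R]_n), iball (k + y) /\ `|eta y - eta (k + y)| < d / 2.
  have : \forall x \near y, iball x /\ `|eta y - eta x| < d / 2.
    near=> x; split; first by near: x; apply: open_nbhs_nbhs; split => //; exact: open_iball.
    by near: x; move/cvgrPdist_lt: (implicit_continuous yr); apply; rewrite divr_gt0.
  rewrite (near_shift 0 y) /=; apply: filterS => k; by rewrite subr0.
near=> k.
have kd : `|k| < d / 2 by near: k; apply: (@near0_norm _ 'rV[R]_n); rewrite divr_gt0.
have [kyr ked] : iball (k + y) /\ `|eta y - eta (k + y)| < d / 2 by near: k.
have [k1 k2 _] := etaP kyr.
set ka := eta (k + y) - eta y.
have kad : `|ka| < d / 2 by rewrite /ka distrC.
have hz : pt k ka + z = pt (k + y) (eta (k + y)).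
  by rewrite /z -ptD /ka subrK.
have := Hd (pt k ka); rewrite hz k2 e2 subr0 sub0r normrN.
have -> : 'd G z (pt k ka) = c * (ka - L k).
  have -> : pt k ka = pt k 0 + ka *: vert by rewrite -pt_vert add0r.
  rewrite linearD linearZ -!deriveE //.
  have alg (a b s : R) : b != 0 -> a + s * b = b * (s - - (a / b)) by move=> b0; field.
  exact: (alg _ _ _ (lt0r_neq0 c0)).
move=> /(_ (le_lt_trans (pt_norm _ _) _)) H.
have {}H : c * `|ka - L k| <= e' * (`|k| + `|ka|).
  rewrite -[c in leLHS](gtr0_norm c0) -normrM; apply: le_trans (H _) _; first by lra.
  by rewrite ler_pM2l // pt_norm.
have ka1 : `|ka| <= `|ka - L k| + M * `|k|.
  rewrite -[ka in leLHS](subrK (L k)); apply: le_trans (ler_normD _ _) _.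
  by rewrite lerD2l.
have e'c : e' <= c / 2 by rewrite /e' ge_min lexx.
have e'e : e' * (2 * (M + 1)) <= e * c.
  by rewrite -ler_pdivlMr ?mulr_gt0 // /e' ge_min lexx orbT.
rewrite -/ka -(ler_pM2l c0).
move: H ka1; set X := `|ka - _|; set Y := `|k|; set Z := `|ka| => H ka1.
have X0 : 0 <= X by exact: normr_ge0.
have Y0 : 0 <= Y by exact: normr_ge0.
have H1 : c * X <= e' * (Y + X + M * Y) by apply: le_trans H _; rewrite ler_pM2l // -addrA lerD2l.
have H2 : e' * X <= c / 2 * X by rewrite ler_wpM2r.
have H3 : e' * (2 * (M + 1)) * Y <= e * c * Y by rewrite ler_wpM2r.
lra.
Unshelve. all: by end_near. Qed.

(** Bootstrapping: the formula for the derivative only involves derivatives of [G] along the graph,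
    so it is [Ck] as soon as [eta] is. *)
Lemma implicit_smooth k : Ck k iball eta.
Proof.
have oB := open_iball.
elim: k => [|k IH]; first exact: implicit_continuous.
split=> [y yr|v]; first by have [] := implicit_diff yr.
have GC u : Ck k Om ('D_u G) by have [_ h] := Gs k.+1; exact: h.
have pC : Ck k iball (fun y => pt y (eta y)).
  by apply: Ck_pt => //; exact: Ck_id.
have inO y : iball y -> Om (pt y (eta y)).
  by move=> yr; have [h _ _] := etaP yr; apply: box => //; exact: ltW.
have : Ck k iball (fun y => - (('D_(pt v 0) G \o (fun y => pt y (eta y))) y
     * (('D_vert G \o (fun y => pt y (eta y))) y)^-1)).
  apply: CkN => //; apply: CkM => //; first exact: (Ck_comp oB oOm inO).
  apply: CkV => //; last exact: (Ck_comp oB oOm inO).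
  by move=> y yr /=; have [h _ _] := etaP yr; rewrite gt_eqF // Gpos // ltW.
by apply: eq_Ck => // y yr; have [_ ->] := implicit_diff yr.
Qed.

End Implicit.

(** * Monodromy: continuation of germs over a simply connected space *)

Section Monodromy.
Context {R : realType} {X : topologicalType} {G : Type} (sim : X -> G -> G -> Prop).
Context (sim_sym : forall p g h, sim p g h -> sim p h g)
  (sim_trans : forall p f g h, sim p f g -> sim p g h -> sim p f h)
  (sim_open : forall p g h, sim p g h -> nbhs p [set q | sim q g h]).
Implicit Types (c : R -> X) (F : R -> G).

(** [sim p g h] reads: [g] and [h] are defined at [p] and have the same germ there. It is a partial
    equivalence relation, and [sim p g g] says that [g] is defined at [p]. Over [V] every germ
    extends, extensions that agree at one point agree everywhere, and points are joined to [p]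
    inside [V]: the space of germs is a covering over [V]. *)
Definition evenly_covered (p : X) (V : set X) : Prop :=
  [/\ open V, V p,
      forall q g, V q -> sim q g g -> exists2 h, (forall r, V r -> sim r h h) & sim q h g,
      forall q g h, V q -> (forall r, V r -> sim r g g) -> (forall r, V r -> sim r h h) ->
        sim q g h -> forall r, V r -> sim r g h &
      forall q, V q -> exists c : R -> X, [/\ {within unit_interval, continuous c},
        c 0 = p, c 1 = q & forall t, 0 <= t <= 1 -> V (c t)]].

Context (cover : forall p, exists V, evenly_covered p V).

Let sim_l p g h : sim p g h -> sim p g g.
Proof. by move=> s; apply: sim_trans s (sim_sym s). Qed.

Let sim_r p g h : sim p g h -> sim p h h.
Proof. by move=> /sim_sym /sim_l. Qed.

(** Continuity on a segment as a condition on parameters, which restriction, affine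
    reparametrisation and concatenation preserve by elementary estimates. *)
Definition pcont c (a b : R) : Prop := forall t, a <= t <= b -> forall V, nbhs (c t) V ->
  exists2 e : R, 0 < e & forall s, a <= s <= b -> `|s - t| < e -> V (c s).

Lemma pcontP c : {within unit_interval, continuous c} <-> pcont c 0 1.
Proof.
split=> [/subspace_continuousP cc t t01 V Vt|cc].
  have := cc t t01 _ Vt; rewrite /nbhs /= /within /= => /nbhs_ballP[e /= e0 He].
  exists e => // s s01 st; apply: He => //.
  by rewrite /ball /= distrC.
apply/subspace_continuousP => t t01 V /(cc t t01)[e e0 He].
apply/nbhs_ballP; exists e => // s; rewrite /ball /= distrC => st s01.
exact: He.
Qed.

Lemma pcont_sub c a b a' b' : a <= a' -> b' <= b -> pcont c a b -> pcont c a' b'.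
Proof.
move=> aa bb cc t /andP[t1 t2] V Vt.
have tab : a <= t <= b by rewrite (le_trans aa) // (le_trans t2).
have [e e0 He] := cc t tab V Vt; exists e => // s /andP[s1 s2]; apply: He.
by rewrite (le_trans aa) // (le_trans s2).
Qed.

Let z01 : 0 <= (0 : R) <= 1. Proof. by rewrite lexx ler01. Qed.
Let o01 : 0 <= (1 : R) <= 1. Proof. by rewrite lexx ler01. Qed.

Let affine_near (k l e : R) : 0 < e ->
  exists2 d, 0 < d & forall s t, `|s - t| < d -> `|k * s + l - (k * t + l)| < e.
Proof.
move=> e0; have k1 : 0 < `|k| + 1 by rewrite ltr_wpDl.
exists (e / (`|k| + 1)) => [|s t]; first by rewrite divr_gt0.
have -> : k * s + l - (k * t + l) = k * (s - t) by ring.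
rewrite ltr_pdivlMr // normrM; apply: le_lt_trans; rewrite mulrC ler_wpM2l //; lra.
Qed.

Lemma pcont_affine c a b a' b' (k l : R) :
  (forall t, a' <= t <= b' -> a <= k * t + l <= b) -> pcont c a b ->
  pcont (fun t => c (k * t + l)) a' b'.
Proof.
move=> kab cc t tab V Vt; have [e e0 He] := cc _ (kab t tab) V Vt.
have [d d0 Hd] := affine_near k l e0; exists d => // s sab /Hd; apply: He; exact: kab.
Qed.

(** A continuous lift of the path to germs: at nearby points of the path, the value of [F] there and
    [F t] have the same germ. *)
Definition coherent c F (a b : R) : Prop := forall t, a <= t <= b ->
  exists2 e : R, 0 < e & forall s, a <= s <= b -> `|s - t| < e -> sim (c s) (F s) (F t).

Lemma coherent_def c F a b t : coherent c F a b -> a <= t <= b -> sim (c t) (F t) (F t).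
Proof. by move=> cF tab; have [e e0 h] := cF t tab; apply: h; rewrite ?subrr ?normr0. Qed.

Lemma coherent_sub c F a b a' b' : a <= a' -> b' <= b -> coherent c F a b -> coherent c F a' b'.
Proof.
move=> aa bb cc t /andP[t1 t2].
have tab : a <= t <= b by rewrite (le_trans aa) // (le_trans t2).
have [e e0 He] := cc t tab; exists e => // s /andP[s1 s2]; apply: He.
by rewrite (le_trans aa) // (le_trans s2).
Qed.

Lemma coherent_affine c F a b a' b' (k l : R) :
  (forall t, a' <= t <= b' -> a <= k * t + l <= b) -> coherent c F a b ->
  coherent (fun t => c (k * t + l)) (fun t => F (k * t + l)) a' b'.
Proof.
move=> kab cc t tab; have [e e0 He] := cc _ (kab t tab).
have [d d0 Hd] := affine_near k l e0; exists d => // s sab /Hd; apply: He; exact: kab.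
Qed.

Lemma eq_coherent c c' F a b : (forall t, a <= t <= b -> c t = c' t) ->
  coherent c F a b -> coherent c' F a b.
Proof.
move=> cc cF t tab; have [e e0 He] := cF t tab; exists e => // s sab.
by rewrite -cc //; exact: He.
Qed.

Lemma coherent_cst c h a b : (forall t, a <= t <= b -> sim (c t) h h) ->
  coherent c (fun=> h) a b.
Proof. by move=> hh t tab; exists 1 => // s sab _; exact: hh. Qed.

(** Near each time both lifts are germs of sections over one evenly covered set, so agreement at one
    point spreads there, and then along the segment by connectedness. *)
Lemma coherent_unique c F F' a b : pcont c a b -> coherent c F a b -> coherent c F' a b ->
  forall s t, a <= s <= b -> a <= t <= b -> sim (c s) (F s) (F' s) -> sim (c t) (F t) (F' t).
Proof.
move=> cc cF cF'; apply: (@segment_ind R (fun t => sim (c t) (F t) (F' t))) => t tab.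
have [V [oV Vt V1 V2 _]] := cover (c t).
have [h hV ht] := V1 _ _ Vt (coherent_def cF tab).
have [h' hV' ht'] := V1 _ _ Vt (coherent_def cF' tab).
have [e1 e10 H1] := cF t tab; have [e2 e20 H2] := cF' t tab.
have [e3 e30 H3] := cc t tab _ (sim_open ht).
have [e4 e40 H4] := cc t tab _ (sim_open ht').
have [e5 e50 H5] := cc t tab _ (open_nbhs_nbhs (conj oV Vt)).
exists (Num.min (Num.min e1 e2) (Num.min e5 (Num.min e3 e4))).
  by rewrite !lt_min e10 e20 e30 e40 e50.
have K s : a <= s <= b -> `|s - t| < Num.min (Num.min e1 e2) (Num.min e5 (Num.min e3 e4)) ->
    [/\ V (c s), sim (c s) h (F s) & sim (c s) h' (F' s)].
  rewrite !lt_min => sab /andP[/andP[h1 h2] /andP[h5 /andP[h3 h4]]].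
  split; first exact: H5.
    by apply: sim_trans (H3 _ sab h3) (sim_sym (H1 _ sab h1)).
  by apply: sim_trans (H4 _ sab h4) (sim_sym (H2 _ sab h2)).
move=> s s' sab sab' /(K s sab)[k1 k2 k3] /(K s' sab')[k1' k2' k3'] ss.
apply: sim_trans (sim_sym k2') _; apply: sim_trans k3'.
apply: (V2 (c s)) => //; apply: sim_trans k2 _; apply: sim_trans ss (sim_sym k3).
Qed.

Lemma coherent_exists c g a b : a <= b -> pcont c a b -> sim (c a) g g ->
  exists2 F, coherent c F a b & F a = g.
Proof.
move=> ab cc gg.
apply: (@segment_ind R (fun t => exists2 F, coherent c F a t & F a = g) a b _ a b);
  rewrite ?lexx ?ab //; last first.
  by exists (fun=> g) => //; apply: coherent_cst => t; rewrite -eq_le => /eqP <-.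
move=> t tab; have [V [oV Vt V1 V2 _]] := cover (c t).
have [e e0 He] := cc t tab _ (open_nbhs_nbhs (conj oV Vt)).
exists e => // s s' /andP[as_ sb] /andP[as' sb'] se s'e [F cF Fa].
have [ss|ss] := leP s' s; first by exists F => //; apply: coherent_sub cF.
have saas : a <= s <= s by rewrite as_ lexx.
have sab : a <= s <= b by rewrite as_ sb.
have [h hV hs] := V1 _ _ (He s sab se) (coherent_def cF saas).
exists (fun r => if r <= s then F r else h); last by rewrite as_.
move=> r /andP[ar rs'].
have rab : a <= r <= b by rewrite ar (le_trans rs').
have Vr x : s < x -> x <= s' -> V (c x).
  move=> sx xs'; apply: He; first by rewrite (le_trans _ (ltW sx)) // (le_trans xs').
  by move: se s'e; rewrite !ltr_norml => /andP[? ?] /andP[? ?]; apply/andP; split; lra.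
case: (ltgtP r s) => rs.
- have ras : a <= r <= s by rewrite ar ltW.
  have [d d0 Hd] := cF r ras; exists (Num.min d (s - r)); first by rewrite lt_min d0 subr_gt0.
  move=> x /andP[ax xs']; rewrite lt_min => /andP[h1 h2].
  have xs : x <= s by move: h2; rewrite ltr_norml => /andP[_]; lra.
  by rewrite xs; apply: Hd => //; rewrite ax.
- exists (r - s); first by rewrite subr_gt0.
  move=> x /andP[ax xs'] xr; have sx : s < x by move: xr; rewrite ltr_norml => /andP[]; lra.
  by rewrite leNgt sx /=; apply/hV/Vr.
- rewrite {}rs in ar rs' rab *.
  have [d d0 Hd] := cF s saas; have [d' d'0 Hd'] := cc s sab _ (sim_open hs).
  exists (Num.min d d'); first by rewrite lt_min d0.
  move=> x /andP[ax xs']; rewrite lt_min => /andP[h1 h2].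
  case: leP => xs; first by apply: Hd => //; rewrite ax.
  by apply: Hd' => //; rewrite ax (le_trans xs').
Qed.

Lemma coherent_germ c F h V a b s t : pcont c a b -> coherent c F a b ->
  (forall r, V r -> sim r h h) -> (forall r, Num.min s t <= r <= Num.max s t -> V (c r)) ->
  a <= s <= b -> a <= t <= b -> sim (c s) (F s) h -> sim (c t) (F t) h.
Proof.
move=> cc cF hV cV /andP[s1 s2] /andP[t1 t2].
have m1 : a <= Num.min s t by rewrite le_min s1 t1.
have m2 : Num.max s t <= b by rewrite ge_max s2 t2.
have := @coherent_unique c F (fun=> h) _ _ (pcont_sub m1 m2 cc) (coherent_sub m1 m2 cF)
  (@coherent_cst c h _ _ (fun r rst => hV _ (cV r rst))) s t.
by rewrite ge_min le_max lexx ge_min le_max lexx !orbT /=; apply.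
Qed.

(** A continuation in [s] that contains one in [t]: for [s] near [s0], agreement of the two lifts is
    carried from [t = 0] to [t = 1] through sets over which one section represents both. The sides
    [t = 0] and [t = 1] are constant, so initial values and end values can be compared at one
    point. *)
Lemma homotopy_coherent (H : R * R -> X) (g : G) (F : R -> R -> G) :
  {within unit_interval `*` unit_interval, continuous H} ->
  (forall s, 0 <= s <= 1 -> H (s, 0) = H (0, 0)) -> (forall s, 0 <= s <= 1 -> H (s, 1) = H (0, 1)) ->
  (forall s, 0 <= s <= 1 -> coherent (fun t => H (s, t)) (F s) 0 1 /\ F s 0 = g) ->
  sim (H (0, 1)) (F 0 1) (F 1 1).
Proof.
move=> /subspace_continuousP cH H0 H1 FP.
have tube s t : 0 <= s <= 1 -> 0 <= t <= 1 -> forall V, nbhs (H (s, t)) V ->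
    exists2 e : R, 0 < e & forall s' t', 0 <= s' <= 1 -> 0 <= t' <= 1 -> `|s' - s| < e ->
      `|t' - t| < e -> V (H (s', t')).
  move=> s01 t01 V Vst; have := cH (s, t) (conj s01 t01) _ Vst.
  rewrite /nbhs /= /within /= => -[[A B] /= [/nbhs_ballP[d d0 dA] /nbhs_ballP[d' d'0 dB]] AB].
  exists (Num.min d d'); first by rewrite lt_min d0.
  move=> s' t' s'01 t'01; rewrite !lt_min => /andP[h1 h2] /andP[h3 h4].
  apply: (AB (s', t')) => //; split; [apply: dA|apply: dB];
    by rewrite /ball /= distrC.
have hor s : 0 <= s <= 1 -> pcont (fun t => H (s, t)) 0 1.
  move=> s01 t t01 V Vt; have [e e0 He] := tube s t s01 t01 V Vt.
  by exists e => // t' t'01 tt; apply: He => //; rewrite subrr normr0.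
suff loc s0 : 0 <= s0 <= 1 -> exists2 e : R, 0 < e & forall s, 0 <= s <= 1 -> `|s - s0| < e ->
    sim (H (0, 1)) (F s 1) (F s0 1).
  apply: (@segment_ind R (fun s => sim (H (0, 1)) (F 0 1) (F s 1)) 0 1 _ 0 1) => //; last first.
    by apply: coherent_def (FP 0 z01).1 o01.
  move=> s0 /loc[e e0 He]; exists e => // s s' s01 s'01 se s'e ss.
  by apply: sim_trans ss _; apply: sim_trans (He s s01 se) (sim_sym (He s' s'01 s'e)).
move=> s01.
have [cF0 F00] := FP s0 s01.
suff : exists2 e : R, 0 < e & forall s, 0 <= s <= 1 -> `|s - s0| < e ->
    sim (H (s, 1)) (F s 1) (F s0 1).
  move=> [e e0 He]; exists e => // s s'01 se; rewrite -(H1 s) //; exact: He.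
apply: (@segment_ind R (fun t => exists2 e : R, 0 < e & forall s, 0 <= s <= 1 -> `|s - s0| < e ->
    sim (H (s, t)) (F s t) (F s0 t)) 0 1 _ 0 1) => //; last first.
  exists 1 => // s s'01 _; rewrite (FP s s'01).2 F00 H0 //.
  have := coherent_def (FP s s'01).1 z01; by rewrite (FP s s'01).2 H0.
move=> t t01; have [V [oV Vt V1 V2 _]] := cover (H (s0, t)).
have [e e0 He] := tube s0 t s01 t01 _ (open_nbhs_nbhs (conj oV Vt)).
have [h hV ht] := V1 _ _ Vt (coherent_def cF0 t01).
have btw a b r : `|a - t| < e -> `|b - t| < e -> 0 <= a <= 1 -> 0 <= b <= 1 ->
    Num.min a b <= r <= Num.max a b -> 0 <= r <= 1 /\ `|r - t| < e.
  move=> ae be /andP[a0 a1] /andP[b0 b1] /andP[]; rewrite ge_min le_max !ltr_norml in ae be *.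
  move: ae be => /andP[? ?] /andP[? ?] k1 k2; split; apply/andP; split;
  by case/orP: k1 => k1; case/orP: k2 => k2; lra.
have base r : 0 <= r <= 1 -> `|r - t| < e -> sim (H (s0, r)) (F s0 r) h.
  move=> r01 re; have te : `|t - t| < e by rewrite subrr normr0.
  apply: (@coherent_germ (fun t => H (s0, t)) (F s0) h V 0 1 t r (hor _ s01) cF0 hV) => //.
  - move=> x /(btw _ _ _ te re t01 r01)[x01 xe]; apply: He => //.
    by rewrite subrr normr0.
  - exact: sim_sym.
exists e => // a b a01 b01 ae be [d d0 Hd].
have ha := tube s0 a s01 a01 _ (sim_open (base a a01 ae)).
have hb := tube s0 b s01 b01 _ (sim_open (base b b01 be)).
case: ha => ea ea0 Ha; case: hb => eb eb0 Hb.
exists (Num.min (Num.min d e) (Num.min ea eb)); first by rewrite !lt_min d0 e0 ea0.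
move=> s s'01; rewrite !lt_min => /andP[/andP[k1 k2] /andP[k3 k4]].
have Sa : sim (H (s, a)) (F s a) h.
  by apply: sim_trans (Hd s s'01 k1) (Ha _ _ s'01 a01 k3 _); rewrite subrr normr0.
have Sb : sim (H (s, b)) (F s b) h.
  apply: (@coherent_germ (fun t => H (s, t)) (F s) h V 0 1 a b (hor _ s'01) (FP s s'01).1 hV) => //.
  by move=> x /(btw _ _ _ ae be a01 b01)[x01 xe]; exact: He.
by apply: sim_trans Sb (sim_sym (Hb _ _ s'01 b01 k4 _)); rewrite subrr normr0.
Qed.

Definition conc c c' : R -> X := fun t => if t <= 1 / 2 then c (2 * t) else c' (2 * t - 1).

Lemma conc_l c c' t : 0 <= t <= 1 -> conc c c' (1 / 2 * t + 0) = c t.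
Proof.
move=> /andP[t0 t1]; rewrite /conc addr0.
have -> : 1 / 2 * t <= 1 / 2 by rewrite ler_piMr // divr_ge0.
by congr (c _); field.
Qed.

Lemma conc_r c c' t : c 1 = c' 0 -> 0 <= t <= 1 -> conc c c' (1 / 2 * t + 1 / 2) = c' t.
Proof.
move=> cc /andP[t0 t1]; rewrite /conc.
have [->|tn] := eqVneq t 0.
  by rewrite mulr0 add0r lexx -cc; congr (c _); field.
have tp : 0 < t by rewrite lt_neqAle eq_sym tn.
have -> : 1 / 2 * t + 1 / 2 <= 1 / 2 = false.
  by apply/negbTE; rewrite -ltNge ltrDr mulr_gt0 // divr_gt0.
by congr (c' _); field.
Qed.

Lemma pcont_conc c c' : c 1 = c' 0 -> pcont c 0 1 -> pcont c' 0 1 -> pcont (conc c c') 0 1.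
Proof.
move=> cc pc pc' t /andP[t0 t1] V Vt.
have hl (s : R) : 0 <= s <= 1 / 2 -> 0 <= 2 * s <= 1 by move=> /andP[? ?]; apply/andP; split; lra.
have hr (s : R) : 1 / 2 <= s <= 1 -> 0 <= 2 * s - 1 <= 1 by move=> /andP[? ?]; apply/andP; split; lra.
have El s : s <= 1 / 2 -> conc c c' s = c (2 * s) by rewrite /conc => ->.
have Er s : 1 / 2 <= s -> conc c c' s = c' (2 * s - 1).
  rewrite le_eqVlt => /predU1P[<-|sh]; last by rewrite /conc leNgt sh.
  rewrite /conc lexx (_ : 2 * (1 / 2) = 1 :> R); last by field.
  by rewrite subrr.
have L : t <= 1 / 2 -> exists2 e : R, 0 < e & forall s, 0 <= s <= 1 / 2 -> `|s - t| < e -> V (conc c c' s).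
  move=> th; rewrite El // in Vt; have [|e e0 He] := pc _ _ V Vt; first by apply: hl; rewrite t0.
  exists (e / 2); first by rewrite divr_gt0.
  move=> s /[dup] s0h /andP[s0 sh] st; rewrite El //; apply: He; first exact: hl.
  by rewrite -mulrBr normrM ger0_norm // mulrC -ltr_pdivlMr.
have Rr : 1 / 2 <= t -> exists2 e : R, 0 < e & forall s, 1 / 2 <= s <= 1 -> `|s - t| < e -> V (conc c c' s).
  move=> th; rewrite Er // in Vt; have [|e e0 He] := pc' _ _ V Vt; first by apply: hr; rewrite th.
  exists (e / 2); first by rewrite divr_gt0.
  move=> s /[dup] s0h /andP[s0 sh] st; rewrite Er //; apply: He; first exact: hr.
  have -> : 2 * s - 1 - (2 * t - 1) = 2 * (s - t) by ring.
  by rewrite normrM ger0_norm // mulrC -ltr_pdivlMr.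
case: (ltgtP t (1 / 2)) => th.
- have [e e0 He] := L (ltW th); exists (Num.min e (1 / 2 - t)); first by rewrite lt_min e0 subr_gt0.
  move=> s /andP[s0 s1]; rewrite lt_min => /andP[h1 h2]; apply: He => //.
  by rewrite s0; move: h2; rewrite ltr_norml => /andP[_]; lra.
- have [e e0 He] := Rr (ltW th); exists (Num.min e (t - 1 / 2)); first by rewrite lt_min e0 subr_gt0.
  move=> s /andP[s0 s1]; rewrite lt_min => /andP[h1 h2]; apply: He => //.
  by rewrite s1 andbT; move: h2; rewrite ltr_norml => /andP[]; lra.
- have [|e e0 He] := L; first by rewrite th.
  have [|e' e'0 He'] := Rr; first by rewrite th.
  exists (Num.min e e'); first by rewrite lt_min e0.
  move=> s /andP[s0 s1]; rewrite lt_min => /andP[h1 h2].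
  by case: (leP s (1 / 2)) => sh; [apply: He|apply: He'] => //; rewrite ?s0 ?s1 ?(ltW sh).
Qed.

Context (sc : @simply_connected R X) (p0 : X) (g0 : G) (g00 : sim p0 g0 g0).

(** The loop formed by [c] and the reversed [c'] contracts to a constant path, over which a lift
    cannot change its germ; hence a lift of the loop from [g0] returns to [g0]. Read from either
    end, its value at the midpoint is the continuation along [c] and along [c']. *)
Lemma path_independent c c' F F' : pcont c 0 1 -> pcont c' 0 1 -> c 0 = p0 -> c' 0 = p0 ->
  c 1 = c' 1 -> coherent c F 0 1 -> coherent c' F' 0 1 -> F 0 = g0 -> F' 0 = g0 ->
  sim (c 1) (F 1) (F' 1).
Proof.
move=> pc pc' c0 c0' c1 cF cF' F0 F0'.
pose rc t := c' (- 1 * t + 1).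
have prc : pcont rc 0 1.
  by apply: pcont_affine pc' => t /andP[? ?]; apply/andP; split; lra.
have crc : c 1 = rc 0 by rewrite c1 /rc mulr0 add0r.
pose l := conc c rc.
have pl : pcont l 0 1 by exact: pcont_conc.
have l0 : l 0 = p0 by have := conc_l c rc z01; rewrite mulr0 addr0 -c0.
have l1 : l 1 = p0.
  have := conc_r crc o01; rewrite (_ : 1 / 2 * 1 + 1 / 2 = 1 :> R); last by field.
  by rewrite -/(l 1) => ->; rewrite /rc (_ : -1 * 1 + 1 = 0 :> R) // mulr1 addNr.
have [_ Hl] := sc; have [|H [cH H0 H1 Hs]] := Hl l (proj2 (pcontP l) pl); first by rewrite l0 l1.
have ex s : exists f : R -> G, 0 <= s <= 1 -> coherent (fun t => H (s, t)) f 0 1 /\ f 0 = g0.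
  have [s01|] := pselect (0 <= s <= 1); last by exists (fun=> g0).
  have [hs0 hs1] := Hs s s01.
  have [||f cf f0] := @coherent_exists (fun t => H (s, t)) g0 0 1 ler01.
  - move=> t t01 V Vt; move/subspace_continuousP: cH => cH.
    have := cH (s, t) (conj s01 t01) _ Vt.
    rewrite /nbhs /= /within /= => -[[A B] /= [/nbhs_ballP[d d0 dA] /nbhs_ballP[d' d'0 dB]] AB].
    exists d' => // t' t'01 tt; apply: (AB (s, t')) => //; split.
      by apply: dA; rewrite /ball /= subrr normr0.
    by apply: dB; rewrite /ball /= distrC.
  - by rewrite hs0 l0.
  by exists f.
have [f fP] := choice ex.
have S := @homotopy_coherent H g0 f cH _ _ fP.
have {}S : sim p0 (f 0 1) (f 1 1).
  have -> : p0 = H (0, 1) by rewrite (Hs 0 z01).2.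
  by apply: S => s s01; [rewrite (Hs s s01).1 (Hs 0 z01).1|rewrite (Hs s s01).2 (Hs 0 z01).2].
have [cf0 f00] := fP 0 z01; have [cf1 f10] := fP 1 o01.
have {cf0} cL : coherent l (f 0) 0 1 by apply: eq_coherent cf0 => t; exact: H0.
have S1 : sim p0 (f 1 1) g0.
  have pcst : pcont (fun=> p0 : X) 0 1.
    by move=> t t01 V Vt; exists 1 => // s _ _; exact: nbhs_singleton.
  have cf1' : coherent (fun=> p0) (f 1) 0 1.
    by apply: eq_coherent cf1 => t t01; rewrite H1 // l0.
  apply: (coherent_unique pcst cf1' (coherent_cst (fun t _ => g00)) z01 o01).
  by rewrite f10.
have La : sim (c 1) (f 0 (1 / 2 * 1 + 0)) (F 1).
  have cLa : coherent c (fun t => f 0 (1 / 2 * t + 0)) 0 1.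
    apply: eq_coherent (coherent_affine _ cL) => [t t01|t /andP[? ?]]; first exact: conc_l.
    by apply/andP; split; lra.
  apply: (coherent_unique pc cLa cF z01 o01).
  by rewrite mulr0 addr0 f00 F0 c0.
have Lb : sim (c' 1) (f 0 (- (1 / 2) * 1 + 1)) (F' 1).
  have cLb : coherent c' (fun t => f 0 (- (1 / 2) * t + 1)) 0 1.
    apply: eq_coherent (coherent_affine _ cL) => [t /andP[t0 t1]|t /andP[? ?]]; last first.
      by apply/andP; split; lra.
    have t01 : 0 <= - 1 * t + 1 <= 1 by apply/andP; split; lra.
    have := conc_r crc t01; rewrite /rc.
    have -> : 1 / 2 * (-1 * t + 1) + 1 / 2 = - (1 / 2) * t + 1 by field.
    have -> : -1 * (-1 * t + 1) + 1 = t by ring.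
    by [].
  apply: (coherent_unique pc' cLb cF' z01 o01).
  rewrite mulr0 add0r F0' c0'; exact: sim_trans S S1.
have E : 1 / 2 * 1 + 0 = - (1 / 2) * 1 + 1 :> R by field.
by rewrite E in La; rewrite c1 in La *; apply: sim_trans (sim_sym La) Lb.
Qed.

(** The value at [p] is the continuation of [g0] along any path to [p]. Near [p] it is given by a
    single section, because a path to [q] may be taken through [p] and then inside [V]. *)
Theorem monodromy : exists F : X -> G, forall p, sim p (F p) (F p) /\
  nbhs p [set q | sim q (F q) (F p)].
Proof.
have ex p : exists g, forall c F, pcont c 0 1 -> c 0 = p0 -> c 1 = p -> coherent c F 0 1 ->
    F 0 = g0 -> sim p (F 1) g.
  have [c [/pcontP pc c0 c1]] := sc.1 p0 p.
  have [|F cF F0] := coherent_exists ler01 pc (g := g0); first by rewrite c0.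
  exists (F 1) => c' F' pc' c0' c1' cF' F0'; rewrite -c1'.
  by apply: path_independent pc' pc c0' c0 _ cF' cF F0' F0; rewrite c1 c1'.
have [F FP] := choice ex; exists F => p.
have [c [/pcontP pc c0 c1]] := sc.1 p0 p.
have [|f cf f0] := coherent_exists ler01 pc (g := g0); first by rewrite c0.
have Sp := FP p c f pc c0 c1 cf f0.
have Spp := sim_r Sp; split=> //.
have [V [oV Vp V1 V2 V3]] := cover p.
have [h hV hp] := V1 _ _ Vp Spp.
have : nbhs p [set q | V q /\ sim q h (F p)].
  by apply: filterI; [exact: open_nbhs_nbhs|exact: sim_open].
apply: filterS => q /= [Vq hq]; apply: sim_trans hq.
have [ga [/pcontP pga ga0 ga1 gaV]] := V3 q Vq.
have cg : c 1 = ga 0 by rewrite c1 ga0.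
pose l := conc c ga; have pl : pcont l 0 1 by exact: pcont_conc.
have l0 : l 0 = p0 by have := conc_l c ga z01; rewrite mulr0 addr0 -c0.
have l1 : l 1 = q.
  have := conc_r cg o01; rewrite (_ : 1 / 2 * 1 + 1 / 2 = 1 :> R); last by field.
  by rewrite ga1.
have [|L cL L0] := coherent_exists ler01 pl (g := g0); first by rewrite l0.
apply: sim_trans (sim_sym (FP q l L pl l0 l1 cL L0)) _.
have La : sim p (L (1 / 2 * 1 + 0)) h.
  have cLa : coherent c (fun t => L (1 / 2 * t + 0)) 0 1.
    apply: eq_coherent (coherent_affine _ cL) => [t t01|t /andP[? ?]]; first exact: conc_l.
    by apply/andP; split; lra.
  have := coherent_unique pc cLa cf z01 o01.
  rewrite mulr0 addr0 L0 f0 c0 c1 => /(_ g00) S.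
  exact: sim_trans (sim_trans S Sp) (sim_sym hp).
have cLb : coherent ga (fun t => L (1 / 2 * t + 1 / 2)) 0 1.
  apply: eq_coherent (coherent_affine _ cL) => [t t01|t /andP[? ?]]; first exact: conc_r.
  by apply/andP; split; lra.
have := @coherent_unique ga _ (fun=> h) 0 1 pga cLb (coherent_cst (fun t t01 => hV _ (gaV t t01))) 0 1 z01 o01.
rewrite ga0 ga1 mulr0 add0r (_ : 1 / 2 * 1 + 1 / 2 = 1 :> R); last by field.
by apply; move: La; rewrite mulr1 addr0.
Qed.

End Monodromy.

(** * Pullback, infinitesimal action, Hodge star, wedge and contraction on components *)

Section TensorAlgebra.
Context {R : realType}.

Definition join n k l (I : midx k n) (J : midx l n) :
    midx (k + l) n :=
  [ffun p => match fintype.split p with inl a => I a | inr b => J b end].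

Lemma tjoin_l n k l (I : midx k n) (J : midx l n) a :
  join I J (lshift l a) = I a.
Proof. by rewrite ffunE (unsplitK (inl a)). Qed.

Lemma tjoin_r n k l (I : midx k n) (J : midx l n) b :
  join I J (rshift k b) = J b.
Proof. by rewrite ffunE (unsplitK (inr b)). Qed.

Lemma join_eta n k l (F : midx (k + l) n) :
  join [ffun a => F (lshift l a)] [ffun b => F (rshift k b)] = F.
Proof. by apply/ffunP => p; case: (split_ordP p) => q ->; rewrite (tjoin_l, tjoin_r) ffunE. Qed.

Lemma big_join n k l (f : midx (k + l) n -> R) :
  \sum_F f F = \sum_I \sum_J f (join I J).
Proof.
rewrite pair_bigA /= (reindex_onto (fun z : midx k n * midx l n => join z.1 z.2)
  (fun F => ([ffun a => F (lshift l a)], [ffun b => F (rshift k b)]))) /=; last first.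
  by move=> F _; exact: join_eta.
apply: eq_bigl => -[I J] /=; apply/eqP; congr pair.
  by apply/ffunP => a; rewrite ffunE tjoin_l.
by apply/ffunP => a; rewrite ffunE tjoin_r.
Qed.

Lemma prod_join m n k l (A : 'M[R]_(m, n)) I I' (J : midx k n) (J' : midx l n) :
  \prod_p A (join I I' p) (join J J' p) = (\prod_p A (I p) (J p)) * \prod_p A (I' p) (J' p).
Proof.
rewrite big_split_ord /=; congr (_ * _); apply: eq_bigr => p _.
  by rewrite !tjoin_l.
by rewrite !tjoin_r.
Qed.

Lemma pullE m n k (A : 'M[R]_(m, n)) (t : cov R n k) (I : midx k m) :
  pull A t I = \sum_(J : midx k n) (\prod_p A (I p) (J p)) * t J.
Proof. by rewrite ffunE. Qed.

Lemma prod_delta n k (I J : midx k n) :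
  \prod_p (1%:M : 'M[R]_n) (I p) (J p) = (I == J)%:R.
Proof.
have [<-|ne] := eqVneq I J; first by rewrite big1 // => p _; rewrite mxE eqxx.
have [p np] : exists p, I p != J p.
  apply/existsP; rewrite -negb_forall; apply: contra ne => /forallP h.
  by apply/eqP/ffunP => p; apply/eqP.
by rewrite (bigD1 p) //= mxE (negbTE np) mul0r.
Qed.

Lemma pull1 n k (t : cov R n k) : pull 1%:M t = t.
Proof.
apply/ffunP => I; rewrite pullE (bigD1 I) //= prod_delta eqxx mul1r big1 ?addr0 // => J ne.
by rewrite prod_delta eq_sym (negbTE ne) mul0r.
Qed.

Lemma sum_prod_mulmx m n p k (A : 'M[R]_(m, n)) (B : 'M[R]_(n, p)) (I : midx k m)
    (K : midx k p) :
  \prod_q (A *m B) (I q) (K q) = \sum_(J : midx k n) (\prod_q A (I q) (J q)) * \prod_q B (J q) (K q).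
Proof.
under eq_bigr do rewrite mxE.
rewrite bigA_distr_bigA /=; apply: eq_bigr => J _.
by rewrite big_split.
Qed.

Lemma pull_comp m n p k (A : 'M[R]_(m, n)) (B : 'M[R]_(n, p)) (t : cov R p k) :
  pull A (pull B t) = pull (A *m B) t.
Proof.
apply/ffunP => I; rewrite !pullE.
under eq_bigr do rewrite pullE mulr_sumr.
rewrite exchange_big /=; apply: eq_bigr => K _.
rewrite sum_prod_mulmx mulr_suml; apply: eq_bigr => J _; by rewrite mulrA.
Qed.

Lemma pullD m n k (A : 'M[R]_(m, n)) (s t : cov R n k) : pull A (s + t) = pull A s + pull A t.
Proof.
apply/ffunP => I; rewrite [RHS]ffunE !pullE -big_split; apply: eq_bigr => J _.
by rewrite ffunE mulrDr.
Qed.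

Lemma pullZ m n k (A : 'M[R]_(m, n)) a (t : cov R n k) : pull A (a *: t) = a *: pull A t.
Proof.
apply/ffunP => I; rewrite [RHS]ffunE !pullE [RHS]mulr_sumr; apply: eq_bigr => J _.
by rewrite ffunE mulrCA.
Qed.

Lemma pull0 m n k (A : 'M[R]_(m, n)) : pull A (0 : cov R n k) = 0.
Proof. by rewrite -(scale0r (0 : cov R n k)) pullZ scale0r. Qed.

Lemma sum_pull_adj m n k (A : 'M[R]_(m, n)) (s : cov R n k) (t : cov R m k) :
  \sum_I pull A s I * t I = \sum_J s J * pull A^T t J.
Proof.
under eq_bigr do rewrite pullE mulr_suml.
rewrite exchange_big /=; apply: eq_bigr => J _.
rewrite pullE mulr_sumr; apply: eq_bigr => I _.
rewrite [X in X * _]mulrC -[LHS]mulrA; congr (_ * (_ * _)).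
by apply: eq_bigr => p _; rewrite mxE.
Qed.

Lemma alternating_pull m n k (A : 'M[R]_(m, n)) (t : cov R n k) : alternating t ->
  alternating (pull A t).
Proof.
move=> alt s I; rewrite !pullE mulr_sumr.
pose h (J : midx k n) : midx k n := [ffun p => J (s p)].
pose h' (J : midx k n) : midx k n := [ffun p => J ((s^-1)%g p)].
have hK : cancel h' h by move=> J; apply/ffunP => p; rewrite !ffunE permK.
have h'K : cancel h h' by move=> J; apply/ffunP => p; rewrite !ffunE permKV.
rewrite (reindex h); last by exists h' => J _; [exact: h'K|exact: hK].
apply: eq_bigr => J _; rewrite alt mulrCA; congr (_ * (_ * _)).
rewrite [RHS](reindex_inj (@perm_inj _ s)) /=; apply: eq_bigr => p _.
by rewrite !ffunE.
Qed.

Lemma actE n k (A : 'M[R]_n) (t : cov R n k) I :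
  act A t I = \sum_(p < k) \sum_(j < n) A (I p) j * t (subst_index I p j).
Proof. by rewrite ffunE. Qed.

Lemma actDl n k (A B : 'M[R]_n) (t : cov R n k) : act (A + B) t = act A t + act B t.
Proof.
apply/ffunP => I; rewrite [RHS]ffunE !actE -big_split; apply: eq_bigr => p _.
by rewrite -big_split; apply: eq_bigr => j _; rewrite mxE mulrDl.
Qed.

Lemma actZl n k a (A : 'M[R]_n) (t : cov R n k) : act (a *: A) t = a *: act A t.
Proof.
apply/ffunP => I; rewrite [RHS]ffunE !actE [RHS]mulr_sumr; apply: eq_bigr => p _.
by rewrite [RHS]mulr_sumr; apply: eq_bigr => j _; rewrite mxE mulrA.
Qed.

Lemma actDr n k (A : 'M[R]_n) (s t : cov R n k) : act A (s + t) = act A s + act A t.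
Proof.
apply/ffunP => I; rewrite [RHS]ffunE !actE -big_split; apply: eq_bigr => p _.
by rewrite -big_split; apply: eq_bigr => j _; rewrite ffunE mulrDr.
Qed.

Lemma act0l n k (t : cov R n k) : act 0 t = 0.
Proof. by rewrite -(scale0r (0 : 'M[R]_n)) actZl scale0r. Qed.

Lemma actZr n k a (A : 'M[R]_n) (t : cov R n k) : act A (a *: t) = a *: act A t.
Proof.
apply/ffunP => I; rewrite [RHS]ffunE !actE [RHS]mulr_sumr; apply: eq_bigr => p _.
by rewrite [RHS]mulr_sumr; apply: eq_bigr => j _; rewrite ffunE mulrCA.
Qed.

Lemma act_sum n k I (r : seq I) (P : pred I) (A : I -> 'M[R]_n) (t : cov R n k) :
  act (\sum_(i <- r | P i) A i) t = \sum_(i <- r | P i) act (A i) t.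
Proof. by elim/big_rec2: _ => [|i s A' _ <-]; rewrite ?act0l // actDl. Qed.

(** Leibniz rule for the product of entries in [pull]: [dcoef A A'] and [dpull A A'] are the
    derivatives, in the direction [A'], of the coefficients and of the pullback as functions of the
    matrix [A]. *)
Definition dcoef m n k (A A' : 'M[R]_(m, n)) (I : midx k m) (J : midx k n) : R :=
  \sum_p A' (I p) (J p) * \prod_(q | q != p) A (I q) (J q).

Definition dpull m n k (A A' : 'M[R]_(m, n)) (t : cov R n k) : cov R m k :=
  [ffun I : midx k m => \sum_(J : midx k n)
    dcoef A A' I J * t J].

Lemma dpullE m n k (A A' : 'M[R]_(m, n)) (t : cov R n k) (I : midx k m) :
  dpull A A' t I = \sum_(J : midx k n)
    dcoef A A' I J * t J.
Proof. by rewrite ffunE. Qed.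

Lemma dpullD m n k (A A' A'' : 'M[R]_(m, n)) (t : cov R n k) :
  dpull A (A' + A'') t = dpull A A' t + dpull A A'' t.
Proof.
apply/ffunP => I; rewrite [RHS]ffunE !dpullE -big_split; apply: eq_bigr => J _.
have -> : dcoef A (A' + A'') I J = dcoef A A' I J + dcoef A A'' I J.
  by rewrite /dcoef -big_split; apply: eq_bigr => p _; rewrite mxE mulrDl.
by rewrite mulrDl.
Qed.

Lemma dpullN m n k (A A' : 'M[R]_(m, n)) (t : cov R n k) :
  dpull A (- A') t = - dpull A A' t.
Proof.
apply/ffunP => I; rewrite [RHS]ffunE !dpullE -sumrN; apply: eq_bigr => J _.
rewrite -mulNr; congr (_ * _); rewrite /dcoef -sumrN; apply: eq_bigr => p _.
by rewrite mxE mulNr.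
Qed.

Lemma subst_indexE n k (I : midx k n) p j q :
  subst_index I p j q = if q == p then j else I q.
Proof. by rewrite ffunE. Qed.

Lemma dpull_mull m n k (A : 'M[R]_m) (J : 'M[R]_(m, n)) (t : cov R n k) :
  dpull J (A *m J) t = act A (pull J t).
Proof.
apply/ffunP => I; rewrite dpullE actE.
under [RHS]eq_bigr => p _ do under eq_bigr => j _ do rewrite pullE mulr_sumr.
transitivity (\sum_(K : midx k n) \sum_p (A *m J) (I p) (K p) * \prod_(q | q != p) J (I q) (K q) * t K).
  apply: eq_bigr => K _; rewrite /dcoef. exact: mulr_suml.
rewrite exchange_big /=; apply: eq_bigr => p _.
rewrite [RHS]exchange_big /=; apply: eq_bigr => K _.
rewrite mxE !mulr_suml; apply: eq_bigr => j _.
rewrite -!mulrA; congr (_ * _); rewrite mulrA; congr (_ * _).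
rewrite [RHS](bigD1 p) //= subst_indexE eqxx; congr (_ * _).
by apply: eq_bigr => q /negbTE qp; rewrite subst_indexE qp.
Qed.

Lemma dpull_mulr m n k (B : 'M[R]_n) (J : 'M[R]_(m, n)) (t : cov R n k) :
  dpull J (J *m B) t = pull J (act B t).
Proof.
apply/ffunP => I; rewrite dpullE pullE.
under [RHS]eq_bigr => K _ do rewrite actE mulr_sumr.
transitivity (\sum_(K : midx k n) \sum_p (J *m B) (I p) (K p) * \prod_(q | q != p) J (I q) (K q) * t K).
  by apply: eq_bigr => K _; rewrite /dcoef; exact: mulr_suml.
rewrite exchange_big [RHS]exchange_big /=; apply: eq_bigr => p _.
under [RHS]eq_bigr do rewrite mulr_sumr.
under eq_bigr do rewrite mxE !mulr_suml.
rewrite !pair_bigA /=.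
pose h (z : midx k n * 'I_n) := (subst_index z.1 p z.2, z.1 p).
have hK : involutive h.
  move=> [K j]; rewrite /h /= subst_indexE eqxx; congr pair.
  by apply/ffunP => q; rewrite !subst_indexE; case: eqP => // ->.
rewrite [RHS](reindex_inj (inv_inj hK)) /=; apply: eq_bigr => -[K j] _ /=.
rewrite subst_indexE eqxx.
have -> : subst_index (subst_index K p j) p (K p) = K.
  by apply/ffunP => q; rewrite !subst_indexE; case: eqP => // ->.
rewrite [in RHS](bigD1 p) //= subst_indexE eqxx -!mulrA; congr (_ * _).
rewrite [RHS]mulrCA; congr (_ * (_ * _)).
by apply: eq_bigr => q /negbTE qp; rewrite subst_indexE qp.
Qed.

(** A variation of [K] can be produced by a matrix on its left or on its right; when both give the
    same variation, the two actions correspond. This serves for changes of frame and for restriction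
    to a hyperplane. *)
Lemma pull_act m n k (K : 'M[R]_(m, n)) (A : 'M[R]_n) (B : 'M[R]_m) (t : cov R n k) :
  K *m A = B *m K -> pull K (act A t) = act B (pull K t).
Proof. by move=> e; rewrite -dpull_mulr e dpull_mull. Qed.

Definition eps n : cov R n n :=
  [ffun F : midx n n => \det (\matrix_(a < n, b < n) ((F a == b)%:R : R))].

Lemma levi_civita_join k l (I : midx k (k + l)) (J : midx l (k + l)) :
  levi_civita_symbol I J = eps (k + l) (join I J) :> R.
Proof.
rewrite [RHS]ffunE /levi_civita_symbol; congr (\det _); apply/matrixP => a b.
by rewrite !mxE ffunE.
Qed.

Lemma det_sum_eps n (M : 'M[R]_n) :
  \det M = \sum_(F : midx n n) (\prod_a M a (F a)) * eps n F.
Proof.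
under [RHS]eq_bigr do rewrite ffunE /determinant mulr_sumr.
rewrite exchange_big /=; apply: eq_bigr => s _.
under [RHS]eq_bigr => F _.
  rewrite mulrCA -big_split /=.
  under eq_bigr do rewrite mxE.
  over.
rewrite -mulr_sumr; congr (_ * _).
rewrite -(bigA_distr_bigA (fun a b => M a b * (b == s a)%:R)) /=; apply: eq_bigr => a _.
rewrite (bigD1 (s a)) //= eqxx mulr1 big1 ?addr0 // => b /negbTE ->.
by rewrite mulr0.
Qed.

Lemma pull_eps n (A : 'M[R]_n) : pull A (eps n) = \det A *: eps n.
Proof.
apply/ffunP => F; rewrite pullE [RHS]ffunE [RHS]/GRing.scale /=.
have := det_sum_eps (\matrix_(a, b) A (F a) b).
under [in X in _ = X -> _]eq_bigr do under eq_bigr do rewrite mxE.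
move=> <-; rewrite ffunE mulrC -det_mulmx; congr (\det _); apply/matrixP => a b.
rewrite !mxE (bigD1 (F a)) //= mxE eqxx mul1r big1 ?addr0 // => c /negbTE ne.
by rewrite mxE eq_sym ne mul0r.
Qed.

Lemma hodgeE k l (m : 'M[R]_(k + l)) (t : cov R (k + l) k) J :
  hodge m t J = Num.sqrt (\det m) / (k`!)%:R *
    \sum_(I : midx k (k + l)) eps (k + l) (join I J) * pull (invmx m) t I.
Proof. by rewrite ffunE; congr (_ * _); apply: eq_bigr => I _; rewrite levi_civita_join. Qed.

(** As [eps] is invariant up to the determinant, [A] acting on the last [l] slots can be traded for
    [\det A] times [invmx A] acting on the first [k]. The same [\det A], positive by hypothesis, is
    the factor by which the square root of the Gram determinant changes. *)
Lemma hodge_pull k l (A m : 'M[R]_(k + l)) (t : cov R (k + l) k) :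
  m \in unitmx -> 0 < \det A ->
  pull A (hodge m t) = hodge (A *m m *m A^T) (pull A t).
Proof.
move=> um dA; have uA : A \in unitmx by rewrite unitmxE unitfE gt_eqF.
have uAT : A^T \in unitmx by rewrite unitmx_tr.
have e1 : invmx (A *m m *m A^T) *m A = invmx A^T *m invmx m.
  have u : A *m m *m A^T \in unitmx by rewrite !unitmx_mul uA um uAT.
  by apply: (can_inj (mulKmx u)); rewrite mulKVmx // mulmxA mulmxK // mulmxK.
have e2 (I : midx k (k + l)) (J : midx l (k + l)) :
    \sum_(J' : midx l (k + l)) (\prod_p A (J p) (J' p)) * eps (k + l) (join I J') =
    \det A * \sum_(I' : midx k (k + l)) (\prod_p (invmx A) (I p) (I' p)) * eps (k + l) (join I' J).
  have key (I' : midx k (k + l)) : \det A * eps (k + l) (join I' J) =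
    \sum_(I'' : midx k (k + l)) (\prod_p A (I' p) (I'' p)) *
      \sum_(J' : midx l (k + l)) (\prod_p A (J p) (J' p)) * eps (k + l) (join I'' J').
    have := congr1 (fun f : cov R (k + l) (k + l) => f (join I' J)) (pull_eps A).
    rewrite [X in _ = X]ffunE pullE big_join /GRing.scale /= => <-.
    apply: eq_bigr => I'' _; rewrite mulr_sumr; apply: eq_bigr => J' _.
    by rewrite prod_join mulrA.
  rewrite mulr_sumr; under [RHS]eq_bigr do rewrite mulrCA key mulr_sumr.
  rewrite exchange_big /=.
  under [RHS]eq_bigr => I'' _.
    under eq_bigr do rewrite mulrA.
    rewrite -mulr_suml -sum_prod_mulmx mulVmx // prod_delta.
    over.
  rewrite [RHS](bigD1 I) //= eqxx mul1r [X in _ = _ + X]big1 ?addr0 // => I'' /negbTE ne.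
  by rewrite eq_sym ne mul0r.
have dd : Num.sqrt (\det (A *m m *m A^T)) = \det A * Num.sqrt (\det m).
  rewrite !det_mulmx det_tr mulrAC -expr2 sqrtrM ?sqr_ge0 // sqrtr_sqr gtr0_norm //.
apply/ffunP => J; rewrite pullE hodgeE pull_comp e1 -pull_comp dd.
set s := pull (invmx m) t; set c := (k`!)%:R^-1.
pose u : cov R (k + l) k := [ffun I : midx k (k + l) => eps (k + l) (join I J)].
have -> : \sum_I eps (k + l) (join I J) * pull (invmx A^T) s I =
    \sum_I s I * pull (invmx A) u I.
  rewrite -[in RHS](trmxK (invmx A)) -sum_pull_adj trmx_inv.
  by apply: eq_bigr => I _; rewrite [u I]ffunE mulrC.
transitivity (Num.sqrt (\det m) * c * \sum_I s I * (\det A * pull (invmx A) u I)); last first.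
  have -> : \sum_I s I * (\det A * pull (invmx A) u I) = \det A * \sum_I s I * pull (invmx A) u I.
    by rewrite [RHS]mulr_sumr; apply: eq_bigr => I _; rewrite [LHS]mulrCA.
  move: (\sum_I _) => x; rewrite /c; ring.
under eq_bigr do rewrite hodgeE mulrCA.
rewrite -mulr_sumr; congr (_ * _).
under eq_bigr do rewrite mulr_sumr.
rewrite exchange_big /=; apply: eq_bigr => I _.
have -> : \det A * pull (invmx A) u I = \sum_(J' : midx l (k + l)) (\prod_p A (J p) (J' p)) * eps (k + l) (join I J').
  rewrite e2 pullE; congr (_ * _); apply: eq_bigr => I' _; congr (_ * _).
  by rewrite /u ffunE.
rewrite mulr_sumr; apply: eq_bigr => J' _; rewrite -/s.
by rewrite mulrA mulrC.
Qed.

Lemma wedgeE n k l (a : cov R n k) (b : cov R n l) I :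
  wedge a b I = (k`! * l`!)%:R^-1 *
    \sum_(s : 'S_(k + l)) (-1) ^+ s
      * a [ffun p => I (s (lshift l p))] * b [ffun q => I (s (rshift k q))].
Proof. by rewrite ffunE. Qed.

Lemma pull_wedge m n k l (A : 'M[R]_(m, n)) (a : cov R n k) (b : cov R n l) :
  pull A (wedge a b) = wedge (pull A a) (pull A b).
Proof.
apply/ffunP => I; rewrite pullE wedgeE.
under eq_bigr do rewrite wedgeE mulrCA.
rewrite -mulr_sumr; congr (_ * _).
under eq_bigr do rewrite mulr_sumr.
rewrite exchange_big /=; apply: eq_bigr => s _.
pose h (J : midx (k + l) n) : midx (k + l) n := [ffun p => J ((s^-1)%g p)].
pose h' (J : midx (k + l) n) : midx (k + l) n := [ffun p => J (s p)].
have hK : cancel h' h by move=> J; apply/ffunP => p; rewrite !ffunE permKV.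
have h'K : cancel h h' by move=> J; apply/ffunP => p; rewrite !ffunE permK.
rewrite (reindex h); last by exists h' => J _; [exact: h'K|exact: hK].
rewrite big_join !pullE -[RHS]mulrA big_distrlr /= mulr_sumr; apply: eq_bigr => J1 _.
rewrite mulr_sumr; apply: eq_bigr => J2 _.
have -> : [ffun p => h (join J1 J2) (s (lshift l p))] = J1.
  by apply/ffunP => p; rewrite !ffunE permK (unsplitK (inl p)).
have -> : [ffun p => h (join J1 J2) (s (rshift k p))] = J2.
  by apply/ffunP => p; rewrite !ffunE permK (unsplitK (inr p)).
have -> : \prod_p A (I p) (h (join J1 J2) p) =
   (\prod_p A ([ffun p => I (s (lshift l p))] p) (J1 p)) * \prod_p A ([ffun p => I (s (rshift k p))] p) (J2 p).
  rewrite -prod_join (reindex_inj (@perm_inj _ s)) /=; apply: eq_bigr => p _.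
  rewrite [h _ _]ffunE permK; congr (A _ _).
  by case: (split_ordP p) => q ->; rewrite (tjoin_l, tjoin_r) ffunE.
set x := \prod_p _; set y := \prod_p _; set sg := (-1) ^+ s.
by rewrite [RHS]mulrCA [RHS]mulrA mulrACA [sg * _]mulrC; ring.
Qed.

(** The vector enters the last slot, which is where e8 stands in [spin7_phi]; contraction with e8
    then produces no sign. *)
Definition ins n k (t : cov R n (k + 1)) (X : 'rV[R]_n) : cov R n k :=
  [ffun I : midx k n => \sum_c X 0 c * t (join I [ffun=> c])].

Lemma big_ffun1 n (f : midx 1 n -> R) : \sum_F f F = \sum_c f [ffun=> c].
Proof.
rewrite (reindex (fun c : 'I_n => [ffun=> c] : midx 1 n)) //.
exists (fun F : midx 1 n => F 0) => [c _|F _]; first by rewrite ffunE.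
by apply/ffunP => p; rewrite ffunE ord1.
Qed.

Lemma ins_pull m n k (A : 'M[R]_(m, n)) (t : cov R n (k + 1)) (Y : 'rV[R]_m) :
  ins (pull A t) Y = pull A (ins t (Y *m A)).
Proof.
apply/ffunP => I; rewrite [LHS]ffunE pullE.
under eq_bigr do rewrite pullE big_join mulr_sumr.
rewrite exchange_big /=; apply: eq_bigr => J _.
rewrite [ins _ _ _]ffunE mulr_sumr.
under eq_bigr do rewrite big_ffun1 mulr_sumr.
rewrite exchange_big /=; apply: eq_bigr => c _.
rewrite mxE mulr_suml mulr_sumr; apply: eq_bigr => d _.
rewrite prod_join big_ord1 !ffunE; ring.
Qed.

End TensorAlgebra.

(** * Derivatives of products and pullbacks *)

Section DerivePull.
Context {R : realType}.
Implicit Types (V : normedModType R).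

Lemma is_derive_bigsum V I (r : seq I) (P : pred I) (f : I -> V -> R) (df : I -> R) x v :
  (forall i, P i -> is_derive x v (f i) (df i)) ->
  is_derive x v (fun y => \sum_(i <- r | P i) f i y) (\sum_(i <- r | P i) df i).
Proof.
move=> h; elim: r => [|i r ih].
  rewrite big_nil; under eq_fun do rewrite big_nil; exact: is_derive_cst.
rewrite big_cons; under eq_fun do rewrite big_cons.
case: ifP => Pi //; apply: is_deriveD; exact: h.
Qed.

Lemma is_derive_prodR V (f g : V -> R) x v (df dg : R) :
  is_derive x v f df -> is_derive x v g dg ->
  is_derive x v (fun y => f y * g y) (df * g x + f x * dg).
Proof.
move=> hf hg; apply: (is_derive_eq (is_deriveM hf hg)).
by rewrite /GRing.scale /= addrC [g x * _]mulrC.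
Qed.

Lemma is_derive_bigprod V (I : eqType) (r : seq I) (f : I -> V -> R) (df : I -> R) x v : uniq r ->
  (forall i, is_derive x v (f i) (df i)) ->
  is_derive x v (fun y => \prod_(i <- r) f i y)
    (\sum_(i <- r) df i * \prod_(j <- r | j != i) f j x).
Proof.
move=> + h; elim: r => [_|i r ih /= /andP[ir ur]].
  rewrite big_nil; under eq_fun do rewrite big_nil; exact: is_derive_cst.
under eq_fun do rewrite big_cons.
apply: (is_derive_eq (is_derive_prodR (h i) (ih ur))).
rewrite big_cons big_cons eqxx /=; congr (_ * _ + _).
  rewrite big_seq [RHS]big_seq_cond; apply: eq_bigl => j.
  by case: (boolP (j \in r)) => // jr /=; apply/esym; apply: contraNneq ir => <-.
rewrite [LHS]mulr_sumr; apply: eq_big_seq => j jr.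
rewrite mulrCA big_cons; case: eqP => // e; by rewrite e jr in ir.
Qed.

Lemma is_derive_mulmx V m n p (A : V -> 'M[R]_(m, n)) (B : V -> 'M[R]_(n, p)) x v (A' : 'M[R]_(m, n)) (B' : 'M[R]_(n, p)) :
  (forall i j, is_derive x v (fun y => A y i j) (A' i j)) ->
  (forall i j, is_derive x v (fun y => B y i j) (B' i j)) ->
  forall i k, is_derive x v (fun y => (A y *m B y) i k) ((A' *m B x + A x *m B') i k).
Proof.
move=> hA hB i k; under eq_fun do rewrite mxE; rewrite mxE [X in X + _]mxE [X in _ + X]mxE -big_split.
by apply: is_derive_bigsum => j _; exact: is_derive_prodR.
Qed.

Lemma is_derive_pull V m n k (A : V -> 'M[R]_(m, n)) (t : V -> cov R n k) x v
    (A' : 'M[R]_(m, n)) (t' : cov R n k) (I : midx k m) :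
  (forall i j, is_derive x v (fun y => A y i j) (A' i j)) ->
  (forall J, is_derive x v (fun y => t y J : R) (t' J : R)) ->
  is_derive x v (fun y => pull (A y) (t y) I : R)
    (dpull (A x) A' (t x) I + pull (A x) t' I : R).
Proof.
move=> hA ht; under eq_fun do rewrite pullE.
rewrite dpullE pullE -big_split /=.
apply: is_derive_bigsum => J _; apply: is_derive_prodR => //.
by apply: is_derive_bigprod => //; exact: index_enum_uniq.
Qed.

End DerivePull.

(** * Metric connections with skew torsion on a coordinate domain *)

Section LocalConnection.
Context {R : realType} {n : nat}.
Implicit Types (g : 'rV[R]_n -> 'M[R]_n) (T : 'rV[R]_n -> cov R n 3).

Definition tri (a b c : 'I_n) : midx 3 n := [ffun p => tnth [tuple a; b; c] p].

Lemma tri_eta (I : midx 3 n) : tri (I 0) (I 1) (I 2) = I.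
Proof.
apply/ffunP => p; rewrite ffunE.
by case: p => -[|[|[|//]]] i; rewrite (tnth_nth (I 0)) /=; congr (I _); apply: val_inj.
Qed.

Lemma big_tri (f : midx 3 n -> R) : \sum_I f I = \sum_a \sum_b \sum_c f (tri a b c).
Proof.
under [RHS]eq_bigr do rewrite pair_bigA.
rewrite pair_bigA /= (reindex_onto (fun z : 'I_n * ('I_n * 'I_n) => tri z.1 z.2.1 z.2.2)
  (fun I => (I 0, (I 1, I 2)))) /=; last by move=> I _; exact: tri_eta.
by apply: eq_bigl => -[a [b c]] /=; rewrite !ffunE !(tnth_nth a) /= eqxx.
Qed.

Lemma pull_tri m (A : 'M[R]_(m, n)) (t : cov R n 3) (a b c : 'I_m) :
  pull A t [ffun p => tnth [tuple a; b; c] p] =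
  \sum_d \sum_e \sum_f A a d * A b e * A c f * t (tri d e f).
Proof.
rewrite pullE big_tri; apply: eq_bigr => d _; apply: eq_bigr => e' _; apply: eq_bigr => f _.
by rewrite !big_ord_recl big_ord0 !ffunE !(tnth_nth a) !(tnth_nth d) /= mulr1 !mulrA.
Qed.

Definition dmet g x (a b c : 'I_n) : R := partial a (fun y => g y b c) x.

(** Connection coefficients with the last index lowered: the entry (b, c) is the inner product of
    nabla_a d_b with d_c, given by the Koszul formula for the first derivatives [d] of the metric
    plus half the torsion. *)
Definition koszul (d t : 'I_n -> 'I_n -> 'I_n -> R) (a : 'I_n) : 'M[R]_n :=
  \matrix_(b, c) (2^-1 * (d a b c + d b a c - d c a b) + 2^-1 * t a b c).

Definition skewc g T x a : 'M[R]_n :=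
  koszul (dmet g x) (fun a b c => T x (tri a b c)) a *m invmx (g x).

Lemma skewcE (M : atlas R n) (g : metric M) (T : tensor M 3) i x a :
  \matrix_(b, c) skew_connection g T i x a b c = skewc (g i) (T i) x a.
Proof.
apply/matrixP => b c; rewrite !mxE /skew_connection /levi_civita -big_split /=.
by apply: eq_bigr => l _; rewrite !mxE -mulrDl.
Qed.

Lemma alternatingN k (t : cov R n k) (alt : alternating t) (p q : 'I_k) (I : midx k n) : p != q ->
  t [ffun r => I (tperm p q r)] = - t I.
Proof. by move=> pq; rewrite alt odd_tperm pq expr1 mulN1r. Qed.

Lemma alt12 (t : cov R n 3) (alt : alternating t) a b c : t (tri b a c) = - t (tri a b c).
Proof.
rewrite -(alternatingN alt _ (isT : (0 : 'I_3) != 1)); congr (t _); apply/ffunP => r.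
rewrite !ffunE; case: tpermP => [->|->|/eqP + /eqP] //.
by case: r => -[|[|[|//]]].
Qed.

Lemma alt23 (t : cov R n 3) (alt : alternating t) a b c : t (tri a c b) = - t (tri a b c).
Proof.
rewrite -(alternatingN alt _ (isT : (1 : 'I_3) != 2)); congr (t _); apply/ffunP => r.
rewrite !ffunE; case: tpermP => [->|->|/eqP + /eqP] //.
by case: r => -[|[|[|//]]].
Qed.

Lemma koszul_metric d t a b c : (forall a b c, d a b c = d a c b) ->
  (forall a b c, t a c b = - t a b c) ->
  koszul d t a b c + koszul d t a c b = d a b c.
Proof. move=> ds tt; rewrite !mxE (tt a b c) (ds a c b); by field. Qed.

(** The fundamental lemma with torsion, by the usual cyclic combination of three compatibility
    equations. It is what identifies the connection induced on the slice. *)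
Lemma koszul_unique d t (k : 'I_n -> 'M[R]_n) :
  (forall a b c, t b a c = - t a b c) -> (forall a b c, t a c b = - t a b c) ->
  (forall a b c, k a b c + k a c b = d a b c) ->
  (forall a b c, k a b c - k b a c = t a b c) -> forall a, k a = koszul d t a.
Proof.
move=> t1 t2 hd ht a; apply/matrixP => b c; rewrite !mxE.
have := ht a b c; have := ht a c b; have := ht b c a; rewrite -!hd.
rewrite (t2 a b c) [t b c a]t2 (t1 a b c) opprK => h1 h2 h3; lra.
Qed.

Lemma skewc_metric g T (U : set 'rV[R]_n) x a : open U -> U x ->
  (forall y, U y -> (g y)^T = g y) -> g x \in unitmx -> alternating (T x) ->
  \matrix_(b, c) dmet g x a b c = skewc g T x a *m g x + g x *m (skewc g T x a)^T.
Proof.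
move=> oU Ux sym ug alt; rewrite trmx_mul trmx_inv sym // mulmxKV // mulKVmx //.
apply/matrixP => b c; rewrite [RHS]mxE [X in _ = _ + X]mxE [LHS]mxE koszul_metric //; last first.
  by move=> *; exact: alt23.
move=> a' b' c'; apply: near_eq_derive.
by apply: (open_near oU Ux) => y Uy; rewrite -[in LHS](sym y) // mxE.
Qed.

(** Parallelism in one chart, with the sum over slots and connection coefficients packed into [act];
    [parallelE] is the translation. *)
Definition parc (U : set 'rV[R]_n) (G : 'rV[R]_n -> 'I_n -> 'M[R]_n) k (S : 'rV[R]_n -> cov R n k) :=
  forall x, U x -> forall a I, partial a (fun y => S y I : R) x = act (G x a) (S x) I.

Lemma parallelE (M : atlas R n) (g : metric M) (T : tensor M 3) k (S : tensor M k) :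
  parallel (skew_connection g T) S <-> forall i, parc (img i) (skewc (g i) (T i)) (S i).
Proof.
have e i x a I : cov_deriv (skew_connection g T) S i x a I =
    partial a (fun y => S i y I : R) x - act (skewc (g i) (T i) x a) (S i x) I.
  rewrite /cov_deriv actE -skewcE; congr (_ - _); apply: eq_bigr => p _; apply: eq_bigr => c _.
  by rewrite mxE.
split=> [h i x ix a I|h i x ix a I].
  by apply/eqP; rewrite -subr_eq0 -e; apply/eqP/h.
by rewrite e h // subrr.
Qed.

End LocalConnection.

(** * Induced connection on a totally geodesic hypersurface *)

Section Naturality.
Context {R : realType} {m n : nat}.
Context (U : set 'rV[R]_m) (O : set 'rV[R]_n) (iota : 'rV[R]_m -> 'rV[R]_n).
Context (oU : open U) (oO : open O) (iO : forall y, U y -> O (iota y)) (ci : smooth_on U iota).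

Let J y := 'J iota y.

Lemma iota_diff y : U y -> differentiable iota y.
Proof. by move=> Uy; have [h _] := ci 1%N; exact: h. Qed.

Lemma Ck_J k : Ck k U J.
Proof. by apply: Ck_jacobian => //; exact: ci. Qed.

Lemma J_diff y : U y -> differentiable J y.
Proof. by move=> Uy; have [h _] := Ck_J 1%N; exact: h. Qed.

Lemma row_J y a : U y -> 'D_(bv a) iota y = row a (J y).
Proof.
move=> Uy; apply/rowP => c; rewrite [RHS]mxE jacobianE; last exact: iota_diff.
by rewrite derive_mxE //; exact: iota_diff.
Qed.

Lemma is_derive_iota (f : 'rV[R]_n -> R) y a : U y -> differentiable f (iota y) ->
  is_derive y (bv a) (f \o iota) (\sum_d J y a d * partial d f (iota y)).
Proof.
move=> Uy df; apply: DeriveDef.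
  by apply: diff_derivable; apply: differentiable_comp => //; exact: iota_diff.
rewrite derive_comp //; last exact: iota_diff.
rewrite row_J // derive_rV //; apply: eq_bigr => d _; by rewrite mxE.
Qed.

Lemma is_derive_J y a b c : U y ->
  is_derive y (bv a) (fun y => J y b c) (('D_(bv a) J y) b c).
Proof.
move=> Uy; have dJ := J_diff Uy; apply: DeriveDef.
  by apply: diff_derivable; move/differentiable_mxP: dJ; exact.
by rewrite derive_mxE.
Qed.

Definition ambient (G : 'rV[R]_n -> 'I_n -> 'M[R]_n) y a : 'M[R]_n :=
  \sum_d J y a d *: G (iota y) d.

(** The last hypothesis is the Gauss formula with zero second fundamental form. It merges the
    derivative of [J] and the ambient connection term into the action of the induced connection
    [K]. *)
Lemma parc_pull (G : 'rV[R]_n -> 'I_n -> 'M[R]_n) (K : 'rV[R]_m -> 'I_m -> 'M[R]_m)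
    k (S : 'rV[R]_n -> cov R n k) :
  (forall I, smooth_on O (fun x => S x I : R)) -> parc O G S ->
  (forall y, U y -> forall a, 'D_(bv a) J y + J y *m ambient G y a = K y a *m J y) ->
  parc U K (fun y => pull (J y) (S (iota y))).
Proof.
move=> sS pS gauss y Uy a I; rewrite /partial.
have h : is_derive y (bv a) (fun y => pull (J y) (S (iota y)) I : R)
   (dpull (J y) ('D_(bv a) J y) (S (iota y)) I + pull (J y) (act (ambient G y a) (S (iota y))) I : R).
  apply: is_derive_pull => [b c|I']; first exact: is_derive_J.
  have [dS _] := sS I' 1%N.
  apply: (is_derive_eq (is_derive_iota a Uy (dS _ (iO Uy)))).
  rewrite act_sum; apply/esym.
  transitivity (\sum_d act (J y a d *: G (iota y) d) (S (iota y)) I').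
    by elim/big_rec2: _ => [|d s t _ <-]; rewrite ffunE.
  by apply: eq_bigr => d _; rewrite actZl ffunE pS //; exact: iO.
by rewrite (@derive_val _ _ _ _ _ _ _ h) -dpull_mulr -dpull_mull -gauss // dpullD [RHS]ffunE.
Qed.

Lemma is_derive_ambient p q (f : 'rV[R]_n -> 'M[R]_(p, q)) (df : 'I_n -> 'M[R]_(p, q)) y a : U y ->
  (forall b c, differentiable (fun x => f x b c) (iota y)) ->
  (forall d b c, partial d (fun x => f x b c) (iota y) = df d b c) ->
  forall b c, is_derive y (bv a) (fun y => f (iota y) b c) ((\sum_d J y a d *: df d) b c).
Proof.
move=> Uy cf hf b c; apply: (is_derive_eq (is_derive_iota a Uy (cf b c))).
by rewrite [RHS]summxE; apply: eq_bigr => d _; rewrite [RHS]mxE hf.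
Qed.

Lemma dJ_sym y a b c : U y -> ('D_(bv a) J y) b c = ('D_(bv b) J y) a c.
Proof.
have e a' b' : U y -> ('D_(bv a') J y) b' c =
    'D_(bv a') ('D_(bv b') (fun y => iota y 0 c)) y.
  move=> Uy; rewrite -(@derive_val _ _ _ _ _ _ _ (is_derive_J a' b' c Uy)).
  apply: near_eq_derive; apply: (open_near oU Uy) => z Uz.
  by rewrite /J jacobianE //; exact: iota_diff.
move=> Uy; apply: etrans (e a b Uy) _; apply: etrans (esym (e b a Uy)).
have c2 : Ck 2 U (fun y => iota y 0 c) by have /(Ck_mxP _ _ oU) := ci 2; exact.
exact: (@schwarz _ _ (fun y => iota y 0 c) U y (bv b) (bv a) oU Uy c2).
Qed.

Section Gauss.
Context (g : 'rV[R]_n -> 'M[R]_n) (T : 'rV[R]_n -> cov R n 3) (al : 'rV[R]_n -> 'cV[R]_n).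
Context (gs : smooth_on O g) (gsym : forall x, O x -> (g x)^T = g x)
  (gu : forall x, O x -> g x \in unitmx) (alt : forall x, O x -> alternating (T x)).
Context (als : smooth_on O al)
  (dal : forall x, O x -> forall a b, partial a (fun x => al x b 0) x = (skewc g T x a *m al x) b 0).
Context (Jal : forall y, U y -> J y *m al (iota y) = 0)
  (Jrow : forall y (v : 'rV[R]_n), U y -> v *m al (iota y) = 0 -> exists u, v = u *m J y).

Let h y := J y *m g (iota y) *m (J y)^T.
Let T' y := pull (J y) (T (iota y)).
Context (hu : forall y, U y -> h y \in unitmx).

Let H y a := 'D_(bv a) J y + J y *m ambient (skewc g T) y a.

Let H_al y a : U y -> H y a *m al (iota y) = 0.
Proof.
move=> Uy; apply/matrixP => b c; rewrite ord1 {c} [RHS]mxE.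
have d1 : forall b c, is_derive y (bv a) (fun y => al (iota y) b c)
    ((\sum_d J y a d *: (skewc g T (iota y) d *m al (iota y))) b c).
  apply: is_derive_ambient => // [b' c|d b' c].
    by have [] := als 1%N => /(_ _ (iO Uy)) /differentiable_mxP.
  by rewrite ord1 dal //; exact: iO.
have hd := is_derive_mulmx (fun b c => is_derive_J a b c Uy) d1 b 0.
have := @derive_val _ _ _ _ _ _ _ hd.
have -> : 'D_(bv a) (fun y => (J y *m al (iota y)) b 0) y = 0.
  rewrite -(@derive_cst _ _ _ (0 : R) (bv a) y); apply: near_eq_derive.
  by apply: (open_near oU Uy) => z Uz; rewrite Jal // mxE.
move=> ->; congr (fun_of_matrix _ _ _); rewrite mulmxDl; congr (_ + _).
rewrite -mulmxA; congr (_ *m _); rewrite mulmx_suml; apply: eq_bigr => d _.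
by rewrite -scalemxAl.
Qed.

Let dg y a b c : U y -> dmet h y a b c = (H y a *m g (iota y) *m (J y)^T) b c + (H y a *m g (iota y) *m (J y)^T) c b.
Proof.
move=> Uy; have Oy := iO Uy.
have d1 : forall b c, is_derive y (bv a) (fun y => g (iota y) b c)
    ((\sum_d J y a d *: (skewc g T (iota y) d *m g (iota y) + g (iota y) *m (skewc g T (iota y) d)^T)) b c).
  apply: is_derive_ambient => // [b' c'|d b' c'].
    by have [] := gs 1%N => /(_ _ Oy) /differentiable_mxP.
  by rewrite -(skewc_metric _ oO) ?mxE //; [exact: gu|exact: alt].
have d2 b' c' := is_derive_mulmx (fun b c => is_derive_J a b c Uy) d1 b' c'.
have d3 : forall b c, is_derive y (bv a) (fun y => (J y)^T b c) (('D_(bv a) J y)^T b c).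
  by move=> b' c'; under eq_fun do rewrite mxE; rewrite mxE; exact: is_derive_J.
rewrite /dmet /partial (@derive_val _ _ _ _ _ _ _ (is_derive_mulmx d2 d3 b c)).
have -> (A B : 'M[R]_m) : A b c + B c b = (A + B^T) b c by rewrite !mxE.
congr (fun_of_matrix _ _ _).
have -> : \sum_d J y a d *: (skewc g T (iota y) d *m g (iota y) + g (iota y) *m (skewc g T (iota y) d)^T) =
   ambient (skewc g T) y a *m g (iota y) + g (iota y) *m (ambient (skewc g T) y a)^T.
  have -> : (ambient (skewc g T) y a)^T = \sum_d J y a d *: (skewc g T (iota y) d)^T.
    apply/matrixP => i j; rewrite mxE !summxE; apply: eq_bigr => d _.
    by rewrite [LHS]mxE [RHS]mxE; congr (_ * _); rewrite [RHS]mxE.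
  rewrite /ambient mulmx_suml mulmx_sumr -big_split; apply: eq_bigr => d _.
  by rewrite -scalemxAl -scalemxAr; exact: scalerDr.
rewrite /H; move: ('D_(bv a) J y) (ambient _ _ _) => P A.
have -> : ((P + J y *m A) *m g (iota y) *m (J y)^T)^T = J y *m g (iota y) *m P^T + J y *m g (iota y) *m A^T *m (J y)^T.
  by rewrite !trmx_mul trmxK gsym // [in X in X = _]raddfD /= trmx_mul !mulmxDr !mulmxA.
rewrite !(mulmxDl, mulmxDr) !mulmxA -!addrA; congr (_ + (_ + _)).
by rewrite addrC.
Qed.

Let tors y a b c : U y -> (H y a *m g (iota y) *m (J y)^T) b c - (H y b *m g (iota y) *m (J y)^T) a c =
  T' y (tri a b c).
Proof.
move=> Uy; have Oy := iO Uy.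
have e a' b' : (H y a' *m g (iota y) *m (J y)^T) b' c =
   \sum_f ('D_(bv a') J y *m g (iota y)) b' f * J y c f +
   \sum_d \sum_e \sum_f J y a' d * J y b' e * J y c f * (skewc g T (iota y) d *m g (iota y)) e f.
  rewrite /H mulmxDl mulmxDl mxE; congr (_ + _).
    by rewrite mxE; apply: eq_bigr => f _; rewrite [(J y)^T _ _]mxE.
  rewrite /ambient mulmx_sumr !mulmx_suml summxE; apply: eq_bigr => d _.
  rewrite -scalemxAr -!scalemxAl [LHS]mxE -[_ *m skewc g T (iota y) d *m _]mulmxA [X in _ * X]mxE mulr_sumr [RHS]exchange_big; apply: eq_bigr => f _.
  rewrite [X in _ * (X * _)]mxE mulr_suml mulr_sumr; apply: eq_bigr => e' _.
  by rewrite [(J y)^T _ _]mxE; ring.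
have k d e' f : (skewc g T (iota y) d *m g (iota y)) e' f = koszul (dmet g (iota y)) (fun a b c => T (iota y) (tri a b c)) d e' f.
  by rewrite /skewc mulmxKV //; exact: gu.
rewrite !e opprD addrACA -sumrB [X in X + _]big1 => [|f _]; last first.
  apply/eqP; rewrite subr_eq0; apply/eqP; congr (_ * _).
  rewrite [LHS]mxE [RHS]mxE; apply: eq_bigr => d _; congr (_ * _); exact: dJ_sym.
rewrite add0r [X in _ - X]exchange_big -sumrB /T' pull_tri; apply: eq_bigr => d _.
rewrite -sumrB; apply: eq_bigr => e' _; rewrite -sumrB; apply: eq_bigr => f _.
rewrite !k [J y b e' * _]mulrC -mulrBr; congr (_ * _); rewrite [koszul _ _ d _ _]mxE [koszul _ _ _ _ _]mxE.
rewrite (alt12 (alt Oy) d e' f).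
have -> : dmet g (iota y) f e' d = dmet g (iota y) f d e'.
  by apply: near_eq_derive; apply: (open_near oO Oy) => x Ox; rewrite -[in LHS](gsym Ox) mxE.
by field.
Qed.

(** [al] is a parallel covector whose annihilator is the image of [J]. Differentiating [J *m al = 0]
    shows that the rows of [H] are annihilated by [al], hence tangent. Their tangential part is
    determined by [H *m g *m J^T], which satisfies the compatibility and torsion equations of the
    induced metric and torsion, so [koszul_unique] applies. *)
Lemma gauss y : U y -> forall a, 'D_(bv a) J y + J y *m ambient (skewc g T) y a = skewc h T' y a *m J y.
Proof.
move=> Uy a; have Oy := iO Uy; rewrite -/(H y a).
have alt' : alternating (T' y) by apply: alternating_pull; exact: alt.
have kos : H y a *m g (iota y) *m (J y)^T = koszul (dmet h y) (fun a b c => T' y (tri a b c)) a.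
  apply: (koszul_unique (k := fun a => H y a *m g (iota y) *m (J y)^T)) => [b b' c|b b' c|b b' c|b b' c].
  - exact: alt12.
  - exact: alt23.
  - by rewrite dg.
  - exact: tors.
apply/eqP; rewrite -subr_eq0; set D := _ - _.
have D1 : D *m al (iota y) = 0.
  by rewrite mulmxBl H_al // -mulmxA Jal // mulmx0 subrr.
have D2 : D *m g (iota y) *m (J y)^T = 0.
  by rewrite /D !mulmxBl kos /skewc -!mulmxA [J y *m _]mulmxA -/(h y) mulVmx ?hu // mulmx1 subrr.
apply/eqP/row_matrixP => b; rewrite row0.
have [u eu] : exists u, row b D = u *m J y.
  by apply: Jrow => //; rewrite -row_mul D1 row0.
have : u *m h y = 0.
  by rewrite /h !mulmxA -eu -!row_mul D2 row0.
move=> /(congr1 (mulmx^~ (invmx (h y)))); rewrite mulmxK ?hu // mul0mx => u0.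
by rewrite eu u0 mul0mx.
Qed.

End Gauss.

End Naturality.

(** * The metric as a covariant tensor *)

Section MetricTensor.
Context {R : realType}.

(** In this form the metric falls under the results on parallel tensors; that a holonomy element
    kills it is skew-symmetry in an orthonormal frame. *)
Definition gten n (h : 'M[R]_n) : cov R n 2 := [ffun I : midx 2 n => h (I 0) (I 1)].

Lemma gtenE n (h : 'M[R]_n) a b : gten h [ffun p => tnth [tuple a; b] p] = h a b.
Proof. by rewrite !ffunE !(tnth_nth a). Qed.

Lemma gten_inj n : injective (@gten n).
Proof. by move=> h h' e; apply/matrixP => a b; rewrite -gtenE e gtenE. Qed.

Lemma big_pair_ffun n (f : midx 2 n -> R) :
  \sum_I f I = \sum_a \sum_b f [ffun p => tnth [tuple a; b] p].
Proof.
rewrite pair_bigA /= (reindex_onto (fun z : 'I_n * 'I_n => [ffun p => tnth [tuple z.1; z.2] p])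
  (fun I : midx 2 n => (I 0, I 1))) /=.
  by apply: eq_bigl => -[a b] /=; rewrite !ffunE !(tnth_nth a) /= eqxx.
move=> I _; apply/ffunP => p; rewrite ffunE.
by case: p => -[|[|//]] i; rewrite (tnth_nth (I 0)) /=; congr (I _); apply: val_inj.
Qed.

Lemma pull_gten m n (A : 'M[R]_(m, n)) (h : 'M[R]_n) : pull A (gten h) = gten (A *m h *m A^T).
Proof.
apply/ffunP => I; rewrite pullE big_pair_ffun [RHS]ffunE mxE exchange_big; apply: eq_bigr => b _.
rewrite mxE mulr_suml; apply: eq_bigr => a _.
have l1 : lift ord0 ord0 = 1 :> 'I_2 by exact: val_inj.
by rewrite gtenE big_ord_recl big_ord1 l1 !ffunE !(tnth_nth a) /= [A^T _ _]mxE mulrAC.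
Qed.

Lemma act_gten n (B h : 'M[R]_n) : act B (gten h) = gten (B *m h + h *m B^T).
Proof.
apply/ffunP => I; rewrite actE [RHS]ffunE !big_ord_recl big_ord0 addr0 [RHS]mxE.
congr (_ + _); rewrite [RHS]mxE; apply: eq_bigr => j _; rewrite !ffunE /=.
  by congr (_ * h _ _); rewrite ?subst_indexE //= !ffunE.
have l1 : lift ord0 ord0 = 1 :> 'I_2 by exact: val_inj.
by rewrite l1 [B^T _ _]mxE mulrC.
Qed.

End MetricTensor.

(** * Parallel transport and holonomy *)

Section Transport.
Context {R : realType} {n : nat} (M : atlas R n) (g : metric M) (T : tensor M 3).

Lemma metric_parallel : (forall i : chart M, open (img i)) -> riemannian g ->
  (forall (i : chart M) x, img i x -> alternating (T i x)) ->
  parallel (skew_connection g T) (fun i x => gten (g i x)).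
Proof.
move=> oimg rg alt; apply/parallelE => i x ix a I.
have ug : g i x \in unitmx.
  rewrite -row_free_unit; apply/inj_row_free => v v0; apply/eqP; apply: contraT => /(metric_pos rg ix).
  by rewrite v0 mul0mx mxE ltxx.
rewrite act_gten -(skewc_metric _ (oimg i) ix) ?ffunE //.
- by rewrite mxE /dmet /partial; congr (derive _ x _); apply/funext => y; rewrite ffunE.
- by move=> y; exact: metric_sym.
- exact: alt.
Qed.

Lemma metric_tensor_law i j x : riemannian g -> overlap i j x ->
  gten (g i x) = pull ('J (trans i j) x) (gten (g j (trans i j x))).
Proof. by move=> rg ov; rewrite pull_gten -(metric_trans rg). Qed.

(** Along a curve, the derivatives of [V] and of the tensor are actions of the same matrix [A t]
    with opposite signs, so the pulled-back tensor is constant. *)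
Lemma transport_pull k (S : tensor M k) i x j y A :
  (forall i I, smooth_on (img i) (fun x => S i x I : R)) ->
  (forall i j x, overlap i j x -> S i x = pull ('J (trans i j) x) (S j (trans i j x))) ->
  parallel (skew_connection g T) S ->
  transport (skew_connection g T) i x j y A -> pull A (S j y) = S i x.
Proof.
move=> sS law /parallelE par; elim=> {i x j y A}.
- by move=> i j x ov; rewrite -law.
- move=> i u V su im V0 dV.
  have du (t : R) : is_derive t 1 u (derive1 u t).
    have [/(_ t I)/derivable1_diffP h _] := su 1%N.
    by rewrite derive1E; exact: DeriveDef.
  have dS I' := (sS i I' 1%N).1.
  pose A t := \sum_a derive1 u t 0 a *: skewc (g i) (T i) (u t) a.
  have AE t : \matrix_(b, c) (\sum_a derive1 u t 0 a * skew_connection g T i (u t) a b c) = A t.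
    apply/matrixP => b c; rewrite mxE summxE; apply: eq_bigr => a _.
    by rewrite -skewcE !mxE.
  have key I (t : R) : 0 <= t <= 1 -> is_derive t 1 (fun t => pull (V t) (S i (u t)) I : R) 0.
    move=> t01; have h : is_derive t 1 (fun t => pull (V t) (S i (u t)) I : R)
      (dpull (V t) (- (V t *m A t)) (S i (u t)) I + pull (V t) (act (A t) (S i (u t))) I : R).
      apply: is_derive_pull => [a b|I'].
        by have := dV t t01; rewrite AE; exact: is_derive_mx.
      have hS := dS I' _ (im t t01).
      apply: (is_derive_eq (is_derive_comp (du t) hS)).
      rewrite derive_rV // /A act_sum.
      transitivity (\sum_a act (derive1 u t 0 a *: skewc (g i) (T i) (u t) a) (S i (u t)) I').
        apply: eq_bigr => a _; rewrite actZl [RHS]ffunE; congr (_ * _).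
        by rewrite -par //; exact: im.
      by elim/big_rec2: _ => [|d s z _ ->]; rewrite [RHS]ffunE.
    by apply: (is_derive_eq h); rewrite dpullN dpull_mulr ffunE addNr.
  apply/ffunP => I; rewrite -[in RHS](pull1 (S i (u 0))) -V0.
  apply/eqP; rewrite -subr_eq0 -normr_le0.
  have := @mvt_real _ (fun t => pull (V t) (S i (u t)) I : R) (fun=> 0) 0 1 0.
  rewrite subr0 normr1 mulr1; apply => r /seg01 r01; first exact: key.
  by rewrite normr0.
- by move=> i x j y k' z A B _ h1 _ h2; rewrite -pull_comp h2 h1.
Qed.

(** The pullback of [S] along the one-parameter subgroup is constant, and its derivative at the
    identity is the infinitesimal action of [B]. *)
Lemma holonomy_act k (S : tensor M k) i x B :
  (forall i I, smooth_on (img i) (fun x => S i x I : R)) ->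
  (forall i j x, overlap i j x -> S i x = pull ('J (trans i j) x) (S j (trans i j x))) ->
  parallel (skew_connection g T) S ->
  holonomy_algebra (skew_connection g T) i x B -> act B (S i x) = 0.
Proof.
move=> sS law par [c [c0 cD dc hol]]; apply/ffunP => I.
have d1 : is_derive (0 : R) 1 (fun t => pull (c t) (S i x) I : R) (act B (S i x) I).
  have h : is_derive (0 : R) 1 (fun t => pull (c t) (S i x) I : R)
      (dpull (c 0) B (S i x) I + pull (c 0) 0 I : R).
    apply: (@is_derive_pull _ _ _ _ _ c (fun=> S i x)) => [a b|I']; first exact: is_derive_mx.
    by apply: (is_derive_eq (is_derive_cst _ _ _)); rewrite ffunE.
  by apply: (is_derive_eq h); rewrite pull0 c0 -[in LHS](mul1mx B) dpull_mulr pull1 [X in _ + X]ffunE addr0.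
rewrite -(@derive_val _ _ _ _ _ _ _ d1) [RHS]ffunE.
have -> : (fun t : R => pull (c t) (S i x) I : R) = cst (S i x I : R).
  by apply/funext => t; rewrite /= (transport_pull sS law par (hol t)).
exact: derive_cst.
Qed.

End Transport.

(** * Smooth atlases and smooth maps *)

Section OpenSets.
Context {R : realType}.

Lemma open_preim (X Y : topologicalType) (U : set X) (V : set Y) (h : X -> Y) : open U ->
  (forall x, U x -> {for x, continuous h}) -> open V -> open (U `&` h @^-1` V).
Proof.
move=> oU ch oV; rewrite openE => x [Ux Vx]; apply: filterI; first exact: open_nbhs_nbhs.
by apply: ch => //; exact: open_nbhs_nbhs.
Qed.

Lemma Ck_continuous (V W : normedModType R) k (U : set V) (f : V -> W) x :
  Ck k U f -> U x -> {for x, continuous f}.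
Proof.
case: k => [|k] h Ux; first exact: h.
by have [d _] := h; apply: differentiable_continuous; exact: d.
Qed.

End OpenSets.

(** The axioms on which smoothness of maps depends, common to [M], the slice, the line and the
    products. *)
Record smooth_atlas (R : realType) n (M : atlas R n) : Prop := SmoothAtlas {
  sa_dom : forall i : chart M, open (dom i);
  sa_img : forall i : chart M, open (img i);
  sa_cover : forall p : M, exists i : chart M, dom i p;
  sa_cmapK : forall (i : chart M) p, dom i p -> cinv i (cmap i p) = p;
  sa_cmap : forall (i : chart M) p, dom i p -> {for p, continuous (cmap i)};
  sa_cinv : forall (i : chart M) x, img i x -> {for x, continuous (cinv i)};
  sa_trans : forall i j : chart M, smooth_on (overlap i j) (trans i j) }.

Section SmoothMaps.
Context {R : realType}.

Lemma oriented_smooth n (M : atlas R n) : oriented_manifold M -> smooth_atlas M.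
Proof.
case=> _ _ h1 h2 h3 h4 h5 h6 h7 _; split => //.
- by move=> i p ip; apply: h5; rewrite inE.
- by move=> i x ix; apply: h6; rewrite inE.
Qed.

Section OneManifold.
Context {n : nat} (M : atlas R n) (sM : smooth_atlas M).

Lemma img_cmap (i : chart M) p : dom i p -> img i (cmap i p).
Proof. by move=> ip; exists p. Qed.

Lemma dom_cinv (i : chart M) x : img i x -> dom i (cinv i x).
Proof. by case=> p ip <-; rewrite (sa_cmapK sM). Qed.

Lemma cinvK (i : chart M) x : img i x -> cmap i (cinv i x) = x.
Proof. by case=> p ip <-; rewrite (sa_cmapK sM). Qed.

Lemma image_cmapE (i : chart M) (V : set M) :
  cmap i @` (dom i `&` V) = img i `&` cinv i @^-1` V.
Proof.
apply/seteqP; split=> [_ [p [ip Vp] <-]|x [ix Vx]].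
  by split; [exact: img_cmap|rewrite /= (sa_cmapK sM)].
by exists (cinv i x); [split => //; exact: dom_cinv|exact: cinvK].
Qed.

Lemma open_image_cmap (i : chart M) (V : set M) : open V -> open (cmap i @` (dom i `&` V)).
Proof.
move=> oV; rewrite image_cmapE; apply: open_preim => //; first exact: (sa_img sM).
by move=> x ix; exact: (sa_cinv sM).
Qed.

Lemma open_overlap (i j : chart M) : open (overlap i j).
Proof. exact/open_image_cmap/(sa_dom sM). Qed.

Lemma overlapP (i j : chart M) p : dom i p -> dom j p -> overlap i j (cmap i p).
Proof. by move=> ip jp; exists p. Qed.

Lemma overlapE (i j : chart M) x : overlap i j x <-> img i x /\ dom j (cinv i x).
Proof. by rewrite /overlap image_cmapE. Qed.

Lemma overlap_img (i j : chart M) x : overlap i j x -> img i x.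
Proof. by case/overlapE. Qed.

Lemma trans_img (i j : chart M) x : overlap i j x -> img j (trans i j x).
Proof. by case/overlapE => ix jx; exact: img_cmap. Qed.

Lemma trans_cmap (i j : chart M) p : dom i p -> trans i j (cmap i p) = cmap j p.
Proof. by move=> ip; rewrite /trans /= (sa_cmapK sM). Qed.

Lemma cinv_trans (i j : chart M) x : overlap i j x -> cinv j (trans i j x) = cinv i x.
Proof. by move=> /overlapE[ix jx]; rewrite /trans /= (sa_cmapK sM). Qed.

Lemma trans_diff (i j : chart M) x : overlap i j x -> differentiable (trans i j) x.
Proof. by move=> h; have [d _] := sa_trans sM i j 1; exact: d. Qed.

End OneManifold.

(** As [local_rep], but with source and target of different dimensions, as for projections of a
    product and the inclusion of the slice. *)
Definition lrep m n (M : atlas R m) (N : atlas R n) (f : M -> N) (i : chart M) (j : chart N) :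
    'rV[R]_m -> 'rV[R]_n :=
  cmap j \o f \o cinv i.

(** Pointwise, of finite order and through one pair of charts, so that it is easy to establish and
    to compose; [smooth_at_charts] passes to any other pair. *)
Definition smooth_at m n (M : atlas R m) (N : atlas R n) k (f : M -> N) (p : M) : Prop :=
  exists (i : chart M) (j : chart N) U, [/\ dom i p, open U, U (cmap i p), U `<=` img i &
    (forall x, U x -> dom j (f (cinv i x))) /\ Ck k U (lrep f i j)].

Lemma smooth_at_charts m n (M : atlas R m) (N : atlas R n) k (f : M -> N) p i j :
  smooth_atlas M -> smooth_atlas N -> smooth_at k f p -> dom i p -> dom j (f p) ->
  exists U, [/\ open U, U (cmap i p), U `<=` img i, (forall x, U x -> dom j (f (cinv i x))) &
    Ck k U (lrep f i j)].
Proof.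
move=> sM sN [i' [j' [U [i'p oU Up Ui' [Uj' CU]]]]] ip jp.
have cU x : U x -> {for x, continuous (lrep f i' j')} by exact: Ck_continuous CU.
pose W := U `&` lrep f i' j' @^-1` overlap j' j.
have oW : open W by apply: open_preim => //; exact: open_overlap.
pose U' := overlap i i' `&` trans i i' @^-1` W.
have oU' : open U'.
  apply: open_preim => //; first exact: open_overlap.
  by move=> x h; apply: differentiable_continuous; exact: (trans_diff sM h).
have e x : U' x -> f (cinv i x) = f (cinv i' (trans i i' x)).
  by move=> [h _]; rewrite (cinv_trans sM h).
exists U'; split => //.
- split; first exact: overlapP.
  split; rewrite /= (trans_cmap sM) //=.
  by rewrite /lrep /= (sa_cmapK sM) //; apply: overlapP => //; rewrite -{1}(sa_cmapK sM i'p); exact: Uj'.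
- by move=> x [h _]; exact: (overlap_img sM h).
- move=> x U'x; rewrite e //; case: U'x => h [U1 /(overlapE sN)[_]].
  by rewrite /lrep /= (sa_cmapK sN) //; exact: Uj'.
- apply: (@eq_Ck _ _ _ _ _ ((trans j' j \o lrep f i' j') \o trans i i')) => //.
    move=> x U'x; rewrite /lrep /= e //; case: U'x => h [U1 _].
    by rewrite /trans /= (sa_cmapK sN) //; exact: Uj'.
  apply: (Ck_comp_mx (O := W)) => //; first by move=> x [].
    by apply: sub_Ck (sa_trans sM i i' k) => x [].
  apply: (Ck_comp_mx (O := overlap j' j)) => //; [exact: open_overlap|by move=> x []| |].
    by apply: sub_Ck CU => x [].
  exact: (sa_trans sN).
Qed.

(** Continuity is recovered from order 0: near [p] the map is the composite of a chart, its local
    representation and an inverse chart. *)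
Lemma smooth_mapP n (M N : atlas R n) (f : M -> N) :
  smooth_atlas M -> smooth_atlas N -> (forall k p, smooth_at k f p) -> smooth_map f.
Proof.
move=> sM sN h; split.
  move=> p; have [i [j [U [ip oU Up Ui [Uj CU]]]]] := h 0 p.
  have c1 : {for p, continuous (cinv j \o (lrep f i j \o cmap i))}.
    apply: continuous_comp; last first.
      apply: (sa_cinv sN); rewrite /lrep /= (sa_cmapK sM) //; apply: img_cmap.
      by rewrite -(sa_cmapK sM ip); exact: Uj.
    apply: continuous_comp; first exact: (sa_cmap sM).
    exact: (Ck_continuous CU).
  have e q : dom i q -> U (cmap i q) -> (cinv j \o (lrep f i j \o cmap i)) q = f q.
    move=> iq Uq; rewrite /lrep /= (sa_cmapK sM) // (sa_cmapK sN) //.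
    by rewrite -(sa_cmapK sM iq); exact: Uj.
  have oV := open_preim (sa_dom sM i) (fun q => sa_cmap sM (p := q)) oU.
  have nV : \forall q \near p, (cinv j \o (lrep f i j \o cmap i)) q = f q.
    by apply: (open_near oV); [split|move=> q [iq Uq]; exact: e].
  rewrite /continuous_at -[X in _ --> X]e //; apply: cvg_trans c1; apply: near_eq_cvg.
  by apply: filterS nV => q ->.
move=> i j k; apply: Ck_locally => _ [p [ip jp] <-].
have [U [oU Up Ui Uj CU]] := smooth_at_charts sM sN (h k p) ip jp.
by exists U.
Qed.

Lemma smooth_at_comp m n l (M : atlas R m) (N : atlas R n) (L : atlas R l) k (f : M -> N) (g : N -> L) p :
  smooth_atlas M -> smooth_atlas N -> smooth_atlas L ->
  smooth_at k f p -> smooth_at k g (f p) -> smooth_at k (g \o f) p.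
Proof.
move=> sM sN sL sf [j [q [V [jp oV Vp Vj [Vq CV]]]]].
have [i ip] := sa_cover sM p.
have [U [oU Up Ui Uj CU]] := smooth_at_charts sM sN sf ip jp.
have cU x : U x -> {for x, continuous (lrep f i j)} by exact: Ck_continuous CU.
have oW := open_preim oU cU oV.
exists i, q, (U `&` lrep f i j @^-1` V); split => //.
- by split => //; rewrite /= /lrep /= (sa_cmapK sM).
- by move=> x [/Ui].
- split=> [x [Ux Vx]|].
    by have := Vq _ Vx; rewrite /lrep /= (sa_cmapK sN) //; exact: Uj.
  apply: (@eq_Ck _ _ _ _ _ (lrep g j q \o lrep f i j)) => //.
    by move=> x [Ux Vx]; rewrite /lrep /= (sa_cmapK sN) //; exact: Uj.
  apply: (Ck_comp_mx (O := V)) => //; [by move=> x []|by apply: sub_Ck CU => x []].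
Qed.

Lemma smooth_at_id n (M : atlas R n) k p : smooth_atlas M -> smooth_at k (id : M -> M) p.
Proof.
move=> sM; have [i ip] := sa_cover sM p; exists i, i, (img i); split => //.
- exact: (sa_img sM).
- exact: img_cmap.
- split=> [x|]; first exact: (dom_cinv sM).
  apply: (@eq_Ck _ _ _ _ _ id); [exact: (sa_img sM)| |exact: Ck_id].
  by move=> x ix; rewrite /lrep /= (cinvK sM).
Qed.

Lemma smooth_at_cst m n (M : atlas R m) (N : atlas R n) k p q : smooth_atlas M -> smooth_atlas N ->
  smooth_at k (fun=> q : N) (p : M).
Proof.
move=> sM sN; have [i ip] := sa_cover sM p; have [j jq] := sa_cover sN q.
exists i, j, (img i); split => //; [exact: (sa_img sM)|exact: img_cmap|split => //].
exact: Ck_cst.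
Qed.

Lemma smooth_line : smooth_atlas (line : atlas R 1).
Proof.
split => //.
- by move=> i; exact: openT.
- move=> i; have -> : img i = setT; last exact: openT.
  apply/seteqP; split => // x _; exists (x 0 0) => //=.
  by apply/rowP => a; rewrite ord1 mxE.
- by move=> p; exists tt.
- by move=> i p _; rewrite /= mxE.
- move=> i p _; apply/continuous_mxP => a b.
  have e : (fun y : R => (const_mx y : 'rV[R]_1) a b) = id by apply/funext => y; rewrite mxE.
  by rewrite /= e; exact: cvg_id.
- by move=> i x _; exact: coord_continuous.
- move=> i j k; apply: (@eq_Ck _ _ _ _ _ id); last exact: Ck_id.
    have -> : overlap i j = setT; last exact: openT.
    apply/seteqP; split => // x _; exists (x 0 0) => //=.
    by apply/rowP => a; rewrite ord1 mxE.
  by move=> x _; rewrite /trans /=; apply/rowP => a; rewrite ord1 mxE.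
Qed.

Lemma smooth_at_line n (M : atlas R n) k (f : M -> line) p i : smooth_atlas M -> dom i p ->
  Ck k (img i) (f \o cinv i : 'rV[R]_n -> R) -> smooth_at k f p.
Proof.
move=> sM ip Cf; exists i, tt, (img i); split => //; [exact: (sa_img sM)|exact: img_cmap|split => //].
apply/Ck_mxP => [|a b]; first exact: (sa_img sM).
by rewrite /lrep /=; under eq_fun do rewrite mxE.
Qed.

Section Product.
Context {m n : nat} (M : atlas R m) (N : atlas R n) (sM : smooth_atlas M) (sN : smooth_atlas N).

Lemma prod_img (k : chart (prod_atlas M N)) : img k = [set x | img k.1 (lsubmx x) /\ img k.2 (rsubmx x)].
Proof.
apply/seteqP; split=> [_ [p [ip jp] <-]|x [[p ip ep] [q jq eq]]].
  by rewrite /= row_mxKl row_mxKr; split; exact: img_cmap.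
by exists (p, q); rewrite //= ep eq hsubmxK.
Qed.

Lemma smooth_prod : smooth_atlas (prod_atlas M N).
Proof.
have oimg (k : chart (prod_atlas M N)) : open (img k).
  rewrite prod_img; apply: openI.
    have := @open_preim _ _ setT (img k.1) (@lsubmx R 1 m n) openT; rewrite setTI; apply.
      by move=> x _; exact: continuous_lsubmx.
    exact: (sa_img sM).
  have := @open_preim _ _ setT (img k.2) (@rsubmx R 1 m n) openT; rewrite setTI; apply.
    by move=> x _; exact: continuous_rsubmx.
  exact: (sa_img sN).
have cK (k : chart (prod_atlas M N)) p : dom k p -> cinv k (cmap k p) = p.
  by case: p => p q [ip jq]; rewrite /= row_mxKl row_mxKr (sa_cmapK sM) // (sa_cmapK sN).
have cm (k : chart (prod_atlas M N)) p : dom k p -> {for p, continuous (cmap k)}.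
  case: p => p q [ip jq]; apply/continuous_mxP => a b.
  rewrite /=; case: (split_ordP b) => c ->.
    have e : (fun p : M * N => row_mx (cmap k.1 p.1) (cmap k.2 p.2) a (lshift n c)) =
      (fun p => cmap k.1 p a c) \o fst by apply/funext => z; rewrite row_mxEl.
    rewrite e.
    have h := (continuous_mxP (cmap k.1) p).1 (sa_cmap sM ip) a c.
    exact: (@cvg_comp _ _ _ fst (fun p => cmap k.1 p a c) _ (nbhs p) _ (@cvg_fst _ _ _ _ _) h).
  have e : (fun p : M * N => row_mx (cmap k.1 p.1) (cmap k.2 p.2) a (rshift m c)) =
    (fun p => cmap k.2 p a c) \o snd by apply/funext => z; rewrite row_mxEr.
  rewrite e.
  have h := (continuous_mxP (cmap k.2) q).1 (sa_cmap sN jq) a c.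
  exact: (@cvg_comp _ _ _ snd (fun p => cmap k.2 p a c) _ (nbhs q) _ (@cvg_snd _ _ _ _ _) h).
have ci (k : chart (prod_atlas M N)) x : img k x -> {for x, continuous (cinv k)}.
  rewrite prod_img => -[h1 h2].
  have c1 : {for x, continuous (cinv k.1 \o @lsubmx R 1 m n)}.
    by apply: continuous_comp; [exact: continuous_lsubmx|exact: (sa_cinv sM)].
  have c2 : {for x, continuous (cinv k.2 \o @rsubmx R 1 m n)}.
    by apply: continuous_comp; [exact: continuous_rsubmx|exact: (sa_cinv sN)].
  exact: (cvg_pair c1 c2).
have od (k : chart (prod_atlas M N)) : open (dom k).
  rewrite openE => -[p q] [ip jq].
  exists (dom k.1, dom k.2) => //; split; apply: open_nbhs_nbhs; split => //.
    exact: (sa_dom sM).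
  exact: (sa_dom sN).
split => //.
- by move=> [p q]; have [i ip] := sa_cover sM p; have [j jq] := sa_cover sN q; exists (i, j).
- move=> k l o.
  have ov x : overlap k l x <-> overlap k.1 l.1 (lsubmx x) /\ overlap k.2 l.2 (rsubmx x).
    split=> [[[p q] [[h1 h2] [h3 h4]] <-]|[[p [ip jp] ep] [q [iq jq] eq]]].
      by rewrite /= row_mxKl row_mxKr; split; exact: overlapP.
    by exists (p, q) => //=; rewrite ep eq hsubmxK.
  have oo : open (overlap k l).
    have -> : overlap k l = [set x | overlap k.1 l.1 (lsubmx x)] `&` [set x | overlap k.2 l.2 (rsubmx x)].
      by apply/seteqP; split=> x /ov.
    apply: openI.
      have := @open_preim _ _ setT (overlap k.1 l.1) (@lsubmx R 1 m n) openT; rewrite setTI; apply.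
        by move=> x _; exact: continuous_lsubmx.
      exact: open_overlap.
    have := @open_preim _ _ setT (overlap k.2 l.2) (@rsubmx R 1 m n) openT; rewrite setTI; apply.
      by move=> x _; exact: continuous_rsubmx.
    exact: open_overlap.
  apply: (@eq_Ck _ _ _ _ _ (fun x => row_mx ((trans k.1 l.1 \o lsubmx) x) ((trans k.2 l.2 \o rsubmx) x))) => //.
  apply: Ck_row_mx => //.
    apply: (Ck_comp_mx (O := overlap k.1 l.1)) => //; [exact: open_overlap|by move=> x /ov[]| |exact: (sa_trans sM)].
    by apply: Ck_lsubmx => //; exact: Ck_id.
  apply: (Ck_comp_mx (O := overlap k.2 l.2)) => //; [exact: open_overlap|by move=> x /ov[]| |exact: (sa_trans sN)].
  by apply: Ck_rsubmx => //; exact: Ck_id.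
Qed.

Lemma smooth_at_fst k p : smooth_at k (fst : prod_atlas M N -> M) p.
Proof.
case: p => p q; have [i ip] := sa_cover sM p; have [j jq] := sa_cover sN q.
exists ((i, j) : chart (prod_atlas M N)), i, (img ((i, j) : chart (prod_atlas M N))); split => //.
- exact: (sa_img smooth_prod).
- exact: (@img_cmap _ (prod_atlas M N)).
- split=> [x|]; first by rewrite prod_img => -[h _]; exact: (dom_cinv sM).
  apply: (@eq_Ck _ _ _ _ _ lsubmx); first exact: (sa_img smooth_prod).
    by move=> x; rewrite prod_img => -[h _]; rewrite /lrep /= (cinvK sM).
  by apply: Ck_lsubmx; [exact: (sa_img smooth_prod)|exact: Ck_id].
Qed.

Lemma smooth_at_snd k p : smooth_at k (snd : prod_atlas M N -> N) p.
Proof.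
case: p => p q; have [i ip] := sa_cover sM p; have [j jq] := sa_cover sN q.
exists ((i, j) : chart (prod_atlas M N)), j, (img ((i, j) : chart (prod_atlas M N))); split => //.
- exact: (sa_img smooth_prod).
- exact: (@img_cmap _ (prod_atlas M N)).
- split=> [x|]; first by rewrite prod_img => -[_ h]; exact: (dom_cinv sN).
  apply: (@eq_Ck _ _ _ _ _ rsubmx); first exact: (sa_img smooth_prod).
    by move=> x; rewrite prod_img => -[_ h]; rewrite /lrep /= (cinvK sN).
  by apply: Ck_rsubmx; [exact: (sa_img smooth_prod)|exact: Ck_id].
Qed.

Lemma smooth_at_pair l (L : atlas R l) k (f : L -> M) (g : L -> N) p : smooth_atlas L ->
  smooth_at k f p -> smooth_at k g p -> smooth_at k (fun q => (f q, g q) : prod_atlas M N) p.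
Proof.
move=> sL [i [j [U [ip oU Up Ui [Uj CU]]]]] sg; have [j' jp'] := sa_cover sN (g p).
have [V [oV Vp Vi Vj CV]] := smooth_at_charts sL sN sg ip jp'.
exists i, (j, j'), (U `&` V); split => //; [exact: openI|by move=> x [/Ui]|split].
  by move=> x [Ux Vx]; split; [exact: Uj|exact: Vj].
apply: Ck_row_mx; [exact: openI|by apply: sub_Ck CU => x []|by apply: sub_Ck CV => x []].
Qed.

End Product.

End SmoothMaps.

(** * Smoothness of square roots *)

Section SquareRoot.
Context {R : realType}.

Lemma derive_sqrt (V : normedModType R) (f : V -> R) x v : 0 < f x -> differentiable f x ->
  differentiable (fun y => Num.sqrt (f y)) x /\
  'D_v (fun y => Num.sqrt (f y)) x = (2 * Num.sqrt (f x))^-1 * 'D_v f x.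
Proof.
move=> fx df.
have ds : derivable (Num.sqrt : R -> R) (f x) 1 by have [] := is_derive1_sqrt fx.
have ds' : differentiable (Num.sqrt : R -> R) (f x) by apply/derivable1_diffP.
have dc : differentiable (Num.sqrt \o f) x by exact: differentiable_comp.
split; first exact: dc.
rewrite (_ : (fun y => _) = Num.sqrt \o f) // deriveE // diff_comp //= -deriveE //.
have := is_derive1_sqrt fx => h.
have e1 : 'd (Num.sqrt : R -> R) (f x) ('d f x v) = 'd f x v * 'd (Num.sqrt : R -> R) (f x) 1.
  by rewrite -[in LHS](mulr1 ('d f x v)) -[_ * 1]/(_ *: (1 : R^o)) linearZ.
transitivity ('d f x v * (2 * Num.sqrt (f x))^-1); last by rewrite mulrC deriveE.
have dv : 'D_(1 : R^o) (Num.sqrt : R -> R) (f x) = (2 * Num.sqrt (f x))^-1 := @derive_val _ _ _ _ _ _ _ h.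
by rewrite deriveE // e1 -dv deriveE.
Qed.

Lemma Ck_sqrt (V : normedModType R) k (U : set V) (f : V -> R) : open U ->
  (forall x, U x -> 0 < f x) -> Ck k U f -> Ck k U (fun x => Num.sqrt (f x)).
Proof.
move=> oU f0; elim: k => [|k IH] /=.
  move=> fc x Ux; apply: (continuous_comp (fc x Ux)); exact: sqrt_continuous.
move=> fC; have [fd fk] := fC; have fV := IH (CkS fC).
split=> [x Ux|v]; first by have [] := derive_sqrt 0 (f0 x Ux) (fd x Ux).
have c2 : Ck k U (fun x => (2 * Num.sqrt (f x))^-1).
  apply: CkV => //; last by apply: CkZ.
  by move=> x Ux; rewrite mulf_neq0 // ?gt_eqF ?sqrtr_gt0 ?f0.
apply: (eq_Ck oU _ (CkM oU c2 (fk v))) => x Ux.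
by have [_ ->] := derive_sqrt v (f0 x Ux) (fd x Ux).
Qed.

End SquareRoot.

(** * Contraction with a vector *)

Section Insertion.
Context {R : realType} {n : nat}.

Lemma insE k (t : cov R n (k + 1)) (X : 'rV[R]_n) I :
  ins t X I = \sum_c X 0 c * t (join I [ffun=> c]).
Proof. by rewrite ffunE. Qed.

Lemma insD k (t : cov R n (k + 1)) X Y : ins t (X + Y) = ins t X + ins t Y.
Proof.
apply/ffunP => I; rewrite [RHS]ffunE !insE -big_split; apply: eq_bigr => c _.
by rewrite mxE mulrDl.
Qed.

Lemma insZ k (t : cov R n (k + 1)) a X : ins t (a *: X) = a *: ins t X.
Proof.
apply/ffunP => I; rewrite [RHS]ffunE !insE [RHS]mulr_sumr; apply: eq_bigr => c _.
by rewrite mxE mulrA.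
Qed.

Lemma ins0t k X : ins (0 : cov R n (k + 1)) X = 0.
Proof. by apply/ffunP => I; rewrite insE big1 ?ffunE // => c _; rewrite ffunE mulr0. Qed.

(** Leibniz rule: the second term comes from the slot that is filled by [X], the first from all the
    others. *)
Lemma ins_act k (t : cov R n (k + 1)) A X : ins (act A t) X = act A (ins t X) + ins t (X *m A).
Proof.
apply/ffunP => I; rewrite [RHS]ffunE !insE actE.
under eq_bigr do rewrite actE big_split_ord /= big_ord1 mulrDr.
rewrite big_split /=; congr (_ + _).
  under eq_bigr do rewrite mulr_sumr.
  rewrite exchange_big /=; apply: eq_bigr => p _.
  under eq_bigr do rewrite mulr_sumr.
  rewrite exchange_big /=; apply: eq_bigr => j _.
  rewrite insE mulr_sumr; apply: eq_bigr => c _; rewrite tjoin_l mulrCA; congr (_ * (_ * t _)).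
  apply/ffunP => q; rewrite subst_indexE; case: (split_ordP q) => r ->.
    by rewrite !tjoin_l subst_indexE (inj_eq (@lshift_inj _ _)).
  by rewrite !tjoin_r eq_rlshift.
under eq_bigr do rewrite mulr_sumr.
rewrite exchange_big /=; apply: eq_bigr => j _.
rewrite mxE mulr_suml; apply: eq_bigr => c _; rewrite tjoin_r ffunE mulrA; congr (_ * t _).
apply/ffunP => q; rewrite subst_indexE; case: (split_ordP q) => r ->.
  by rewrite !tjoin_l eq_lrshift.
by rewrite !tjoin_r !ffunE ord1 eqxx.
Qed.

Lemma join_tri (I : midx 2 n) c : join I [ffun=> c] = tri (I 0) (I 1) c.
Proof.
apply/ffunP => q; case: (split_ordP q) => r ->.
  rewrite tjoin_l ffunE; case: r => -[|[|//]] i; rewrite (tnth_nth c) /=; congr (I _); exact: val_inj.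
by rewrite tjoin_r !ffunE (tnth_nth c) ord1.
Qed.

End Insertion.

(** * The unit kernel field of a parallel torsion form *)

Section KernelField.
Context {R : realType} {n : nat} (O : set 'rV[R]_n) (oO : open O).
Context (g : 'rV[R]_n -> 'M[R]_n) (T : 'rV[R]_n -> cov R n 3).
Context (gs : smooth_on O g) (gsym : forall x, O x -> (g x)^T = g x)
  (gpos : forall x, O x -> forall v : 'rV[R]_n, v != 0 -> 0 < (v *m g x *m v^T) 0 0)
  (alt : forall x, O x -> alternating (T x)) (Ts : forall I, smooth_on O (fun x => T x I : R))
  (Tpar : parc O (skewc g T) T).
Context (ker1 : forall x, O x -> exists v0 : 'rV[R]_n, [/\ v0 != 0, ins (T x : cov R n (2 + 1)) v0 = 0 &
  forall v, ins (T x : cov R n (2 + 1)) v = 0 -> exists c, v = c *: v0]).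

Local Notation insT x v := (ins (T x : cov R n (2 + 1)) v).

Lemma pos_unit (m : 'M[R]_n) : (forall v : 'rV[R]_n, v != 0 -> 0 < (v *m m *m v^T) 0 0) -> m \in unitmx.
Proof.
move=> pos; rewrite -row_free_unit; apply/inj_row_free => v v0; apply/eqP; apply: contraT => /pos.
by rewrite v0 mul0mx mxE ltxx.
Qed.

Let gu x : O x -> g x \in unitmx.
Proof. by move=> Ox; apply: pos_unit; exact: gpos. Qed.

Lemma is_derive_entry (V : set 'rV[R]_n) p q (f : 'rV[R]_n -> 'M[R]_(p, q)) x v b c :
  Ck 1 V f -> V x -> is_derive x v (fun y => f y b c) (('D_v f x) b c).
Proof.
move=> [df _] Vx; have d := df x Vx; apply: DeriveDef.
  by apply: diff_derivable; move/differentiable_mxP: d; exact.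
by rewrite derive_mxE.
Qed.

Lemma is_derive_g x a b c : O x -> is_derive x (bv a) (fun y => g y b c)
  ((skewc g T x a *m g x + g x *m (skewc g T x a)^T) b c).
Proof.
move=> Ox; have h := is_derive_entry (bv a) b c (gs 1) Ox.
apply: (is_derive_eq h); rewrite -(skewc_metric _ oO Ox) //; [|exact: gu|exact: alt].
by rewrite mxE /dmet /partial (@derive_val _ _ _ _ _ _ _ h).
Qed.

Section Field.
Context (V : set 'rV[R]_n) (X : 'rV[R]_n -> 'rV[R]_n) (oV : open V) (VO : V `<=` O) (cX : Ck 1 V X).
Context (Xu : forall x, V x -> X x *m g x *m (X x)^T = 1%:M) (Xk : forall x, V x -> insT x (X x) = 0).

(** Differentiating [ins T X = 0], with [T] parallel, puts [X' + X *m G] in the kernel of [T]; so it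
    is a multiple of [X], and differentiating the norm of [X] shows that the factor is 0. *)
Lemma kernel_parallel x a : V x -> 'D_(bv a) X x = - (X x *m skewc g T x a).
Proof.
move=> Vx; have Ox := VO Vx; set X' := 'D_(bv a) X x; set G := skewc g T x a.
have dX b c : is_derive x (bv a) (fun y => X y b c) (X' b c) by exact: is_derive_entry cX Vx.
have WK : insT x (X' + X x *m G) = 0.
  have h : insT x X' + ins (act G (T x) : cov R n (2 + 1)) (X x) = 0.
    apply/ffunP => I.
    have hd : is_derive x (bv a) (fun y => \sum_c X y 0 c * T y (join I [ffun=> c]))
       (\sum_c (X' 0 c * T x (join I [ffun=> c]) + X x 0 c * act G (T x) (join I [ffun=> c]))).
      apply: is_derive_bigsum => c _; apply: is_derive_prodR => //.
      have [dT _] := Ts (join I [ffun=> c]) 1.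
      apply: DeriveDef; first by apply: diff_derivable; exact: dT.
      exact: Tpar.
    have := @derive_val _ _ _ _ _ _ _ hd.
    have -> : 'D_(bv a) (fun y => \sum_c X y 0 c * T y (join I [ffun=> c])) x = 0.
      transitivity ('D_(bv a : 'rV[R]_n) (cst (0 : R)) x); last exact: derive_cst.
      apply: near_eq_derive.
      apply: (open_near oV Vx) => y Vy; have := congr1 (fun f : cov R n 2 => f I) (Xk Vy).
      by rewrite insE ffunE.
    by move=> e; rewrite [LHS]ffunE !insE [RHS]ffunE [RHS]e big_split.
  move: h; rewrite ins_act Xk // insD => <-; rewrite addrA; congr (_ + _).
  rewrite -[LHS]addr0; congr (_ + _).
  by apply/ffunP => I; rewrite actE ffunE big1 // => p _; rewrite big1 // => j _; rewrite ffunE mulr0.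
have [v0 [v00 _ kv]] := ker1 Ox.
have [c0 eX] := kv _ (Xk Vx); have [c eW] := kv _ WK.
have c00 : c0 != 0.
  apply/eqP => z; move: (Xu Vx); rewrite eX z scale0r !mul0mx => /matrixP/(_ 0 0).
  by rewrite !mxE eqxx => /eqP; rewrite eq_sym oner_eq0.
pose d := c / c0.
have eWX : X' + X x *m G = d *: X x by rewrite eW eX scalerA /d divfK.
suff d0 : d = 0 by apply/eqP; rewrite -addr_eq0 eWX d0 scale0r.
have dXT b c' : is_derive x (bv a) (fun y => (X y)^T b c') (X'^T b c').
  by under eq_fun do rewrite mxE; rewrite mxE.
have hd := is_derive_mulmx (is_derive_mulmx dX (fun b c => is_derive_g a b c Ox)) dXT 0 0.
have := @derive_val _ _ _ _ _ _ _ hd.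
have -> : 'D_(bv a) (fun y => (X y *m g y *m (X y)^T) 0 0) x = 0.
  transitivity ('D_(bv a : 'rV[R]_n) (cst ((1%:M : 'M[R]_1) 0 0 : R)) x); last exact: derive_cst.
  apply: near_eq_derive.
  by apply: (open_near oV Vx) => y Vy; rewrite Xu.
have -> : (X' *m g x + X x *m (skewc g T x a *m g x + g x *m (skewc g T x a)^T)) *m (X x)^T +
    X x *m g x *m X'^T = (X' + X x *m G) *m g x *m (X x)^T + X x *m g x *m (X' + X x *m G)^T.
  rewrite -/G; move: (G) (X') => G' Y; rewrite [in RHS]raddfD /= trmx_mul !(mulmxDl, mulmxDr) !mulmxA -!addrA; congr (_ + (_ + _)).
  by rewrite addrC.
rewrite eWX -!scalemxAl Xu // linearZ /= -scalemxAr Xu // !mxE eqxx mulr1 => /esym/eqP.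
by rewrite -mulr2n mulrn_eq0 => /eqP.
Qed.

Lemma kernel_form x a b : V x ->
  is_derive x (bv a) (fun y => (X y *m g y) 0 b) ((X x *m g x *m (skewc g T x a)^T) 0 b).
Proof.
move=> Vx; have Ox := VO Vx.
have dX := fun b c => is_derive_entry (bv a) b c cX Vx.
apply: (is_derive_eq (is_derive_mulmx dX (fun b c => is_derive_g a b c Ox) 0 b)).
rewrite kernel_parallel // mulmxDr mulNmx !mulmxA addrA addNr add0r //.
Qed.

(** This is closedness of the covector dual to [X]: the antisymmetric part of its derivative is the
    torsion contracted with [X], which vanishes. *)
Lemma kernel_form_sym x a b : V x ->
  (X x *m g x *m (skewc g T x a)^T) 0 b = (X x *m g x *m (skewc g T x b)^T) 0 a.
Proof.
move=> Vx; have Ox := VO Vx.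
have e a' b' : (X x *m g x *m (skewc g T x a')^T) 0 b' =
    \sum_l X x 0 l * koszul (dmet g x) (fun a b c => T x (tri a b c)) a' b' l.
  rewrite /skewc trmx_mul trmx_inv gsym // mulmxA mulmxK ?gu // mxE; apply: eq_bigr => l _.
  by rewrite [X in _ * X]mxE.
rewrite !e; apply/eqP; rewrite -subr_eq0 -sumrB; apply/eqP.
transitivity (\sum_l X x 0 l * T x (tri a b l)).
  apply: eq_bigr => l _; rewrite -mulrBr [koszul _ _ a _ _]mxE [koszul _ _ _ _ _]mxE.
  rewrite (alt12 (alt Ox) a b l).
  have -> : dmet g x l b a = dmet g x l a b.
    by apply: near_eq_derive; apply: (open_near oO Ox) => y Oy; rewrite -[in LHS](gsym Oy) mxE.
  congr (_ * _); by field.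
have := congr1 (fun f : cov R n 2 => f [ffun p => tnth [tuple a; b] p]) (Xk Vx).
rewrite insE [X in _ = X -> _]ffunE => e0; rewrite -[RHS]e0; apply: eq_bigr => l _; rewrite join_tri.
by rewrite !ffunE !(tnth_nth a).
Qed.

End Field.

(** A smooth choice on a kernel line that is only known pointwise. The rows of [N] are the equations
    of the kernel, and a kernel vector [w] satisfies [w *m Q = (w *m v0^T) *m v0]; where [Q] is
    invertible, [v0 *m invmx Q] therefore spans the kernel, and it is smooth. *)
Lemma unit_kernel_local x0 : O x0 -> exists V X, [/\ open V, V x0, V `<=` O, smooth_on V X &
  forall x, V x -> X x *m g x *m (X x)^T = 1%:M /\ insT x (X x) = 0].
Proof.
move=> Ox0; have [v0 [v00 kv0 k0]] := ker1 Ox0.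
pose K := midx 2 n.
pose N x : 'M[R]_(#|{: K}|, n) := \matrix_(i, a) T x (join (enum_val i : midx 2 n) [ffun=> a]).
pose Q x := (N x)^T *m N x + v0^T *m v0.
have kN x (v : 'rV[R]_n) : insT x v = 0 <-> v *m (N x)^T = 0.
  have e i : (v *m (N x)^T) 0 i = insT x v (enum_val i).
    by rewrite mxE insE; apply: eq_bigr => c _; rewrite !mxE.
  split=> h; first by apply/rowP => i; rewrite e h ffunE mxE.
  by apply/ffunP => I; rewrite [RHS]ffunE -(enum_rankK I) -e h mxE.
have sqE m (u : 'rV[R]_m) : (u *m u^T) 0 0 = \sum_k u 0 k ^+ 2.
  by rewrite mxE; apply: eq_bigr => k _; rewrite mxE expr2.
have sq_ge m (u : 'rV[R]_m) : 0 <= (u *m u^T) 0 0 by rewrite sqE sumr_ge0 // => k _; exact: sqr_ge0.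
have sq0 m (u : 'rV[R]_m) : (u *m u^T) 0 0 = 0 -> u = 0.
  rewrite sqE => /psumr_eq0P h; apply/rowP => k; rewrite mxE; apply/eqP; rewrite -sqrf_eq0; apply/eqP.
  by apply: h => // j _; exact: sqr_ge0.
(* [v *m Q x0 *m v^T] is a sum of two squares: the first vanishes only on the kernel line, the
   second on that line only at 0. *)
have uQ : Q x0 \in unitmx.
  rewrite -row_free_unit; apply/inj_row_free => v vQ.
  have : (v *m (N x0)^T *m (v *m (N x0)^T)^T) 0 0 + (v *m v0^T *m (v *m v0^T)^T) 0 0 = 0.
    transitivity ((v *m Q x0 *m v^T) 0 0); last by rewrite vQ mul0mx mxE.
    by rewrite mulmxDr mulmxDl !trmx_mul !trmxK !mulmxA [RHS]mxE.
  move=> /eqP; rewrite paddr_eq0 // => /andP[/eqP s0 /eqP d0].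
  have [c ec] := k0 _ ((kN _ _).2 (sq0 _ _ s0)).
  have := sq0 _ _ d0; rewrite ec -scalemxAl => /matrixP/(_ 0 0); rewrite !mxE => /eqP.
  rewrite mulf_eq0 => /orP[/eqP ->|/eqP h]; first by rewrite scale0r.
  by move: v00; rewrite (sq0 _ v0) ?eqxx // mxE.
have Qs : smooth_on O Q.
  move=> k; have Ns : Ck k O N.
    by apply/(Ck_mxP _ _ oO) => i a; under eq_fun do rewrite mxE; exact: Ts.
  apply: CkD => //; last exact: Ck_cst.
  by apply: Ck_mulmx => //; exact: Ck_tr.
pose V := O `&` (fun x => \det (Q x)) @^-1` [set y | y != 0].
have oV : open V.
  have oN : open [set y : R | y != 0] := @open_neq R 0.
  apply: (@open_preim _ _ O [set y : R | y != 0] (fun x => \det (Q x))) => //.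
  by move=> x Ox; apply: (Ck_continuous (k := 0) _ Ox); apply: Ck_det => //; exact: Qs.
have VO : V `<=` O by move=> x [].
have Vu x : V x -> Q x \in unitmx by case=> _; rewrite unitmxE unitfE.
pose Y x := v0 *m invmx (Q x).
have kY x : V x -> insT x (Y x) = 0 /\ Y x != 0.
  move=> Vx; have [w [w0 kw _]] := ker1 (VO _ Vx); have uQx := Vu _ Vx.
  have wQ : w *m Q x = (w *m v0^T) 0 0 *: v0.
    by rewrite mulmxDr mulmxA ((kN _ _).1 kw) mul0mx add0r mulmxA {1}[w *m v0^T]mx11_scalar mul_scalar_mx.
  have wY : w = (w *m v0^T) 0 0 *: Y x by rewrite /Y scalemxAl -wQ mulmxK.
  have [c c0 wcY] : exists2 c, c != 0 & w = c *: Y x.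
    exists ((w *m v0^T) 0 0) => //; by apply: contraNneq w0 => z; rewrite wY z scale0r.
  have -> : Y x = c^-1 *: w by rewrite wcY scalerA mulVf // scale1r.
  by rewrite insZ kw scaler0 scaler_eq0 negb_or invr_eq0 c0.
have Ys : smooth_on V Y.
  move=> k; apply: Ck_mulmx => //; first exact: Ck_cst.
  by apply: Ck_invmx => //; apply: sub_Ck (Qs k).
have q0 x : V x -> 0 < (Y x *m g x *m (Y x)^T) 0 0.
  by move=> Vx; have [_ h] := kY x Vx; exact: gpos (VO _ Vx) _ h.
pose q x := (Num.sqrt ((Y x *m g x *m (Y x)^T) 0 0))^-1.
have qs k : Ck k V q.
  apply: CkV => // [x Vx|]; first by rewrite gt_eqF // sqrtr_gt0 q0.
  apply: Ck_sqrt => //; have gk : Ck k V g by apply: sub_Ck (gs k).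
  have : Ck k V (fun x => Y x *m g x *m (Y x)^T).
    by apply: Ck_mulmx => //; [exact: Ck_mulmx|exact: Ck_tr].
  by move/(Ck_mxP _ _ oV); exact.
exists V, (fun x => q x *: Y x); split => //.
- by split => //=; rewrite -unitfE -unitmxE.
- move=> k; apply/(Ck_mxP _ _ oV) => i j.
  have -> : (fun x => (q x *: Y x) i j) = (fun x => q x * Y x i j) by apply/funext => x; rewrite mxE.
  by apply: CkM => //; have /(Ck_mxP _ _ oV) := Ys k; exact.
- move=> x Vx; have [kx _] := kY x Vx; split; last by rewrite insZ kx scaler0.
  rewrite -!scalemxAl linearZ /= -scalemxAr scalerA [_ *m _]mx11_scalar /q.
  have := q0 x Vx; set y := (_ *m _) 0 0 => y0.
  by rewrite scale_scalar_mx -invfM -expr2 sqr_sqrtr ?ltW // mulVf ?gt_eqF.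
Qed.

Theorem local_potential x0 : O x0 -> exists r X (h : 'rV[R]_n -> R), 0 < r /\
  [/\ forall x, `|x - x0| < r -> O x, smooth_on [set x | `|x - x0| < r] X,
      smooth_on [set x | `|x - x0| < r] h,
      forall x, `|x - x0| < r -> X x *m g x *m (X x)^T = 1%:M /\ insT x (X x) = 0 &
      forall x a, `|x - x0| < r -> partial a h x = (X x *m g x) 0 a].
Proof.
move=> Ox0; have [V [X [oV Vx0 VO Xs XP]]] := unit_kernel_local Ox0.
have Xu x : V x -> X x *m g x *m (X x)^T = 1%:M by case/XP.
have Xk x : V x -> insT x (X x) = 0 by case/XP.
pose al x := X x *m g x.
have als : smooth_on V al.
  by move=> k; apply: Ck_mulmx; [|exact: Xs|apply: sub_Ck (gs k)].
have [rho [K [rho0 K0 ballV tm]]] := tame_exists oV Vx0 (als 2).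
have ald x : V x -> differentiable al x by move=> Vx; have [d _] := als 1; exact: d.
have dal x a b : V x -> ('D_(bv a) al x) 0 b = (al x *m (skewc g T x a)^T) 0 b.
  move=> Vx; rewrite derive_mxE; last exact: ald.
  have h := kernel_form oV VO (Xs 1) Xu Xk a b Vx.
  by rewrite (@derive_val _ _ _ _ _ _ _ h).
have closed x : `|x - x0| < rho -> forall v w, dot ('D_v al x) w = dot ('D_w al x) v.
  move=> /ballV Vx v w.
  have e u z : dot ('D_u al x) z = \sum_a \sum_b u 0 a * z 0 b * (al x *m (skewc g T x a)^T) 0 b.
    rewrite derive_rV; last exact: ald.
    rewrite /dot exchange_big /=; apply: eq_bigr => b _.
    rewrite summxE mulr_suml; apply: eq_bigr => a _.
    have -> : (u 0 a *: 'D_(bv a) al x) 0 b = u 0 a * ('D_(bv a) al x) 0 b by rewrite mxE.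
    by rewrite dal // mulrAC.
  rewrite !e exchange_big /=; apply: eq_bigr => b _; apply: eq_bigr => a _.
  by rewrite [w 0 b * _]mulrC (kernel_form_sym VO Xk) // mulrAC mulrC mulrA mulrAC.
have [h hP] := poincare tm K0 closed.
pose B := [set x : 'rV[R]_n | `|x - x0| < rho].
have oB : open B by exact: open_iball.
have BV : B `<=` V by move=> x; exact: ballV.
exists rho, X, h; split => //; split.
- by move=> x /ballV/VO.
- by move=> k; apply: sub_Ck (Xs k).
- case=> [|k]; first by move=> x /hP[d _]; exact: differentiable_continuous.
  split=> [x /hP[]//|v].
  apply: (@eq_Ck _ _ _ _ _ (fun x => \sum_b al x 0 b * v 0 b)) => // [x /hP[_ ->] //|].
  apply: Ck_sum => // b _; apply: CkM => //; last exact: Ck_cst.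
  have /(Ck_mxP _ _ oB) : Ck k B al by apply: sub_Ck (als k).
  exact.
- by move=> x /ballV Vx; exact: XP.
- move=> x a /hP[_ dh]; rewrite /partial dh /dot.
  have d b : (bv a : 'rV[R]_n) 0 b = (b == a)%:R by rewrite mxE eqxx.
  rewrite (bigD1 a) //= d eqxx mulr1 big1 ?addr0 // => b /negbTE ba.
  by rewrite d ba mulr0.
Qed.

End KernelField.

(** * Functions on a ball with zero derivative or with values 1 and -1 *)

Section Rigidity.
Context {R : realType} {n : nat}.

Lemma is_derive_affine (x v : 'rV[R]_n) (t : R) : is_derive t 1 (fun t : R => x + t *: v) v.
Proof.
apply: (@is_derive_quadP _ _ _ _ _ _ 1 0) => // s _.
by rewrite scalerDl addrA [x + _ + _]addrC addrK subrr normr0 mul0r.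
Qed.

Lemma constant_on_ball (k : 'rV[R]_n -> R) x1 r :
  (forall x, `|x - x1| < r -> differentiable k x /\ forall v, 'D_v k x = 0) ->
  forall x, `|x - x1| < r -> k x = k x1.
Proof.
move=> h x xr; apply/eqP; rewrite -subr_eq0 -normr_le0.
have x1r : `|x1 - x1| < r by rewrite subrr normr0; apply: le_lt_trans xr.
have := @mvt_real _ (fun t : R => k (x1 + t *: (x - x1))) (fun=> 0) 0 1 0.
rewrite scale0r addr0 scale1r [x1 + _]addrC subrK mul0r; apply => t /seg01 t01; last by rewrite normr0.
have [d e] := h _ (dist_convex x1r xr t01).
by apply: (is_derive_eq (is_derive_lineR d)); exact: e.
Qed.

Lemma sign_on_ball (q : 'rV[R]_n -> R) x1 r :
  (forall x, `|x - x1| < r -> {for x, continuous q}) ->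
  (forall x, `|x - x1| < r -> q x = 1 \/ q x = -1) ->
  forall x, `|x - x1| < r -> q x = q x1.
Proof.
move=> cq q1 x xr.
have x1r : `|x1 - x1| < r by rewrite subrr normr0; apply: le_lt_trans xr.
pose ga (t : R) := x1 + t *: (x - x1).
have g01 t : 0 <= t <= 1 -> `|ga t - x1| < r by exact: dist_convex.
have -> : x = ga 1 by rewrite /ga scale1r addrC subrK.
have z01 : 0 <= (0 : R) <= 1 by rewrite lexx ler01.
have o01 : 0 <= (1 : R) <= 1 by rewrite lexx ler01.
apply: (@segment_ind _ (fun t => q (ga t) = q x1) 0 1 _ 0 1 z01 o01); last by rewrite /ga scale0r addr0.
move=> t t01; have cg : {for t, continuous (q \o ga)}.
  apply: continuous_comp; last exact: cq (g01 _ t01).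
  apply: (@derive_continuous _ 1 n ga t (x - x1)).
  exact: is_derive_affine.
have [e e0 eP] : exists2 e : R, 0 < e & forall s, `|s - t| < e -> `|q (ga s) - q (ga t)| < 1.
  have : \forall s \near t, `|(q \o ga) t - (q \o ga) s| < 1.
    by move/cvgrPdist_lt: cg; apply.
  move=> /nbhs_ballP[e /= e0 eP]; exists e => // s st; rewrite distrC; apply: eP.
  by rewrite /ball /= distrC.
exists e => // s s' s01 s'01 st s't <-.
have close u : 0 <= u <= 1 -> `|u - t| < e -> q (ga u) = q (ga t).
  move=> u01 /eP h.
  have [a|a] := q1 _ (g01 _ u01); have [b|b] := q1 _ (g01 _ t01); rewrite a b // in h *.
  - by move: h; rewrite opprK ger0_norm ?addr_ge0 // => h; lra.
  - by move: h; rewrite -opprD normrN ger0_norm ?addr_ge0 // => h; lra.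
by rewrite !close.
Qed.

End Rigidity.

(** * A global potential of the kernel field *)

Section GlobalPotential.
Context {R : realType} {n : nat} (M : atlas R n) (sM : smooth_atlas M).
Context (g : metric M) (rg : riemannian g) (T : tensor M 3) (fT : form_field T).
Context (Tpar : parallel (skew_connection g T) T).

Local Notation insT i x v := (ins (T i x : cov R n (2 + 1)) v).

Context (ker1 : forall (i : chart M) x, img i x -> exists v0 : 'rV[R]_n, [/\ v0 != 0, insT i x v0 = 0 &
  forall v, insT i x v = 0 -> exists c, v = c *: v0]).

Definition grad (i : chart M) (h : M -> R) x : 'rV[R]_n := \row_a partial a (h \o cinv i : 'rV[R]_n -> R) x.

(** The normalisation is put on covectors because the derivative of a function is one; the metric
    dual of [al] is a unit vector in the kernel of [T]. *)
Definition unit_form i x (al : 'rV[R]_n) : Prop :=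
  al *m invmx (g i x) *m al^T = 1%:M /\ insT i x (al *m invmx (g i x)) = 0.

Lemma metric_unit (i : chart M) x : img i x -> g i x \in unitmx.
Proof. by move=> ix; apply: pos_unit => v v0; exact: (metric_pos rg ix v0). Qed.

Lemma trans_unit (i j : chart M) x : overlap i j x -> 'J (trans i j) x \in unitmx.
Proof.
move=> ov; have := metric_unit (overlap_img sM ov); rewrite (metric_trans rg ov) !unitmx_mul.
by case/andP => /andP[].
Qed.

Lemma grad_trans (i j : chart M) x h : overlap i j x ->
  differentiable (h \o cinv j : 'rV[R]_n -> R) (trans i j x) ->
  grad i h x = grad j h (trans i j x) *m ('J (trans i j) x)^T.
Proof.
move=> ov dh; apply/rowP => a; rewrite !mxE /partial.
have e : \forall y \near x, (h \o cinv i) y = ((h \o cinv j) \o trans i j) y.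
  have no : nbhs (x : 'rV[R]_n) (overlap i j) by apply: open_nbhs_nbhs; split; [exact: open_overlap|].
  apply: filterS no => y oy /=.
  by rewrite -(cinv_trans sM oy).
rewrite (near_eq_derive _ e) derive_comp //; last exact: (trans_diff sM ov).
rewrite derive_rV //; apply: eq_bigr => b _.
have -> : ('J (trans i j) x)^T b a = ('D_(bv a) (trans i j) x) 0 b.
  by rewrite mxE jacobianE ?derive_mxE //; exact: (trans_diff sM ov).
by rewrite [grad _ _ _ _ _]mxE; exact: mulrC.
Qed.

Lemma unit_form_trans (i j : chart M) x al : overlap i j x ->
  unit_form j (trans i j x) al -> unit_form i x (al *m ('J (trans i j) x)^T).
Proof.
move=> ov [h1 h2]; have uJ := trans_unit ov; set J := 'J (trans i j) x in uJ *.
have uJT : J^T \in unitmx by rewrite unitmx_tr.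
have ugj := metric_unit (trans_img sM ov).
have e : al *m J^T *m invmx (g i x) *m J = al *m invmx (g j (trans i j x)).
  apply: (can_inj (mulmxK ugj)); rewrite mulmxKV //.
  apply: (can_inj (mulmxK uJT)); rewrite -!mulmxA [J *m (_ *m _)]mulmxA -(metric_trans rg ov).
  by rewrite mulVmx ?mulmx1 ?(metric_unit (overlap_img sM ov)).
split.
  by rewrite trmx_mul trmxK mulmxA e.
have [_ law] := fT.1; rewrite (law i j x ov) -/J.
by rewrite (@ins_pull _ _ _ 2 J (T j (trans i j x))) e h2 pull0.
Qed.

Lemma unit_form_sign i x al be : img i x -> unit_form i x al -> unit_form i x be ->
  (al *m invmx (g i x) *m be^T = 1%:M /\ be = al) \/ (al *m invmx (g i x) *m be^T = (-1)%:M /\ be = - al).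
Proof.
move=> ix [a1 a2] [b1 b2]; have [v0 [v00 _ kv]] := ker1 ix; have ug := metric_unit ix.
have [a ea] := kv _ a2; have [b eb] := kv _ b2.
have a0 : a != 0.
  apply/eqP => z; move: a1; rewrite ea z scale0r mul0mx => /matrixP/(_ 0 0).
  by rewrite !mxE eqxx => /eqP; rewrite eq_sym oner_eq0.
have ebe : be = (b / a) *: al.
  have ui : invmx (g i x) \in unitmx by rewrite unitmx_inv.
  apply: (can_inj (mulmxK ui)).
  by rewrite eb -scalemxAl ea scalerA divfK.
move: b1; rewrite ebe -!scalemxAl linearZ /= -scalemxAr a1 scalerA => /matrixP/(_ 0 0).
rewrite !mxE eqxx mulr1 -expr2 => /eqP; rewrite sqrf_eq1 => /orP[] /eqP ->; [left|right].
  by rewrite !scale1r.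
by rewrite !scaleN1r; split => //; rewrite -[in RHS]scalemx1 scaleN1r.
Qed.

Definition potential_on (V : set M) (h : M -> R) : Prop := forall i : chart M,
  smooth_on (img i `&` cinv i @^-1` V) (h \o cinv i : 'rV[R]_n -> R) /\
  forall x, img i x -> V (cinv i x) -> unit_form i x (grad i h x).

Lemma open_chart_preim (i : chart M) (V : set M) : open V -> open (img i `&` cinv i @^-1` V).
Proof. by move=> oV; rewrite -(image_cmapE sM); exact: (open_image_cmap sM). Qed.

Lemma potential_diff V h i x : potential_on V h -> img i x -> V (cinv i x) ->
  differentiable (h \o cinv i : 'rV[R]_n -> R) x.
Proof. by move=> hp ix Vx; have [sm _] := hp i; have [d _] := sm 1; exact: d. Qed.

Lemma potential_sub (V V' : set M) h : V' `<=` V -> potential_on V h -> potential_on V' h.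
Proof.
move=> sub hp i; have [sm un] := hp i; split=> [k|x ix /sub]; last exact: un.
by apply: sub_Ck (sm k) => x [ix /sub].
Qed.

Lemma eq_potential (V : set M) h h' : open V -> (forall q, V q -> h q = h' q) ->
  potential_on V h -> potential_on V h'.
Proof.
move=> oV e hp i; have [sm un] := hp i; have oW := open_chart_preim (i := i) oV; split=> [k|x ix Vx].
  by apply: (eq_Ck oW _ (sm k)) => x [ix Vx]; exact: e.
have -> : grad i h' x = grad i h x; last exact: un.
apply/rowP => a; rewrite !mxE; apply: near_eq_derive.
by apply: (open_near oW) => // y [iy Vy]; rewrite /= e.
Qed.

Lemma potential_chart (V : set M) (i : chart M) h : open V -> V `<=` dom i ->
  smooth_on (img i `&` cinv i @^-1` V) (h \o cinv i : 'rV[R]_n -> R) ->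
  (forall x, img i x -> V (cinv i x) -> unit_form i x (grad i h x)) -> potential_on V h.
Proof.
move=> oV Vi sm un j; have oW := open_chart_preim (i := j) oV.
have ov x : img j x -> V (cinv j x) -> overlap j i x.
  by move=> jx Vx; apply/(overlapE sM); split => //; exact: Vi.
have ti x : img j x -> V (cinv j x) -> (img i `&` cinv i @^-1` V) (trans j i x).
  move=> jx Vx; split; first exact: (trans_img sM (ov _ jx Vx)).
  by rewrite /= (cinv_trans sM) //; exact: ov.
split=> [k|x jx Vx].
  apply: (@eq_Ck _ _ _ _ _ ((h \o cinv i) \o trans j i)) => //.
    by move=> x [jx Vx]; rewrite /= -(cinv_trans sM (ov _ jx Vx)).
  apply: (Ck_comp (O := img i `&` cinv i @^-1` V)) => //.
  - exact: open_chart_preim.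
  - by move=> x [jx Vx]; exact: ti.
  - by apply: sub_Ck (sa_trans sM j i k) => x [jx Vx]; exact: ov.
have [tx tV] := ti x jx Vx.
rewrite (grad_trans (ov _ jx Vx)); last by have [d _] := sm 1; exact: d.
by apply: unit_form_trans; [exact: ov|exact: un].
Qed.

(** The relation to which [monodromy] is applied. As it also demands a potential near [p], being
    related to itself at [p] means being a potential there. *)
Definition germ_eq (p : M) (h h' : M -> R) : Prop :=
  exists V, [/\ open V, V p, potential_on V h & forall q, V q -> h q = h' q].

Lemma germ_sym p h h' : germ_eq p h h' -> germ_eq p h' h.
Proof.
case=> V [oV Vp hp e]; exists V; split => //; first exact: eq_potential hp.
by move=> q Vq; rewrite e.
Qed.

Lemma germ_trans p f h k : germ_eq p f h -> germ_eq p h k -> germ_eq p f k.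
Proof.
case=> V [oV Vp hp e] [V' [oV' Vp' hp' e']]; exists (V `&` V'); split => //; first exact: openI.
  by apply: potential_sub hp => q [].
by move=> q [Vq V'q]; rewrite e // e'.
Qed.

Lemma germ_open p h k : germ_eq p h k -> nbhs p [set q | germ_eq q h k].
Proof. by case=> V [oV Vp hp e]; apply: (open_near oV Vp) => q Vq; exists V. Qed.

Lemma potential_germ V h p : open V -> V p -> potential_on V h -> germ_eq p h h.
Proof. by move=> oV Vp hp; exists V. Qed.

Lemma potential_affine (V : set M) h (s c : R) : open V -> s = 1 \/ s = -1 -> potential_on V h ->
  potential_on V (fun q => s * h q + c).
Proof.
move=> oV s1 hp i; have [sm un] := hp i; have oW := open_chart_preim (i := i) oV; split=> [k|x ix Vx].
  by apply: CkD => //; [apply: CkZ|exact: Ck_cst]; [|exact: sm].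
have -> : grad i (fun q => s * h q + c) x = s *: grad i h x.
  apply/rowP => a; rewrite !mxE /partial.
  have d : is_derive x (bv a : 'rV[R]_n) (h \o cinv i : 'rV[R]_n -> R)
      ('D_(bv a) (h \o cinv i : 'rV[R]_n -> R) x).
    by apply: DeriveDef => //; apply: diff_derivable; exact: potential_diff hp ix Vx.
  have d' := is_deriveD (is_deriveZ s d) (is_derive_cst c x (bv a : 'rV[R]_n)).
  by rewrite (@derive_val _ _ _ _ _ _ _ d') addr0.
have [u1 u2] := un x ix Vx; split.
  rewrite -!scalemxAl linearZ /= -scalemxAr u1 scalerA.
  by case: s1 => ->; rewrite ?mulr1 ?mulrNN ?mulr1 scale1r.
by rewrite -scalemxAl insZ u2 scaler0.
Qed.

(** The two gradients are unit covectors on one line, so their pairing [q] is 1 or -1; being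
    continuous it is constant on the ball, and [k - s * h] has zero derivative. *)
Lemma potential_rigid (V : set M) (i : chart M) (h k : M -> R) x1 r :
  (forall x, `|x - x1| < r -> img i x /\ V (cinv i x)) -> 0 < r ->
  potential_on V h -> potential_on V k ->
  exists s c : R, (s = 1 \/ s = -1) /\ forall x, `|x - x1| < r -> k (cinv i x) = s * h (cinv i x) + c.
Proof.
move=> BV r0 hp kp; pose B := [set x : 'rV[R]_n | `|x - x1| < r].
have oB : open B by exact: open_iball.
have uf u x : potential_on V u -> B x -> unit_form i x (grad i u x).
  by move=> up /BV[ix Vx]; exact: (up i).2.
have uC u m : potential_on V u -> Ck m B (u \o cinv i : 'rV[R]_n -> R).
  by move=> up; have [sm _] := up i; apply: sub_Ck (sm m) => x /BV.
have gC u m : potential_on V u -> Ck m B (grad i u).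
  move=> up; apply/(Ck_mxP _ _ oB) => a b; under eq_fun do rewrite mxE.
  by have [_] := uC u m.+1 up; exact.
pose q x := (grad i h x *m invmx (g i x) *m (grad i k x)^T) 0 0.
have q1 x : B x -> q x = 1 \/ q x = -1.
  move=> Bx; have [ix _] := BV x Bx.
  by have [[e _]|[e _]] := unit_form_sign ix (uf h x hp Bx) (uf k x kp Bx); [left|right]; rewrite /q e mxE eqxx.
have cq x : B x -> {for x, continuous q}.
  move=> Bx; apply: (Ck_continuous (k := 0) _ Bx).
  have : Ck 0 B (fun x => grad i h x *m invmx (g i x) *m (grad i k x)^T).
    apply: (Ck_mulmx oB); last by apply: (Ck_tr oB); exact: gC.
    apply: (Ck_mulmx oB); first exact: gC.
    apply: (Ck_invmx oB) => [y /BV[iy _]|]; first exact: metric_unit.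
    by apply: sub_Ck (metric_smooth rg i 0) => y /BV[].
  by move/(Ck_mxP _ _ oB); exact.
have x1B : B x1 by rewrite /B /= subrr normr0.
pose s := q x1; have s1 : s = 1 \/ s = -1 by exact: q1.
have gk x : B x -> grad i k x = s *: grad i h x.
  move=> Bx; have qs : q x = s by exact: (@sign_on_ball _ _ q x1 r cq q1).
  have [ix _] := BV x Bx.
  have [[e ->]|[e ->]] := unit_form_sign ix (uf h x hp Bx) (uf k x kp Bx).
    by rewrite -qs /q e mxE eqxx scale1r.
  by rewrite -qs /q e mxE eqxx scaleN1r.
exists s, (k (cinv i x1) - s * h (cinv i x1)); split => // x Bx.
pose w y := (k \o cinv i) y - s * (h \o cinv i) y : R.
suff : w x = w x1 by rewrite /w /= => <-; rewrite addrC subrK.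
apply: (@constant_on_ball _ _ w x1 r) => // y By.
have [kd _] := uC k 1 kp; have [hd _] := uC h 1 hp.
have wC : Ck 1 B w by apply: CkB => //; [exact: uC|apply: CkZ => //; exact: uC].
have [wd _] := wC; split; first exact: wd.
move=> v; rewrite derive_rV; last exact: wd.
rewrite big1 // => a _; apply/eqP; rewrite scaler_eq0; apply/orP; right; apply/eqP.
have dk : is_derive y (bv a : 'rV[R]_n) (k \o cinv i : 'rV[R]_n -> R) (grad i k y 0 a).
  by apply: DeriveDef; [apply: diff_derivable; exact: kd|rewrite mxE].
have dh : is_derive y (bv a : 'rV[R]_n) (h \o cinv i : 'rV[R]_n -> R) (grad i h y 0 a).
  by apply: DeriveDef; [apply: diff_derivable; exact: hd|rewrite mxE].
have d' := is_deriveB dk (is_deriveZ s dh).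
by rewrite (@derive_val _ _ _ _ _ _ _ d') gk // mxE subrr.
Qed.

Lemma local_potential_chart p : exists (i : chart M) x0 r h, [/\ dom i p, x0 = cmap i p, 0 < r,
  (forall x, `|x - x0| < r -> img i x) & potential_on (dom i `&` cmap i @^-1` [set x | `|x - x0| < r]) h].
Proof.
have [i ip] := sa_cover sM p.
have alt x : img i x -> alternating (T i x) by exact: fT.2.
have ix0 := img_cmap ip.
have kp := @ker1 i.
have Tp := (parallelE g T T).1 Tpar i.
have Ts := fT.1.1 i.
have gsy x (ix : img i x) := metric_sym rg ix.
have gpo x (ix : img i x) := metric_pos rg ix.
have [r [X [h [r0 [BO Xs hs XP dh]]]]] := local_potential (sa_img sM (i := i)) (metric_smooth rg i)
  gsy gpo alt Ts Tp kp ix0.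
exists i, (cmap i p), r, (h \o cmap i); split => //.
have oB : open [set x : 'rV[R]_n | `|x - cmap i p| < r] by exact: open_iball.
set V := dom i `&` _.
have oV : open V by apply: open_preim => //; [exact: (sa_dom sM)|move=> q; exact: (sa_cmap sM)].
have VB x : img i x -> V (cinv i x) -> `|x - cmap i p| < r by move=> ix [_]; rewrite /= (cinvK sM ix).
apply: (@potential_chart V i) => // [q []//|k|x ix Vx].
  apply: (@eq_Ck _ _ _ _ _ h); [exact: open_chart_preim| |].
    by move=> x [ix _]; rewrite /= (cinvK sM).
  by apply: sub_Ck (hs k) => x [ix Vx]; exact: VB.
have xr := VB x ix Vx.
have -> : grad i (h \o cmap i) x = X x *m g i x.
  apply/rowP => a; rewrite mxE -dh //; apply: near_eq_derive.
  by apply: (open_near oB xr) => y /BO iy; rewrite /= (cinvK sM).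
have [u1 u2] := XP x xr; have ug := metric_unit ix.
by split; rewrite mulmxK // trmx_mul (metric_sym rg ix) mulmxA.
Qed.

Context (hsc : @simply_connected R M).

Theorem global_potential (p0 : M) : exists f : M -> R, f p0 = 0 /\ potential_on setT f.
Proof.
(* On the domain of a local potential [h], any germ of a potential is that of [s * h + c] with [s]
   equal to 1 or -1. So it extends over the whole domain, and [s] and [c] are determined by the
   germ. *)
have cover p : exists V, @evenly_covered R _ _ germ_eq p V.
  have [i [x0 [r [h [ip ex0 r0 BO hp]]]]] := local_potential_chart p.
  have oB : open [set x : 'rV[R]_n | `|x - x0| < r] by exact: open_iball.
  move: hp; set V := dom i `&` _ => hp.
  have oV : open V by apply: open_preim => //; [exact: (sa_dom sM)|move=> q; exact: (sa_cmap sM)].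
  have Vp : V p by split => //=; rewrite ex0 subrr normr0.
  have BV x : `|x - x0| < r -> img i x /\ V (cinv i x).
    move=> xr; have ix := BO x xr; split => //; split; first exact: (dom_cinv sM).
    by rewrite /= (cinvK sM).
  exists V; split => //.
  - move=> q k Vq [W [oW Wq kp _]].
    have [iq /= qr] := Vq.
    have oVW : open (img i `&` cinv i @^-1` (V `&` W)) by apply: open_chart_preim; exact: openI.
    have : nbhs (cmap i q) (img i `&` cinv i @^-1` (V `&` W)).
      by apply: open_nbhs_nbhs; split => //; split; [exact: img_cmap|rewrite /= (sa_cmapK sM)].
    move=> /nbhs_ballP[e /= e0 eB].
    have eBV x : `|x - cmap i q| < e -> img i x /\ (V `&` W) (cinv i x).
      by move=> xe; apply: eB; rewrite -ball_normE /= distrC.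
    have [s [c [s1 ks]]] := potential_rigid eBV e0 (potential_sub (fun q => @proj1 _ _) hp)
      (potential_sub (fun q => @proj2 _ _) kp).
    exists (fun q => s * h q + c).
      by move=> z Vz; apply: (potential_germ oV Vz); exact: potential_affine.
    have oE : open [set x : 'rV[R]_n | `|x - cmap i q| < e] by exact: open_iball.
    exists (dom i `&` cmap i @^-1` [set x | `|x - cmap i q| < e]); split.
    - by apply: open_preim => //; [exact: (sa_dom sM)|move=> z; exact: (sa_cmap sM)].
    - by split => //=; rewrite subrr normr0.
    - apply: potential_sub (potential_affine c oV s1 hp) => z [iz /= ze].
      by have [_ []] := eBV _ ze; rewrite (sa_cmapK sM).
    - by move=> z [iz /= ze]; rewrite -{2}(sa_cmapK sM iz) ks // (sa_cmapK sM).
  - move=> q k k' Vq kp k'p [W [oW Wq _ kk']] z Vz.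
    have pot u : (forall r, V r -> germ_eq r u u) -> potential_on V u.
      move=> up j; split=> [m|x jx Vx].
        apply: Ck_locally => x [jx Vx]; have [W' [oW' W'x u' _]] := up _ Vx.
        by exists (img j `&` cinv j @^-1` W'); [split|exact: (u' j).1].
      by have [W' [oW' W'x u' _]] := up _ Vx; exact: (u' j).2.
    have [s [c [s1 ks]]] := potential_rigid BV r0 hp (pot k kp).
    have [s' [c' [s1' ks']]] := potential_rigid BV r0 hp (pot k' k'p).
    have oVW : open (img i `&` cinv i @^-1` (V `&` W)) by apply: open_chart_preim; exact: openI.
    have [iq /= qr] := Vq; have iq' := img_cmap iq.
    have Oq : (img i `&` cinv i @^-1` (V `&` W)) (cmap i q) by split => //; rewrite /= (sa_cmapK sM).
    have nn : \forall x \near cmap i q, s * (h \o cinv i) x + c = s' * (h \o cinv i) x + c'.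
      apply: (open_near oVW Oq) => x [ix [Vx Wx]]; have [_ /=] := Vx; rewrite (cinvK sM ix) => xr.
      by rewrite -ks // -ks' // kk'.
    have hd : differentiable (h \o cinv i : 'rV[R]_n -> R) (cmap i q).
      by apply: (potential_diff hp iq'); rewrite (sa_cmapK sM).
    have ss : s = s'.
      have dq (y d : R) a : 'D_(bv a) (fun x => y * (h \o cinv i) x + d) (cmap i q) = y * grad i h (cmap i q) 0 a.
        have d1 : is_derive (cmap i q) (bv a : 'rV[R]_n) (h \o cinv i : 'rV[R]_n -> R)
          ('D_(bv a) (h \o cinv i : 'rV[R]_n -> R) (cmap i q)).
          by apply: DeriveDef => //; exact: diff_derivable.
        have d' := is_deriveD (is_deriveZ y d1) (is_derive_cst d (cmap i q) (bv a : 'rV[R]_n)).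
        by rewrite (@derive_val _ _ _ _ _ _ _ d') addr0 mxE.
      have eg : s *: grad i h (cmap i q) = s' *: grad i h (cmap i q).
        have eg a : s * grad i h (cmap i q) 0 a = s' * grad i h (cmap i q) 0 a.
          by rewrite -(dq s c) -(dq s' c'); exact: near_eq_derive.
        by apply/rowP => a; rewrite mxE [RHS]mxE; exact: eg.
      have [u1 _] : unit_form i (cmap i q) (grad i h (cmap i q)).
        by apply: (hp i).2 => //; rewrite (sa_cmapK sM).
      have := congr1 (fun v => v *m invmx (g i (cmap i q)) *m (grad i h (cmap i q))^T) eg.
      by rewrite -!scalemxAl u1 => /matrixP/(_ 0 0); rewrite !mxE eqxx !mulr1.
    have cc : c = c'.
      by have := nbhs_singleton nn; rewrite ss => /addrI.
    exists V; split => //; first exact: pot.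
    move=> y [iy /= yr]; rewrite -(sa_cmapK sM iy) ks // ks' //.
    by rewrite ss cc.
  - move=> q [iq /= qr]; pose c (t : R) := x0 + t *: (cmap i q - x0).
    have x0r : `|x0 - x0| < r by rewrite subrr normr0.
    have cr t : 0 <= t <= 1 -> `|c t - x0| < r by exact: dist_convex.
    exists (cinv i \o c); split.
    - apply: continuous_in_subspaceT => t; rewrite inE /unit_interval /= => t01.
      apply: continuous_comp; last by apply: (sa_cinv sM); apply: BO; exact: cr.
      apply: (@derive_continuous _ 1 n c t (cmap i q - x0)).
      exact: is_derive_affine.
    - by rewrite /c /= scale0r addr0 ex0 (sa_cmapK sM).
    - by rewrite /c /= scale1r addrC subrK (sa_cmapK sM).
    - by move=> t t01; exact: (BV _ (cr _ t01)).2.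
have [i [x0 [r [h [ip ex0 r0 BO hp]]]]] := local_potential_chart p0.
have oB : open [set x : 'rV[R]_n | `|x - x0| < r] by exact: open_iball.
move: hp; set V := dom i `&` _ => hp.
have oV : open V by apply: open_preim => //; [exact: (sa_dom sM)|move=> q; exact: (sa_cmap sM)].
have Vp : V p0 by split => //=; rewrite ex0 subrr normr0.
have [F FP] := monodromy germ_sym germ_trans germ_open cover hsc (potential_germ oV Vp hp).
(* [F] attaches a function to each point, meaningful only near that point; the diagonal collects the
   values. *)
pose f p := F p p.
have pf p : exists W, [/\ open W, W p & potential_on W f].
  have [[W [oW Wp Fp _]]] := FP p; rewrite nbhsE => -[W' [oW' W'p W'F]].
  exists (W `&` W'); split => //; first exact: openI.
  apply: (@eq_potential _ (F p)); [exact: openI| |by apply: potential_sub Fp => q []].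
  by move=> q [Wq /W'F[W'' [_ W''q _ e]]]; rewrite /f e.
have fp : potential_on setT f.
  move=> j; split=> [k|x jx _].
    apply: Ck_locally => x [jx _]; have [W [oW Wx Wf]] := pf (cinv j x).
    by exists (img j `&` cinv j @^-1` W); [split|exact: (Wf j).1].
  by have [W [oW Wx Wf]] := pf (cinv j x); exact: (Wf j).2.
exists (fun q => 1 * f q + - f p0); split; first by rewrite mul1r subrr.
by apply: potential_affine => //; [exact: openT|left].
Qed.

End GlobalPotential.

Section Helpers.
Context {R : realType}.

Lemma derive_jacobian m n (f : 'rV[R]_m -> 'rV[R]_n) x v : differentiable f x -> 'D_v f x = v *m 'J f x.
Proof. by move=> df; rewrite /jacobian mul_rV_lin1 deriveE. Qed.

Lemma is_derive_shift n (u : R -> 'rV[R]_n) (s t : R) du : is_derive (s + t) 1 u du ->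
  is_derive t 1 (fun t => u (s + t)) du.
Proof. exact: is_derive_shift_rV. Qed.

Lemma is_derive_uniq (V W : normedModType R) (f : V -> W) x v d d' :
  is_derive x v f d -> is_derive x v f d' -> d = d'.
Proof. by move=> h h'; rewrite -(@derive_val _ _ _ _ _ _ _ h) (@derive_val _ _ _ _ _ _ _ h'). Qed.

Lemma is_derive_scale n (u : R -> 'rV[R]_n) (s t : R) du : is_derive (s * t) 1 u du ->
  is_derive s 1 (fun s => u (s * t)) (t *: du).
Proof.
move=> h; apply: is_derive_mxI => i j.
have h1 := is_derive_mx i j h.
have h2 := is_deriveM_cst t s.
have h3 := @is_derive1_comp _ (fun s => u s i j) (fun s => s * t) s _ _ h1 h2.
by apply: (is_derive_eq h3); rewrite mxE mulrC.
Qed.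

Lemma near_ball (t : R) (P : R -> Prop) : (\forall s \near t, P s) ->
  exists2 e, 0 < e & forall s, `|s - t| < e -> P s.
Proof.
move=> /nbhs_ballP[e /= e0 eP]; exists e => // s st; apply: eP.
by rewrite -ball_normE /= distrC.
Qed.

Lemma near_open (X : topologicalType) (c : R -> X) (V : set X) (t : R) :
  {for t, continuous c} -> open V -> V (c t) -> exists2 e, 0 < e & forall s, `|s - t| < e -> V (c s).
Proof.
move=> cc oV Vt; apply: (@near_ball t (fun s => V (c s))).
by apply: (cc V); apply: open_nbhs_nbhs.
Qed.

Lemma koszul_sym n (g : 'rV[R]_n -> 'M[R]_n) (O : set 'rV[R]_n) x a b c : open O -> O x ->
  (forall y, O y -> (g y)^T = g y) -> skewc g (fun=> 0) x a b c = skewc g (fun=> 0) x b a c.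
Proof.
move=> oO Ox sym; rewrite /skewc [LHS]mxE [RHS]mxE; apply: eq_bigr => l _; congr (_ * _).
rewrite [LHS]mxE [RHS]mxE !ffunE !mulr0 !addr0.
have -> : dmet g x l a b = dmet g x l b a.
  by apply: near_eq_derive; apply: (open_near oO Ox) => y Oy; rewrite -[in LHS](sym y Oy) mxE.
by congr (_ * _); rewrite [dmet g x a b l + _]addrC.
Qed.

End Helpers.

(** * The complete flow of a parallel field *)

Section Flow.
Context {R : realType} {n : nat} (M : atlas R n) (sM : smooth_atlas M) (hM : hausdorff_space M).
Context (g : metric M) (rg : riemannian g) (hcomplete : complete_metric g).

Definition lcc (i : chart M) x a : 'M[R]_n := skewc (g i) (fun=> 0) x a.

Lemma lccE i x a b c : levi_civita g i x a b c = lcc i x a b c.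
Proof.
rewrite /lcc -(skewcE g (fun _ _ => 0)) mxE /skew_connection [X in _ + X]big1 ?addr0 // => l _.
by rewrite ffunE mulr0 mul0r.
Qed.

Lemma lcc_sym (i : chart M) x a b c : img i x -> lcc i x a b c = lcc i x b a c.
Proof. by move=> ix; apply: (koszul_sym _ _ _ (sa_img sM (i := i)) ix) => y iy; exact: metric_sym rg _ _ iy. Qed.

Lemma is_derive_metric (i : chart M) x a b c : img i x ->
  is_derive x (bv a) (fun y => g i y b c) ((lcc i x a *m g i x + g i x *m (lcc i x a)^T) b c).
Proof.
move=> ix; have h := is_derive_entry (bv a) b c (metric_smooth rg i 1) ix.
have alt0 : alternating (0 : cov R n 3) by move=> s I; rewrite !ffunE mulr0.
have gsy y (iy : img i y) := metric_sym rg iy.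
apply: (is_derive_eq h).
rewrite -(@skewc_metric _ _ (g i) (fun=> 0) _ x a (sa_img sM (i := i)) ix gsy (metric_unit rg ix) alt0).
by rewrite mxE /dmet /partial (@derive_val _ _ _ _ _ _ _ h).
Qed.

Definition along (i : chart M) x (v : 'rV[R]_n) : 'M[R]_n := \sum_a v 0 a *: lcc i x a.

Lemma is_derive_metric_curve (i : chart M) (u : R -> 'rV[R]_n) (t : R) du b c : img i (u t) ->
  is_derive t 1 u du ->
  is_derive t 1 (fun t => g i (u t) b c)
    ((along i (u t) du *m g i (u t) + g i (u t) *m (along i (u t) du)^T) b c).
Proof.
move=> ix hu; have [dg _] := metric_smooth rg i 1; have d := dg _ ix.
have d' : differentiable (fun y => g i y b c) (u t) by move/differentiable_mxP: d; exact.
apply: (is_derive_eq (is_derive_comp hu d')); rewrite derive_rV //.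
have e a : 'D_(bv a) (fun y => g i y b c) (u t) =
  (lcc i (u t) a *m g i (u t) + g i (u t) *m (lcc i (u t) a)^T) b c.
  by have h := is_derive_metric a b c ix; rewrite (@derive_val _ _ _ _ _ _ _ h).
under eq_bigr do rewrite e.
have -> : (along i (u t) du)^T = \sum_a du 0 a *: (lcc i (u t) a)^T.
  apply/matrixP => k l; rewrite mxE !summxE; apply: eq_bigr => d0 _.
  by rewrite [LHS]mxE [RHS]mxE; congr (_ * _); rewrite [RHS]mxE.
rewrite /along mulmx_suml mulmx_sumr -big_split summxE; apply: eq_bigr => a _.
rewrite -scalemxAl -scalemxAr [RHS]mxE [X in _ = X + _]mxE [X in _ = _ + X]mxE [X in _ *: X = _]mxE.
exact: mulrDr.
Qed.

Context (X : chart M -> 'rV[R]_n -> 'rV[R]_n).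
Context (Xs : forall i, smooth_on (img i) (X i)).
Context (Xt : forall i j x, overlap i j x -> X j (trans i j x) = X i x *m 'J (trans i j) x).
Context (Xpar : forall (i : chart M) x a, img i x -> 'D_(bv a) (X i) x = - (X i x *m lcc i x a)).

Definition icurve (c : R -> M) : Prop := continuous c /\
  forall i t, dom i (c t) -> is_derive t 1 (cmap i \o c) (X i (cmap i (c t))).

Lemma curve_trans (c : R -> M) i j (t : R) du : {for t, continuous c} -> dom i (c t) -> dom j (c t) ->
  is_derive t 1 (cmap i \o c) du ->
  is_derive t 1 (cmap j \o c) (du *m 'J (trans i j) (cmap i (c t))).
Proof.
move=> cc ic jc hu; have ov := overlapP ic jc; have dt := trans_diff sM ov.
rewrite -derive_jacobian //; apply: near_eq_is_derive (is_derive_comp hu dt).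
have : nbhs t (c @^-1` dom i) by apply: cc; apply: open_nbhs_nbhs; split => //; exact: (sa_dom sM).
by apply: filterS => s ics /=; rewrite (trans_cmap sM).
Qed.

Lemma icurve_chart (c : R -> M) i (t : R) : {for t, continuous c} -> dom i (c t) ->
  is_derive t 1 (cmap i \o c) (X i (cmap i (c t))) ->
  forall j, dom j (c t) -> is_derive t 1 (cmap j \o c) (X j (cmap j (c t))).
Proof.
move=> cc ic hu j jc; apply: (is_derive_eq (curve_trans cc ic jc hu)).
by rewrite -Xt ?(trans_cmap sM) //; exact: overlapP.
Qed.

Lemma is_derive_X (i : chart M) (u : R -> 'rV[R]_n) (t : R) du b c : img i (u t) ->
  is_derive t 1 u du ->
  is_derive t 1 (fun t => X i (u t) b c) ((- (X i (u t) *m along i (u t) du)) b c).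
Proof.
move=> ix hu; have [dX _] := Xs i 1; have d := dX _ ix.
apply: (is_derive_eq (is_derive_mx b c (is_derive_comp hu d))); rewrite derive_rV //.
congr (fun_of_matrix _ _ _); rewrite /along mulmx_sumr -sumrN; apply: eq_bigr => a _.
by rewrite Xpar // -scalemxAr scalerN.
Qed.

(** Along the geodesic the difference [w] between the velocity and [X] is parallel, as both are, so
    its length is locally constant and its vanishing propagates. [P] asks for one chart only,
    because [icurve_chart] passes to the others. *)
Lemma geodesic_icurve (c : R -> M) i p : geodesic (levi_civita g) c -> c 0 = p -> dom i p ->
  derive1 (cmap i \o c) 0 = X i (cmap i p) -> icurve c.
Proof.
move=> [cc geo] c0 ip ci; split => //.
have du i' t : dom i' (c t) -> is_derive t 1 (cmap i' \o c) (derive1 (cmap i' \o c) t).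
  by move=> /(geo i') [d _ _]; rewrite derive1E; exact: DeriveDef.
pose P t := exists2 j, dom j (c t) & derive1 (cmap j \o c) t = X j (cmap j (c t)).
suff PT t : P t.
  move=> j t jt; have [k kt e] := PT t.
  by apply: (icurve_chart (cc t) kt) => //; rewrite -e; exact: du.
apply: (@real_ind _ P _ 0); last by exists i; rewrite c0.
move=> {i p c0 ip ci} t0.
have [i it] := sa_cover sM (c t0).
have [e e0 eP] := near_open (cc t0) (sa_dom sM i) it.
pose u := cmap i \o c; pose w (t : R) := derive1 u t - X i (u t).
have img_u (r : R) : `|r - t0| < e -> img i (u r) by move=> /eP; exact: img_cmap.
have dw (r : R) : `|r - t0| < e -> forall b k, is_derive r 1 (fun t => w t b k) ((- (w r *m along i (u r) (derive1 u r))) b k).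
  move: r => {}t te b k; have [_ d2 acc] := geo i t (eP t te).
  have h1 : is_derive t 1 (derive1 u) (- (derive1 u t *m along i (u t) (derive1 u t))).
    apply: DeriveDef => //; rewrite -derive1E; apply/rowP => l.
    have /eqP := acc l; rewrite addr_eq0 => /eqP ->; rewrite [RHS]mxE; congr (- _).
    rewrite mxE exchange_big; apply: eq_bigr => b' _; rewrite /along summxE mulr_sumr.
    apply: eq_bigr => a' _; rewrite [X in _ = _ * X]mxE lccE -/u; ring.
  have h2 := is_derive_X b k (img_u t te) (du i t (eP t te)).
  have h3 := is_deriveB (is_derive_mx b k h1) h2.
  have -> : (fun t => w t b k) = (fun t => derive1 u t b k) - (fun t => X i (u t) b k).
    by apply/funext => z; rewrite /w !mxE.
  apply: (is_derive_eq h3); rewrite -/u /w mulmxBl opprB.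
  by rewrite [X in _ - X]mxE [X in X - _]mxE [RHS]mxE [X in _ = _ + X]mxE opprK addrC.
pose q (t : R) := (w t *m g i (u t) *m (w t)^T) 0 0.
have dq (r : R) : `|r - t0| < e -> is_derive r 1 q 0.
  move: r => {}t te; have dwT b k : is_derive t 1 (fun t => (w t)^T b k) ((- (w t *m along i (u t) (derive1 u t)))^T b k).
    by under eq_fun do rewrite mxE; rewrite mxE; exact: dw.
  have h := is_derive_mulmx (is_derive_mulmx (dw t te)
    (fun b k => is_derive_metric_curve b k (img_u t te) (du i t (eP t te)))) dwT 0 0.
  have z (B : 'M[R]_1) : B = 0 -> B 0 0 = 0 by move=> ->; rewrite mxE.
  apply: (is_derive_eq h); apply: z; rewrite -/u; set Ga := along _ _ _.
  rewrite [(- _)^T]raddfN /= trmx_mul mulmxN mulNmx mulmxDr !mulmxA addrA addNr add0r.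
  exact: subrr.
have qc (s s' : R) : `|s - t0| < e -> `|s' - t0| < e -> q s = q s'.
  move=> se s'e; apply/eqP; rewrite -subr_eq0 -normr_le0.
  have := @mvt_real _ q (fun=> 0) s' s 0; rewrite mul0r; apply => r rP; last by rewrite normr0.
  apply: dq; apply: (@between_lt _ (s' - t0) (s - t0) (r - t0)) => //.
  by rewrite -addr_minl -addr_maxl !lerD2r.
exists e => // s s' se s'e [j js ej].
have ds : derive1 u s = X i (u s).
  have h := icurve_chart (cc s) js; rewrite -ej in h.
  have h' := h (du j s js) i (eP s se).
  by rewrite derive1E (@derive_val _ _ _ _ _ _ _ h').
have qs : q s' = 0 by rewrite -(qc s s') // /q /w ds subrr !mul0mx mxE.
exists i; first exact: eP.
apply/eqP; rewrite -subr_eq0; apply/eqP.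
have [//|w0] := eqVneq (w s') 0.
by have := metric_pos rg (img_u s' s'e) w0; rewrite -/(q s') qs ltxx.
Qed.

Lemma icurve_exists p : exists c, icurve c /\ c 0 = p.
Proof.
have [i ip] := sa_cover sM p; have [c [geo c0 ci]] := hcomplete (X i (cmap i p)) ip.
by exists c; split => //; exact: geodesic_icurve geo c0 ip ci.
Qed.

(** Disagreement is an open condition because [M] is Hausdorff; agreement is one by the local
    Lipschitz bound on [X] and Gronwall. *)
Lemma icurve_unique c1 c2 s : icurve c1 -> icurve c2 -> c1 s = c2 s -> forall t, c1 t = c2 t.
Proof.
move=> [cc1 d1] [cc2 d2] e12 t; apply: (@real_ind _ (fun t => c1 t = c2 t) _ s) => // {s t e12} t0.
have [eq0|ne0] := eqVneq (c1 t0) (c2 t0); last first.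
  have := hM; rewrite open_hausdorff => /(_ _ _ ne0)[[A B] /= [At Bt] [oA oB AB]].
  rewrite !inE in At Bt.
  have [e e0 eA] := near_open (cc1 t0) oA At; have [e' e'0 eB] := near_open (cc2 t0) oB Bt.
  exists (Num.min e e'); first by rewrite lt_min e0.
  move=> s s'; rewrite lt_min => /andP[se se'] _ h.
  have : (A `&` B) (c1 s) by split; [exact: eA|rewrite h; exact: eB].
  by move/eqP: AB => ->.
have [i it] := sa_cover sM (c1 t0).
have [rho [K [rho0 K0 ballO [_ _ _ lip _]]]] := tame_exists (sa_img sM (i := i)) (img_cmap it) (Xs i 2).
pose x0 := cmap i (c1 t0); pose V := dom i `&` cmap i @^-1` [set x | `|x - x0| < rho].
have oV : open V.
  apply: open_preim; [exact: (sa_dom sM)|by move=> q; exact: (sa_cmap sM)|exact: open_iball].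
have V1 : V (c1 t0) by split => //=; rewrite subrr normr0.
have V2 : V (c2 t0) by rewrite -eq0.
have [e1 e10 eV1] := near_open (cc1 t0) oV V1; have [e2 e20 eV2] := near_open (cc2 t0) oV V2.
(* The time from [s] to [s'] is below [2 * e], the interval given to [gronwall], which asks for
   [4 * K * e <= 1]. The bound by a quarter of [e1] and [e2] keeps [s + r] inside both
   neighbourhoods. *)
pose e := Num.min (Num.min e1 e2 / 4) (1 / (8 * K)).
have e0 : 0 < e by rewrite !lt_min !divr_gt0 ?mulr_gt0 // lt_min e10.
have [ee1 ee2] : 4 * e <= e1 /\ 4 * e <= e2.
  have : e <= Num.min e1 e2 / 4 by rewrite ge_min lexx.
  by rewrite ler_pdivlMr // le_min mulrC => /andP[].
have eK : 8 * K * e <= 1.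
  have : e <= 1 / (8 * K) by rewrite ge_min lexx orbT.
  by rewrite ler_pdivlMr ?mulr_gt0 // mulrC.
exists e => // s s' se s'e h.
pose v (r : R) := (cmap i \o c1) (s + r) - (cmap i \o c2) (s + r).
have loc (r : R) : `|r| < 2 * e -> V (c1 (s + r)) /\ V (c2 (s + r)).
  move=> re; have : `|s + r - t0| < 4 * e.
    rewrite addrAC; apply: le_lt_trans (ler_normD _ _) _; lra.
  by move=> h4; split; [apply: eV1|apply: eV2]; apply: lt_le_trans h4 _.
have L0 : 0 <= (0 : R) by [].
have dv (r : R) : `|r| < 2 * e -> is_derive r 1 v (X i ((cmap i \o c1) (s + r)) - X i ((cmap i \o c2) (s + r))).
  move=> re; have [[i1 _] [i2 _]] := loc r re.
  have h1 := is_derive_shift (d1 i _ i1); have h2 := is_derive_shift (d2 i _ i2).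
  exact: (is_deriveB h1 h2).
have := @gronwall _ _ _ v (fun r => X i ((cmap i \o c1) (s + r)) - X i ((cmap i \o c2) (s + r))) (2 * e) K 0
  (ltW K0) L0 _ dv.
have v0 : v 0 = 0 by rewrite /v addr0 /= h subrr.
rewrite v0 normr0 mul0r addr0 mulr0 => gr.
have vs : v (s' - s) = 0.
  apply/eqP; rewrite -normr_le0; apply: gr.
  - lra.
  - move=> r re; have [[i1 r1] [i2 r2]] := loc r re; rewrite addr0; exact: lip.
  - have -> : s' - s = (s' - t0) - (s - t0) by rewrite opprB addrA subrK.
    apply: le_lt_trans (ler_normB _ _) _; lra.
have s2e : `|s' - s| < 2 * e.
  have -> : s' - s = (s' - t0) - (s - t0) by rewrite opprB addrA subrK.
  apply: le_lt_trans (ler_normB _ _) _; lra.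
have [[i1 _] [i2 _]] := loc _ s2e; have e12' : s + (s' - s) = s' by rewrite addrC subrK.
move: vs i1 i2; rewrite /v e12' /= => /eqP.
by rewrite subr_eq0 => /eqP e12 i1 i2; rewrite -(sa_cmapK sM i1) e12 (sa_cmapK sM).
Qed.

Lemma icurve_shift c s : icurve c -> icurve (fun t => c (s + t)).
Proof.
move=> [cc dc]; split=> [t|i t it].
  by apply: continuous_comp; [apply: cvgD; [exact: cvg_cst|exact: cvg_id]|exact: cc].
by apply: (@is_derive_shift _ _ (cmap i \o c)); exact: dc.
Qed.

(** The integral curve is picked by choice; the constant curve is only the default value of [xget],
    and [icurve_exists] shows that it is never reached for lack of a curve. *)
Definition flow (t : R) (p : M) : M := xget (fun=> p) [set c | icurve c /\ c 0 = p] t.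

Lemma flow_icurve p : icurve (flow^~ p).
Proof.
have [c cP] := icurve_exists p; rewrite /flow.
by have [] := @xgetPex _ (fun=> p) [set c | icurve c /\ c 0 = p] (ex_intro _ c cP).
Qed.

Lemma flow0 p : flow 0 p = p.
Proof.
have [c cP] := icurve_exists p; rewrite /flow.
by have [] := @xgetPex _ (fun=> p) [set c | icurve c /\ c 0 = p] (ex_intro _ c cP).
Qed.

Lemma flowD s t p : flow (s + t) p = flow t (flow s p).
Proof.
apply: (@icurve_unique (fun t => flow (s + t) p) (flow^~ (flow s p)) 0).
- exact/icurve_shift/flow_icurve.
- exact: flow_icurve.
- by rewrite addr0 flow0.
Qed.

Lemma is_derive_flow i t p : dom i (flow t p) ->
  is_derive t 1 (cmap i \o (flow^~ p)) (X i (cmap i (flow t p))).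
Proof. by have [_] := flow_icurve p; exact. Qed.

Lemma flow_continuous p : continuous (flow^~ p).
Proof. by have [] := flow_icurve p. Qed.

(** The obstacle is that a curve might leave the chart domain although its coordinates never
    approach the boundary of the ball. The set [C] is compact, hence closed in the Hausdorff space
    [M], and this excludes such an escape; the speed bound keeps the curve away from the
    boundary. *)
Lemma flow_trap (i : chart M) x0 b K q t : 0 < b -> (forall x, `|x - x0| <= b -> img i x) ->
  (forall x, `|x - x0| <= b -> `|X i x| <= K) -> dom i q -> `|cmap i q - x0| < b / 2 ->
  K * `|t| < b / 2 -> dom i (flow t q) /\ `|cmap i (flow t q) - x0| < b.
Proof.
move=> b0 BO XK iq qb Kt.
have K0 : 0 <= K.
  by apply: le_trans (normr_ge0 _) (XK x0 _); rewrite subrr normr0 ltW.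
pose C : set M := cinv i @` [set x | `|x - x0| <= b].
have cC : closed C.
  apply: compact_closed => //; apply: continuous_compact.
    by apply: continuous_in_subspaceT => x; rewrite inE /= => /BO ix; exact: (sa_cinv sM).
  apply: bounded_closed_compact.
    exists (`|x0| + b); split => [|m hm x /= xb]; first exact: num_real.
    rewrite -[x](subrK x0); apply: le_trans (ler_normD _ _) _; lra.
  have -> : [set x | `|x - x0| <= b] = closed_ball x0 b.
    by rewrite closed_ballE //; apply/seteqP; split=> x; rewrite /closed_ball_ /= distrC.
  exact: closed_ball_closed.
have CP p : C p <-> dom i p /\ `|cmap i p - x0| <= b.
  split=> [[x xb <-]|[ip pb]]; last by exists (cmap i p) => //; exact: (sa_cmapK sM).
  by rewrite (cinvK sM (BO x xb)); split => //; exact: (dom_cinv sM (BO x xb)).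
pose c (s : R) := flow (s * t) q.
have cc s : {for s, continuous c}.
  apply: continuous_comp; last exact: flow_continuous.
  by apply: cvgM; [exact: cvg_id|exact: cvg_cst].
pose P s := forall r, 0 <= r <= s -> C (c r).
have bound s : P s -> 0 <= s <= 1 -> `|cmap i (c s) - x0| < b.
  move=> Ps s01.
  have := @mvt_mx _ _ _ (cmap i \o c) (fun r => t *: X i (cmap i (c r))) 0 s (K * `|t|).
  have /andP[s0 s1] := s01.
  rewrite /Num.min /Num.max; case: ltgtP s0 => // [s0 _|<- _ _]; last first.
    by rewrite /c mul0r flow0; apply: lt_trans qb _; lra.
  move=> h; have {h} : `|cmap i (c s) - cmap i (c 0)| <= K * `|t| * `|s - 0|.
    apply: h => r rs; have /CP[ir rb] := Ps r rs.
      exact: (is_derive_scale (is_derive_flow ir)).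
    by rewrite normrZ mulrC ler_wpM2r //; exact: XK.
  rewrite subr0 (ger0_norm (ltW s0)) /c mul0r flow0 -/(c s) => h.
  have -> : cmap i (c s) - x0 = (cmap i (c s) - cmap i q) + (cmap i q - x0) by rewrite addrA subrK.
  apply: le_lt_trans (ler_normD _ _) _; have : K * `|t| * s <= K * `|t|.
    by rewrite ler_piMr // mulr_ge0.
  by lra.
have o01 : 0 <= (1 : R) <= 1 by rewrite lexx ler01.
suff P1 : P 1.
  have /CP[] : C (c 1) by apply: P1.
  by have := bound 1 P1 o01; rewrite /c mul1r.
have z01 : 0 <= (0 : R) <= 1 by rewrite lexx ler01.
apply: (@segment_ind _ P 0 1 _ 0 1 z01 o01); last first.
  move=> r; rewrite -eq_le => /eqP <-; apply/CP; rewrite /c mul0r flow0; split => //.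
  by apply: ltW; apply: lt_trans qb _; lra.
move=> s0 s01; have [Ps0|] := pselect (P s0).
  have b1 := bound s0 Ps0 s01.
  have oV : open (dom i `&` cmap i @^-1` [set x | `|x - x0| < b]).
    by apply: open_preim; [exact: (sa_dom sM)|move=> p; exact: (sa_cmap sM)|exact: open_iball].
  have /CP[is0 _] : C (c s0) by apply: Ps0; have /andP[-> _] := s01; exact: lexx.
  have [e e0 eV] := near_open (cc s0) oV (conj is0 b1).
  exists e => // s s' sI s'I se s'e _ r /andP[r0 rs'].
  have [rs|sr] := leP r s0; first by apply: Ps0; rewrite r0.
  have /eV[ir rb] : `|r - s0| < e.
    by apply: le_lt_trans s'e; rewrite !ger0_norm ?subr_ge0 ?(ltW sr) //; [lra|lra].
  by apply/CP; split => //; exact: ltW.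
move=> /existsNP[r] /not_implyP[/andP[r0 rs] nC].
have [rs0|rs0] := ltP r s0.
  exists (s0 - r) => [|s s' sI s'I se s'e Ps]; first by rewrite subr_gt0.
  exfalso; apply: nC; apply: Ps; rewrite r0 /=.
  by move: se; rewrite ltr_norml => /andP[]; lra.
have er : r = s0 by apply/eqP; rewrite eq_le rs.
have oC : open (~` C) by rewrite openC.
rewrite er in nC; have [e e0 eV] := near_open (cc s0) oC nC.
exists e => // s s' sI s'I se s'e Ps; exfalso; apply: (eV s se); apply: Ps.
by have /andP[-> _] := sI; rewrite lexx.
Qed.

Definition flowmap (z : prod_atlas line M) : M := flow z.1 z.2.

Let sL : smooth_atlas (prod_atlas (line : atlas R 1) M).
Proof. exact: smooth_prod smooth_line sM. Qed.

Lemma flow_local k p : exists e V, [/\ 0 < e, open V, V p &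
  forall (s : R) q, `|s| < e -> V q -> smooth_at k flowmap ((s, q) : prod_atlas line M)].
Proof.
have [i ip] := sa_cover sM p; pose x0 := cmap i p.
have [rho [K [rho0 K0 ballO [_ XK _ _ _]]]] := tame_exists (sa_img sM (i := i)) (img_cmap ip) (Xs i 2).
have [a a0 flk] := flow_Ck k (sa_img sM (i := i)) (img_cmap ip) (Xs i).
pose b := Num.min a (rho / 2).
have b0 : 0 < b by rewrite lt_min a0 divr_gt0.
have ba : b <= a by rewrite ge_min lexx.
have brho : b < rho.
  have : b <= rho / 2 by rewrite ge_min lexx orbT.
  lra.
(* A curve that starts in the ball of radius [r = b / 2] moves by at most [K * d <= b / 4], so
   [flow_trap] keeps it in the ball of radius [b], where the hypotheses of [flow_Ck] hold. *)
pose d := Num.min a (b / (4 * K)); pose r := b / 2.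
have d0 : 0 < d by rewrite lt_min a0 divr_gt0 // mulr_gt0.
have da : d <= a by rewrite ge_min lexx.
have r0 : 0 < r by rewrite divr_gt0.
have ra : r <= a by rewrite /r; lra.
have dK : K * d <= b / 4.
  have : d <= b / (4 * K) by rewrite ge_min lexx orbT.
  rewrite ler_pdivlMr ?mulr_gt0 // => h; lra.
pose ph (t : R) x := cmap i (flow t (cinv i x)).
have trap (t : R) x : `|t| < d -> `|x - x0| < r -> img i x ->
    dom i (flow t (cinv i x)) /\ `|ph t x - x0| < b.
  move=> td xr ix; apply: (@flow_trap i x0 b K) => //.
  - by move=> y yb; apply: ballO; exact: le_lt_trans yb brho.
  - by move=> y yb; apply: XK; exact: le_lt_trans yb brho.
  - exact: (dom_cinv sM).
  - by rewrite (cinvK sM).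
  - have : K * `|t| <= K * d by rewrite ler_wpM2l // ltW.
    lra.
have BO x : `|x - x0| < r -> img i x by move=> xr; apply: ballO; rewrite /r in xr; apply: lt_trans xr _; lra.
have sol : solves (X i) ph x0 a d r.
  move=> x xr; have ix := BO x xr; split; first by rewrite /ph flow0 (cinvK sM).
  move=> t td; have [it tb] := trap t x td xr ix; split; first exact: lt_le_trans tb ba.
  exact: is_derive_flow.
exists d, (dom i `&` cmap i @^-1` [set x | `|x - x0| < r]); split => //.
- by apply: open_preim; [exact: (sa_dom sM)|move=> q; exact: (sa_cmap sM)|exact: open_iball].
- by split => //=; rewrite subrr normr0.
- move=> s q sd [iq /= qr].
  exists ((tt, i) : chart (prod_atlas line M)), i, (flow_domain x0 d r); split => //.
  - exact: open_flow_domain.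
  - by rewrite /flow_domain /= row_mxKl row_mxKr mxE.
  - move=> z [zd zr]; rewrite prod_img; split => /=; last exact: BO.
    by exists (lsubmx z 0 0) => //=; apply/rowP => c; rewrite ord1 mxE.
  - split; last exact: flk sol.
    by move=> z [zd zr]; have [] := trap _ _ zd zr (BO _ zr).
Qed.

(** By the group law, the flow near (s + t, p) is the map sending (r, q) to the flow of [flow s q]
    for the time [r - s], a composite of maps known to be smooth. *)
Lemma flow_compose k (s t : R) p : smooth_at k flowmap ((s, p) : prod_atlas line M) ->
  smooth_at k flowmap ((t, flow s p) : prod_atlas line M) ->
  smooth_at k flowmap ((s + t, p) : prod_atlas line M).
Proof.
move=> h1 h2.
pose sh (r : (line : atlas R 1)) : (line : atlas R 1) := (r : R) - s.
pose inner (z : prod_atlas line M) : M := flow s z.2.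
have si : smooth_at k inner ((s + t, p) : prod_atlas line M).
  have h0 : smooth_at k (fun _ : prod_atlas line M => (s : (line : atlas R 1))) ((s + t, p) : prod_atlas line M).
    by apply: smooth_at_cst; [exact: sL|exact: smooth_line].
  have h3 := smooth_at_pair sM sL h0 (smooth_at_snd smooth_line sM k (s + t, p)).
  exact: (smooth_at_comp sL sL sM h3 h1).
have ss : smooth_at k (fun z : prod_atlas line M => sh z.1) ((s + t, p) : prod_atlas line M).
  apply: (smooth_at_comp sL smooth_line smooth_line (smooth_at_fst smooth_line sM k (s + t, p))).
  apply: (@smooth_at_line R 1 line k sh ((s + t, p) : prod_atlas line M).1 tt smooth_line) => //.
  have oi : open (img (tt : chart (line : atlas R 1))) := sa_img smooth_line (i := tt).
  apply: (@eq_Ck _ _ _ _ _ (fun x : 'rV[R]_1 => x 0 0 - s)) => //.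
  apply: CkB => //; last exact: Ck_cst.
  by have /(Ck_mxP _ _ oi) : Ck k (img (tt : chart (line : atlas R 1))) id by exact: Ck_id; exact.
have sp := smooth_at_pair sM sL ss si.
have h2' : smooth_at k flowmap ((sh (s + t), inner (s + t, p)) : prod_atlas line M).
  by rewrite /sh addrC addKr.
have <- : flowmap \o (fun q : prod_atlas line M => (sh q.1, inner q)) = flowmap.
  apply/funext => -[r q]; rewrite /flowmap /= /sh /inner -flowD.
  by congr (flow _ _); rewrite addrC subrK.
exact: (smooth_at_comp sL sL sM sp h2').
Qed.

Theorem flow_smooth k z : smooth_at k flowmap z.
Proof.
case: z => t p; apply: (@real_ind _ (fun t => smooth_at k flowmap ((t, p) : prod_atlas line M)) _ 0); last first.
  have [e [V [e0 oV Vp h]]] := flow_local k p.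
  by apply: h => //; rewrite normr0.
move=> t0; have [e [V [e0 oV Vp h]]] := flow_local k (flow t0 p).
have [d d0 dV] := near_open (@flow_continuous p t0) oV Vp.
exists (Num.min d (e / 2)); first by rewrite lt_min d0 divr_gt0.
move=> s s'; rewrite !lt_min => /andP[sd se] /andP[s'd s'e] hs.
have -> : s' = s + (s' - s) by rewrite addrC subrK.
apply: flow_compose => //; apply: h; last exact: dV.
have -> : s' - s = (s' - t0) - (s - t0) by rewrite opprB addrA subrK.
apply: le_lt_trans (ler_normB _ _) _; lra.
Qed.

Lemma flow_slice k t p : smooth_at k (flow t) p.
Proof.
have h0 : smooth_at k (fun _ : M => (t : (line : atlas R 1))) p.
  by apply: smooth_at_cst; [exact: sM|exact: smooth_line].
have h := smooth_at_pair sM sM h0 (smooth_at_id k p sM).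
exact: (smooth_at_comp sM sL sM h (flow_smooth k _)).
Qed.

Lemma flow_diff i j t p : dom i p -> dom j (flow t p) -> differentiable (lrep (flow t) i j) (cmap i p).
Proof.
move=> ip jp; have [U [oU Up _ _ [d _]]] := smooth_at_charts sM sM (flow_slice 1 t p) ip jp.
exact: d.
Qed.

(** The flow preserves its own field: differentiate [flow t (flow s p) = flow s (flow t p)] at
    [s = 0]. *)
Lemma flow_field i j t p : dom i p -> dom j (flow t p) ->
  X j (cmap j (flow t p)) = X i (cmap i p) *m 'J (lrep (flow t) i j) (cmap i p).
Proof.
move=> ip jp; have df := flow_diff ip jp.
have ip0 : dom i (flow 0 p) by rewrite flow0.
have h1 : is_derive (0 : R) 1 (cmap i \o flow^~ p) (X i (cmap i p)).
  by have := is_derive_flow ip0; rewrite flow0.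
have df' : differentiable (lrep (flow t) i j) ((cmap i \o flow^~ p) 0) by rewrite /= flow0.
have h2 := is_derive_comp h1 df'.
have jp0 : dom j (flow 0 (flow t p)) by rewrite flow0.
have h3 := is_derive_flow jp0; rewrite flow0 in h3.
have e : \forall s \near (0 : R), (lrep (flow t) i j \o (cmap i \o flow^~ p)) s = (cmap j \o flow^~ (flow t p)) s.
  have [d d0 dV] := near_open (@flow_continuous p 0) (sa_dom sM i) ip0.
  apply/nbhs_ballP; exists d => //= s; rewrite -ball_normE /= distrC subr0 => sd.
  have /dV is_ : `|s - 0| < d by rewrite subr0.
  by rewrite /lrep /= (sa_cmapK sM is_) -!flowD addrC.
have h4 := near_eq_is_derive e h2.
have e0 : (cmap i \o flow^~ p) 0 = cmap i p by rewrite /= flow0.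
rewrite e0 derive_jacobian // in h4.
exact: (is_derive_uniq h3 h4).
Qed.

(** [Q t] is the metric at [p] pulled back by the time [t] map. By symmetry of second derivatives,
    the time derivative of the Jacobian is a space derivative of [X], which parallelism turns into
    minus a connection term; it cancels the derivative of the metric along the flow line, so [Q] is
    constant. *)
Lemma flow_isometry i j t p : dom i p -> dom j (flow t p) ->
  let J := 'J (lrep (flow t) i j) (cmap i p) in
  J *m g j (cmap j (flow t p)) *m J^T = g i (cmap i p).
Proof.
move=> ip; move: j; pose x0 := cmap i p.
pose Q t (j : chart M) := 'J (lrep (flow t) i j) x0 *m g j (cmap j (flow t p)) *m ('J (lrep (flow t) i j) x0)^T.
have chart_indep (r : R) j l : dom j (flow r p) -> dom l (flow r p) -> Q r j = Q r l.
  move: r => {}t jt lt_; have ov := overlapP jt lt_.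
  have e : 'J (lrep (flow t) i l) x0 = 'J (lrep (flow t) i j) x0 *m 'J (trans j l) (cmap j (flow t p)).
    have df := flow_diff ip jt.
    have eL : lrep (flow t) i j x0 = cmap j (flow t p) by rewrite /lrep /= /x0 (sa_cmapK sM ip).
    have dt : differentiable (trans j l) (lrep (flow t) i j x0) by rewrite eL; exact: (trans_diff sM ov).
    have := jacobian_comp df dt; rewrite eL => <-.
    have [U [oU Ux0 Ui Uj _]] := smooth_at_charts sM sM (flow_slice 1 t p) ip jt.
    have d1 := flow_diff ip lt_; have d2 := differentiable_comp df dt.
    apply/matrixP => a b; apply: etrans (jacobianE a b d1) _; apply: etrans _ (esym (jacobianE a b d2)).
    apply: near_eq_derive; apply: (open_near oU Ux0) => y Uy.
    by rewrite /lrep /= (trans_cmap sM) //; exact: Uj.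
  rewrite /Q e (metric_trans rg ov) (trans_cmap sM) // trmx_mul !mulmxA //.
pose P t := forall j, dom j (flow t p) -> Q t j = g i x0.
suff : P t by move=> h j jt; exact: h.
apply: (@real_ind _ P _ 0) => [{t} t0|]; last first.
  move=> j jp; rewrite (@chart_indep 0 j i) // ?flow0 // /Q flow0.
  have -> : 'J (lrep (flow 0) i i) x0 = 1%:M.
    have oi := sa_img sM (i := i); have ix0 : img i x0 := img_cmap ip.
    apply/matrixP => a b; rewrite jacobianE; last by apply: flow_diff; rewrite ?flow0.
    transitivity ('D_(bv a) (fun y : 'rV[R]_n => y 0 b) x0).
      apply: near_eq_derive; apply: (open_near oi ix0) => y iy.
      by rewrite /lrep /= flow0 (cinvK sM).
    have did : differentiable (id : 'rV[R]_n -> 'rV[R]_n) x0.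
      by have [d _] := @Ck_id R 'rV[R]_n 1 setT; exact: d.
    by rewrite -(derive_mxE _ _ _ did) derive_id !mxE eqxx /= eq_sym.
  by rewrite mul1mx trmx1 mulmx1.
have [j jt0] := sa_cover sM (flow t0 p).
have [U [oU Uz Ui Uj CU]] := @smooth_at_charts _ _ _ (prod_atlas line M) M 2 flowmap (t0, p) (tt, i) j sL sM
  (flow_smooth 2 (t0, p)) (conj I ip) jt0.
pose G := lrep flowmap ((tt, i) : chart (prod_atlas line M)) j.
(* [z t x] is the point (t, x), written as a line in the time direction [z0] so that derivatives
   along lines apply to it. *)
pose z0 : 'rV[R]_(1 + n) := row_mx (const_mx 1) 0.
pose z (t : R) x : 'rV[R]_(1 + n) := row_mx 0 x + t *: z0.
have zE t x : z t x = row_mx (const_mx t) x.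
  rewrite /z /z0 scale_row_mx add_row_mx scaler0 addr0 add0r; congr row_mx.
  by apply/matrixP => a b; rewrite !mxE mulr1.
have GE t x : G (z t x) = lrep (flow t) i j x.
  by rewrite zE /G /lrep /= row_mxKl row_mxKr mxE.
have cz (t : R) : {for t, continuous (fun t => z t x0)}.
  by apply: (@derive_continuous _ 1 _ _ t z0); exact: is_derive_affine.
have Uz0 : U (z t0 x0) by rewrite zE.
have [e e0 eU] := near_open (cz t0) oU Uz0.
have zsurj w : w = z (lsubmx w 0 0) (rsubmx w).
  apply: etrans (esym (hsubmxK w)) _; rewrite zE; congr row_mx; apply/matrixP => a b.
  by rewrite [RHS]mxE !ord1.
have Uimg w : U w -> img i (rsubmx w) by move=> /Ui; rewrite prod_img => -[].
have Ujj t x : U (z t x) -> dom j (flow t (cinv i x)).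
  by move=> /Uj; rewrite zE /flowmap /= row_mxKl row_mxKr mxE.
have dG w : U w -> differentiable G w by move=> Uw; have [d _] := CkS CU; exact: d.
have D0 w : U w -> 'D_z0 G w = X j (G w).
  move=> Uw; have dGw := dG w Uw; move: (Uw); rewrite (zsurj w); set t := lsubmx w 0 0; set x := rsubmx w => Uw'.
  have jt := Ujj t x Uw'.
  have h := is_derive_flow jt.
  have dGz : differentiable G (row_mx 0 x + t *: z0) by rewrite -/(z t x) -zsurj.
  have h2 := is_derive_line dGz.
  have e1 : (fun s => G (row_mx 0 x + s *: z0)) = cmap j \o flow^~ (cinv i x).
    by apply/funext => s; rewrite -/(z s x) GE.
  rewrite e1 in h2; rewrite -(@derive_val _ _ _ _ _ _ _ h2) (@derive_val _ _ _ _ _ _ _ h).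
  by rewrite GE.
pose zb (b : 'I_n) : 'rV[R]_(1 + n) := row_mx 0 (bv b).
have zD (t : R) x y : z t (x + y) = z t x + row_mx 0 y.
  by rewrite !zE add_row_mx addr0.
have dline (t : R) (H : 'rV[R]_(1 + n) -> R) b : differentiable H (z t x0) ->
    is_derive x0 (bv b) (fun x => H (z t x)) ('D_(zb b) H (z t x0)).
  move=> dH; have dH0 : differentiable H (z t x0 + (0 : R) *: zb b) by rewrite scale0r addr0.
  have cz1 : Ck 1 setT (z t).
    apply: (@eq_Ck _ _ _ _ _ (fun x => row_mx (const_mx t) x)); [exact: openT|by move=> x _; rewrite zE|].
    by apply: Ck_row_mx; [exact: openT|exact: Ck_cst|exact: Ck_id].
  have [dz _] := cz1.
  have dHz : differentiable (H \o z t) x0 by apply: differentiable_comp => //; exact: dz.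
  apply: DeriveDef; first exact: diff_derivable.
  have dHz0 : differentiable (H \o z t) (x0 + (0 : R) *: bv b) by rewrite scale0r addr0.
  have h1 := is_derive_lineR dHz0; have h2 := is_derive_lineR dH0.
  rewrite scale0r addr0 in h1; rewrite scale0r addr0 in h2.
  have e1 : (fun s : R => (H \o z t) (x0 + s *: bv b)) = (fun s => H (z t x0 + s *: zb b)).
    by apply/funext => s; rewrite /= zD /zb scale_row_mx scaler0.
  by rewrite e1 in h1; exact: (is_derive_uniq h1 h2).
have GcC c : Ck 2 U (fun w => G w 0 c) by have /(Ck_mxP _ _ oU) := CU; exact.
have JE (t : R) b c : U (z t x0) -> 'J (lrep (flow t) i j) x0 b c = 'D_(zb b) (fun w => G w 0 c) (z t x0).
  move=> Uzt; have jt := Ujj t x0 Uzt; rewrite (sa_cmapK sM) // in jt.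
  rewrite jacobianE; last exact: flow_diff.
  have [dGc _] := CkS (GcC c); have h := dline t _ b (dGc _ Uzt).
  rewrite -(@derive_val _ _ _ _ _ _ _ h).
  have <- : (fun x => G (z t x) 0 c) = (fun y => lrep (flow t) i j y 0 c) by apply/funext => x; rewrite GE.
  by [].
have dJ (t : R) : `|t - t0| < e -> forall b c, is_derive t 1 (fun t => 'J (lrep (flow t) i j) x0 b c)
    ((- ('J (lrep (flow t) i j) x0 *m along j (cmap j (flow t p)) (X j (cmap j (flow t p))))) b c).
  move=> te b c; have {}Uz := eU t te.
  have jt := Ujj t x0 Uz; rewrite (sa_cmapK sM) // in jt; have ijt := img_cmap jt.
  have [_ C1] := GcC c; have [dH _] := C1 (zb b).
  have h := is_derive_lineR (dH _ Uz : differentiable _ (row_mx 0 x0 + t *: z0)).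
  have h' : is_derive t 1 (fun t => 'J (lrep (flow t) i j) x0 b c)
      ('D_z0 ('D_(zb b) (fun w => G w 0 c)) (z t x0)).
    apply: near_eq_is_derive h.
    have nU : \forall s \near t, U (z s x0) := cz t U (open_nbhs_nbhs (conj oU Uz)).
    by apply: filterS nU => s Us; rewrite JE.
  apply: (is_derive_eq h'); rewrite (schwarz _ _ oU Uz (GcC c)).
  have eX : 'D_(zb b) ('D_z0 (fun w => G w 0 c)) (z t x0) = 'D_(zb b) ((fun y => X j y 0 c) \o G) (z t x0).
    apply: near_eq_derive; apply: (open_near oU Uz) => w Uw.
    by rewrite -derive_mxE ?D0 //; exact: dG.
  have eG : G (z t x0) = cmap j (flow t p) by rewrite GE /lrep /= (sa_cmapK sM).
  have [dX _] := Xs j 1.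
  have dXc : differentiable (fun y => X j y 0 c) (G (z t x0)).
    by rewrite eG; have := dX _ ijt; move/differentiable_mxP; exact.
  rewrite eX derive_comp //; last exact: dG.
  rewrite eG derive_rV; last by rewrite -eG.
  rewrite [RHS]mxE [in RHS]mxE -sumrN; apply: eq_bigr => d _.
  rewrite derive_mxE; last exact: dG.
  rewrite -JE // -mulrN; congr (_ * _).
  have hx := is_derive_entry (bv d) 0 c (Xs j 1) ijt.
  rewrite (@derive_val _ _ _ _ _ _ _ hx) Xpar // [LHS]mxE; congr (- _).
  rewrite mxE /along summxE; apply: eq_bigr => l _.
  (* Absence of torsion enters here: it turns the derivative of [X] in the direction [d] into row
     [d] of the connection matrix in the direction of [X]. *)
  by rewrite [RHS]mxE lcc_sym.
have dQ (t : R) : `|t - t0| < e -> forall a b, is_derive t 1 (fun t => Q t j a b) 0.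
  move=> te a b; have {}Uz := eU t te.
  have jt := Ujj t x0 Uz; rewrite (sa_cmapK sM) // in jt; have ijt := img_cmap jt.
  have hJ := dJ t te; have hg := fun b c => is_derive_metric_curve b c ijt (is_derive_flow jt).
  have hJT b' c' : is_derive t 1 (fun t => ('J (lrep (flow t) i j) x0)^T b' c')
     ((- ('J (lrep (flow t) i j) x0 *m along j (cmap j (flow t p)) (X j (cmap j (flow t p)))))^T b' c').
    by under eq_fun do rewrite mxE; rewrite mxE; exact: hJ.
  have h := is_derive_mulmx (is_derive_mulmx hJ hg) hJT a b.
  have zz (B : 'M[R]_n) : B = 0 -> B a b = 0 by move=> ->; rewrite mxE.
  apply: (is_derive_eq h); apply: zz; rewrite /=; set Ga := along _ _ _.
  rewrite [(- _)^T]raddfN /= trmx_mul mulmxN mulNmx mulmxDr !mulmxA addrA addNr add0r.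
  exact: subrr.
have Qc s s' : `|s - t0| < e -> `|s' - t0| < e -> Q s j = Q s' j.
  move=> se s'e; apply/matrixP => a b; apply/eqP; rewrite -subr_eq0 -normr_le0.
  have := @mvt_real _ (fun t => Q t j a b) (fun=> 0) s' s 0; rewrite mul0r; apply => r rP; last by rewrite normr0.
  apply: dQ; apply: (@between_lt _ (s' - t0) (s - t0) (r - t0)) => //.
  by rewrite -addr_minl -addr_maxl !lerD2r.
exists e => // s s' se s'e Ps l ls'.
have js : dom j (flow s p) by have := Ujj s x0 (eU s se); rewrite (sa_cmapK sM).
have js' : dom j (flow s' p) by have := Ujj s' x0 (eU s' s'e); rewrite (sa_cmapK sM).
by rewrite (chart_indep s' l j) // (Qc s' s) // Ps.
Qed.

End Flow.

(** * Topology of a subset *)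

Section SubtypeTopology.
Context {X : topologicalType} (A : set X).

Lemma nbhs_val (p : A) (U : set A) : nbhs p U ->
  exists V, [/\ open V, V (set_val p) & forall q : A, V (set_val q) -> U q].
Proof. rewrite nbhsE => -[B [[V oV <-] Bp] BU]; exists V; split => //. Qed.

Lemma val_continuous : continuous (set_val : A -> X).
Proof. exact: initial_continuous. Qed.

Lemma hausdorff_val : hausdorff_space X -> hausdorff_space A.
Proof.
move=> h p q cl; apply: val_inj; apply: h => U V Up Vq.
have [z [Uz Vz]] := cl _ _ (val_continuous Up) (val_continuous Vq).
by exists (set_val z).
Qed.

Lemma second_countable_val : @second_countable X -> @second_countable A.
Proof.
move=> [B cB [oB bB]]; exists [set set_val @^-1` V | V in B].
  exact: card_le_trans (card_image_le _ _) cB.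
split=> [_ [V BV <-]|p U /nbhs_val[V [oV Vp VU]]]; first by exists V => //; exact: oB.
have [W [BW Wp] WV] := bB (set_val p) V (open_nbhs_nbhs (conj oV Vp)).
by exists (set_val @^-1` W); [split => //; exists W|move=> q Wq; apply: VU; exact: WV].
Qed.

Lemma continuous_at_val (Y : topologicalType) (f : Y -> A) (y : Y) :
  {for y, continuous (set_val \o f)} -> {for y, continuous f}.
Proof.
move=> cf U /nbhs_val[V [oV Vp VU]].
have : nbhs y ((set_val \o f) @^-1` V) by apply: cf; exact: open_nbhs_nbhs.
by apply: filterS => z Vz; exact: VU.
Qed.

End SubtypeTopology.

(** * The zero level of the potential as an oriented Riemannian hypersurface *)

Section Slice.
Context {R : realType} {n : nat} (M : atlas R (n + 1)) (sM : smooth_atlas M).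
Context (g : metric M) (rg : riemannian g).
Context (f : M -> R) (fs : forall i : chart M, smooth_on (img i) (f \o cinv i : 'rV[R]_(n + 1) -> R)).

Definition gradf (i : chart M) x : 'rV[R]_(n + 1) := grad i f x.
Definition normal (i : chart M) x : 'rV[R]_(n + 1) := gradf i x *m invmx (g i x).

Context (fu : forall (i : chart M) x, img i x -> normal i x *m (gradf i x)^T = 1%:M).

Definition slice : Type := [set p | f p = 0].

(* Affine coordinates [x |-> (x - base) *m invmx basis] adapted to the slice,
   which is the graph of [height] over a ball. *)
Record slice_chart := SliceChart {
  amb : chart M; base : 'rV[R]_(n + 1); basis_mx : 'M[R]_(n + 1);
  rad : R; tall : R; height : 'rV[R]_n -> R;
  det_basis : 0 < \det basis_mx;
  rad_gt0 : 0 < rad; tall_gt0 : 0 < tall;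
  chart_box : forall y t, `|y - 0| < rad -> `|t - 0| <= tall -> img amb (base + pt y t *m basis_mx);
  chart_pos : forall y t, `|y - 0| < rad -> `|t - 0| <= tall ->
    0 < 'D_(vert n) ((f \o cinv amb) \o (fun z => base + z *m basis_mx)) (pt y t);
  heightP : forall y, `|y - 0| < rad -> [/\ `|height y - 0| < tall,
    f (cinv amb (base + pt y (height y) *m basis_mx)) = 0 &
    forall t, `|t - 0| < tall -> f (cinv amb (base + pt y t *m basis_mx)) = 0 -> t = height y] }.

Definition affine (c : slice_chart) (z : 'rV[R]_(n + 1)) := base c + z *m basis_mx c.
Definition coaffine (c : slice_chart) (x : 'rV[R]_(n + 1)) := (x - base c) *m invmx (basis_mx c).

Lemma basis_unit c : basis_mx c \in unitmx.
Proof. by rewrite unitmxE unitfE gt_eqF // det_basis. Qed.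

Lemma affineK c : cancel (affine c) (coaffine c).
Proof. by move=> z; rewrite /coaffine /affine addrC addKr mulmxK // basis_unit. Qed.

Lemma coaffineK c : cancel (coaffine c) (affine c).
Proof. by move=> z; rewrite /coaffine /affine mulmxKV ?basis_unit // addrC subrK. Qed.

Lemma Ck_affine c k U : open U -> Ck k U (affine c).
Proof.
by move=> oU; apply: CkD => //; [exact: Ck_cst|apply: Ck_mulmx => //; [exact: Ck_id|exact: Ck_cst]].
Qed.

Lemma Ck_coaffine c k U : open U -> Ck k U (coaffine c).
Proof.
move=> oU; apply: Ck_mulmx => //; last exact: Ck_cst.
by apply: CkD => //; [exact: Ck_id|exact: Ck_cst].
Qed.

Definition slab c : set 'rV[R]_(n + 1) := [set z | `|lsubmx z| < rad c /\ `|rsubmx z 0 0| < tall c].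

Lemma open_slab c : open (slab c).
Proof.
have -> : slab c = (fun z : 'rV[R]_(n + 1) => lsubmx z : 'rV[R]_n) @^-1` [set y | `|y - 0| < rad c] `&`
    (fun z : 'rV[R]_(n + 1) => rsubmx z : 'rV[R]_1) @^-1` [set y | `|y - 0| < tall c].
  apply/seteqP; split=> z /=; rewrite /slab /= !subr0 => -[h1 h2]; split => //.
    apply: mx_normr_lt => [|i j]; first exact: tall_gt0.
    by rewrite !ord1.
  by apply: le_lt_trans h2; exact: mx_normr_ge.
apply: openI.
  have := @open_preim _ _ setT [set y : 'rV[R]_n | `|y - 0| < rad c] (@lsubmx R 1 n 1) openT; rewrite setTI; apply.
    by move=> x _; exact: continuous_lsubmx.
  exact: open_iball.
have := @open_preim _ _ setT [set y : 'rV[R]_1 | `|y - 0| < tall c] (@rsubmx R 1 n 1) openT; rewrite setTI; apply.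
  by move=> x _; exact: continuous_rsubmx.
exact: open_iball.
Qed.

Lemma slab_pt c y t : slab c (pt y t) <-> `|y| < rad c /\ `|t| < tall c.
Proof. by rewrite /slab /pt /= row_mxKl row_mxKr mxE eqxx mulr1n. Qed.

Lemma ptE (z : 'rV[R]_(n + 1)) : z = pt (lsubmx z) (rsubmx z 0 0).
Proof. by rewrite /pt -[LHS]hsubmxK -mx11_scalar. Qed.

Definition embed c (y : 'rV[R]_n) : 'rV[R]_(n + 1) := affine c (pt y (height c y)).

Definition sdom (c : slice_chart) : set slice :=
  [set p | dom (amb c) (set_val p) /\ slab c (coaffine c (cmap (amb c) (set_val p)))].

Definition smap (c : slice_chart) (p : slice) : 'rV[R]_n :=
  lsubmx (coaffine c (cmap (amb c) (set_val p))).

Context (p0 : slice).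

(** The inverse chart is obtained by choice, with default value [p0] outside the ball; this is why a
    point of the slice is a parameter of the atlas. *)
Definition sinv (c : slice_chart) (y : 'rV[R]_n) : slice :=
  xget p0 [set p | sdom c p /\ smap c p = y].

Definition slice_atlas : atlas R n := @Atlas R n [set p | f p = 0] slice_chart sdom smap sinv.

Local Notation N := slice_atlas.

Definition ball0 c : set 'rV[R]_n := [set y | `|y| < rad c].

Lemma open_ball0 c : open (ball0 c).
Proof.
have -> : ball0 c = [set y | `|y - 0| < rad c] by apply/seteqP; split=> y; rewrite /ball0 /= subr0.
exact: open_iball.
Qed.

Lemma embed_img c y : ball0 c y -> img (amb c) (embed c y).
Proof.
move=> yb; have yr : `|y - 0| < rad c by rewrite subr0.
have [h _ _] := heightP yr.
by apply: chart_box => //; exact: ltW.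
Qed.

Lemma embed_slice c y : ball0 c y -> f (cinv (amb c) (embed c y)) = 0.
Proof.
move=> yb; have yr : `|y - 0| < rad c by rewrite subr0.
by have [_ h _] := heightP yr. Qed.

Lemma coaffine_embed c y : coaffine c (embed c y) = pt y (height c y).
Proof. exact: affineK. Qed.

Lemma slice_valP (p : slice) : f (set_val p) = 0.
Proof. by have := set_valP p. Qed.

(** Along the vertical segment over [smap c p] the function [f] has a single zero, the height; the
    last adapted coordinate of [p] is also a zero. *)
Lemma embed_smap c p : sdom c p -> embed c (smap c p) = cmap (amb c) (set_val p).
Proof.
move=> [ip [h1 h2]]; rewrite /embed -[RHS](coaffineK c); congr (affine c _).
rewrite [RHS]ptE -/(smap c p); congr pt; have yr : `|smap c p - 0| < rad c by rewrite subr0.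
have [_ _ uniq] := heightP yr; apply/esym/uniq; first by rewrite subr0.
rewrite -ptE -/(affine c _) coaffineK (sa_cmapK sM) //; exact: slice_valP.
Qed.

Lemma smap_ball c p : sdom c p -> ball0 c (smap c p).
Proof. by case=> ip []. Qed.

Lemma embed_dom c y : ball0 c y -> exists p : slice, [/\ set_val p = cinv (amb c) (embed c y), sdom c p & smap c p = y].
Proof.
move=> yb; have fp := embed_slice yb; have pin : cinv (amb c) (embed c y) \in [set p | f p = 0] by rewrite inE.
pose p : slice := SigSub pin; have ep : set_val p = cinv (amb c) (embed c y) by [].
have yr : `|y - 0| < rad c by rewrite subr0.
have [ht _ _] := heightP yr; rewrite subr0 in ht.
have e1 : coaffine c (cmap (amb c) (set_val p)) = pt y (height c y).
  by rewrite ep (cinvK sM) ?coaffine_embed //; exact: embed_img.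
exists p; split => //; last by rewrite /smap e1 row_mxKl.
split; first by rewrite ep; apply: (dom_cinv sM); exact: embed_img.
by rewrite e1; apply/slab_pt.
Qed.

Lemma smap_inj c p q : sdom c p -> sdom c q -> smap c p = smap c q -> p = q.
Proof.
move=> cp cq e; apply: val_inj; have [ip _] := cp; have [iq _] := cq.
rewrite -[LHS](sa_cmapK sM ip) -[RHS](sa_cmapK sM iq); congr (cinv _ _).
by rewrite -!embed_smap // e.
Qed.

Lemma sinvK c y : ball0 c y -> sdom c (sinv c y) /\ smap c (sinv c y) = y.
Proof.
move=> yb; have [p [_ cp ep]] := embed_dom yb.
exact: (@xgetPex _ p0 [set p | sdom c p /\ smap c p = y] (ex_intro _ p (conj cp ep))).
Qed.

Lemma smapK c p : sdom c p -> sinv c (smap c p) = p.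
Proof. by move=> cp; have [c1 c2] := sinvK (smap_ball cp); exact: smap_inj c1 cp c2. Qed.

Lemma val_sinv c y : ball0 c y -> set_val (sinv c y) = cinv (amb c) (embed c y).
Proof.
move=> yb; have [p [ep cp sp]] := embed_dom yb; rewrite -ep; congr set_val.
by rewrite -sp smapK.
Qed.

Lemma simg c : img (c : chart N) = ball0 c.
Proof.
apply/seteqP; split=> [_ [p cp <-]|y yb]; first exact: smap_ball.
by have [h1 h2] := sinvK yb; exists (sinv c y).
Qed.

Lemma height_smooth c k : Ck k (ball0 c) (height c).
Proof.
pose G := (f \o cinv (amb c)) \o affine c.
pose Om := affine c @^-1` img (amb c).
have oOm : open Om.
  have := @open_preim _ _ setT (img (amb c)) (affine c) openT; rewrite setTI; apply.
    by move=> x _; apply: (Ck_continuous (k := 0) (U := setT)) => //; apply: Ck_affine; exact: openT.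
  exact: (sa_img sM).
have Gs : smooth_on Om G.
  move=> m; apply: (Ck_comp (O := img (amb c))) => //; [exact: (sa_img sM)|exact: Ck_affine|exact: fs].
have -> : ball0 c = iball 0 (rad c) by apply/seteqP; split=> y; rewrite /ball0 /iball /= subr0.
exact: (implicit_smooth oOm Gs (@chart_box c) (@chart_pos c) (@heightP c)).
Qed.

Lemma embed_smooth c : smooth_on (ball0 c) (embed c).
Proof.
move=> k; have oB := @open_ball0 c.
have oT : open (setT : set 'rV[R]_(n + 1)) := openT.
apply: (Ck_comp_mx (O := setT) (f := fun y => pt y (height c y))) => //; last exact: Ck_affine.
by apply: Ck_pt => //; [exact: Ck_id|exact: height_smooth].
Qed.

(** The slice coordinates are the first [n] of a system of smooth coordinates of [M], so smoothness
    as a map into [M] is enough. *)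
Lemma smooth_into_slice l (L : atlas R l) k (F : L -> N) p : smooth_atlas L ->
  (exists c : slice_chart, sdom c (F p)) ->
  smooth_at k (fun q => set_val (F q) : M) p -> smooth_at k F p.
Proof.
move=> sL [c cF] sF; have [i ip] := sa_cover sL p; have [jF slF] := cF.
have [U [oU Up Ui Uj CU]] := smooth_at_charts sL sM sF ip jF.
pose h x := coaffine c (lrep (fun q => set_val (F q) : M) i (amb c) x).
have hk : Ck k U h.
  have oT : open (setT : set 'rV[R]_(n + 1)) := openT.
  by apply: (Ck_comp_mx (O := setT)) => //; exact: Ck_coaffine.
have ch x : U x -> {for x, continuous h} by exact: Ck_continuous hk.
have oW : open (U `&` h @^-1` slab c) := open_preim oU ch (@open_slab c).
exists i, (c : chart N), (U `&` h @^-1` slab c); split => //.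
- by split => //=; rewrite /h /lrep /= (sa_cmapK sL).
- by move=> x [/Ui].
- split=> [x [Ux sx]|]; first by split; [exact: Uj|].
  by apply: Ck_lsubmx => //; apply: sub_Ck hk => x [].
Qed.

Context (frames : forall (i : chart M) x, img i x -> exists E : 'M[R]_(n + 1),
  0 < \det E /\ dsubmx E = normal i x).

Lemma gradfE (i : chart M) x v : img i x -> 'D_v (f \o cinv i : 'rV[R]_(n + 1) -> R) x = (v *m (gradf i x)^T) 0 0.
Proof.
move=> ix; have [d _] := fs i 1; rewrite derive_rV; last exact: d.
by rewrite mxE; apply: eq_bigr => a _; rewrite !mxE.
Qed.

(** The last basis vector is the normal, along which [f] has derivative 1 at [p]. On a small box the
    vertical derivative stays positive and [f] changes sign between bottom and top, so the implicit
    function theorem applies. *)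
Lemma slice_chart_exists (p : slice) : exists c, sdom c p.
Proof.
have [i ip] := sa_cover sM (set_val p); pose x := cmap i (set_val p); have ix : img i x := img_cmap ip.
have [E [dE lE]] := frames ix.
have uE : E \in unitmx by rewrite unitmxE unitfE gt_eqF.
pose aff (z : 'rV[R]_(n + 1)) := x + z *m E.
have oT : open (setT : set 'rV[R]_(n + 1)) := openT.
have affC k : Ck k setT aff.
  by apply: CkD => //; [exact: Ck_cst|apply: Ck_mulmx => //; [exact: Ck_id|exact: Ck_cst]].
pose Om := aff @^-1` img i.
have oOm : open Om.
  have := @open_preim _ _ setT (img i) aff openT; rewrite setTI; apply; last exact: (sa_img sM).
  by move=> z _; exact: (Ck_continuous (affC 0)).
have aff0 : aff 0 = x by rewrite /aff mul0mx addr0.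
have Om0 : Om 0 by rewrite /Om /= aff0.
pose G := (f \o cinv i : 'rV[R]_(n + 1) -> R) \o aff.
have Gs : smooth_on Om G.
  by move=> k; apply: (Ck_comp (O := img i)) => //; [exact: (sa_img sM)|apply: sub_Ck (affC k)|exact: fs].
have G0 : G 0 = 0 by rewrite /G /= aff0 (sa_cmapK sM) //; exact: slice_valP.
have GV : 'D_(vert n) G 0 = 1.
  have [da _] := affC 1; have da0 : differentiable aff 0 by exact: da.
  have df0 : differentiable (f \o cinv i : 'rV[R]_(n + 1) -> R) (aff 0).
    by rewrite aff0; have [d _] := fs i 1; exact: d.
  rewrite /G derive_comp // aff0 gradfE //.
  have -> : 'D_(vert n) aff 0 = vert n *m E.
    have hl : is_derive (0 : R) 1 (fun s : R => x + s *: (vert n *m E)) (vert n *m E) by exact: is_derive_affine.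
    have da00 : differentiable aff (0 + (0 : R) *: vert n) by rewrite scale0r addr0.
    have h2 := is_derive_line da00; rewrite scale0r addr0 in h2.
    have e : (fun s => aff (0 + s *: vert n)) = (fun s : R => x + s *: (vert n *m E)).
      by apply/funext => s; rewrite add0r /aff scalemxAl.
    by rewrite e in h2; exact: (is_derive_uniq h2 hl).
  have -> : vert n *m E = normal i x.
    by rewrite -lE -[in LHS](vsubmxK E) /vert /pt mul_row_col mul0mx add0r mul_scalar_mx scale1r.
  by rewrite fu // mxE eqxx.
have [dl dl0 dlP] : exists2 dl, 0 < dl & forall z, `|z| < dl -> Om z /\ 0 < 'D_(vert n) G z.
  have [_ G1] := Gs 1; have cG := G1 (vert n).
  have n1 : \forall z \near (0 : 'rV[R]_(n + 1)), Om z by exact: open_nbhs_nbhs.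
  have n2 : \forall z \near (0 : 'rV[R]_(n + 1)), 0 < 'D_(vert n) G z.
    have h : 'D_(vert n) G 0 > 0 by rewrite GV.
    have c0 : {for 0, continuous ('D_(vert n) G)} by exact: cG.
    by apply: (c0 [set y : R | 0 < y]); apply: open_nbhs_nbhs; split => //; exact: open_gt.
  have : \forall z \near (0 : 'rV[R]_(n + 1)), Om z /\ 0 < 'D_(vert n) G z by apply: filterS2 n1 n2.
  move=> /nbhs_ballP[dl /= dl0 P]; exists dl => // z zd; apply: P.
  by rewrite -ball_normE /= sub0r normrN.
pose rho := dl / 4; have rho0 : 0 < rho by rewrite divr_gt0.
have ptdl y t : `|y| < rho -> `|t| <= rho -> `|pt y t : 'rV[R]_(n + 1)| < dl.
  by move=> yr tr; apply: le_lt_trans (pt_norm _ _) _; rewrite /rho in yr tr; lra.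
have box y t : `|y - 0| < rho -> `|t - 0| <= rho -> Om (pt y t).
  by rewrite !subr0 => yr tr; have [] := dlP _ (ptdl y t yr tr).
have pos y t : `|y - 0| < rho -> `|t - 0| <= rho -> 0 < 'D_(vert n) G (pt y t).
  by rewrite !subr0 => yr tr; have [] := dlP _ (ptdl y t yr tr).
have p00 : pt 0 0 = 0 :> 'rV[R]_(n + 1) by rewrite /pt raddf0 row_mx0.
have z0 : `|0 - 0 : 'rV[R]_n| < rho by rewrite subrr normr0.
have m0 : `|0 - 0 : R| <= rho by rewrite subrr normr0 ltW.
have G1 : G (pt 0 (0 - rho)) < 0.
  have m1 : `|0 - rho - 0| <= rho by rewrite subr0 sub0r normrN gtr0_norm.
  have lt0 : 0 - rho < 0 by rewrite sub0r oppr_lt0.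
  by have := implicit_incr Gs box pos z0 m1 m0 lt0; rewrite p00 G0.
have G2 : 0 < G (pt 0 (0 + rho)).
  have m1 : `|0 + rho - 0| <= rho by rewrite subr0 add0r gtr0_norm.
  have lt0 : 0 < 0 + rho by rewrite add0r.
  by have := implicit_incr Gs box pos z0 m0 m1 lt0; rewrite p00 G0.
have [r r0 rP] : exists2 r, 0 < r & forall y, `|y - 0| < r -> `|y - 0| < rho /\ G (pt y (0 - rho)) < 0 < G (pt y (0 + rho)).
  have cq t : `|t| <= rho -> {for 0, continuous (fun y : 'rV[R]_n => G (pt y t))}.
    move=> tr; apply: (@continuous_comp _ _ _ (fun y : 'rV[R]_n => pt y t) G).
      exact: continuous_pt.
    by apply: (Ck_continuous (Gs 0)); apply: box; rewrite ?subr0 // normr0.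
  have m1 : `|0 - rho| <= rho by rewrite sub0r normrN gtr0_norm.
  have m2 : `|0 + rho| <= rho by rewrite add0r gtr0_norm.
  have n1 : \forall y \near (0 : 'rV[R]_n), G (pt y (0 - rho)) < 0.
    by apply: (cq _ m1 [set y : R | y < 0]); apply: open_nbhs_nbhs; split => //; exact: open_lt.
  have n2 : \forall y \near (0 : 'rV[R]_n), 0 < G (pt y (0 + rho)).
    by apply: (cq _ m2 [set y : R | 0 < y]); apply: open_nbhs_nbhs; split => //; exact: open_gt.
  have n3 : \forall y \near (0 : 'rV[R]_n), G (pt y (0 - rho)) < 0 < G (pt y (0 + rho)).
    by apply: filterS2 n1 n2 => y -> ->.
  move: n3 => /nbhs_ballP[r /= r0 P]; exists (Num.min r rho); first by rewrite lt_min r0.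
  move=> y; rewrite lt_min => /andP[yr yrho]; split => //; apply: P.
  by rewrite -ball_normE /= distrC.
have rbox y t : `|y - 0| < r -> `|t - 0| <= rho -> Om (pt y t) by move=> /rP[h _]; exact: box.
have rpos y t : `|y - 0| < r -> `|t - 0| <= rho -> 0 < 'D_(vert n) G (pt y t) by move=> /rP[h _]; exact: pos.
have rneg y : `|y - 0| < r -> G (pt y (0 - rho)) < 0 < G (pt y (0 + rho)) by move=> /rP[].
have [eta etaP] := implicit_exists rho0 Gs rbox rpos rneg.
pose c := SliceChart dE r0 rho0 rbox rpos etaP.
exists c; split => //.
have -> : coaffine c (cmap i (set_val p)) = pt 0 0.
  by rewrite p00 /coaffine /= -/x subrr mul0mx.
by apply/slab_pt; rewrite !normr0.
Qed.

Lemma overlap_slice (c d : chart N) y : overlap c d y ->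
  [/\ ball0 c y, ball0 d (trans c d y), overlap (amb c) (amb d) (embed c y) &
    embed d (trans c d y) = trans (amb c) (amb d) (embed c y)].
Proof.
move=> [p [cp dp] <-]; have [ip _] := cp; have [jp _] := dp.
have e : trans c d (smap c p) = smap d p by rewrite /trans /= smapK.
have ec : embed c (cmap c p) = cmap (amb c) (set_val p) by exact: embed_smap.
rewrite -/(smap c p) in ec *; rewrite e ec; split.
- exact: smap_ball.
- exact: smap_ball.
- exact: overlapP.
- by rewrite embed_smap // (trans_cmap sM).
Qed.

Lemma open_sdom c : open (sdom c : set N).
Proof.
exists (dom (amb c) `&` (coaffine c \o cmap (amb c)) @^-1` slab c) => //.
apply: open_preim; [exact: (sa_dom sM)| |exact: open_slab].
move=> q iq; apply: continuous_comp; first exact: (sa_cmap sM).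
have oT : open (setT : set 'rV[R]_(n + 1)) := openT.
exact: (Ck_continuous (@Ck_coaffine c 0 setT oT)).
Qed.

Lemma embed_cont c y : ball0 c y -> {for y, continuous (embed c)}.
Proof. exact: Ck_continuous ((@embed_smooth c 0)). Qed.

Lemma smooth_slice : smooth_atlas N.
Proof.
have od c : open (sdom c : set N) := open_sdom c.
have oi (c : chart N) : open (img c) by rewrite simg; exact: open_ball0.
have cK (c : chart N) p : dom c p -> cinv c (cmap c p) = p by exact: smapK.
have oT : open (setT : set 'rV[R]_(n + 1)) := openT.
have cm (c : chart N) p : dom c p -> {for p, continuous (cmap c)}.
  move=> [ip sp]; apply: (@continuous_comp _ _ _ (fun q : N => coaffine c (cmap (amb c) (set_val q))) (@lsubmx R 1 n 1)); last exact: continuous_lsubmx.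
  apply: (@continuous_comp _ _ _ (fun q : N => cmap (amb c) (set_val q)) (coaffine c)); last first.
    exact: (Ck_continuous (@Ck_coaffine c 0 setT oT)).
  apply: (@continuous_comp _ _ _ (fun q : N => set_val q) (cmap (amb c))); last exact: (sa_cmap sM).
  exact: val_continuous.
have ci (c : chart N) y : img c y -> {for y, continuous (cinv c)}.
  rewrite simg => yb; apply: continuous_at_val.
  have nb : \forall z \near y, (cinv (amb c) \o embed c) z = (set_val \o (sinv c)) z.
    by apply: (open_near (@open_ball0 c) yb) => z zb; rewrite /= val_sinv.
  have cc : {for y, continuous (cinv (amb c) \o embed c)}.
    apply: continuous_comp; first exact: embed_cont.
    by apply: (sa_cinv sM); exact: embed_img.
  move=> V; rewrite /= val_sinv // => nV; have := cc V nV.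
  by apply: filterS2 nb => z /= ->.
split => //; first exact: slice_chart_exists.
move=> c d k.
have oo : open (overlap c d).
  have -> : overlap c d = img c `&` cinv c @^-1` (dom d).
    apply/seteqP; split=> [_ [p [cp dp] <-]|y [cy dy]].
      by split; [exists p|change (sdom d (sinv c (smap c p))); rewrite smapK].
    exists (cinv c y); last first.
      by case: cy => p cp <-; rewrite cK.
    by split => //; case: cy => p cp <-; rewrite cK.
  by apply: open_preim => //; exact: ci.
apply: (@eq_Ck _ _ _ _ _ (fun y => lsubmx (coaffine d (trans (amb c) (amb d) (embed c y))))) => //.
  move=> y /overlap_slice[_ yd _ <-].
  by rewrite coaffine_embed row_mxKl.
apply: Ck_lsubmx => //.
apply: (Ck_comp_mx (O := setT) (f := fun y => trans (amb c) (amb d) (embed c y))) => //; last exact: Ck_coaffine.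
apply: (Ck_comp_mx (O := overlap (amb c) (amb d))) => //.
- exact: open_overlap.
- by move=> y /overlap_slice[].
- by apply: sub_Ck (@embed_smooth c k) => y /overlap_slice[].
- exact: (sa_trans sM).
Qed.

Definition Jemb (c : chart N) y : 'M[R]_(n, n + 1) := 'J (embed c) y.

Lemma embed_diff (c : chart N) y : ball0 c y -> differentiable (embed c) y.
Proof. by move=> yb; have [d _] := @embed_smooth c 1; exact: d. Qed.

Lemma Jemb_trans (c d : chart N) y : overlap c d y ->
  Jemb c y *m 'J (trans (amb c) (amb d)) (embed c y) = 'J (trans c d) y *m Jemb d (trans c d y).
Proof.
move=> ov; have [yc yd ova e] := overlap_slice ov.
have d1 := trans_diff sM ova; have d2 := trans_diff smooth_slice ov; have d3 := embed_diff yd.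
rewrite -(jacobian_comp (embed_diff yc) d1) -(jacobian_comp d2 d3).
have dA := differentiable_comp (embed_diff yc) d1; have dB := differentiable_comp d2 d3.
apply/matrixP => a b; apply: etrans (jacobianE a b dA) _; apply: etrans _ (esym (jacobianE a b dB)).
have no : nbhs (y : 'rV[R]_n) (overlap c d).
  by apply: open_nbhs_nbhs; split; [exact: open_overlap smooth_slice _ _|].
apply: near_eq_derive; apply: filterS no => z /overlap_slice[_ _ _ ez].
by rewrite /= ez.
Qed.

Lemma normal_trans (i j : chart M) x : overlap i j x ->
  normal j (trans i j x) = normal i x *m 'J (trans i j) x.
Proof.
move=> ov; have ugi := metric_unit rg (overlap_img sM ov); have ugj := metric_unit rg (trans_img sM ov).
have uJ : 'J (trans i j) x \in unitmx.
  by have := ugi; rewrite (metric_trans rg ov) !unitmx_mul => /andP[/andP[]].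
have uJT : ('J (trans i j) x)^T \in unitmx by rewrite unitmx_tr.
have df : differentiable (f \o cinv j : 'rV[R]_(n + 1) -> R) (trans i j x).
  by have [d _] := fs j 1; apply: d; exact: (trans_img sM ov).
rewrite /normal /gradf (grad_trans sM ov df).
apply: (can_inj (mulmxK ugj)); rewrite mulmxKV //.
apply: (can_inj (mulmxK uJT)); rewrite -!mulmxA [_ *m (_ *m (_)^T)]mulmxA -(metric_trans rg ov).
by rewrite mulVmx ?mulmx1.
Qed.

Lemma gradf_normal (i : chart M) x : img i x -> gradf i x = normal i x *m g i x.
Proof. by move=> ix; rewrite /normal mulmxKV // metric_unit. Qed.

Lemma Jemb_gradf (c : chart N) y : ball0 c y -> Jemb c y *m (gradf (amb c) (embed c y))^T = 0.
Proof.
move=> yb; have iy := embed_img yb.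
have df : differentiable (f \o cinv (amb c) : 'rV[R]_(n + 1) -> R) (embed c y).
  by have [d _] := fs (amb c) 1; exact: d.
apply/matrixP => a b; rewrite ord1 [RHS]mxE.
transitivity ('D_(bv a) ((f \o cinv (amb c) : 'rV[R]_(n + 1) -> R) \o embed c) y); last first.
  transitivity ('D_(bv a : 'rV[R]_n) (cst (0 : R)) y); last exact: derive_cst.
  apply: near_eq_derive; apply: (open_near (@open_ball0 c) yb) => z zb.
  exact: embed_slice.
rewrite derive_comp //; last exact: embed_diff.
rewrite gradfE // derive_jacobian; last exact: embed_diff.
by rewrite -mulmxA -rowE [RHS]mxE.
Qed.

(** Relative to the basis of the chart, the matrix has rows [(1, q)] and [(u, w)], so its
    determinant is that of [w - u *m q]. Pairing the rows with the gradient gives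
    [(w - u *m q) *m b = 1], where [b] is the vertical derivative of [f], positive by
    [chart_pos]. *)
Lemma det_Jemb (c : chart N) y : ball0 c y -> 0 < \det (col_mx (Jemb c y) (normal (amb c) (embed c y))).
Proof.
move=> yb; have iy := embed_img yb; have uB := basis_unit c; have dB := det_basis c.
set B := basis_mx c in uB dB; set X := normal _ _; set al := gradf (amb c) (embed c y).
pose Y := X *m invmx B; pose q : 'cV[R]_n := \col_a 'D_(bv a) (height c) y.
have yr : `|y - 0| < rad c by rewrite subr0.
have [ht _ _] := heightP yr.
have dh : differentiable (height c) y by have [d _] := @height_smooth c 1; exact: d.
have JE : Jemb c y = row_mx 1%:M q *m B.
  have dp : differentiable (fun y => pt y (height c y)) y.
    have [d _] : Ck 1 (ball0 c) (fun y => pt y (height c y)).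
      by apply: Ck_pt; [exact: open_ball0|exact: Ck_id|exact: height_smooth].
    exact: d.
  have oT : open (setT : set 'rV[R]_(n + 1)) := openT.
  have [da _] := @Ck_affine c 1 setT oT.
  have daf : differentiable (affine c) (pt y (height c y)) by exact: da.
  rewrite /Jemb (jacobian_comp dp daf); congr (_ *m _).
    have [did _] := @Ck_id R 'rV[R]_n 1 setT.
    apply/matrixP => a b; rewrite jacobianE //; case: (split_ordP b) => k ->.
      rewrite row_mxEl.
      transitivity ('D_(bv a) (fun z : 'rV[R]_n => z 0 k) y).
        have -> // : (fun y0 => pt y0 (height c y0) 0 (lshift 1 k)) = (fun z : 'rV[R]_n => z 0 k).
        by apply/funext => z; rewrite row_mxEl.
      rewrite -derive_mxE; last exact: did.
      by rewrite derive_id !mxE eqxx /= eq_sym.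
    have -> : (fun y0 => pt y0 (height c y0) 0 (rshift n k)) = height c.
      by apply/funext => z; rewrite row_mxEr !ord1 mxE eqxx mulr1n.
    by rewrite row_mxEr mxE.
  apply/row_matrixP => a; rewrite !rowE -derive_jacobian //.
  have hl : is_derive (0 : R) 1 (fun s : R => affine c (pt y (height c y)) + s *: (bv a *m B)) (bv a *m B) by exact: is_derive_affine.
  have da00 : differentiable (affine c) (pt y (height c y) + (0 : R) *: bv a) by rewrite scale0r addr0.
  have h2 := is_derive_line da00; rewrite scale0r addr0 in h2.
  have e : (fun s => affine c (pt y (height c y) + s *: bv a)) = (fun s : R => affine c (pt y (height c y)) + s *: (bv a *m B)).
    by apply/funext => s; rewrite /affine mulmxDl addrA scalemxAl.
  by rewrite e in h2; exact: (is_derive_uniq h2 hl).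
have XE : X = Y *m B by rewrite /Y mulmxKV.
rewrite JE XE -mul_col_mx det_mulmx mulr_gt0 // -[Y]hsubmxK; set u := lsubmx Y; set w := rsubmx Y.
pose be := B *m al^T.
have e1 : row_mx 1%:M q *m be = 0 by rewrite /be mulmxA -JE; exact: Jemb_gradf.
have e2 : row_mx u w *m be = 1%:M by rewrite hsubmxK /be mulmxA -XE; exact: fu.
have b0 : 0 < (dsubmx be) 0 0.
  have := chart_pos yr (ltW ht); rewrite -[(fun z => _)]/(affine c).
  have oT : open (setT : set 'rV[R]_(n + 1)) := openT.
  have [da _] := @Ck_affine c 1 setT oT.
  have daf : differentiable (affine c) (pt y (height c y)) by exact: da.
  have df : differentiable (f \o cinv (amb c) : 'rV[R]_(n + 1) -> R) (affine c (pt y (height c y))).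
    by have [d _] := fs (amb c) 1; apply: d; exact: iy.
  rewrite (derive_comp (g := f \o cinv (amb c)) _ daf df) gradfE //.
  have -> : 'D_(vert n) (affine c) (pt y (height c y)) = vert n *m B.
    have hl : is_derive (0 : R) 1 (fun s : R => affine c (pt y (height c y)) + s *: (vert n *m B)) (vert n *m B) by exact: is_derive_affine.
    have da00 : differentiable (affine c) (pt y (height c y) + (0 : R) *: vert n) by rewrite scale0r addr0.
    have h2 := is_derive_line da00; rewrite scale0r addr0 in h2.
    have e : (fun s => affine c (pt y (height c y) + s *: vert n)) = (fun s : R => affine c (pt y (height c y)) + s *: (vert n *m B)).
      by apply/funext => s; rewrite /affine mulmxDl addrA scalemxAl.
    by rewrite e in h2; exact: (is_derive_uniq h2 hl).
  by rewrite -mulmxA -/be -[in X in _ < X -> _](vsubmxK be) /vert /pt mul_row_col mul0mx add0r mul_scalar_mx scale1r.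
move: e1 e2; rewrite -[be]vsubmxK !mul_row_col; set b1 := usubmx be; set b := dsubmx be in b0 *.
rewrite mul1mx => /eqP; rewrite addr_eq0 => /eqP e1 e2.
have -> : col_mx (row_mx 1%:M q) (row_mx u w) =
    block_mx 1%:M 0 u 1%:M *m block_mx 1%:M q 0 (w - u *m q).
  by rewrite mulmx_block !mul1mx !mul0mx !addr0 mulmx1 addrC subrK /block_mx.
rewrite det_mulmx det_lblock det_ublock !det1 !mul1r det_mx11.
have : (w - u *m q) *m b = 1%:M by rewrite mulmxBl -e2 e1 mulmxN -mulmxA addrC.
move: (w - u *m q) => a /(congr1 (fun m : 'M[R]_1 => m 0 0)).
rewrite [X in X = _]mxE big_ord1 [X in _ = X]mxE eqxx mulr1n => e3.
by rewrite -(pmulr_lgt0 _ b0) e3.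
Qed.

(** Transition maps of [M] carry the normal to the normal, so in the positive bases of [det_Jemb]
    their Jacobian is block diagonal with last block 1. *)
Lemma slice_oriented : oriented_manifold M -> oriented_manifold N.
Proof.
move=> oM; have sN := smooth_slice; split.
- exact/hausdorff_val/(manifold_hausdorff oM).
- exact/second_countable_val/(manifold_second_countable oM).
- exact: (sa_dom sN).
- exact: (sa_img sN).
- exact: (sa_cover sN).
- exact: (sa_cmapK sN).
- by move=> c p; rewrite inE; exact: (sa_cmap sN).
- by move=> c p; rewrite inE; exact: (sa_cinv sN).
- exact: (sa_trans sN).
- move=> c d y ov; have [yc yd ova e] := overlap_slice ov.
  have dJ := trans_oriented oM ova; have d1 := det_Jemb yc; have d2 := det_Jemb yd.
  have : col_mx (Jemb c y) (normal (amb c) (embed c y)) *m 'J (trans (amb c) (amb d)) (embed c y) =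
     block_mx ('J (trans c d) y) 0 0 1%:M *m col_mx (Jemb d (trans c d y)) (normal (amb d) (embed d (trans c d y))).
    by rewrite mul_col_mx mul_block_col !mul0mx addr0 add0r mul1mx Jemb_trans // e (normal_trans ova).
  move/(congr1 determinant); rewrite !det_mulmx det_ublock det1 mulr1 => ed.
  by rewrite -(pmulr_lgt0 _ d2) -ed mulr_gt0.
Qed.

Lemma Jemb_free (c : chart N) y (v : 'rV[R]_n) : ball0 c y -> v *m Jemb c y = 0 -> v = 0.
Proof.
move=> yb vJ; have : row_mx v 0 *m col_mx (Jemb c y) (normal (amb c) (embed c y)) = 0.
  by rewrite mul_row_col vJ mul0mx addr0.
have u : col_mx (Jemb c y) (normal (amb c) (embed c y)) \in unitmx.
  by rewrite unitmxE unitfE gt_eqF // det_Jemb.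
move/(congr1 (mulmx^~ (invmx (col_mx (Jemb c y) (normal (amb c) (embed c y)))))).
by rewrite mulmxK // mul0mx => /(congr1 lsubmx); rewrite row_mxKl raddf0.
Qed.

Lemma Jemb_row (c : chart N) y (v : 'rV[R]_(n + 1)) : ball0 c y ->
  v *m (gradf (amb c) (embed c y))^T = 0 -> exists u, v = u *m Jemb c y.
Proof.
move=> yb; set A := col_mx (Jemb c y) (normal (amb c) (embed c y)).
have u : A \in unitmx by rewrite unitmxE unitfE gt_eqF // det_Jemb.
rewrite -(mulmxKV u v); move: (v *m invmx A) => w; rewrite -(hsubmxK w) mul_row_col mulmxDl.
rewrite -mulmxA Jemb_gradf // mulmx0 add0r -mulmxA fu; last exact: embed_img.
rewrite mulmx1 => w0; exists (lsubmx w); by rewrite w0 mul0mx addr0.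
Qed.

Definition slice_metric : metric N := fun c y =>
  Jemb c y *m g (amb c) (embed c y) *m (Jemb c y)^T.

Lemma Ck_Jemb (c : chart N) k : Ck k (ball0 c) (Jemb c).
Proof. by apply: Ck_jacobian; [exact: open_ball0|exact: embed_smooth]. Qed.

Lemma slice_riemannian : riemannian slice_metric.
Proof.
split.
- move=> c k; rewrite simg; have oB := @open_ball0 c.
  apply: Ck_mulmx => //; last by apply: Ck_tr => //; exact: Ck_Jemb.
  apply: Ck_mulmx => //; first exact: Ck_Jemb.
  apply: (Ck_comp_mx (O := img (amb c))) => //.
  + exact: (sa_img sM).
  + by move=> y; exact: embed_img.
  + exact: embed_smooth.
  + exact: (metric_smooth rg).
- move=> c y; rewrite simg => yb; rewrite /slice_metric !trmx_mul trmxK (metric_sym rg) ?mulmxA //.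
  exact: embed_img.
- move=> c y; rewrite simg => yb v v0.
  have -> : v *m slice_metric c y *m v^T = (v *m Jemb c y) *m g (amb c) (embed c y) *m (v *m Jemb c y)^T.
    by rewrite /slice_metric trmx_mul !mulmxA.
  apply: (metric_pos rg); first exact: embed_img.
  by apply: contra v0 => /eqP/(Jemb_free yb)/eqP.
- move=> c d y ov; have [yc yd ova e] := overlap_slice ov.
  rewrite /slice_metric (metric_trans rg ova) e.
  have -> : 'J (trans c d) y *m (Jemb d (trans c d y) *m g (amb d) (trans (amb c) (amb d) (embed c y)) *m (Jemb d (trans c d y))^T) *m ('J (trans c d) y)^T =
    ('J (trans c d) y *m Jemb d (trans c d y)) *m g (amb d) (trans (amb c) (amb d) (embed c y)) *m ('J (trans c d) y *m Jemb d (trans c d y))^T.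
    by rewrite trmx_mul !mulmxA.
  by rewrite -Jemb_trans // trmx_mul !mulmxA.
Qed.

Definition slice_tensor k (S : tensor M k) : tensor N k := fun c y =>
  pull (Jemb c y) (S (amb c) (embed c y)).

Lemma slice_tensor_field k (S : tensor M k) : tensor_field S -> tensor_field (slice_tensor S).
Proof.
move=> [sS law]; split=> [c I m|c d y ov].
  rewrite simg; have oB := @open_ball0 c.
  apply: (@eq_Ck _ _ _ _ _ (fun y => \sum_(J : midx k (n + 1))
      (\prod_p Jemb c y (I p) (J p)) * ((fun x => S (amb c) x J : R) \o embed c) y)) => //.
    by move=> y _; rewrite [RHS]pullE.
  apply: Ck_sum => // J _; apply: CkM => //.
    apply: Ck_prod => // p _; have /(Ck_mxP _ _ oB) := @Ck_Jemb c m; exact.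
  apply: (Ck_comp (O := img (amb c))) => //.
  - exact: (sa_img sM).
  - by move=> y; exact: embed_img.
  - exact: embed_smooth.
  - exact: sS.
have [yc yd ova e] := overlap_slice ov.
by rewrite /slice_tensor e pull_comp -Jemb_trans // -pull_comp -law.
Qed.

Lemma slice_form_field k (S : tensor M k) : form_field S -> form_field (slice_tensor S).
Proof.
move=> [tS aS]; split; first exact: slice_tensor_field.
by move=> c y; rewrite simg => yb; apply: alternating_pull; apply: aS; exact: embed_img.
Qed.

Context (T : tensor M 3) (fT : form_field T).
Context (Xpar : forall (i : chart M) x a, img i x ->
  'D_(bv a) (normal i) x = - (normal i x *m skewc (g i) (T i) x a)).

Lemma Ck_gradf (i : chart M) k : Ck k (img i) (gradf i).
Proof.
have oi := sa_img sM (i := i); apply/(Ck_mxP _ _ oi) => a b.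
by under eq_fun do rewrite mxE; have [_] := fs i k.+1; exact.
Qed.

Lemma Ck_normal (i : chart M) : smooth_on (img i) (normal i).
Proof.
move=> k; have oi := sa_img sM (i := i); apply: Ck_mulmx => //; first exact: Ck_gradf.
by apply: Ck_invmx => // [x|]; [exact: metric_unit|exact: (metric_smooth rg)].
Qed.

Lemma gradf_parallel (i : chart M) x a b : img i x ->
  partial a (fun x => (gradf i x)^T b 0) x = (skewc (g i) (T i) x a *m (gradf i x)^T) b 0.
Proof.
move=> ix; have oi := sa_img sM (i := i).
have gsy y (iy : img i y) := metric_sym rg iy.
have dX := fun b c => is_derive_entry (bv a) b c (Ck_normal i 1) ix.
have dg b' c' : is_derive x (bv a) (fun y => g i y b' c')
    ((skewc (g i) (T i) x a *m g i x + g i x *m (skewc (g i) (T i) x a)^T) b' c').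
  have h := is_derive_entry (bv a) b' c' (metric_smooth rg i 1) ix.
  apply: (is_derive_eq h).
  by rewrite -(@skewc_metric _ _ (g i) (T i) _ x a oi ix gsy (metric_unit rg ix) (fT.2 i x ix)) mxE /dmet /partial (@derive_val _ _ _ _ _ _ _ h).
have h := is_derive_mulmx dX dg 0 b.
have e : \forall y \near x, (gradf i y)^T b 0 = (normal i y *m g i y) 0 b.
  by apply: (open_near oi ix) => y iy; rewrite mxE (gradf_normal iy).
rewrite /partial (near_eq_derive _ e) (@derive_val _ _ _ _ _ _ _ h) Xpar // mulNmx mulmxDr !mulmxA addrA addNr add0r -gradf_normal //.
by rewrite -[gradf i x *m _]trmxK trmx_mul trmxK mxE.
Qed.

(** Instance of [gauss] with the gradient of [f] as parallel covector: the slice is totally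
    geodesic, and its induced connection has the restricted torsion. *)
Lemma slice_gauss (c : chart N) y : ball0 c y -> forall a,
  'D_(bv a) (Jemb c) y + Jemb c y *m ambient (embed c) (skewc (g (amb c)) (T (amb c))) y a =
  skewc (slice_metric c) (slice_tensor T c) y a *m Jemb c y.
Proof.
move=> yb; have oi := sa_img sM (i := amb c).
have gsy x (ix : img (amb c) x) := metric_sym rg ix.
have als : smooth_on (img (amb c)) (fun x => (gradf (amb c) x)^T).
  by move=> k; apply: Ck_tr => //; exact: Ck_gradf.
have hu z : ball0 c z -> slice_metric c z \in unitmx.
  by move=> zb; apply: (metric_unit slice_riemannian); rewrite simg.
apply: (@gauss _ _ _ (ball0 c) (img (amb c)) (embed c) (@open_ball0 c) oi (@embed_img c) (@embed_smooth c)
  (g (amb c)) (T (amb c)) (fun x => (gradf (amb c) x)^T) (metric_smooth rg (amb c)) gsy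
  (fun x ix => metric_unit rg ix) (fT.2 (amb c)) als) => //.
- by move=> x ix a b; exact: gradf_parallel.
- by move=> z zb; exact: Jemb_gradf.
- by move=> z v zb; exact: Jemb_row.
Qed.

Lemma slice_parallel k (S : tensor M k) : tensor_field S -> parallel (skew_connection g T) S ->
  parallel (skew_connection slice_metric (slice_tensor T)) (slice_tensor S).
Proof.
move=> tS /parallelE pS; apply/parallelE => c; rewrite simg.
apply: (@parc_pull _ _ _ (ball0 c) (img (amb c)) (embed c) (@open_ball0 c) (@embed_img c) (@embed_smooth c)
  (skewc (g (amb c)) (T (amb c)))) => //.
- exact: tS.1.
- by move=> y yb a; exact: slice_gauss.
Qed.

Definition contract k (S : tensor M (k + 1)) : tensor M k := fun i x => ins (S i x) (normal i x).

Lemma contract_field k (S : tensor M (k + 1)) : tensor_field S -> tensor_field (contract S).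
Proof.
move=> [sS law]; split=> [i I m|i j x ov].
  have oi := sa_img sM (i := i).
  apply: (@eq_Ck _ _ _ _ _ (fun x => \sum_c normal i x 0 c * S i x (join I [ffun=> c]))) => //.
    by move=> x _; rewrite [RHS]insE.
  apply: Ck_sum => // c _; apply: CkM => //; last exact: sS.
  by have /(Ck_mxP _ _ oi) := Ck_normal i m; exact.
by rewrite /contract (law i j x ov) ins_pull -normal_trans.
Qed.

(** Leibniz rule: the derivative of the normal cancels the term of [ins_act] that comes from the
    contracted slot. *)
Lemma contract_parallel k (S : tensor M (k + 1)) : tensor_field S -> parallel (skew_connection g T) S ->
  parallel (skew_connection g T) (contract S).
Proof.
move=> [sS _] /parallelE pS; apply/parallelE => i x ix a I.
have h : is_derive x (bv a) (fun y => \sum_c normal i y 0 c * S i y (join I [ffun=> c]))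
  (\sum_c (('D_(bv a) (normal i) x) 0 c * S i x (join I [ffun=> c]) +
     normal i x 0 c * act (skewc (g i) (T i) x a) (S i x) (join I [ffun=> c]))).
  apply: is_derive_bigsum => c _; apply: is_derive_prodR; first exact: is_derive_entry (Ck_normal i 1) ix.
  have [dS _] := sS i (join I [ffun=> c]) 1.
  by apply: DeriveDef; [apply: diff_derivable; exact: dS|exact: pS].
have e : (fun y => contract S i y I : R) = (fun y => \sum_c normal i y 0 c * S i y (join I [ffun=> c])).
  by apply/funext => y; rewrite /contract insE.
rewrite /partial e (@derive_val _ _ _ _ _ _ _ h) big_split /= -!insE Xpar //.
set G := skewc _ _ _ _.
have key : ins (S i x) (- (normal i x *m G)) + ins (act G (S i x)) (normal i x) = act G (ins (S i x) (normal i x)).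
  by rewrite ins_act -[- (_ *m _)]scaleN1r insZ scaleN1r addrCA addNr addr0.
by have := congr1 (fun t : cov R (n + 1) k => t I) key; rewrite [X in X = _ -> _]ffunE.
Qed.

End Slice.

(** * The isometry with the product of the line and the slice *)

Section Splitting.
Context {R : realType} {n : nat} (M : atlas R (n + 1)) (sM : smooth_atlas M) (hM : hausdorff_space M).
Context (g : metric M) (rg : riemannian g) (hc : complete_metric g).
Context (f : M -> R) (fs : forall i : chart M, smooth_on (img i) (f \o cinv i : 'rV[R]_(n + 1) -> R)).
Context (fu : forall (i : chart M) x, img i x -> normal g f i x *m (gradf f i x)^T = 1%:M).
Context (p0 : slice f).
Context (frames : forall (i : chart M) x, img i x -> exists E : 'M[R]_(n + 1),
  0 < \det E /\ dsubmx E = normal g f i x).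
Context (Xpar : forall (i : chart M) x a, img i x ->
  'D_(bv a) (normal g f i) x = - (normal g f i x *m lcc g i x a)).

Let X := normal g f.
Let N := slice_atlas p0.
Let h : metric N := slice_metric g (p0 := p0).
Let sN : smooth_atlas N := smooth_slice sM fs fu p0 frames.
Let sL : smooth_atlas (prod_atlas (line : atlas R 1) N) := smooth_prod smooth_line sN.
Let Xs := Ck_normal sM rg fs.
Let Xt : forall i j x, overlap i j x -> X j (trans i j x) = X i x *m 'J (trans i j) x.
Proof. by move=> i j x ov; exact: normal_trans. Qed.
Let Fl := flow X.
Let Fl0 p : Fl 0 p = p := flow0 sM rg hc Xs Xt Xpar p.
Let FlD s t p : Fl (s + t) p = Fl t (Fl s p) := flowD sM hM rg hc Xs Xt Xpar s t p.
Let dFl i t p : dom i (Fl t p) -> is_derive t 1 (cmap i \o (Fl^~ p)) (X i (cmap i (Fl t p))).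
Proof. exact: (is_derive_flow sM rg hc Xs Xt Xpar). Qed.

(** [f] grows at unit rate along flow lines, since [fu] pairs the normal with the gradient to 1. *)
Lemma height_flow t p : f (Fl t p) = f p + t.
Proof.
have d (s : R) : is_derive s 1 (fun s : R => f (Fl s p)) 1.
  have [i ip] := sa_cover sM (Fl s p); have ix := img_cmap ip.
  have [df _] := fs i 1.
  have h1 := is_derive_comp (dFl ip) (df _ ix); rewrite (gradfE fs _ ix) in h1.
  have h2 : is_derive s 1 (fun s : R => f (Fl s p)) ((X i (cmap i (Fl s p)) *m (gradf f i (cmap i (Fl s p)))^T) 0 0).
    apply: near_eq_is_derive h1.
    have cF : continuous (fun t => Fl t p) by exact: (flow_continuous sM rg hc Xs Xt Xpar).
    have [e e0 eP] := near_open (cF s) (sa_dom sM i) ip.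
    apply/nbhs_ballP; exists e => //= r; rewrite -ball_normE /= distrC => /eP ir.
    by rewrite (sa_cmapK sM).
  by apply: (is_derive_eq h2); rewrite fu // mxE eqxx.
apply/eqP; rewrite -subr_eq0 opprD addrA -normr_le0.
have := @mvt_real _ (fun s => f (Fl s p) - s) (fun=> 0) 0 t 0.
rewrite Fl0 mul0r subr0 => mv; rewrite addrAC; apply: mv => r _; last by rewrite normr0.
by apply: (is_derive_eq (is_deriveB (d r) (is_derive_id r 1))); rewrite subrr.
Qed.

(** The flow is followed backwards for the time [f p], down to level 0. *)
Definition to_slice (p : M) : slice f := SigSub (mem_set (etrans (height_flow (- f p) p) (subrr (f p)))).

Lemma val_to_slice p : set_val (to_slice p) = Fl (- f p) p.
Proof. by []. Qed.

Definition split_map (p : M) : prod_atlas (line : atlas R 1) N := (f p, to_slice p).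
Definition join_map (z : prod_atlas (line : atlas R 1) N) : M := Fl z.1 (set_val z.2).

Lemma split_mapK : cancel split_map join_map.
Proof. by move=> p; rewrite /join_map /split_map /= val_to_slice -FlD addNr Fl0. Qed.

Lemma join_mapK : cancel join_map split_map.
Proof.
move=> [t q]; have fq := slice_valP q.
have ft : f (join_map (t, q)) = t by rewrite /join_map /= height_flow fq add0r.
rewrite /split_map ft; congr pair; apply: val_inj.
change (Fl (- f (join_map (t, q))) (join_map (t, q)) = set_val q).
by rewrite ft /join_map /= -FlD subrr Fl0.
Qed.

Lemma smooth_val k (q : N) : smooth_at k (fun q : N => set_val q : M) q.
Proof.
have [c cq] := sa_cover sN q; have oB := @open_ball0 _ _ _ _ c.
exists c, (amb c), (ball0 c); split; [exact: cq|exact: oB|exact: smap_ball|by rewrite simg|].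
- split=> [y yb|].
    by rewrite /= (val_sinv sM) //; apply: (dom_cinv sM); exact: embed_img.
  apply: (@eq_Ck _ _ _ _ _ (embed c)) => //; last exact: embed_smooth.
  by move=> y yb; rewrite /lrep /= (val_sinv sM) // (cinvK sM) //; exact: embed_img.
Qed.

Lemma join_smooth k z : smooth_at k join_map z.
Proof.
have s1 := smooth_at_fst smooth_line sN k z.
have s2 := smooth_at_comp sL sN sM (smooth_at_snd smooth_line sN k z) (smooth_val k z.2).
have sp := smooth_at_pair sM sL s1 s2.
exact: (smooth_at_comp sL (smooth_prod smooth_line sM) sM sp (flow_smooth sM hM rg hc Xs Xt Xpar k _)).
Qed.

Lemma split_smooth k p : smooth_at k split_map p.
Proof.
have [i ip] := sa_cover sM p; have oi := sa_img sM (i := i).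
have s1 : smooth_at k (f : M -> (line : atlas R 1)) p := smooth_at_line sM ip (fs i k).
have sm : smooth_at k ((fun q => - f q : R) : M -> (line : atlas R 1)) p.
  by apply: (smooth_at_line (i := i) sM ip); apply: CkN => //; exact: fs.
have sp := smooth_at_pair sM sM sm (smooth_at_id k p sM).
have sF := smooth_at_comp sM (smooth_prod smooth_line sM) sM sp (flow_smooth sM hM rg hc Xs Xt Xpar k _).
have s2 : smooth_at k (to_slice : M -> N) p.
  apply: (smooth_into_slice sM sM); last exact: sF.
  exact: (slice_chart_exists sM fs fu frames).
exact: (smooth_at_pair sN sM s1 s2).
Qed.

(** The time row of the Jacobian is [X] and the other rows are tangent vectors of the slice moved by
    the flow. As the flow preserves both [X] and the metric, the inner products are those on the
    slice itself. *)
Lemma join_jacobian (c : chart N) (i : chart M) (t : R) y : ball0 c y ->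
  dom i (Fl t (cinv (amb c) (embed c y))) ->
  let K := 'J (lrep join_map ((tt, c) : chart (prod_atlas (line : atlas R 1) N)) i) (row_mx (const_mx t) y) in
  K *m g i (cmap i (Fl t (cinv (amb c) (embed c y)))) *m K^T = block_mx 1%:M 0 0 (h c y).
Proof.
move=> yb; set q := cinv (amb c) (embed c y) => iq; set w := row_mx (const_mx t) y.
set L := lrep join_map _ i; set K := 'J L w; set x := cmap i _.
have iy := embed_img yb; have qd : dom (amb c) q := dom_cinv sM iy.
have qx : cmap (amb c) q = embed c y by rewrite (cinvK sM).
have vq : set_val (sinv p0 c y) = q by rewrite (val_sinv sM).
have dL : differentiable L w.
  have wd : dom ((tt, c) : chart (prod_atlas (line : atlas R 1) N)) ((t, sinv p0 c y) : prod_atlas (line : atlas R 1) N).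
    by split => //=; have [] := sinvK sM p0 yb.
  have id_ : dom i (join_map ((t, sinv p0 c y) : prod_atlas (line : atlas R 1) N)) by rewrite /join_map /= vq.
  have [U [oU Uw _ _ [d _]]] := smooth_at_charts sL sM (join_smooth 1 (t, sinv p0 c y)) wd id_.
  by apply: d; move: Uw; rewrite /= (sinvK sM p0 yb).2.
have LE s z : ball0 c z -> L (row_mx (const_mx s) z) = cmap i (Fl s (cinv (amb c) (embed c z))).
  by move=> zb; rewrite /L /lrep /join_map /= row_mxKl row_mxKr mxE (val_sinv sM).
pose z0 : 'rV[R]_(1 + n) := row_mx (const_mx 1) 0.
have K0 : usubmx K = X i x.
  have d1 : differentiable L (row_mx 0 y + t *: z0).
    rewrite /z0 scale_row_mx add_row_mx scaler0 addr0 add0r.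
    by have -> : t *: const_mx 1 = const_mx t :> 'rV[R]_1 by apply/matrixP => a b; rewrite !mxE mulr1.
  have h1 := is_derive_line d1.
  have e1 : (fun s => L (row_mx 0 y + s *: z0)) = cmap i \o Fl^~ q.
    apply/funext => s; rewrite /= -(LE s y yb) /z0 scale_row_mx add_row_mx scaler0 addr0 add0r.
    by congr (L (row_mx _ _)); apply/matrixP => a b; rewrite !mxE mulr1.
  rewrite e1 derive_jacobian // in h1.
  have h2 := is_derive_uniq h1 (dFl iq).
  rewrite -[RHS]h2 /z0 scale_row_mx add_row_mx scaler0 addr0 add0r.
  have -> : t *: const_mx 1 = const_mx t :> 'rV[R]_1 by apply/matrixP => a b; rewrite !mxE mulr1.
  rewrite -/w -/K -[in RHS](vsubmxK K) mul_row_col mul0mx addr0.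
  have -> : const_mx 1 = 1%:M :> 'M[R]_1 by apply/matrixP => a b; rewrite !ord1 !mxE eqxx.
  by rewrite mul1mx.
pose Jf := 'J (lrep (Fl t) (amb c) i) (embed c y).
have K1 : dsubmx K = Jemb c y *m Jf.
  pose aff (z : 'rV[R]_n) : 'rV[R]_(1 + n) := row_mx (const_mx t) z.
  have [da _] : Ck 1 setT aff by apply: Ck_row_mx; [exact: openT|exact: Ck_cst|exact: Ck_id].
  have dy : differentiable aff y by exact: da.
  have df : differentiable (lrep (Fl t) (amb c) i) (embed c y).
    by rewrite -qx; exact: (flow_diff sM hM rg hc Xs Xt Xpar).
  have de : differentiable (embed c) y := embed_diff sM fs (p0 := p0) yb.
  have Ja : 'J aff y = row_mx 0 1%:M.
    have [did _] := @Ck_id R 'rV[R]_n 1 setT.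
    apply/matrixP => a b; rewrite jacobianE //; case: (split_ordP b) => k ->.
      rewrite row_mxEl mxE.
      have -> : (fun z => aff z 0 (lshift n k)) = cst t by apply/funext => z; rewrite row_mxEl mxE.
      exact: derive_cst.
    rewrite row_mxEr.
    have -> : (fun z => aff z 0 (rshift 1 k)) = (fun z : 'rV[R]_n => z 0 k) by apply/funext => z; rewrite row_mxEr.
    rewrite -derive_mxE; last exact: did.
    by rewrite derive_id !mxE eqxx /= eq_sym.
  have e1 : 'J (L \o aff) y = dsubmx K.
    by rewrite (jacobian_comp dy dL) Ja -/K -[in LHS](vsubmxK K) mul_row_col mul0mx add0r mul1mx.
  rewrite -e1 /Jemb /Jf -(jacobian_comp de df).
  have dA : differentiable (L \o aff) y := differentiable_comp dy dL.
  have dB := differentiable_comp de df.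
  have oB := @open_ball0 _ _ _ _ c.
  apply/matrixP => a b; apply: etrans (jacobianE a b dA) _; apply: etrans _ (esym (jacobianE a b dB)).
  by apply: near_eq_derive; apply: (open_near oB yb) => z zb; rewrite /= LE.
have iso := flow_isometry sM hM rg hc Xs Xt Xpar qd iq; rewrite /= qx -/x -/Jf in iso.
have fld : X i x = X (amb c) (embed c y) *m Jf.
  by rewrite /Jf -qx; exact: (flow_field sM hM rg hc Xs Xt Xpar qd iq).
have ix : img i x := img_cmap iq.
have u0 : X i x *m g i x *m (X i x)^T = 1%:M.
  by rewrite -(gradf_normal rg f ix) -[LHS]trmxK trmx_mul trmxK fu // trmx1.
have u1 : X i x *m g i x *m (Jemb c y *m Jf)^T = 0.
  have gn : gradf f (amb c) (embed c y) = X (amb c) (embed c y) *m g (amb c) (embed c y) := gradf_normal rg f iy.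
  rewrite fld; move: gn; move: (X (amb c) _) => Xc gn.
  by rewrite trmx_mul -!mulmxA [Jf *m (_ *m _)]mulmxA [Jf *m g i x *m _]mulmxA iso mulmxA -gn -[LHS]trmxK trmx_mul trmxK (Jemb_gradf sM fs yb) trmx0.
have u2 : (Jemb c y *m Jf) *m g i x *m (Jemb c y *m Jf)^T = h c y.
  by rewrite trmx_mul -!mulmxA [Jf *m (_ *m _)]mulmxA [Jf *m g i x *m _]mulmxA iso /h /slice_metric mulmxA.
have eK : K = col_mx (X i x) (Jemb c y *m Jf) by rewrite -(vsubmxK K) K0 K1.
rewrite /= eK tr_col_mx mul_col_mx mul_col_row u0 u1 u2; congr block_mx.
by rewrite -[LHS]trmxK -[RHS]trmx0 -u1 !trmx_mul !trmxK (metric_sym rg ix) !mulmxA.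
Qed.

(** The two maps are inverse to each other, hence so are their Jacobians, and the formula of
    [join_jacobian] is inverted. *)
Lemma split_metric (i : chart M) (j : chart (prod_atlas (line : atlas R 1) N)) x :
  img i x -> dom j (split_map (cinv i x)) ->
  let J := 'J (lrep split_map i j) x in
  g i x = J *m block_mx 1%:M 0 0 (h j.2 (rsubmx (lrep split_map i j x))) *m J^T.
Proof.
case: j => [[] c] ix jd J; pose p := cinv i x.
have ip : dom i p := dom_cinv sM ix.
have xp : cmap i p = x by rewrite (cinvK sM).
have [_ cd] := jd; have sd : sdom c (to_slice p) := cd.
pose y := smap c (to_slice p); have yb : ball0 c y := smap_ball sd.
have vy : cinv (amb c) (embed c y) = Fl (- f p) p.
  by rewrite -(val_sinv sM p0 yb) /y (smapK sM) // val_to_slice.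
have ft : Fl (f p) (cinv (amb c) (embed c y)) = p by rewrite vy -FlD addNr Fl0.
have iq : dom i (Fl (f p) (cinv (amb c) (embed c y))) by rewrite ft.
have := join_jacobian yb iq; rewrite ft xp.
set jj : chart (prod_atlas (line : atlas R 1) N) := (tt, c).
set w := row_mx _ y; set K := 'J _ w => KK.
have ew : lrep split_map i jj x = w by [].
have [U [oU Ux Ui Uj [dU _]]] := smooth_at_charts sM sL (split_smooth 1 p) ip jd.
have dS : differentiable (lrep split_map i jj) x by rewrite -xp; exact: dU.
have dJ : differentiable (lrep join_map jj i) (lrep split_map i jj x).
  have jk : join_map (split_map p) = p := split_mapK p.
  have id_ : dom i (join_map (split_map p)) by rewrite jk.
  have [V [oV Vw _ _ [dV _]]] := smooth_at_charts sL sM (join_smooth 1 (split_map p)) jd id_.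
  exact: dV.
have JK : J *m K = 1%:M.
  rewrite /J /K -ew -(jacobian_comp dS dJ).
  have dA := differentiable_comp dS dJ.
  have [did _] := @Ck_id R 'rV[R]_(n + 1) 1 setT.
  apply/matrixP => a b; apply: etrans (jacobianE a b dA) _.
  transitivity ('D_(bv a) (fun z : 'rV[R]_(n + 1) => z 0 b) x).
    rewrite xp in Ux; apply: near_eq_derive; apply: (open_near oU Ux) => z Uz.
    have e3 := sa_cmapK sL (Uj z Uz).
    change ((cmap i (join_map (cinv jj (cmap jj (split_map (cinv i z)))))) 0 b = z 0 b).
    by rewrite e3 split_mapK (cinvK sM) //; exact: Ui.
  rewrite -derive_mxE; last exact: did.
  by rewrite derive_id !mxE eqxx /= eq_sym.
have -> : rsubmx (lrep split_map i jj x) = y by rewrite ew /w row_mxKr.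
rewrite /= -KK.
have -> : J *m (K *m g i x *m K^T) *m J^T = (J *m K) *m g i x *m (J *m K)^T by rewrite trmx_mul !mulmxA.
by rewrite JK mul1mx trmx1 mulmx1.
Qed.

End Splitting.

(** * Exterior forms with integer components and their evaluation *)

Section Basis.
Context {R : realType}.

(** Multi-indices as lists of natural numbers counted from 1, as in [e]; such lists can be
    evaluated, unlike finite functions into ordinals. *)
Definition idx n k (I : midx k n) : seq nat := [seq (val (I a)).+1 | a <- enum 'I_k].

Lemma size_idx n k (I : midx k n) : size (idx I) = k.
Proof. by rewrite size_map size_enum_ord. Qed.

Lemma nth_idx n k (I : midx k n) (a : 'I_k) : nth 0%N (idx I) a = (val (I a)).+1.
Proof. by rewrite (nth_map a) ?size_enum_ord // nth_ord_enum. Qed.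

(** The forms [e] indexed by ordinal-valued functions, convenient for sums over multi-indices;
    [e_basis] relates the two. *)
Definition basis_form n k (F : midx k n) : cov R n k :=
  [ffun I : midx k n => \det (\matrix_(a < k, b < k) ((I a == F b)%:R : R))].

Lemma e_basis n k (s : k.-tuple nat) (F : midx k n) :
  tval s = idx F -> e n s = basis_form F.
Proof.
move=> sF; apply/ffunP => I; rewrite !ffunE; congr (\det _); apply/matrixP => a b; rewrite !mxE.
by rewrite (tnth_nth 0%N) sF nth_idx eqSS.
Qed.

Lemma alternating_basis n k (F : midx k n) : alternating (basis_form F).
Proof.
move=> s I; rewrite !ffunE.
have -> : \matrix_(a < k, b < k) (([ffun p => I (s p)] a == F b)%:R : R) =
    perm_mx s *m \matrix_(a < k, b < k) ((I a == F b)%:R).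
  by rewrite -row_permE; apply/matrixP => a b; rewrite !mxE ffunE.
by rewrite det_mulmx det_perm.
Qed.

Lemma sum_mul_basis n k (F : midx k n) (u : cov R n k) :
  \sum_I u I * basis_form F I = \sum_(s : 'S_k) (-1) ^+ s * u [ffun p => F (s p)].
Proof.
under eq_bigr do rewrite ffunE /determinant mulr_sumr.
rewrite exchange_big /=; apply: eq_bigr => s _.
rewrite (bigD1 [ffun p => F (s p)]) //= [X in _ + X]big1 => [|I ne].
  rewrite [X in u _ * (_ * X)]big1 => [|p _]; last by rewrite mxE ffunE eqxx.
  by rewrite mulr1 mulrC; exact: addr0.
rewrite [X in u _ * (_ * X)](_ : _ = 0) ?mulr0 //.
have [p np] : exists p, I p != F (s p).
  apply/existsP; rewrite -negb_forall; apply: contra ne => /forallP h.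
  by apply/eqP/ffunP => p; rewrite ffunE; apply/eqP.
by rewrite (bigD1 p) //= mxE (negbTE np) mul0r.
Qed.

Lemma sum_basis n k (F : midx k n) (t : cov R n k) : alternating t ->
  \sum_I t I * basis_form F I = k`!%:R * t F.
Proof.
move=> alt; rewrite sum_mul_basis (eq_bigr (fun=> t F : R)).
  by rewrite sumr_const card_Sn; exact: esym (mulr_natl _ _).
by move=> s _; rewrite alt; apply: (signrMK s).
Qed.

Lemma basis_swap n k (F I : midx k n) : basis_form F I = basis_form I F.
Proof. by rewrite !ffunE -det_tr; congr (\det _); apply/matrixP => a b; rewrite !mxE eq_sym. Qed.

Lemma sum_basis_fun n k (F : midx k n) (f : midx k n -> R) :
  alternating ([ffun I => f I] : cov R n k) -> \sum_I f I * basis_form F I = k`!%:R * f F.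
Proof.
move=> /(sum_basis F) h; transitivity (k`!%:R * ([ffun I => f I] : cov R n k) F : R); last by rewrite ffunE.
by rewrite -h; apply: eq_bigr => I _; rewrite [in RHS]ffunE.
Qed.

(** The sign is read off from the determinant of a block diagonal permutation matrix. *)
Lemma sign_block_perm k l (s : 'S_k) (t : 'S_l) : exists r : 'S_(k + l),
  [/\ (-1) ^+ r = (-1) ^+ s * (-1) ^+ t :> R,
      forall a, r (lshift l a) = lshift l (s a) & forall b, r (rshift k b) = rshift k (t b)].
Proof.
pose f (p : 'I_(k + l)) := match fintype.split p with inl a => lshift l (s a) | inr b => rshift k (t b) end.
have fl a : f (lshift l a) = lshift l (s a) by rewrite /f (unsplitK (inl a)).
have fr b : f (rshift k b) = rshift k (t b) by rewrite /f (unsplitK (inr b)).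
have inj : injective f.
  move=> p q; case: (split_ordP p) => a ->; case: (split_ordP q) => b ->; rewrite ?fl ?fr.
  - by move/lshift_inj/perm_inj ->.
  - by move/eqP; rewrite eq_lrshift.
  - by move/eqP; rewrite eq_rlshift.
  by move/rshift_inj/perm_inj ->.
exists (perm inj); split=> [|a|b]; rewrite ?permE //.
rewrite -!det_perm -(det_ublock _ 0); congr (\det _); apply/matrixP => p q; rewrite mxE mxE permE.
case: (split_ordP p) => a ->; rewrite ?fl ?fr ?col_mxEu ?col_mxEd.
  by case: (split_ordP q) => b ->; rewrite ?row_mxEl ?row_mxEr !mxE ?(inj_eq (@lshift_inj _ _)) ?eq_lrshift.
by case: (split_ordP q) => b ->; rewrite ?row_mxEl ?row_mxEr !mxE ?(inj_eq (@rshift_inj _ _)) ?eq_rlshift.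
Qed.

Lemma alternating_join n k l (t : cov R n (k + l)) (s : 'S_k) (r : 'S_l)
    (F : midx k n) (G : midx l n) : alternating t ->
  t (join [ffun p => F (s p)] [ffun q => G (r q)]) = (-1) ^+ s * (-1) ^+ r * t (join F G).
Proof.
move=> alt; have [u [<- ul ur]] := sign_block_perm s r; rewrite -alt; congr (t _); apply/ffunP => p.
rewrite [RHS]ffunE; case: (split_ordP p) => a ->.
  by rewrite ul !tjoin_l ffunE.
by rewrite ur !tjoin_r ffunE.
Qed.

Lemma alternating_joinl n k l (t : cov R n (k + l)) (G : midx l n) : alternating t ->
  alternating ([ffun F : midx k n => t (join F G)] : cov R n k).
Proof.
move=> alt s F; rewrite !ffunE.
have := alternating_join s 1%g F G alt; rewrite odd_perm1 mulr1 => <-; congr (t (join _ _)).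
by apply/ffunP => q; rewrite ffunE perm1.
Qed.

Lemma alternating_joinr n k l (t : cov R n (k + l)) (F : midx k n) : alternating t ->
  alternating ([ffun G : midx l n => t (join F G)] : cov R n l).
Proof.
move=> alt s G; rewrite !ffunE.
have := alternating_join 1%g s F G alt; rewrite odd_perm1 mul1r => <-; congr (t (join _ _)).
by apply/ffunP => q; rewrite ffunE perm1.
Qed.

(** The sum over permutations is a pairing with [basis_form I] as a function of its multi-index.
    Pairing an alternating function with a basis form evaluates it up to a factorial; doing this in
    the first [k] and then in the last [l] slots yields the two factorials that the normalisation of
    [wedge] divides out. *)
Lemma wedge_basis n k l (F : midx k n) (G : midx l n) :
  wedge (basis_form F) (basis_form G) = basis_form (join F G).
Proof.
apply/ffunP => I; rewrite wedgeE.
pose u : cov R n (k + l) := [ffun H : midx (k + l) n =>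
  basis_form F [ffun p => H (lshift l p)] * basis_form G [ffun q => H (rshift k q)]].
have e1 : \sum_(s : 'S_(k + l)) (-1) ^+ s * basis_form F [ffun p => I (s (lshift l p))]
     * basis_form G [ffun q => I (s (rshift k q))] = \sum_H u H * basis_form I H.
  rewrite sum_mul_basis; apply: eq_bigr => s _; rewrite -[LHS]mulrA; congr (_ * _).
  have -> : [ffun p => I (s (lshift l p))] = [ffun p => [ffun q => I (s q)] (lshift l p)].
    by apply/ffunP => p; rewrite !ffunE.
  have -> : [ffun q => I (s (rshift k q))] = [ffun p => [ffun q => I (s q)] (rshift k p)].
    by apply/ffunP => p; rewrite !ffunE.
  by rewrite [RHS]ffunE.
rewrite e1 big_join.
under eq_bigr => F' _ do under eq_bigr => G' _ do rewrite ffunE.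
pose u' : cov R n (k + l) := [ffun H => basis_form I H].
have uE H : u' H = basis_form I H by rewrite ffunE.
have ualt : alternating u'.
  by move=> r H; rewrite !uE (alternating_basis I).
rewrite exchange_big /=.
transitivity ((k`! * l`!)%:R^-1 * (\sum_G' (k`!%:R * u' (join F G')) * basis_form G G') : R).
  congr (_ * _); apply: eq_bigr => G' _.
  have := sum_basis_fun F (alternating_joinl G' ualt) => /= <-; rewrite mulr_suml; apply: eq_bigr => F' _.
  have -> : [ffun p => join F' G' (lshift l p)] = F' by apply/ffunP => p; rewrite ffunE tjoin_l.
  have -> : [ffun q => join F' G' (rshift k q)] = G' by apply/ffunP => p; rewrite ffunE tjoin_r.
  by rewrite uE mulrC mulrA.
under eq_bigr do rewrite -mulrA.
have := sum_basis_fun G (alternating_joinr F ualt); rewrite -mulr_sumr uE basis_swap => h.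
apply: etrans (congr1 (fun z : R => (k`! * l`!)%:R^-1 * (k`!%:R * z)) h) _.
have sc (z : R) : (k`! * l`!)%:R^-1 * (k`!%:R * (l`!%:R * z)) = z.
  have n0 : (k`! * l`!)%:R != 0 :> R by rewrite pnatr_eq0 muln_eq0 negb_or -!lt0n !fact_gt0.
  by rewrite [X in _ * X]mulrA -natrM mulKf.
exact: sc.
Qed.

Lemma eps_basis n : eps n = basis_form (finfun id) :> cov R n n.
Proof. by apply/ffunP => I; rewrite !ffunE; congr (\det _); apply/matrixP => a b; rewrite !mxE !ffunE. Qed.

Lemma hodge_basis k l (F : midx k (k + l)) (J : midx l (k + l)) :
  hodge 1%:M (basis_form F) J = basis_form (finfun id) (join F J).
Proof.
have i1 : invmx 1%:M = 1%:M :> 'M[R]_(k + l) by rewrite invmx1.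
rewrite hodgeE i1 pull1 det1 sqrtr1 eps_basis mul1r (sum_basis_fun F (alternating_joinl J (alternating_basis (finfun id)))) mulrA mulVf ?mul1r //.
Qed.

Lemma alternating_hodge k l (m : 'M[R]_(k + l)) (t : cov R (k + l) k) :
  alternating (hodge m t : cov R (k + l) l).
Proof.
move=> s J; rewrite !hodgeE mulrCA; congr (_ * _); rewrite mulr_sumr; apply: eq_bigr => I _.
have := alternating_joinr I (alternating_basis (finfun id)) s J.
by rewrite ffunE [X in _ = _ * X -> _]ffunE eps_basis => ->; rewrite mulrA.
Qed.

(** The value of [e s] at the index list [l], for [s] without repetition, as a computable integer.
    It is Laplace expansion along the first row, where at most one entry is non-zero: the head of
    [l] is looked up in [s], gives the sign of its position, and is removed. *)
Fixpoint ee (s l : seq nat) : int :=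
  if l is a :: l' then
    if a \in s then (if odd (index a s) then - ee (rem a s) l' else ee (rem a s) l') else 0
  else (nilp s)%:R.

Lemma nth_rem (a : nat) (s : seq nat) q : nth 0%N (rem a s) q = nth 0%N s (bump (index a s) q).
Proof.
rewrite remE nth_cat nth_drop /bump size_take.
have [lt|ge] := ltnP (index a s) (size s); first last.
  have is_ : index a s = size s by apply/eqP; rewrite eqn_leq index_size ge.
  rewrite is_; case: (ltnP q (size s)) => h; first by rewrite nth_take // leqNgt h.
  rewrite !nth_default //; first exact: (leq_trans h (leq_addl _ _)).
  by rewrite addSn leqW // leq_addr.
case: ltnP => h; first by rewrite nth_take // leqNgt h.
by rewrite addSn subnKC // add1n.
Qed.

Lemma det_ee k (s l : k.-tuple nat) : uniq s ->
  \det (\matrix_(a < k, b < k) ((tnth l a == tnth s b)%:R : R)) = (ee s l)%:~R.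
Proof.
elim: k s l => [|k IH] s l us; first by rewrite det_mx00 (tuple0 s) (tuple0 l).
case/tupleP: l => a l; rewrite (expand_det_row _ 0) /=.
case: ifP => as_; last first.
  rewrite big1 // => b _; rewrite mxE tnth0.
  case: eqP => [eb|]; last by rewrite mul0r.
  by rewrite eb mem_tnth in as_.
have lt : (index a s < k.+1)%N by rewrite -[X in (_ < X)%N](size_tuple s) index_mem.
pose b0 := Ordinal lt.
have sb0 : tnth s b0 = a by rewrite (tnth_nth 0%N) /= nth_index.
rewrite (bigD1 b0) //= big1 ?addr0 => [|b nb]; last first.
  rewrite mxE tnth0; case: eqP => [eb|_]; last exact: mul0r.
  case/eqP: nb; apply/val_inj; change (val b = index a s); move: eb; rewrite (tnth_nth 0%N) => ->.
  by rewrite /= index_uniq // size_tuple.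
rewrite mxE tnth0 sb0 eqxx mul1r /cofactor /= add0n.
have sz : size (rem a s) == k by rewrite size_rem // size_tuple.
rewrite -signr_odd.
have -> : row' 0 (col' b0 (\matrix_(a1, b) ((tnth [tuple of a :: l] a1 == tnth s b)%:R : R))) =
    \matrix_(p < k, q < k) ((tnth l p == tnth (Tuple sz) q)%:R).
  apply/matrixP => p q; rewrite !mxE; congr (_ == _)%:R.
    by rewrite tnthS.
  by rewrite !(tnth_nth 0%N) /= nth_rem.
rewrite IH /=; last exact: rem_uniq.
by case: (odd _); rewrite ?mulN1r ?mul1r ?rmorphN.
Qed.

(** [f] computes the components of [t] as integers from index lists. Given such a function for each
    side, an identity of forms becomes a boolean computation. *)
Definition num n k (t : cov R n k) (f : seq nat -> int) : Prop :=
  forall I, t I = (f (idx I))%:~R :> R.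

Lemma num_e n k (s : k.-tuple nat) : num (e n s) (fun l => if uniq s then ee s l else 0).
Proof.
move=> I; case: ifPn => us; last first.
  rewrite ffunE -det_tr; case/(uniqPn 0%N): us => i [j [ij]]; rewrite size_tuple => jk eij.
  have ik := ltn_trans ij jk.
  apply: (@determinant_alternate _ _ _ (Ordinal ik) (Ordinal jk)); first by rewrite -val_eqE /= ltn_eqF.
  by move=> b; rewrite !mxE !(tnth_nth 0%N) /= eij.
 have sz : size (idx I) == k by rewrite size_idx.
rewrite ffunE -(det_ee (Tuple sz) us); congr (\det _); apply/matrixP => a b; rewrite !mxE.
by rewrite [in RHS](tnth_nth 0%N) nth_idx.
Qed.

Lemma e_basis_exists n k (s : k.-tuple nat) : all (fun a => 0 < a <= n)%N s ->
  exists F : midx k n, tval s = idx F.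
Proof.
move=> /allP h.
have lt (p : 'I_k) : ((tnth s p).-1 < n)%N.
  by have /andP[h0 h1] := h _ (mem_tnth p s); rewrite prednK.
exists [ffun p => Ordinal (lt p)]; apply: (@eq_from_nth _ 0%N); first by rewrite size_idx size_tuple.
move=> p; rewrite size_tuple => pk; rewrite (nth_idx _ (Ordinal pk)) ffunE /=.
have /andP[h0 _] := h _ (mem_tnth (Ordinal pk) s).
by rewrite prednK // (tnth_nth 0%N).
Qed.

Lemma idx_join n k l (I : midx k n) (J : midx l n) :
  idx (join I J) = idx I ++ idx J.
Proof.
apply: (@eq_from_nth _ 0%N); first by rewrite size_cat !size_idx.
move=> p; rewrite size_idx => pk; rewrite (nth_idx _ (Ordinal pk)) nth_cat size_idx.
case: (split_ordP (Ordinal pk)) => q eq_; rewrite eq_ ?tjoin_l ?tjoin_r.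
  have pq : p = q :> nat := congr1 val eq_.
  by rewrite pq ?ltn_ord nth_idx.
have -> : p = (k + q)%N := congr1 val eq_.
by rewrite addKn nth_idx.
Qed.

Lemma wedge_e n k l (s : k.-tuple nat) (t : l.-tuple nat) :
  all (fun a => 0 < a <= n)%N s -> all (fun a => 0 < a <= n)%N t ->
  wedge (e n s) (e n t) = e n [tuple of s ++ t] :> cov R n (k + l).
Proof.
move=> /e_basis_exists[F sF] /e_basis_exists[G tG].
rewrite (e_basis sF) (e_basis tG) wedge_basis; symmetry; apply: e_basis.
by rewrite idx_join -sF -tG.
Qed.

Lemma num_hodge k l (s : k.-tuple nat) : all (fun a => 0 < a <= k + l)%N s ->
  num (@hodge R k l 1%:M (e (k + l) s)) (fun r => ee (iota 1 (k + l)) (s ++ r)).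
Proof.
move=> /e_basis_exists[F sF] J; rewrite (e_basis sF) hodge_basis.
have sz : size (iota 1 (k + l)) == (k + l)%N by rewrite size_iota.
have ei : tval (Tuple sz) = idx (finfun id : midx (k + l) (k + l)).
  apply: (@eq_from_nth _ 0%N); rewrite ?size_idx size_iota // => p pk.
  by rewrite (nth_idx _ (Ordinal pk)) ffunE nth_iota //= add1n.
by rewrite -(e_basis ei) num_e /= iota_uniq idx_join -sF.
Qed.

Lemma wedgeDl n k l (a a' : cov R n k) (b : cov R n l) : wedge (a + a') b = wedge a b + wedge a' b.
Proof.
apply/ffunP => I; rewrite [RHS]ffunE !wedgeE -mulrDr; congr (_ * _).
by rewrite -big_split; apply: eq_bigr => s _; rewrite [in LHS]ffunE /= mulrDr mulrDl.
Qed.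

Lemma wedgeZl n k l c (a : cov R n k) (b : cov R n l) : wedge (c *: a) b = c *: wedge a b.
Proof.
apply/ffunP => I; rewrite [RHS]ffunE !wedgeE [RHS]mulrCA; congr (_ * _).
rewrite [RHS]mulr_sumr; apply: eq_bigr => s _; rewrite [X in _ * X * _]ffunE.
by apply: etrans (congr1 (fun z : R => z * _) (mulrCA _ _ _)) _; exact: esym (mulrA _ _ _).
Qed.

Lemma wedgeNl n k l (a : cov R n k) (b : cov R n l) : wedge (- a) b = - wedge a b.
Proof. by rewrite -scaleN1r wedgeZl scaleN1r. Qed.

Lemma wedgeDr n k l (a : cov R n k) (b b' : cov R n l) : wedge a (b + b') = wedge a b + wedge a b'.
Proof.
apply/ffunP => I; rewrite [RHS]ffunE !wedgeE -mulrDr; congr (_ * _).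
by rewrite -big_split; apply: eq_bigr => s _; rewrite [X in _ * X = _]ffunE /= mulrDr.
Qed.

Lemma wedgeZr n k l c (a : cov R n k) (b : cov R n l) : wedge a (c *: b) = c *: wedge a b.
Proof.
apply/ffunP => I; rewrite [RHS]ffunE !wedgeE [RHS]mulrCA; congr (_ * _).
by rewrite [RHS]mulr_sumr; apply: eq_bigr => s _; rewrite [X in _ * X = _]ffunE mulrCA.
Qed.

Lemma hodgeD k l m (s t : cov R (k + l) k) : hodge m (s + t) = hodge m s + hodge m t :> cov R (k + l) l.
Proof.
apply/ffunP => J; rewrite [RHS]ffunE !hodgeE -mulrDr; congr (_ * _).
by rewrite -big_split; apply: eq_bigr => I _; rewrite pullD [X in _ * X = _]ffunE /= mulrDr.
Qed.

Lemma hodgeZ k l m c (t : cov R (k + l) k) : hodge m (c *: t) = c *: hodge m t :> cov R (k + l) l.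
Proof.
apply/ffunP => J; rewrite [RHS]ffunE !hodgeE [RHS]mulrCA; congr (_ * _).
by rewrite [RHS]mulr_sumr; apply: eq_bigr => I _; rewrite pullZ [X in _ * X = _]ffunE mulrCA.
Qed.

Section Num.
Variables (n k : nat).
Implicit Types (s t : cov R n k) (f g : seq nat -> int).

Lemma numD s t f g : num s f -> num t g -> num (s + t) (fun l => f l + g l).
Proof. by move=> h1 h2 I; rewrite ffunE h1 h2 rmorphD. Qed.

Lemma numN t f : num t f -> num (- t) (fun l => - f l).
Proof. by move=> h I; rewrite ffunE h rmorphN. Qed.

Lemma numZ (c : int) t f : num t f -> num (c%:~R *: t) (fun l => c * f l).
Proof. by move=> h I; rewrite ffunE h rmorphM. Qed.

End Num.

Lemma alternating_ins n k (t : cov R n (k + 1)) (v : 'rV[R]_n) : alternating t -> alternating (ins t v).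
Proof.
move=> alt s I; rewrite !ffunE mulr_sumr; apply: eq_bigr => c _.
by have := alternating_joinl [ffun=> c] alt s I; rewrite !ffunE => ->; rewrite mulrCA.
Qed.

Lemma num_ins n k (t : cov R n (k + 1)) f (j : 'I_n) : num t f ->
  num (ins t (bv j)) (fun l => f (rcons l j.+1)).
Proof.
move=> h I; rewrite ffunE (bigD1 j) //= big1 => [|c nc].
  rewrite mxE !eqxx mul1r addr0 h idx_join -cats1; congr (f (_ ++ _))%:~R.
  by rewrite /idx enum_ordSl enum_ord0 /= ffunE.
by rewrite mxE eqxx (negbTE nc) mul0r.
Qed.

Lemma pull_row10 n m k (t : cov R (n + m) k) I :
  pull (row_mx 1%:M 0 : 'M[R]_(n, n + m)) t I = t [ffun p => lshift m (I p)].
Proof.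
rewrite pullE (bigD1 [ffun p => lshift m (I p)]) //= [X in _ + X]big1 => [|J nJ].
  rewrite [X in X * _]big1 => [|p _]; last by rewrite ffunE row_mxEl mxE eqxx.
  by rewrite mul1r; exact: addr0.
have [p np] : exists p, J p != lshift m (I p).
  apply/existsP; rewrite -negb_forall; apply: contra nJ => /forallP h'.
  by apply/eqP/ffunP => p; rewrite ffunE; apply/eqP.
rewrite (bigD1 p) //=; suff -> : (row_mx 1%:M 0 : 'M[R]_(n, n + m)) (I p) (J p) = 0 by rewrite !mul0r.
case: (split_ordP (J p)) np => q ->; last by rewrite row_mxEr mxE.
by rewrite (inj_eq (@lshift_inj _ _)) row_mxEl mxE eq_sym => /negbTE ->.
Qed.

Lemma num_pull_widen n m k (t : cov R (n + m) k) f : num t f ->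
  num (pull (row_mx 1%:M 0 : 'M[R]_(n, n + m)) t) f.
Proof. by move=> h I; rewrite pull_row10 h; congr (f _)%:~R; apply: eq_map => a; rewrite ffunE. Qed.

Fixpoint sumz (f : nat -> int) (l : seq nat) : int :=
  if l is a :: l' then f a + sumz f l' else 0.

Lemma sumz_ord f m n : \sum_(i < n) (f (m + i)%N)%:~R = (sumz f (iota m n))%:~R :> R.
Proof.
elim: n m => [|n IH] m; first by rewrite big_ord0.
rewrite big_ord_recl [iota m n.+1]/= [RHS]rmorphD addn0 -[X in _ = _ + X]IH; congr (_ + _); apply: eq_bigr => i _.
by rewrite addSnnS.
Qed.

Lemma num_act n k (A : 'M[R]_n) (a : nat -> nat -> int) (t : cov R n k) f :
  (forall i j, A i j = (a i.+1 j.+1)%:~R) -> num t f ->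
  num (act A t) (fun l => sumz (fun p => sumz (fun j => a (nth 0%N l p) j * f (set_nth 0%N l p j)) (iota 1 n)) (iota 0 k)).
Proof.
move=> hA h I; rewrite actE -sumz_ord; apply: eq_bigr => p _.
rewrite -sumz_ord; apply: eq_bigr => j _.
rewrite rmorphM /= hA nth_idx h; congr (_ * (f _)%:~R).
apply: (@eq_from_nth _ 0%N); rewrite add0n; first by rewrite size_set_nth !size_idx; apply/esym/maxn_idPr.
move=> q; rewrite size_idx => qk; rewrite (nth_idx _ (Ordinal qk)) nth_set_nth /= ffunE.
rewrite -val_eqE /=; case: eqP => // _; by rewrite -(nth_idx I (Ordinal qk)).
Qed.

Lemma num_so_of_form n (t : cov R n 2) f : num t f ->
  forall i j, so_of_form t i j = (f [:: i.+1; j.+1])%:~R.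
Proof.
move=> h i j; rewrite mxE h; congr (f _)%:~R.
by rewrite /idx !enum_ordSl enum_ord0 /= !ffunE !(tnth_nth i).
Qed.

Lemma alternating_rep n k (t : cov R n k) (p q : 'I_k) (I : midx k n) :
  alternating t -> p != q -> I p = I q -> t I = 0.
Proof.
move=> alt pq eI; have := alt (tperm p q) I.
have -> : [ffun r => I (tperm p q r)] = I.
  by apply/ffunP => r; rewrite ffunE; case: tpermP => [->|->|].
by rewrite odd_tperm pq expr1 mulN1r; move: (t I : R) => z /eqP; rewrite -subr_eq0 opprK -mulr2n mulrn_eq0 => /eqP.
Qed.

(** Sublists of length [k]; those of [iota 1 n] are the increasing multi-indices, which determine an
    alternating form. *)
Fixpoint combs (l : seq nat) (k : nat) : seq (seq nat) :=
  match k, l with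
  | 0, _ => [:: [::]]
  | k'.+1, a :: l' => [seq a :: c | c <- combs l' k'] ++ combs l' k
  | _, [::] => [::]
  end.

Lemma mem_combs l s : subseq s l -> s \in combs l (size s).
Proof.
elim: l s => [|a l IH] [|b s] //=.
case: eqP => [->|_] sub; rewrite mem_cat; last by rewrite (IH (b :: s)) ?orbT.
by apply/orP; left; apply/mapP; exists s; rewrite ?IH.
Qed.

Lemma sorted_idx n k (I : midx k n) : sorted ltn (idx I) -> idx I \in combs (iota 1 n) k.
Proof.
move=> so; rewrite -[k in combs _ k](size_idx I); apply: mem_combs.
suff -> : idx I = [seq a <- iota 1 n | a \in idx I] by exact: filter_subseq.
apply: (irr_sorted_eq ltn_trans ltnn so); first by rewrite (sorted_filter ltn_trans) // iota_ltn_sorted.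
move=> a; rewrite mem_filter mem_iota; apply/idP/andP => [ai|[]//]; split=> //.
by case/mapP: ai => p _ ->; rewrite /= add1n ltnS ltn_ord.
Qed.

(** A repeated index gives 0, and a multi-index without repetition is sorted by a permutation at the
    cost of a sign. *)
Lemma alternating0 n k (t : cov R n k) : alternating t ->
  (forall I, idx I \in combs (iota 1 n) k -> t I = 0) -> t = 0.
Proof.
move=> alt h; apply/ffunP => I; rewrite ffunE.
have [inj|] := boolP (injectiveb I); last first.
  case/injectivePn => p [q pq eI]; exact: alternating_rep alt pq eI.
move/injectiveP: inj => inj.
have ui : uniq (idx I).
  by rewrite map_inj_uniq ?enum_uniq // => p q /succn_inj/val_inj/inj.
have sz : size (idx I) == k by rewrite size_idx.
have /tuple_permP[p ep] : perm_eq (sort leq (idx I)) (Tuple sz) by rewrite perm_sort.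
have eJ : sort leq (idx I) = idx [ffun a => I (p a)].
  rewrite ep; apply: eq_map => a; rewrite (tnth_nth 0%N) /= nth_idx ffunE.
  by [].
have so : sorted ltn (idx [ffun a => I (p a)]).
  by rewrite -eJ ltn_sorted_uniq_leq sort_uniq ui sort_sorted //; exact: leq_total.
have := h _ (sorted_idx so); rewrite alt => /eqP; rewrite mulf_eq0 signr_eq0 /= => /eqP; exact.
Qed.

Lemma num_eq n k (s t : cov R n k) f g : alternating s -> alternating t ->
  num s f -> num t g -> all (fun l => f l == g l) (combs (iota 1 n) k) -> s = t.
Proof.
move=> as_ at_ hf hg /allP h; apply/eqP; rewrite -subr_eq0; apply/eqP; apply: alternating0.
  by move=> p I; rewrite !ffunE as_ at_ mulrBr.
by move=> I /h /eqP e; rewrite !ffunE hf hg e subrr.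
Qed.

Lemma alternatingD n k (s t : cov R n k) : alternating s -> alternating t -> alternating (s + t).
Proof. by move=> hs ht p I; rewrite !ffunE hs ht mulrDr. Qed.

Lemma alternatingZ n k c (t : cov R n k) : alternating t -> alternating (c *: t).
Proof. by move=> h p I; rewrite !ffunE h; exact: mulrCA. Qed.

Lemma alternating_opp n k (t : cov R n k) : alternating t -> alternating (- t).
Proof. by move=> h; rewrite -scaleN1r; exact: alternatingZ. Qed.

Lemma alternating0c n k : alternating (0 : cov R n k).
Proof. by move=> p I; rewrite !ffunE mulr0. Qed.

Lemma alternating_e n k (s : k.-tuple nat) : alternating (e n s : cov R n k).
Proof.
move=> p I; rewrite !ffunE.
set A := (X in _ = _ * \det X).
suff -> : \matrix_(a, b) (([ffun p0 => I (p p0)] a).+1 == tnth s b)%:R = perm_mx p *m A.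
  by rewrite det_mulmx det_perm.
by rewrite -row_permE; apply/matrixP => a b; rewrite !mxE ffunE.
Qed.

Lemma alternating_wedge n k l (a : cov R n k) (b : cov R n l) : alternating (wedge a b).
Proof.
move=> p I; rewrite !wedgeE mulrCA; congr (_ * _); rewrite mulr_sumr.
rewrite (reindex_inj (mulIg p^-1)%g) /=; apply: eq_bigr => s _.
rewrite odd_permM odd_permV signr_addb [_ * (-1) ^+ p]mulrC -!mulrA; congr (_ * (_ * (_ * _))).
  by congr (a _); apply/ffunP => q; rewrite !ffunE permM permKV.
by congr (b _); apply/ffunP => q; rewrite !ffunE permM permKV.
Qed.

Lemma alternating_act n k (A : 'M[R]_n) (t : cov R n k) : alternating t -> alternating (act A t).
Proof.
move=> alt s I; rewrite !actE mulr_sumr (reindex_inj (@perm_inj _ s^-1%g)) /=; apply: eq_bigr => p _.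
rewrite mulr_sumr; apply: eq_bigr => j _; rewrite mulrCA; congr (_ * _); first by rewrite ffunE permKV.
by rewrite -alt; congr (t _); apply/ffunP => q; rewrite !ffunE (canF_eq (permK s)).
Qed.

End Basis.

Ltac cov_ring := apply/ffunP => ?; rewrite !ffunE /GRing.scale /=; ring.
Ltac num_tac := repeat first [apply: numD | apply: numN | apply: num_e | apply: numZ | (apply: (@num_hodge _ 3 4); by [])
  | (apply: (@num_hodge _ 4 4); by [])].
Ltac alt_tac := repeat first [apply: alternatingD | apply: alternating_opp | apply: alternating_e
  | apply: alternatingZ | apply: alternating_wedge | apply: (@alternating_hodge _ 3 4)
  | apply: (@alternating_hodge _ 4 4)].

Ltac num_eq_tac := apply: num_eq; [by alt_tac | by alt_tac | by num_tac | by num_tac | by vm_compute].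

(** * The Spin(7) and G2 forms in coordinates *)

Section Forms.
Context {R : realType}.
Notation e := (@e R _).

Lemma hodgeN k l m (t : cov R (k + l) k) : hodge m (- t) = - hodge m t :> cov R (k + l) l.
Proof. by rewrite -scaleN1r hodgeZ scaleN1r. Qed.

Lemma g2_formE n : (n == 7) || (n == 8) ->
  g2_form n = e [tuple 1; 2; 7]%N + e [tuple 3; 4; 7]%N + e [tuple 5; 6; 7]%N + D n :> cov R n 3.
Proof.
move=> hn; rewrite /g2_form /Z !wedgeDl; congr (_ + _ + _ + _); case/orP: hn => /eqP ->; rewrite wedge_e //; num_eq_tac.
Qed.

Lemma spin7_formE : spin7_form =
  e [tuple 1; 2; 7; 8]%N + e [tuple 3; 4; 7; 8]%N + e [tuple 5; 6; 7; 8]%N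
  + (e [tuple 2; 4; 6; 8]%N - e [tuple 2; 3; 5; 8]%N - e [tuple 1; 4; 5; 8]%N - e [tuple 1; 3; 6; 8]%N)
  - (- e [tuple 1; 3; 5; 7]%N + e [tuple 2; 4; 5; 7]%N + e [tuple 1; 4; 6; 7]%N + e [tuple 2; 3; 6; 7]%N)
  + (e [tuple 1; 2; 3; 4]%N + e [tuple 1; 2; 5; 6]%N + e [tuple 3; 4; 5; 6]%N) :> cov R 8 4.
Proof.
have phiE : spin7_phi = e [tuple 1; 2; 7; 8]%N + e [tuple 3; 4; 7; 8]%N + e [tuple 5; 6; 7; 8]%N
  + (e [tuple 2; 4; 6; 8]%N - e [tuple 2; 3; 5; 8]%N - e [tuple 1; 4; 5; 8]%N - e [tuple 1; 3; 6; 8]%N) :> cov R 8 4.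
  rewrite /spin7_phi g2_formE // /D !(wedgeDl, wedgeNl) !wedge_e //; num_eq_tac.
rewrite /spin7_form phiE !(hodgeD, hodgeN); num_eq_tac.
Qed.

(** The model computation behind [slice_star]: in a frame whose last vector is normal to the slice,
    the first seven coordinates of [Phi] see only the star of the G2 form. *)
Lemma g2_star : pull (row_mx 1%:M 0 : 'M[R]_(7, 7 + 1)) (spin7_form : cov R (7 + 1) 4) =
  @hodge R 3 4 1%:M (g2_form 7).
Proof.
rewrite spin7_formE g2_formE // !(hodgeD, hodgeN) /D; apply: num_eq; first by apply: alternating_pull; alt_tac.
- by alt_tac.
- by apply: num_pull_widen; num_tac.
- by num_tac.
by vm_compute.
Qed.

Lemma g2_contraction : pull (row_mx 1%:M 0 : 'M[R]_(7, 7 + 1)) (ins (spin7_form : cov R 8 (3 + 1)) (bv ord_max)) =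
  g2_form 7.
Proof.
rewrite spin7_formE g2_formE // /D; apply: num_eq; first by apply: alternating_pull; apply: alternating_ins; alt_tac.
- by alt_tac.
- by apply: num_pull_widen; apply: num_ins; num_tac.
- by num_tac.
by vm_compute.
Qed.

End Forms.

(** The size 8 is written as a nested sum so that the blocks of [rot] reduce on the indices; [j5] to
    [j8] are the positions of e5 to e8. *)
Notation ord8 := 'I_(4 + ((1 + 1) + (1 + 1))).
Notation j5 := (rshift 4 (lshift (1 + 1) (lshift 1 0)) : ord8).
Notation j6 := (rshift 4 (lshift (1 + 1) (rshift 1 0)) : ord8).
Notation j7 := (rshift 4 (rshift (1 + 1) (lshift 1 0)) : ord8).
Notation j8 := (rshift 4 (rshift (1 + 1) (rshift 1 0)) : ord8).

(** * Opposite rotations of the planes (e5, e6) and (e7, e8) *)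

Section Unitary.
Context {R : realType}.
Let bl := (block_mxEul, block_mxEur, block_mxEdl, block_mxEdr).
Notation e := (@e R _).

Definition rot2 (a b : R) : 'M[R]_(1 + 1) := block_mx a%:M b%:M (- b)%:M a%:M.

Lemma mul_rot2 a b a' b' : rot2 a b *m rot2 a' b' = rot2 (a * a' - b * b') (a * b' + b * a').
Proof.
rewrite /rot2 mulmx_block -!scalar_mxM -!raddfD /=; congr (block_mx _%:M _%:M _%:M _%:M); ring.
Qed.

Lemma tr_rot2 a b : (rot2 a b)^T = rot2 a (- b).
Proof. by rewrite /rot2 tr_block_mx !tr_scalar_mx opprK. Qed.

Lemma det_rot2 a b : \det (rot2 a b) = a ^+ 2 + b ^+ 2.
Proof.
have det2 (M : 'M[R]_2) : \det M = M 0 0 * M 1 1 - M 0 1 * M 1 0.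
  rewrite (expand_det_row _ 0) big_ord_recl big_ord1 /cofactor !det_mx11 !mxE /=.
  have -> : lift ord0 0 = 1 :> 'I_2 by exact/val_inj.
  have -> : lift 1 0 = 0 :> 'I_2 by exact/val_inj.
  by rewrite expr0 mul1r expr1 mulN1r mulrN.
rewrite det2.
have -> : 0 = lshift 1 (0 : 'I_1) :> 'I_2 by exact/val_inj.
have -> : 1 = rshift 1 (0 : 'I_1) :> 'I_2 by exact/val_inj.
have e1 : rot2 a b (lshift 1 0) (lshift 1 0) = a by rewrite /rot2 block_mxEul mxE.
have e2 : rot2 a b (lshift 1 0) (rshift 1 0) = b by rewrite /rot2 block_mxEur mxE.
have e3 : rot2 a b (rshift 1 0) (lshift 1 0) = - b by rewrite /rot2 block_mxEdl mxE.
have e4 : rot2 a b (rshift 1 0) (rshift 1 0) = a by rewrite /rot2 block_mxEdr mxE.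
by rewrite e1 e2 e3 e4 mulrN opprK.
Qed.

(** The opposite angles make [D] and [Dbar] transform like e7 and e8, so that [D] wedge e8 minus
    [Dbar] wedge e7, a part of [spin7_form], is invariant. *)
Definition rot (c s : R) : 'M[R]_(4 + ((1 + 1) + (1 + 1))) :=
  block_mx 1%:M 0 0 (block_mx (rot2 c s) 0 0 (rot2 c (- s))).

Lemma rot_tr c s : (rot c s)^T = rot c (- s).
Proof. by rewrite /rot (tr_block_mx 1%:M) (tr_block_mx (rot2 _ _)) !trmx0 trmx1 !tr_rot2. Qed.

Lemma rot_orth c s : c ^+ 2 + s ^+ 2 = 1 -> rot c s *m (rot c s)^T = 1%:M.
Proof.
move=> cs; rewrite rot_tr /rot (mulmx_block 1%:M) (mulmx_block (rot2 _ _)) !mulmx0 !mul0mx !addr0 !add0r mulmx1 !mul_rot2.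
have -> : c * c - s * - s = 1 by rewrite -cs; ring.
have -> : c * - s + s * c = 0 by ring.
have -> : c * c - - s * - - s = 1 by rewrite -cs; ring.
have -> : c * - - s + - s * c = 0 by ring.
by rewrite /rot2 oppr0 raddf0 -!scalar_mx_block.
Qed.

Lemma det_rot c s : c ^+ 2 + s ^+ 2 = 1 -> \det (rot c s) = 1.
Proof. by move=> cs; rewrite /rot !det_ublock det1 !det_rot2 sqrrN cs !mul1r. Qed.

Lemma pull_e1 m n (A : 'M[R]_(m, n)) (j : 'I_n) (I : midx 1 m) a :
  a = (val j).+1 -> pull A (e [tuple a]) I = A (I 0) j.
Proof.
move=> ->; rewrite pullE big_ffun1 (bigD1 j) //= [X in _ + X]big1 => [|c nc].
  rewrite big_ord1 ffunE [e _ _]ffunE det_mx11 mxE ffunE tnth0 eqxx mulr1; exact: addr0.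
rewrite [e _ _]ffunE det_mx11 mxE [[ffun=> c] 0]ffunE tnth0 eqSS.
by rewrite (inj_eq val_inj) (negbTE nc) mulr0.
Qed.

Lemma rotE c s a :
  [/\ forall i, rot c s a (lshift _ i) = (a == lshift _ i)%:R,
      rot c s a j5 = c * (a == j5)%:R - s * (a == j6)%:R,
      rot c s a j6 = s * (a == j5)%:R + c * (a == j6)%:R,
      rot c s a j7 = c * (a == j7)%:R + s * (a == j8)%:R &
      rot c s a j8 = - s * (a == j7)%:R + c * (a == j8)%:R].
Proof.
case: (split_ordP a) => p ->.
  by split=> [i||||]; rewrite /rot ?bl ?eq_shift ?mxE ?mulr0 ?mulr1 ?mulr1n ?mulr0n ?subr0 ?addr0 ?add0r ?sub0r ?opprK.
case: (split_ordP p) => {}p ->; case: (split_ordP p) => {}p ->; rewrite !ord1;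
  by split=> [i||||]; rewrite /rot /rot2 ?bl ?eq_shift ?mxE ?mulr0 ?mulr1 ?mulr1n ?mulr0n ?subr0 ?addr0 ?add0r ?sub0r ?opprK.
Qed.

Lemma rot_e c s :
  [/\ forall i : 'I_4, pull (rot c s) (e [tuple (val i).+1]) = e [tuple (val i).+1],
      pull (rot c s) (e [tuple 5]%N) = c *: e [tuple 5]%N - s *: e [tuple 6]%N,
      pull (rot c s) (e [tuple 6]%N) = s *: e [tuple 5]%N + c *: e [tuple 6]%N,
      pull (rot c s) (e [tuple 7]%N) = c *: e [tuple 7]%N + s *: e [tuple 8]%N &
      pull (rot c s) (e [tuple 8]%N) = - s *: e [tuple 7]%N + c *: e [tuple 8]%N :> cov R (4 + ((1 + 1) + (1 + 1))) 1].
Proof.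
have eE (j : ord8) a (I : {ffun 'I_1 -> _}) : a = (val j).+1 ->
    e [tuple a] I = (I 0 == j)%:R.
  by move=> ->; rewrite ffunE det_mx11 mxE tnth0 eqSS.
split=> [i||||]; apply/ffunP => I; have [h1 h5 h6 h7 h8] := rotE c s (I 0).
- by rewrite (pull_e1 _ I (j := lshift _ i)) // (eE (lshift _ i)) // h1.
- rewrite (pull_e1 _ I (j := j5)) // h5 -(eE j5 5%N) // -(eE j6 6%N) //.
  by rewrite [RHS]ffunE [X in _ = X + _]ffunE [X in _ = _ + X]ffunE [X in _ = _ - X]ffunE.
- rewrite (pull_e1 _ I (j := j6)) // h6 -(eE j5 5%N) // -(eE j6 6%N) //.
  by rewrite [RHS]ffunE [X in _ = X + _]ffunE [X in _ = _ + X]ffunE.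
- rewrite (pull_e1 _ I (j := j7)) // h7 -(eE j7 7%N) // -(eE j8 8%N) //.
  by rewrite [RHS]ffunE [X in _ = X + _]ffunE [X in _ = _ + X]ffunE.
by rewrite (pull_e1 _ I (j := j8)) // h8 -(eE j7 7%N) // -(eE j8 8%N) // [RHS]ffunE [X in _ = X + _]ffunE [X in _ = _ + X]ffunE.
Qed.

(** [sig] and [tau] involve only the first four coordinates, which [rot] fixes. They make [D] and
    [Dbar] linear in e5 and e6, from which the effect of the rotation is read off. *)
Definition sig : cov R 8 2 := e [tuple 2; 4]%N - e [tuple 1; 3]%N.
Definition tau : cov R 8 2 := e [tuple 1; 4]%N + e [tuple 2; 3]%N.

Lemma D_wedge : D 8 = wedge sig (e [tuple 6]%N) - wedge tau (e [tuple 5]%N).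
Proof. rewrite /sig /tau /D !(wedgeDl, wedgeNl) !wedge_e //; num_eq_tac. Qed.

Lemma Dbar_wedge : Dbar 8 = wedge sig (e [tuple 5]%N) + wedge tau (e [tuple 6]%N).
Proof. rewrite /sig /tau /Dbar !(wedgeDl, wedgeNl) !wedge_e //; num_eq_tac. Qed.

Lemma wedgeNr n k l (a : cov R n k) (b : cov R n l) : wedge a (- b) = - wedge a b.
Proof. by rewrite -scaleN1r wedgeZr scaleN1r. Qed.

Lemma pullN m n k (A : 'M[R]_(m, n)) (t : cov R n k) : pull A (- t) = - pull A t.
Proof. by rewrite -scaleN1r pullZ scaleN1r. Qed.

Lemma rot_wedge c s k l (a : cov R 8 k) (b : cov R 8 l) :
  pull (rot c s) (wedge a b) = wedge (pull (rot c s) a) (pull (rot c s) b).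
Proof. exact: pull_wedge. Qed.

Let w11 c s (a : cov R 8 1) (b : cov R 8 1) : pull (rot c s) (wedge a b : cov R 8 2) = (wedge (pull (rot c s) a) (pull (rot c s) b) : cov R 8 2) :=
  @rot_wedge c s 1 1 a b.
Let w21 c s (a : cov R 8 2) (b : cov R 8 1) : pull (rot c s) (wedge a b : cov R 8 3) = (wedge (pull (rot c s) a) (pull (rot c s) b) : cov R 8 3) :=
  @rot_wedge c s 2 1 a b.
Let w22 c s (a : cov R 8 2) (b : cov R 8 2) : pull (rot c s) (wedge a b : cov R 8 4) = (wedge (pull (rot c s) a) (pull (rot c s) b) : cov R 8 4) :=
  @rot_wedge c s 2 2 a b.
Let w31 c s (a : cov R 8 3) (b : cov R 8 1) : pull (rot c s) (wedge a b : cov R 8 4) = (wedge (pull (rot c s) a) (pull (rot c s) b) : cov R 8 4) :=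
  @rot_wedge c s 3 1 a b.

Lemma rot_e2 c s (a b : 'I_4) :
  pull (rot c s) (e [tuple (val a).+1; (val b).+1] : cov R 8 2) = e [tuple (val a).+1; (val b).+1].
Proof.
have [h _ _ _ _] := rot_e c s.
have ok (i : 'I_4) : all (fun a => 0 < a <= 8)%N [tuple (val i).+1] by rewrite /= andbT; exact: leq_trans (ltn_ord i) _.
have w : wedge (e [tuple (val a).+1]) (e [tuple (val b).+1]) = e [tuple (val a).+1; (val b).+1] :> cov R 8 2.
  by rewrite wedge_e //; congr e; exact: val_inj.
by rewrite -w w11 !h.
Qed.

Lemma rot_Z1 c s : pull (rot c s) (Z1 8) = Z1 8.
Proof. by rewrite /Z1 pullD (rot_e2 c s 0 1) (rot_e2 c s 2 3). Qed.

Lemma rot_sig c s : pull (rot c s) sig = sig.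
Proof. by rewrite /sig pullD pullN (rot_e2 c s 1 3) (rot_e2 c s 0 2). Qed.

Lemma rot_tau c s : pull (rot c s) tau = tau.
Proof. by rewrite /tau pullD (rot_e2 c s 0 3) (rot_e2 c s 1 2). Qed.

Lemma wedge_self a : (0 < a <= 8)%N -> wedge (e [tuple a]) (e [tuple a]) = 0 :> cov R 8 2.
Proof.
move=> ha; have al : all (fun a => 0 < a <= 8)%N [:: a] by rewrite /= ha.
by rewrite wedge_e //; apply/ffunP => I; rewrite [RHS]ffunE num_e /= inE eqxx.
Qed.

Lemma rot_Z2 c s : c ^+ 2 + s ^+ 2 = 1 -> pull (rot c s) (Z2 8) = Z2 8.
Proof.
move=> cs; have [_ h5 h6 _ _] := rot_e c s.
have w : wedge (e [tuple 5]%N) (e [tuple 6]%N) = Z2 8 :> cov R 8 2.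
  by rewrite /Z2 wedge_e //; num_eq_tac.
have w55 := @wedge_self 5 isT.
have w66 := @wedge_self 6 isT.
have w65 : wedge (e [tuple 6]%N) (e [tuple 5]%N) = - Z2 8 :> cov R 8 2.
  by rewrite /Z2 wedge_e //; num_eq_tac.
rewrite -w w11 h5 h6 !(wedgeDl, wedgeDr, wedgeNl, wedgeZl, wedgeZr) w w55 w66 w65 -[RHS]scale1r -cs; move: (Z2 8) => z; cov_ring.
Qed.

Lemma rot_D c s : pull (rot c s) (D 8) = c *: D 8 + s *: Dbar 8.
Proof.
have [_ h5 h6 _ _] := rot_e c s.
rewrite D_wedge Dbar_wedge pullD pullN !w21 rot_sig rot_tau h5 h6.
move: sig tau => x y; rewrite !(wedgeDr, wedgeNr, wedgeZr).
move: (wedge x _) (wedge x _) (wedge y _) (wedge y _) => ? ? ? ?; cov_ring.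
Qed.

Lemma rot_Dbar c s : pull (rot c s) (Dbar 8) = c *: Dbar 8 - s *: D 8.
Proof.
have [_ h5 h6 _ _] := rot_e c s.
rewrite D_wedge Dbar_wedge pullD !w21 rot_sig rot_tau h5 h6.
move: sig tau => x y; rewrite !(wedgeDr, wedgeNr, wedgeZr).
move: (wedge x _) (wedge x _) (wedge y _) (wedge y _) => ? ? ? ?; cov_ring.
Qed.

Lemma rot_spin7 c s : c ^+ 2 + s ^+ 2 = 1 -> pull (rot c s) spin7_form = spin7_form.
Proof.
move=> cs; have [_ _ _ h7 h8] := rot_e c s.
have w77 := @wedge_self 7 isT.
have z7 : spin7_form =
    (wedge (Z1 8 + Z2 8) (e [tuple 7; 8]%N) : cov R 8 4)
  + ((wedge (D 8) (e [tuple 8]%N) : cov R 8 4) - (wedge (Dbar 8) (e [tuple 7]%N) : cov R 8 4))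
  + (wedge (e [tuple 1; 2]%N) (e [tuple 3; 4]%N) + wedge (Z1 8) (Z2 8)).
  rewrite spin7_formE /D /Dbar /Z1 /Z2 !(wedgeDl, wedgeNl) !wedge_e //; num_eq_tac.
have r78 : pull (rot c s) (e [tuple 7; 8]%N : cov R 8 2) = e [tuple 7; 8]%N.
  have w : wedge (e [tuple 7]%N) (e [tuple 8]%N) = e [tuple 7; 8]%N :> cov R 8 2.
    by rewrite wedge_e //; num_eq_tac.
  have w88 := @wedge_self 8 isT.
  have w87 : wedge (e [tuple 8]%N) (e [tuple 7]%N) = - e [tuple 7; 8]%N :> cov R 8 2.
    by rewrite wedge_e //; num_eq_tac.
  rewrite -{1}w w11 h7 h8 !(wedgeDl, wedgeDr, wedgeNl, wedgeZl, wedgeZr) w w77 w88 w87 -[RHS]scale1r -cs; move: (e _) => z; cov_ring.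
rewrite z7; move: (rot_Z1 c s) (rot_Z2 cs) (rot_D c s) (rot_Dbar c s) (rot_e2 c s 0 1) (rot_e2 c s 2 3) h7 h8.
move: r78 (Z1 8) (Z2 8) (D 8) (Dbar 8) (e [tuple 1; 2]%N) (e [tuple 3; 4]%N) => r78 z1 z2 d db x y r1 r2 r3 r4 rx ry h7 h8.
rewrite !pullD pullN !(w22, w31) pullD r1 r2 r3 r4 rx ry r78 h7 h8; congr (_ + _ + _).
rewrite !(wedgeDl, wedgeNl, wedgeZl, wedgeDr, wedgeZr).
move: (wedge d (e [tuple 7]%N)) (wedge d (e [tuple 8]%N)) (wedge db (e [tuple 7]%N)) (wedge db (e [tuple 8]%N)) => d7 d8 b7 b8.
rewrite -[RHS]scale1r -cs; cov_ring.
Qed.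

Definition W : cov R 8 2 := Z1 8 - 2 *: Z2 8.
(** A family that contains the type II forms and is stable under [rot], which turns (al, be) and
    (la, mu) by the same rotation; type II itself ties the two pairs together and is not kept by the
    proof. *)
Definition torsion3 (al be la mu : R) : cov R 8 3 :=
  al *: (wedge W (e [tuple 7]%N) : cov R 8 3) + be *: (wedge W (e [tuple 8]%N) : cov R 8 3)
  + la *: D 8 + mu *: Dbar 8.

Lemma typeIIE a1 a2 b1 :
  typeII_form a1 a2 b1 = torsion3 (a2 + b1) a1 (7 / 4 * a2) (7 / 4 * a1).
Proof.
rewrite /typeII_form /torsion3 -/W.
move: (wedge W _) (wedge W _) (D 8) (Dbar 8) => w7 w8 d db.
cov_ring.
Qed.

Lemma rot_torsion3 c s al be la mu : c ^+ 2 + s ^+ 2 = 1 ->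
  pull (rot c s) (torsion3 al be la mu) =
  torsion3 (c * al - s * be) (s * al + c * be) (c * la - s * mu) (s * la + c * mu).
Proof.
move=> cs; have [_ _ _ h7 h8] := rot_e c s.
have rW : pull (rot c s) W = W by rewrite /W pullD pullN pullZ rot_Z1 rot_Z2.
rewrite /torsion3; move: rW (rot_D c s) (rot_Dbar c s); move: W (D 8) (Dbar 8) => w d db rw rd rdb.
rewrite !pullD !pullZ !w21 rw rd rdb h7 h8 !(wedgeDr, wedgeZr).
move: (wedge w _) (wedge w _) => w7 w8.
cov_ring.
Qed.

Definition num2 n (A : 'M[R]_n) (a : nat -> nat -> int) : Prop := forall i j, A i j = (a i.+1 j.+1)%:~R.

Lemma num2_so n (t : cov R n 2) f : num t f -> num2 (so_of_form t) (fun i j => f [:: i; j]).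
Proof. by move=> h i j; rewrite (num_so_of_form h). Qed.

Lemma num2_mul n (A B : 'M[R]_n) a b : num2 A a -> num2 B b ->
  num2 (A *m B) (fun i j => sumz (fun k => a i k * b k j) (iota 1 n)).
Proof.
move=> hA hB i j; rewrite mxE -sumz_ord; apply: eq_bigr => k _.
by rewrite hA hB rmorphM.
Qed.

Lemma num2_eq n (A B : 'M[R]_n) a b : num2 A a -> num2 B b ->
  all (fun i => all (fun j => a i j == b i j) (iota 1 n)) (iota 1 n) -> A = B.
Proof.
move=> hA hB /allP h; apply/matrixP => i j; rewrite hA hB; congr _%:~R; apply/eqP.
have mi (k : 'I_n) : k.+1 \in iota 1 n by rewrite mem_iota /= add1n ltnS ltn_ord.
exact: (allP (h _ (mi i)) _ (mi j)).
Qed.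

Definition u2_basis n : 4.-tuple 'M[R]_n :=
  [tuple so_of_form (P7 n + 2 *: P8 n)%R; so_of_form (P5 n); so_of_form (P6 n); so_of_form (P7 n)].

Lemma u2P n (A : 'M[R]_n) : reflect (exists x : 'I_4 -> R, A = \sum_i x i *: tnth (u2_basis n) i) (A \in u2 n).
Proof.
apply: (iffP idP) => [h|[x ->]].
  exists (fun i => coord (u2_basis n) i A); rewrite {1}(coord_span h).
  by apply: eq_bigr => i _; rewrite (tnth_nth 0).
by apply: rpred_sum => i _; apply: rpredZ; apply: memv_span; rewrite mem_tnth.
Qed.

End Unitary.

Lemma num_scale2 (R : realType) n k (t : cov R n k) f : num t f -> num (2 *: t) (fun l => 2%:Z * f l).
Proof. exact: (@numZ _ _ _ 2%:Z). Qed.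

Ltac num2_tac := repeat first [apply: num2_mul | apply: num2_so | apply: num_scale2 | progress num_tac].
Ltac int_eval := repeat match goal with |- context [@intmul ?V 1 ?z] =>
  let z' := eval vm_compute in z in progress change (@intmul V 1 z) with (@intmul V 1 z') end.

(** * Commutation of the rotations with u(2) *)

Section UnitaryAlgebra.
Context {R : realType}.
Notation e := (@e R _).

Lemma mul_rot c s c' s' : rot c s *m rot c' s' = rot (c * c' - s * s') (c * s' + s * c') :> 'M[R]_(4 + ((1 + 1) + (1 + 1))).
Proof.
by rewrite /rot (mulmx_block 1%:M) (mulmx_block (rot2 _ _)) !mulmx0 !mul0mx !addr0 !add0r mulmx1 !mul_rot2 mulrNN mulrN mulNr opprD.
Qed.

Lemma ord8_cases (j : ord8) :
  (exists i, j = lshift _ i) \/ j = j5 \/ j = j6 \/ j = j7 \/ j = j8.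
Proof.
case: (split_ordP j) => {}j ->; first by left; exists j.
by right; case: (split_ordP j) => {}j ->; case: (split_ordP j) => {}j ->; rewrite !ord1; do ?[by left | right].
Qed.

(** With [J = rot 0 1], the matrices on the right are powers of [J]. Commutation with all rotations
    is thereby reduced to commutation with one integer matrix, which can be evaluated. *)
Lemma rot_affine c s : rot c s = 2^-1 *: (rot 1 0 + rot (-1) 0)
  + (c / 2) *: (rot 1 0 - rot (-1) 0) + (s / 2) *: (rot 0 1 - rot 0 (-1)) :> 'M[R]_(4 + ((1 + 1) + (1 + 1))).
Proof.
have comb (A B C E : 'M[R]_(4 + ((1 + 1) + (1 + 1)))) x y z a b :
    (x *: (A + B) + y *: (A - B) + z *: (C - E)) a b =
    x * (A a b + B a b) + y * (A a b - B a b) + z * (C a b - E a b) by rewrite !mxE.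
apply/matrixP => a; move: (rotE c s a) (rotE (1 : R) 0 a) (rotE (-1 : R) 0 a) (rotE (0 : R) 1 a) (rotE (0 : R) (-1) a).
move: (rot c s) (rot 1 0) (rot (-1) 0) (rot 0 1) (rot 0 (-1)) => A B C E F.
move=> [h1 h5 h6 h7 h8] [k1 k5 k6 k7 k8] [l1 l5 l6 l7 l8] [m1 m5 m6 m7 m8] [n1 n5 n6 n7 n8].
move=> b; case: (ord8_cases b) => [[i ->]|[->|[->|[->|->]]]]; rewrite comb.
- by rewrite h1 k1 l1 m1 n1; do ?[move: (_ == _)%:R => ?]; field.
- by rewrite h5 k5 l5 m5 n5; do ?[move: (_ == _)%:R => ?]; field.
- by rewrite h6 k6 l6 m6 n6; do ?[move: (_ == _)%:R => ?]; field.
- by rewrite h7 k7 l7 m7 n7; do ?[move: (_ == _)%:R => ?]; field.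
by rewrite h8 k8 l8 m8 n8; do ?[move: (_ == _)%:R => ?]; field.
Qed.

Lemma num2_rot : num2 (rot 0 1 : 'M[R]_8) (fun i j =>
  if (j <= 4)%N then (i == j)%:R else if j == 5%N then - (i == 6%N)%:R else if j == 6%N then (i == 5%N)%:R
  else if j == 7%N then (i == 8%N)%:R else - (i == 7%N)%:R).
Proof.
have bN (b : bool) : - b%:R = (- b%:R)%:~R :> R by rewrite rmorphN; case: b.
have bP (b : bool) : b%:R = b%:R%:~R :> R by case: b.
move=> a; have [h1 h5 h6 h7 h8] := rotE (0 : R) 1 a.
move=> b; case: (ord8_cases b) => [[i ->]|[->|[->|[->|->]]]].
- by rewrite h1 /= ltn_ord eqSS -val_eqE; case: (_ == _).
- rewrite h5 !mul0r mul1r sub0r -val_eqE /=.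
  first [exact: bN | exact: bP].
- rewrite h6 !mul0r mul1r addr0 -val_eqE /=.
  first [exact: bN | exact: bP].
- rewrite h7 !mul0r mul1r add0r -val_eqE /=.
  first [exact: bN | exact: bP].
rewrite h8 !mul0r mulN1r addr0 -val_eqE /=; exact: bN.
Qed.

Lemma u2_rot c s (A : 'M[R]_8) : A \in u2 8 -> rot c s *m A = A *m rot c s.
Proof.
move=> Au; pose J : 'M[R]_8 := rot 0 1.
have comJ : J *m A = A *m J.
  case/u2P: Au => x ->; rewrite mulmx_sumr mulmx_suml; apply: eq_bigr => i _.
  rewrite -scalemxAr -scalemxAl; congr (_ *: _).
  case: i => -[|[|[|[|//]]]] h; rewrite (tnth_nth 0) /=.
  - by apply: num2_eq; [apply: num2_mul; [exact: num2_rot | num2_tac] | apply: num2_mul; [num2_tac | exact: num2_rot] | vm_compute].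
  - by apply: num2_eq; [apply: num2_mul; [exact: num2_rot | num2_tac] | apply: num2_mul; [num2_tac | exact: num2_rot] | vm_compute].
  - by apply: num2_eq; [apply: num2_mul; [exact: num2_rot | num2_tac] | apply: num2_mul; [num2_tac | exact: num2_rot] | vm_compute].
  by apply: num2_eq; [apply: num2_mul; [exact: num2_rot | num2_tac] | apply: num2_mul; [num2_tac | exact: num2_rot] | vm_compute].
have J2 : rot (-1) 0 = J *m J.
  by rewrite [RHS](mul_rot 0 1 0 1) !mul0r !mul1r sub0r addr0.
have J3 : rot 0 (-1) = J *m J *m J.
  by rewrite -J2 [RHS](mul_rot (-1) 0 0 1) !mul0r !mulr0 mulN1r subr0 addr0.
have J4 : rot 1 0 = J *m J *m (J *m J).
  by rewrite -J2 [RHS](mul_rot (-1) 0 (-1) 0) !mul0r !mulr0 mulN1r opprK subr0 addr0.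
have com (B C : 'M[R]_8) : B *m A = A *m B -> C *m A = A *m C -> B *m C *m A = A *m (B *m C).
  by move=> hB hC; rewrite -mulmxA hC mulmxA hB -mulmxA.
have c2 := com J J comJ comJ; have c3 := com _ J c2 comJ; have c4 := com _ _ c2 c2.
rewrite rot_affine -/J J3 J4 J2.
have cD (B C : 'M[R]_8) : B *m A = A *m B -> C *m A = A *m C -> (B + C) *m A = A *m (B + C).
  by move=> hB hC; rewrite mulmxDl mulmxDr hB hC.
have cZ k (B : 'M[R]_8) : B *m A = A *m B -> (k *: B) *m A = A *m (k *: B).
  by move=> hB; rewrite -scalemxAl -scalemxAr hB.
have cN (B C : 'M[R]_8) : B *m A = A *m B -> C *m A = A *m C -> (B - C) *m A = A *m (B - C).
  by move=> hB hC; rewrite mulmxBl mulmxBr hB hC.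
by apply: (cD); [apply: (cD); apply: (cZ); [exact: (cD) | exact: (cN)] | apply: (cZ); exact: (cN)].
Qed.

(** The square of this generator is diagonal, with entries -1 on e1 to e4, -4 on e5 and e6, and 0 on
    e7 and e8. *)
Lemma u2_kernel (v : 'rV[R]_8) : v *m so_of_form (P7 8 + 2 *: P8 8)%R = 0 ->
  forall j : 'I_8, (j < 6)%N -> v 0 j = 0.
Proof.
set B := so_of_form _ => vB j j6.
pose d (i k : nat) : int := if i == k then (if (i <= 4)%N then -1 else if (i <= 6)%N then - 4%:Z else 0) else 0.
pose Dd : 'M[R]_8 := \matrix_(i, k) (d i.+1 k.+1)%:~R.
have hd : num2 Dd d by move=> i k; rewrite mxE.
have BB : B *m B = Dd by apply: num2_eq; [num2_tac | exact: hd | vm_compute].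
have : (v *m (B *m B)) 0 j = 0 by rewrite mulmxA vB mul0mx mxE.
rewrite BB mxE (bigD1 j) //= big1 ?addr0 => [|k kj]; last by rewrite mxE /d eqSS -val_eqE in kj *; rewrite (negbTE kj) mulr0.
rewrite mxE /d eqxx /= => /eqP; rewrite mulf_eq0 => /orP[/eqP//|]; rewrite intr_eq0.
by case: ifP => // _; rewrite j6.
Qed.

Lemma u2_ulsubmx (A : 'M[R]_(7 + 1)) : A \in u2 8 -> ulsubmx A \in u2 7.
Proof.
case/(@u2P R 8) => x eA; apply/u2P; exists x; apply/matrixP => a b.
transitivity (A (lshift 1 a) (lshift 1 b)); first by rewrite !mxE.
rewrite eA !summxE; apply: eq_bigr => i _; rewrite [LHS]mxE [RHS]mxE; congr (_ * _).
have ul (A8 : 'M[R]_8) (A7 : 'M[R]_7) f : num2 A8 f -> num2 A7 f -> A8 (lshift 1 a) (lshift 1 b) = A7 a b.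
  by move=> h8 h7; rewrite h8 h7.
case: i => -[|[|[|[|//]]]] h; rewrite !(tnth_nth 0) /=; apply: ul; num2_tac.
Qed.

End UnitaryAlgebra.

(** * Isotropy and kernel of the type II forms *)

Section TypeII.
Context {R : realType}.
Notation e := (@e R _).

Lemma num0 n k : num (0 : cov R n k) (fun=> 0).
Proof. by move=> I; rewrite ffunE. Qed.

Lemma num2_opp_tr n (A : 'M[R]_n) a : num2 A a -> num2 (- A^T) (fun i j => - a j i).
Proof. by move=> h i j; rewrite !mxE h rmorphN. Qed.

(** An element of su(3) outside u(2): with the four generators of [u2 8] it makes five independent
    matrices that kill [D]. *)
Definition Q15 : 'M[R]_8 := so_of_form (e [tuple 1; 5]%N + e [tuple 2; 6]%N).

Lemma Q15_spin7 : spin7 Q15.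
Proof.
split.
  have : Q15 = - Q15^T by apply: num2_eq; [num2_tac | apply: num2_opp_tr; num2_tac | vm_compute].
  by move=> h; rewrite /so /= {2}h opprK.
rewrite spin7_formE; apply: num_eq; first by apply: alternating_act; alt_tac.
- exact: alternating0c.
- by apply: num_act; [exact: num2_so (numD (num_e _) (num_e _)) | num_tac].
- exact: num0.
by vm_compute.
Qed.

Definition su3_basis : 5.-tuple 'M[R]_8 := [tuple of rcons (u2_basis 8) Q15].

Lemma su3_D i : act (tnth su3_basis i) (D 8) = 0.
Proof.
have ok (A : 'M[R]_8) a : num2 A a ->
   all (fun l => sumz (fun p => sumz (fun j => a (nth 0%N l p) j * (ee [:: 2; 4; 6] (set_nth 0 l p j) - ee [:: 2; 3; 5] (set_nth 0 l p j)
      - ee [:: 1; 4; 5] (set_nth 0 l p j) - ee [:: 1; 3; 6] (set_nth 0 l p j))) (iota 1 8)) (iota 0 3) == 0) (combs (iota 1 8) 3)%N -> act A (D 8) = 0.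
  move=> hA h; apply: num_eq; first by apply: alternating_act; rewrite /D; alt_tac.
  - exact: alternating0c.
  - by apply: num_act hA _; rewrite /D; num_tac.
  - exact: num0.
  exact: h.
case: i => -[|[|[|[|[|//]]]]] h; rewrite (tnth_nth 0) /=.
all: by apply: ok; [num2_tac | vm_compute].
Qed.

Lemma su3_free (x : 'I_5 -> R) : \sum_i x i *: tnth su3_basis i = 0 -> forall i, x i = 0.
Proof.
pose sk (L : seq (nat * nat * int)) (a b : nat) : int := sumz (fun k => let: (c, d, z) := nth (0%N, 0%N, 0) L k in
  if (a == c) && (b == d) then z else if (a == d) && (b == c) then - z else 0) (iota 0 (size L)).
pose L : seq (seq (nat * nat * int)) := [:: [:: (1%N, 2%N, 1); (3%N, 4%N, 1); (5%N, 6%N, - 2%:Z)]; [:: (1%N, 3%N, 1); (2%N, 4%N, 1)];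
  [:: (1%N, 4%N, 1); (2%N, 3%N, -1)]; [:: (1%N, 2%N, 1); (3%N, 4%N, -1)]; [:: (1%N, 5%N, 1); (2%N, 6%N, 1)]].
pose M i : 'M[R]_8 := \matrix_(a, b) (sk (nth [::] L i) a.+1 b.+1)%:~R.
have hM i : num2 (M i) (sk (nth [::] L i)) by move=> a b; rewrite mxE.
have eM (i : 'I_5) : tnth su3_basis i = M i.
  by case: i => -[|[|[|[|[|//]]]]] h; rewrite (tnth_nth 0) /=; (apply: num2_eq; [num2_tac | exact: hM | vm_compute]).
under eq_bigr do rewrite eM; move=> s0.
have en (a b : 'I_8) : \sum_(i < 5) x i * (sk (nth [::] L i) a.+1 b.+1)%:~R = 0.
  have := congr1 (fun A : 'M[R]_8 => A a b) s0; rewrite summxE [RHS]mxE => h; rewrite -[RHS]h.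
  by apply: eq_bigr => i _; rewrite !mxE.
pose o k : 'I_8 := inord k.
have vo k : (k < 8)%N -> (o k).+1 = k.+1 by move=> h; rewrite inordK.
have ex k l : (k < 8)%N -> (l < 8)%N -> \sum_(i < 5) x i * (sk (nth [::] L i) k.+1 l.+1)%:~R = 0.
  by move=> hk hl; have := en (o k) (o l); rewrite !vo.
(* The entries (1, 2), (1, 3), (1, 4), (1, 5) and (5, 6), counted from 1, already separate the five
   matrices. *)
move: (ex 0%N 1%N isT isT) (ex 0%N 2%N isT isT) (ex 0%N 3%N isT isT) (ex 0%N 4%N isT isT) (ex 4%N 5%N isT isT).
rewrite !big_ord_recl !big_ord0 /= /L /=; int_eval; rewrite !(mulr0, mulr1, addr0, add0r) => h1 h2 h3 h4 h5.
have {}h5 : x ord0 = 0.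
  by move/eqP: h5; rewrite mulf_eq0 intr_eq0 orbF => /eqP.
rewrite h5 add0r in h1.
by case=> -[|[|[|[|[|//]]]]] h; [rewrite -[RHS]h5 | rewrite -[RHS]h2 | rewrite -[RHS]h3 | rewrite -[RHS]h1 | rewrite -[RHS]h4]; congr x; apply: val_inj.
Qed.

(** A dimension count: conjugation keeps the five matrices of [su3_basis] independent, while [u2 8]
    is spanned by four. *)
Lemma su3_not_u2 (K : 'M[R]_8) : K \in unitmx -> (forall A : 'M[R]_8, A \in u2 8 -> spin7 A) ->
  ~ (forall A : 'M[R]_8, spin7 A -> act A (D 8) = 0 -> K *m A *m invmx K \in u2 8).
Proof.
move=> Ku hu h.
have su i : K *m tnth su3_basis i *m invmx K \in u2 8.
  apply: h (su3_D i); case: (unliftP ord_max i) => [j ->|->].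
    apply: hu; apply: memv_span; case: j => -[|[|[|[|//]]]] hj; by rewrite (tnth_nth 0) /= !inE eqxx ?orbT.
  by rewrite (tnth_nth 0) /=; exact: Q15_spin7.
pose X := [tuple K *m tnth su3_basis i *m invmx K | i < 5].
have fX : free X.
  apply/freeP => k s0; apply: su3_free.
  have : K *m (\sum_i k i *: tnth su3_basis i) *m invmx K = 0.
    rewrite -[RHS]s0 mulmx_sumr mulmx_suml; apply: eq_bigr => i _.
    by rewrite -scalemxAr -scalemxAl -tnth_nth tnth_mktuple.
  move=> /(congr1 (mulmx (invmx K))) /(congr1 (mulmx ^~ K)); rewrite mulmx0 mul0mx.
  by rewrite !mulmxA mulVmx // mul1mx mulmxKV.
have : (5 <= \dim (u2 8 : {vspace 'M[R]_8}))%N.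
  have d5 : \dim <<X>> = 5%N by have := fX; rewrite /free => /eqP ->; rewrite size_tuple.
  apply: leq_trans (dimvS (U := <<X>>%VS) _); first by rewrite d5.
  by apply/span_subvP => A /tnthP[i ->]; rewrite tnth_mktuple.
by apply/negP; rewrite -ltnNge ltnS; exact: leq_trans (dim_span _) _.
Qed.

Lemma insDt n k (s t : cov R n (k + 1)) v : ins (s + t) v = ins s v + ins t v.
Proof.
apply/ffunP => I; rewrite [RHS]ffunE !insE -big_split; apply: eq_bigr => c _.
by rewrite [(s + t) _]ffunE /= mulrDr.
Qed.

Lemma insZt n k a (t : cov R n (k + 1)) v : ins (a *: t) v = a *: ins t v.
Proof.
apply/ffunP => I; rewrite [RHS]ffunE !insE [RHS]mulr_sumr; apply: eq_bigr => c _.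
by rewrite [(a *: t) _]ffunE mulrCA.
Qed.

Lemma num_tri n (t : cov R n 3) f a b c : num t f -> t (tri a b c) = (f [:: a.+1; b.+1; c.+1])%:~R.
Proof.
move=> h; rewrite h; congr (f _)%:~R.
by rewrite /idx !enum_ordSl enum_ord0 /= !ffunE !(tnth_nth a).
Qed.

(** [inord 6] and [inord 7] stand for e7 and e8. The vector is orthogonal to [al e7 + be e8], the
    covector that [W] is wedged with in [torsion3]. *)
Definition kerT (al be : R) : 'rV[R]_8 := be *: bv (inord 6) - al *: bv (inord 7).

Lemma W_matrix : so_of_form W = so_of_form (P7 8 + 2 *: P8 8)%R :> 'M[R]_8.
Proof. by rewrite /W; apply: num2_eq; [num2_tac | num2_tac | vm_compute]. Qed.

Lemma wedge_W a : (0 < a <= 8)%N -> wedge W (e [tuple a]) =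
  e [tuple 1; 2; a]%N + e [tuple 3; 4; a]%N - 2 *: e [tuple 5; 6; a]%N :> cov R 8 3.
Proof.
move=> ha; have al : all (fun a => 0 < a <= 8)%N [:: a] by rewrite /= ha.
have w2 b c : (0 < b <= 8)%N -> (0 < c <= 8)%N -> wedge (e [tuple b; c]) (e [tuple a]) = e [tuple b; c; a] :> cov R 8 3.
  move=> hb hc; have hbc : all (fun a => 0 < a <= 8)%N [:: b; c] by rewrite /= hb hc.
  rewrite (@wedge_e R 8 2 1 [tuple b; c] [tuple a] hbc al).
  by apply/ffunP => I; rewrite !ffunE; congr (\det _); apply/matrixP => x y; rewrite !mxE !(tnth_nth 0%N).
by rewrite /W /Z1 /Z2 wedgeDl wedgeDl wedgeNl wedgeZl !w2.
Qed.

Lemma ins_torsion3_basis al be la mu :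
  ins (torsion3 al be la mu : cov R 8 (2 + 1)) (bv (inord 6)) = al *: W /\
  ins (torsion3 al be la mu : cov R 8 (2 + 1)) (bv (inord 7)) = be *: W.
Proof.
have o6 : (inord 6 : 'I_8).+1 = 7 by rewrite inordK.
have o7 : (inord 7 : 'I_8).+1 = 8 by rewrite inordK.
have z (j : 'I_8) (t : cov R 8 (2 + 1)) f g (s : cov R 8 2) : alternating t -> num t f -> alternating s -> num s g ->
    all (fun l => f (rcons l j.+1) == g l) (combs (iota 1 8) 2) -> ins t (bv j) = s.
  by move=> at_ nt as_ ns h; apply: num_eq (num_ins j nt) ns h => //; exact: alternating_ins.
pose w a : cov R 8 (2 + 1) := wedge W (e [tuple a]).
have w76 : ins (w 7) (bv (inord 6)) = W.
  by rewrite /w wedge_W // /W; apply: z; rewrite ?o6; [alt_tac | num2_tac | alt_tac | num2_tac | vm_compute].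
have w87 : ins (w 8) (bv (inord 7)) = W.
  by rewrite /w wedge_W // /W; apply: z; rewrite ?o7; [alt_tac | num2_tac | alt_tac | num2_tac | vm_compute].
have z0 (j : 'I_8) (t : cov R 8 (2 + 1)) f : alternating t -> num t f ->
    all (fun l => f (rcons l j.+1) == 0) (combs (iota 1 8) 2) -> ins t (bv j) = 0.
  by move=> at_ nt h; apply: (z j t f _ 0 at_ nt _ _ h); [exact: alternating0c | exact: num0].
have w77 : ins (w 7) (bv (inord 7)) = 0.
  by rewrite /w wedge_W //; apply: z0; rewrite ?o7; [alt_tac | num2_tac | vm_compute].
have w86 : ins (w 8) (bv (inord 6)) = 0.
  by rewrite /w wedge_W //; apply: z0; rewrite ?o6; [alt_tac | num2_tac | vm_compute].
have d6 : ins (D 8 : cov R 8 (2 + 1)) (bv (inord 6)) = 0.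
  by rewrite /D; apply: z0; rewrite ?o6; [alt_tac | num2_tac | vm_compute].
have d7 : ins (D 8 : cov R 8 (2 + 1)) (bv (inord 7)) = 0.
  by rewrite /D; apply: z0; rewrite ?o7; [alt_tac | num2_tac | vm_compute].
have b6 : ins (Dbar 8 : cov R 8 (2 + 1)) (bv (inord 6)) = 0.
  by rewrite /Dbar; apply: z0; rewrite ?o6; [alt_tac | num2_tac | vm_compute].
have b7 : ins (Dbar 8 : cov R 8 (2 + 1)) (bv (inord 7)) = 0.
  by rewrite /Dbar; apply: z0; rewrite ?o7; [alt_tac | num2_tac | vm_compute].
by rewrite /torsion3 -/(w 7) -/(w 8) !insDt !insZt w76 w77 w86 w87 d6 d7 b6 b7 !scaler0 !addr0 add0r.
Qed.

Lemma ins_torsion3 al be la mu : ins (torsion3 al be la mu : cov R 8 (2 + 1)) (kerT al be) = 0.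
Proof.
have [h6 h7] := ins_torsion3_basis al be la mu.
by rewrite /kerT insD -scaleNr !insZ h6 h7 !scalerA mulNr [al * _]mulrC scaleNr subrr.
Qed.

(** Contraction with e7 and e8 leaves [al *: W] and [be *: W]. One coefficient is non-zero, so a
    kernel vector is killed by the matrix of [W] and lies in the span of e7 and e8 by [u2_kernel];
    there the condition is a single linear equation. *)
Lemma torsion3_kernel al be la mu (v : 'rV[R]_8) : (al, be) != (0, 0) ->
  ins (torsion3 al be la mu : cov R 8 (2 + 1)) v = 0 -> exists c, v = c *: kerT al be.
Proof.
move=> n0 iv; pose T := torsion3 al be la mu.
have altT : alternating T.
  by rewrite /T /torsion3 !wedge_W // /D /Dbar; alt_tac.
have ev a b : \sum_c v 0 c * T (tri a b c) = 0.
  have := congr1 (fun t : cov R 8 2 => t (finfun (fun p => tnth [tuple a; b] p))) iv.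
  rewrite insE [RHS]ffunE => h; rewrite -[RHS]h; apply: eq_bigr => c _.
  by rewrite join_tri !ffunE.
have [h6 h7] := ins_torsion3_basis al be la mu.
have Tk k a c z : ins (T : cov R 8 (2 + 1)) (bv k) = z *: W -> T (tri k a c) = z * so_of_form W a c.
  move=> h; rewrite (alt12 altT) (alt23 altT) opprK mxE.
  have := congr1 (fun t : cov R 8 2 => t (finfun (fun p => tnth [tuple a; c] p))) h.
  rewrite insE [RHS]ffunE (bigD1 k) //= big1 => [|j nj]; last by rewrite mxE eqxx (negbTE nj) mul0r.
  by rewrite mxE !eqxx mul1r addr0 join_tri !ffunE.
have vT k z : ins (T : cov R 8 (2 + 1)) (bv k) = z *: W -> z *: (v *m (so_of_form W)^T) = 0.
  move=> h; apply/rowP => a; rewrite [RHS]mxE; apply: etrans (ev k a); rewrite !mxE mulr_sumr.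
  by apply: eq_bigr => c _; rewrite (Tk _ _ _ _ h) [(_^T) _ _]mxE mulrCA.
have trW : (so_of_form W)^T = - so_of_form W :> 'M[R]_8.
  have h : so_of_form W = - (so_of_form W)^T :> 'M[R]_8.
    by rewrite /W; apply: num2_eq; [num2_tac | apply: num2_opp_tr; num2_tac | vm_compute].
  by rewrite {2}h opprK.
have vW : v *m so_of_form (P7 8 + 2 *: P8 8)%R = 0.
  rewrite -W_matrix; apply/eqP; rewrite -oppr_eq0 -mulmxN -trW.
  have [a0|a0] := eqVneq al 0; last by have /eqP := vT _ _ h6; rewrite scaler_eq0 (negbTE a0).
  have b0 : be != 0 by apply: contraNneq n0 => ->; rewrite a0.
  by have /eqP := vT _ _ h7; rewrite scaler_eq0 (negbTE b0).
have v0 := u2_kernel vW.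
have i67 : (inord 7 : 'I_8) != inord 6 by rewrite -val_eqE /= !inordK.
have vlast (j : 'I_8) : j != inord 6 -> j != inord 7 -> v 0 j = 0.
  move=> j6 j7; apply: v0; rewrite ltnNge; apply/negP => h.
  have : (j <= 7)%N by rewrite -ltnS.
  rewrite leq_eqVlt => /orP[/eqP e7|]; first by case/eqP: j7; apply: val_inj; rewrite /= inordK.
  rewrite ltnS leq_eqVlt => /orP[/eqP e6|]; first by case/eqP: j6; apply: val_inj; rewrite /= inordK.
  by rewrite ltnNge h.
have vE : v = v 0 (inord 6) *: bv (inord 6) + v 0 (inord 7) *: bv (inord 7).
  apply/rowP => j; rewrite !mxE eqxx /=.
  have [->|j6] := eqVneq j (inord 6); first by rewrite eq_sym (negbTE i67) mulr1 mulr0 addr0.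
  have [->|j7] := eqVneq j (inord 7); first by rewrite mulr1 mulr0 add0r.
  by rewrite vlast // !mulr0 addr0.
have rel : v 0 (inord 6) * al + v 0 (inord 7) * be = 0.
  have := iv; rewrite {1}vE insD !insZ h6 h7 !scalerA -scalerDl => /eqP; rewrite scaler_eq0 => /orP[/eqP //|/eqP W0].
  have nW g : num (W : cov R 8 2) g -> g [:: 1; 2]%N = 1 -> False.
    move=> hg g1; have := num_so_of_form hg 0 1; rewrite mxE W0 ffunE g1 => /eqP.
    by rewrite eq_sym oner_eq0.
  by exfalso; apply: nW; [rewrite /W; num2_tac | vm_compute].
have [a0|a0] := eqVneq al 0.
  have b0 : be != 0 by apply: contraNneq n0 => ->; rewrite a0.
  exists (v 0 (inord 6) / be); rewrite {1}vE /kerT a0 scale0r subr0 scalerA divfK //.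
  move: rel; rewrite a0 mulr0 add0r => /eqP; rewrite mulf_eq0 (negbTE b0) orbF => /eqP ->.
  by rewrite scale0r addr0.
exists (- v 0 (inord 7) / al); rewrite {1}vE /kerT scalerBr !scalerA divfK // scaleNr opprK; congr (_ *: _ + _).
apply: (mulIf a0); move/eqP: rel; rewrite addr_eq0 => /eqP ->; field; exact: a0.
Qed.

End TypeII.

(** * Exterior derivatives of parallel forms *)

Section Exterior.
Context {R : realType} {n : nat}.

Definition delta_form (a : 'I_n) : cov R n 1 := basis_form [ffun=> a].

Lemma wedge_sumr k l (a : cov R n k) J (r : seq J) (P : pred J) (b : J -> cov R n l) :
  wedge a (\sum_(j <- r | P j) b j) = \sum_(j <- r | P j) wedge a (b j).
Proof.
apply: (big_morph (wedge a)) => [x y|]; first exact: wedgeDr.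
by rewrite -(scale0r (0 : cov R n l)) wedgeZr scale0r.
Qed.

Lemma cov_sumE k J (r : seq J) (P : pred J) (b : J -> cov R n k) I :
  (\sum_(j <- r | P j) b j) I = \sum_(j <- r | P j) b j I :> R.
Proof. by elim/big_rec2: _ => [|j y x _ <-]; rewrite ffunE. Qed.

Lemma basis_expansion k (t : cov R n k) : alternating t ->
  t = k`!%:R^-1 *: \sum_F t F *: basis_form F.
Proof.
move=> alt; apply/ffunP => I; rewrite [RHS]ffunE cov_sumE.
have -> : \sum_F (t F *: basis_form F) I = k`!%:R * t I :> R.
  by rewrite -(sum_basis I alt); apply: eq_bigr => F _; rewrite [LHS]ffunE basis_swap.
by rewrite /GRing.scale /= mulKf // pnatr_eq0 -lt0n fact_gt0.
Qed.

Lemma basis_laplace k (a : 'I_n) (F : midx k n) (I : midx (1 + k) n) :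
  basis_form (join [ffun=> a] F) I =
  \sum_(p < 1 + k) (-1) ^+ p * (I p == a)%:R * basis_form F [ffun q => I (lift p q)] :> R.
Proof.
rewrite ffunE (expand_det_col _ (lshift k 0)); apply: eq_bigr => p _.
rewrite mxE tjoin_l ffunE /cofactor addn0 mulrCA -mulrA; congr (_ * (_ * _)).
rewrite ffunE; congr (\det _); apply/matrixP => q r; rewrite !mxE; congr (_ == _)%:R; first by rewrite ffunE.
have -> : lift (lshift k 0) r = rshift 1 r :> 'I_(1 + k) by apply: val_inj.
by rewrite tjoin_r.
Qed.

(** The left side is the formula of [ext_deriv] with the partial derivatives abstracted into [S]:
    exterior differentiation is the sum over a of dx^a wedge the derivative along a. *)
Lemma ext_wedge k (S : 'I_n -> cov R n k) (I : {ffun 'I_k.+1 -> 'I_n}) : (forall a, alternating (S a)) ->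
  \sum_(p < k.+1) (-1) ^+ p * S (I p) [ffun q => I (lift p q)] =
  (\sum_a wedge (delta_form a) (S a) : cov R n (1 + k)) I :> R.
Proof.
move=> alt; rewrite cov_sumE.
have e1 a : wedge (delta_form a) (S a) I = \sum_(p < 1 + k) (-1) ^+ p * (I p == a)%:R * S a [ffun q => I (lift p q)] :> R.
  rewrite {1}(basis_expansion (alt a)) wedgeZr wedge_sumr [LHS]ffunE cov_sumE.
  transitivity (k`!%:R^-1 * \sum_F \sum_(p < 1 + k) S a F * ((-1) ^+ p * (I p == a)%:R * basis_form F [ffun q => I (lift p q)]) : R).
    apply: (congr1 (fun z : R => k`!%:R^-1 * z)); apply: eq_bigr => F _.
    by rewrite wedgeZr wedge_basis [LHS]ffunE basis_laplace; exact: mulr_sumr.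
  rewrite exchange_big [LHS]mulr_sumr; apply: eq_bigr => p _.
  transitivity (k`!%:R^-1 * ((-1) ^+ p * (I p == a)%:R * (k`!%:R * S a [ffun q => I (lift p q)])) : R).
    congr (_ * _); rewrite -(sum_basis _ (alt a)) mulr_sumr; apply: eq_bigr => F _.
    by rewrite [in RHS]basis_swap mulrCA.
  rewrite mulrCA; congr (_ * _); rewrite mulKf // pnatr_eq0 -lt0n fact_gt0 //.
under [RHS]eq_bigr do rewrite e1.
rewrite exchange_big; apply: eq_bigr => p _; rewrite (bigD1 (I p)) //= eqxx mulr1 big1 ?addr0 // => a na.
by rewrite eq_sym (negbTE na) mulr0 mul0r.
Qed.

(** The action, defined on the arguments, is moved to the labels of the basis form: the determinant
    is expanded along a row and reassembled along a column. *)
Lemma act_basis k (A : 'M[R]_n) (F : midx k n) :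
  act A (basis_form F) = \sum_q \sum_b A b (F q) *: basis_form (subst_index F q b).
Proof.
apply/ffunP => I; rewrite actE cov_sumE.
pose M : 'M[R]_k := \matrix_(a, b) (I a == F b)%:R.
transitivity (\sum_p \sum_q A (I p) (F q) * cofactor M p q).
  apply: eq_bigr => p _.
  transitivity (\sum_j A (I p) j * \sum_q (j == F q)%:R * cofactor M p q).
    apply: eq_bigr => j _; congr (_ * _); rewrite ffunE (expand_det_row _ p); apply: eq_bigr => q _.
    rewrite mxE subst_indexE eqxx; congr (_ * (_ * \det _)); apply/matrixP => r s.
    by rewrite !mxE subst_indexE [lift _ _ == _]eq_sym (negbTE (neq_lift _ _)).
  under eq_bigr do rewrite mulr_sumr.
  rewrite exchange_big; apply: eq_bigr => q _; rewrite (bigD1 (F q)) //= eqxx mul1r big1 ?addr0 // => j nj.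
  by rewrite (negbTE nj) mul0r mulr0.
rewrite exchange_big; apply: eq_bigr => q _; rewrite cov_sumE.
transitivity (\sum_b A b (F q) * \sum_p (I p == b)%:R * cofactor M p q); last first.
  apply: eq_bigr => b _; rewrite [RHS]ffunE; congr (_ * _); rewrite ffunE (expand_det_col _ q); apply: eq_bigr => p _.
  rewrite mxE subst_indexE eqxx; congr (_ * (_ * \det _)); apply/matrixP => r s.
  by rewrite !mxE subst_indexE [lift _ _ == _]eq_sym (negbTE (neq_lift _ _)).
under [RHS]eq_bigr do rewrite mulr_sumr.
rewrite exchange_big; apply: eq_bigr => p _; rewrite (bigD1 (I p)) //= eqxx mul1r big1 ?addr0 // => b nb.
by rewrite eq_sym (negbTE nb) mul0r mulr0.
Qed.

(** Coefficients symmetric in two indices meet a wedge product antisymmetric in them. This is why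
    the Levi-Civita part of the connection drops out of the exterior derivative. *)
Lemma sym_wedge_act k (G : 'I_n -> 'M[R]_n) (psi : cov R n k) : alternating psi ->
  (forall a b c, G a b c = G b a c) -> \sum_a wedge (delta_form a) (act (G a) psi) = 0.
Proof.
move=> alt sym; rewrite (basis_expansion alt).
have actS (A : 'M[R]_n) (r : midx k n -> R) : act A (\sum_F r F *: basis_form F) = \sum_F r F *: act A (basis_form F).
  have a0 : act A 0 = 0 :> cov R n k by have := actZr 0 A (0 : cov R n k); rewrite !scale0r.
  rewrite (big_morph (act A) (fun x y => actDr A x y) a0).
  by apply: eq_bigr => F _; rewrite actZr.
under eq_bigr do rewrite actZr actS wedgeZr wedge_sumr.
rewrite -scaler_sumr exchange_big big1 ?scaler0 // => F _.
under eq_bigr do rewrite wedgeZr.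
rewrite -scaler_sumr; apply/eqP; rewrite scaler_eq0; apply/orP; right; apply/eqP.
under eq_bigr do rewrite act_basis wedge_sumr.
rewrite exchange_big big1 // => q _.
under eq_bigr do rewrite wedge_sumr.
pose H a b := basis_form (join [ffun=> a] (subst_index F q b)) : cov R n (1 + k).
have Hs a b : H b a = - H a b.
  apply/ffunP => I; rewrite [RHS]ffunE /H basis_swap [in RHS]basis_swap.
  have ne : lshift k 0 != rshift 1 q :> 'I_(1 + k) by rewrite eq_lrshift.
  rewrite -(alternatingN (alternating_basis I) (join [ffun=> a] (subst_index F q b)) ne).
  congr (basis_form I _); apply/ffunP => p; rewrite [RHS]ffunE.
  case: tpermP => [->|->|].
  - by rewrite tjoin_l tjoin_r !ffunE eqxx.
  - by rewrite tjoin_l tjoin_r !ffunE eqxx.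
  case: (split_ordP p) => r ->; rewrite ?ord1 ?tjoin_l ?tjoin_r // => _ nr.
  by rewrite !ffunE; case: eqP nr => // ->.
pose X := \sum_a \sum_b G a b (F q) *: H a b.
have -> : \sum_a \sum_b wedge (delta_form a) (G a b (F q) *: basis_form (subst_index F q b)) = X.
  by apply: eq_bigr => a _; apply: eq_bigr => b _; rewrite wedgeZr wedge_basis.
have : X = - X.
  rewrite {1}/X exchange_big -sumrN; apply: eq_bigr => a _; rewrite -sumrN; apply: eq_bigr => b _.
  by rewrite sym Hs scalerN.
move=> h; apply/ffunP => I; have := congr1 (fun t : cov R n (1 + k) => t I) h; rewrite /= !ffunE.
by move=> /eqP; rewrite -subr_eq0 opprK -mulr2n mulrn_eq0 => /eqP.
Qed.

End Exterior.

(** * The exterior derivative of the star of the G2 form *)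

Section Integrability.
Context {R : realType}.

Definition tmx n (T : cov R n 3) (a : 'I_n) : 'M[R]_n := \matrix_(b, c) T (tri a b c).

(** What is left of the exterior derivative of a form that is parallel for the connection with
    torsion [T]; [m] stands for the inverse metric. Being algebraic, it can be computed in an
    adapted frame. *)
Definition torsion_ext n k (T : cov R n 3) (m : 'M[R]_n) (psi : cov R n k) : cov R n (1 + k) :=
  \sum_a wedge (delta_form a) (act (2^-1 *: tmx T a *m m) psi).

Lemma pull_sum m n k (A : 'M[R]_(m, n)) J (r : seq J) (P : pred J) (t : J -> cov R n k) :
  pull A (\sum_(j <- r | P j) t j) = \sum_(j <- r | P j) pull A (t j).
Proof. by apply: (big_morph (pull A)) => [x y|]; [exact: pullD | exact: pull0]. Qed.

Lemma wedge_suml n k l J (r : seq J) (P : pred J) (a : J -> cov R n k) (b : cov R n l) :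
  wedge (\sum_(j <- r | P j) a j) b = \sum_(j <- r | P j) wedge (a j) b.
Proof.
apply: (big_morph (fun x => wedge x b)) => [x y|]; first exact: wedgeDl.
by have := wedgeZl 0 (0 : cov R n k) b; rewrite !scale0r.
Qed.

Lemma pull_delta_form m n (A : 'M[R]_(m, n)) a : pull A (delta_form a) = \sum_b A b a *: delta_form b.
Proof.
have d p (i : 'I_p) (I : midx 1 p) : delta_form i I = (I 0 == i)%:R :> R.
  by rewrite ffunE det_mx11 mxE ffunE.
apply/ffunP => I; rewrite pullE big_ffun1 cov_sumE.
rewrite (bigD1 a) //= [X in _ + X = _]big1 => [|c nc]; last by rewrite d ffunE (negbTE nc) mulr0.
rewrite d [[ffun=> a] 0]ffunE eqxx mulr1 big_ord1 ffunE.
rewrite (bigD1 (I 0)) //= [X in _ = _ + X]big1 => [|c nc].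
  have -> : (A (I 0) a *: delta_form (I 0)) I = A (I 0) a :> R by rewrite ffunE d eqxx; exact: mulr1.
  by [].
by rewrite ffunE d eq_sym (negbTE nc); exact: mulr0.
Qed.

Lemma tmx_pull m n (L : 'M[R]_(m, n)) (T : cov R n 3) b :
  tmx (pull L T) b = L *m (\sum_a L b a *: tmx T a) *m L^T.
Proof.
apply/matrixP => c d; rewrite mxE pull_tri mxE.
under [RHS]eq_bigr do rewrite mxE mulr_suml.
rewrite [RHS]exchange_big /=.
under [RHS]eq_bigr => i _ do under eq_bigr => j _ do rewrite summxE mulr_sumr mulr_suml.
under [RHS]eq_bigr => i _ do rewrite exchange_big /=.
rewrite [RHS]exchange_big /=; apply: eq_bigr => a _; apply: eq_bigr => i _; apply: eq_bigr => j _.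
rewrite !mxE; ring.
Qed.

(** The sum over a pairs basis and dual basis, hence is independent of the frame; orthonormality of
    [L] writes the inverse metric as [L^T *m L]. *)
Lemma torsion_ext_pull n k (L h : 'M[R]_n) (T : cov R n 3) (psi : cov R n k) :
  h \in unitmx -> L *m h *m L^T = 1%:M ->
  pull L (torsion_ext T (invmx h) psi) = torsion_ext (pull L T) 1%:M (pull L psi).
Proof.
move=> hu Lh; rewrite /torsion_ext pull_sum.
have hL : L^T *m L = invmx h.
  have [Lu _] := mulmx1_unit (etrans (mulmxA L h L^T) Lh).
  have hLL : h *m (L^T *m L) = 1%:M.
    by rewrite mulmxA; apply: mulmx1C; rewrite mulmxA.
  by rewrite -[LHS]mul1mx -(mulVmx hu) -mulmxA hLL mulmx1.
under eq_bigr do rewrite pull_wedge pull_delta_form wedge_suml.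
rewrite exchange_big; apply: eq_bigr => b _.
under eq_bigr do rewrite wedgeZl -wedgeZr -pullZ -actZl.
rewrite -wedge_sumr -pull_sum -act_sum; congr wedge.
apply: pull_act; rewrite tmx_pull mulmx1.
have -> : \sum_a L b a *: (2^-1 *: tmx T a *m invmx h) = 2^-1 *: (\sum_a L b a *: tmx T a) *m invmx h.
  rewrite -scalemxAl mulmx_suml scaler_sumr; apply: eq_bigr => a _.
  by rewrite -!scalemxAl !scalerA mulrC.
rewrite -!scalemxAl -scalemxAr; congr (_ *: _).
by rewrite -hL !mulmxA.
Qed.

Lemma torsion_extD n k (T T' : cov R n 3) m (psi : cov R n k) :
  torsion_ext (T + T') m psi = torsion_ext T m psi + torsion_ext T' m psi.
Proof.
rewrite /torsion_ext -big_split /=; apply: eq_bigr => a _; rewrite -wedgeDr -actDl -mulmxDl -scalerDr.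
by congr (wedge _ (act (_ *: _ *m _) _)); apply/matrixP => b c; rewrite !mxE ffunE.
Qed.

Lemma torsion_extZ n k c (T : cov R n 3) m (psi : cov R n k) :
  torsion_ext (c *: T) m psi = c *: torsion_ext T m psi.
Proof.
rewrite /torsion_ext scaler_sumr; apply: eq_bigr => a _; rewrite -wedgeZr -actZl.
congr (wedge _ (act _ _)); rewrite -!scalemxAl !scalerA mulrC -scalerA; congr (_ *: _).
by rewrite scalemxAl; congr (_ *m _); apply/matrixP => b d; rewrite !mxE ffunE.
Qed.

Definition torsion_ext_num (n k : nat) (f g : seq nat -> int) (l : seq nat) : int :=
  sumz (fun p => let l' := take p l ++ drop p.+1 l in
    (-1) ^+ p * sumz (fun q => sumz (fun c => f [:: nth 0%N l p; nth 0%N l' q; c] * g (set_nth 0%N l' q c)) (iota 1 n)) (iota 0 k)) (iota 0 k.+1).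

(** The factor 2 clears the one half in front of the torsion, so that the components stay
    integers. *)
Lemma num_torsion_ext n k (T : cov R n 3) (psi : cov R n k) f g : alternating psi -> num T f -> num psi g ->
  num (2 *: torsion_ext T 1%:M psi) (torsion_ext_num n k f g).
Proof.
move=> alt hf hg I.
have -> : 2 *: torsion_ext T 1%:M psi = \sum_a wedge (delta_form a) (act (tmx T a) psi).
  rewrite /torsion_ext scaler_sumr; apply: eq_bigr => a _; rewrite -wedgeZr -actZl.
  by rewrite mulmx1 scalerA divff ?scale1r // pnatr_eq0.
rewrite -ext_wedge => [|a]; last exact: alternating_act.
rewrite -sumz_ord; apply: eq_bigr => p _; rewrite add0n rmorphM /= rmorphXn rmorphN1; congr (_ * _).
have nt a : num2 (tmx T a) (fun b c => f [:: a.+1; b; c]) by move=> b c; rewrite mxE (num_tri _ _ _ hf).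
rewrite (num_act (nt _) hg) nth_idx; congr (_%:~R).
have -> : idx [ffun q => I (lift p q)] = take p (idx I) ++ drop p.+1 (idx I).
  apply: (@eq_from_nth _ 0%N).
    rewrite size_idx size_cat size_take size_drop size_idx ltn_ord add1n subSS subnKC // -ltnS; exact: ltn_ord.
  move=> q; rewrite size_idx => qk; rewrite (nth_idx _ (Ordinal qk)) ffunE nth_cat size_take size_idx ltn_ord.
  rewrite nth_drop -(nth_idx I) /= /bump; case: ltnP => h; first by rewrite nth_take // leqNgt h.
  by have -> : (p.+1 + (q - p) = true + q)%N by rewrite addSn subnKC.
by [].
Qed.

Lemma alternating_torsion_ext n k (T : cov R n 3) m (psi : cov R n k) : alternating (torsion_ext T m psi).
Proof.
rewrite /torsion_ext; elim/big_ind: _ => [|x y|a _]; [exact: alternating0c | exact: alternatingD | exact: alternating_wedge].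
Qed.

(** What remains of [torsion3] on the first seven coordinates. *)
Definition torsion7 (al la mu : R) : cov R 7 3 :=
  al *: (e 7 [tuple 1; 2; 7]%N + e 7 [tuple 3; 4; 7]%N - 2 *: e 7 [tuple 5; 6; 7]%N)
  + la *: D 7 + mu *: Dbar 7.

(* The 1-form theta is recovered equivariantly as a multiple of the star of T /\ omega. *)
Lemma g2_lee al la mu :
  torsion_ext (torsion7 al la mu) 1%:M (@hodge R 3 4 1%:M (g2_form 7)) =
  wedge (- 1 *: (@hodge R 6 1 1%:M (wedge (torsion7 al la mu) (g2_form 7) : cov R 7 6)))
    (@hodge R 3 4 1%:M (g2_form 7) : cov R 7 4) :> cov R 7 (1 + 4).
Proof.
set psi := hodge 1%:M (g2_form 7).
have ap : alternating psi by apply: (@alternating_hodge _ 3 4).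
pose g l : int := ee [:: 1; 2; 3; 4]%N l + ee [:: 1; 2; 5; 6]%N l + ee [:: 3; 4; 5; 6]%N l
    - (- ee [:: 1; 3; 5; 7]%N l + ee [:: 2; 4; 5; 7]%N l + ee [:: 1; 4; 6; 7]%N l + ee [:: 2; 3; 6; 7]%N l).
have psiE : psi = e 7 [tuple 1; 2; 3; 4]%N + e 7 [tuple 1; 2; 5; 6]%N + e 7 [tuple 3; 4; 5; 6]%N
    - (- e 7 [tuple 1; 3; 5; 7]%N + e 7 [tuple 2; 4; 5; 7]%N + e 7 [tuple 1; 4; 6; 7]%N + e 7 [tuple 2; 3; 6; 7]%N).
  rewrite /psi g2_formE // /D !(hodgeD, hodgeN); num_eq_tac.
have np : num psi g by rewrite psiE; num_tac.
have z (T : cov R 7 3) f : num T f ->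
    all (fun l => torsion_ext_num 7 4 f g l == 0) (combs (iota 1 7) 5) -> torsion_ext T 1%:M psi = 0.
  move=> h hz; have : 2 *: torsion_ext T 1%:M psi = 0.
    apply: num_eq; [exact/alternatingZ/alternating_torsion_ext | exact: alternating0c
      | exact: (num_torsion_ext ap h np) | exact: num0 | exact: hz].
  by move/eqP; rewrite scaler_eq0 pnatr_eq0 /= => /eqP.
pose w : cov R 7 3 := e 7 [tuple 1; 2; 7]%N + e 7 [tuple 3; 4; 7]%N - 2 *: e 7 [tuple 5; 6; 7]%N.
have tw : torsion_ext w 1%:M psi = 0 by apply: z; [rewrite /w; num2_tac | vm_compute].
have td : torsion_ext (D 7) 1%:M psi = 0 by apply: z; [rewrite /D; num2_tac | vm_compute].
(* Only the [Dbar] part contributes: it gives -4 times e7 wedge the 4-form, while the star of [Dbar]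
   wedge the G2 form is 4 times e7. This is the origin of the factor -1. *)
have tb : torsion_ext (Dbar 7) 1%:M psi = - 4 *: (wedge (e 7 [tuple 7]%N) psi : cov R 7 (1 + 4)).
  have h : 2 *: torsion_ext (Dbar 7) 1%:M psi = (- 8%:Z)%:~R *: (wedge (e 7 [tuple 7]%N) psi : cov R 7 (1 + 4)).
    rewrite {2}psiE !(wedgeDr, wedgeNr) !wedge_e //.
    have nb : num (Dbar 7 : cov R 7 3) (fun l => - ee [:: 1; 3; 5]%N l + ee [:: 2; 4; 5]%N l + ee [:: 1; 4; 6]%N l + ee [:: 2; 3; 6]%N l).
      by rewrite /Dbar; num_tac.
    apply: num_eq; [exact/alternatingZ/alternating_torsion_ext | by alt_tac
      | exact: (num_torsion_ext ap nb np) | apply: numZ; by num_tac | by vm_compute].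
  have n2 : 2 != 0 :> R by rewrite pnatr_eq0.
  apply: (scalerI n2); rewrite h scalerA; congr (_ *: _); rewrite rmorphN /=; ring.
have ww : wedge w (g2_form 7) = 0 :> cov R 7 6.
  rewrite g2_formE // /w /D !(wedgeDl, wedgeDr, wedgeNl, wedgeNr, wedgeZl) !wedge_e //.
  by apply: num_eq; [by alt_tac | exact: alternating0c | by num2_tac | exact: num0 | by vm_compute].
have wd : wedge (D 7) (g2_form 7) = 0 :> cov R 7 6.
  rewrite g2_formE // /D !(wedgeDl, wedgeDr, wedgeNl, wedgeNr) !wedge_e //.
  by apply: num_eq; [by alt_tac | exact: alternating0c | by num2_tac | exact: num0 | by vm_compute].
have wb : wedge (Dbar 7) (g2_form 7) = 4%:Z%:~R *: e 7 [tuple 1; 2; 3; 4; 5; 6]%N :> cov R 7 6.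
  rewrite g2_formE // /Dbar /D !(wedgeDl, wedgeDr, wedgeNl, wedgeNr) !wedge_e //.
  by num_eq_tac.
have h7 : @hodge R 6 1 1%:M (e 7 [tuple 1; 2; 3; 4; 5; 6]%N) = e 7 [tuple 7]%N.
  by apply: num_eq; [exact: (@alternating_hodge _ 6 1) | by alt_tac | apply: (@num_hodge _ 6 1); by [] | by num_tac | by vm_compute].
rewrite /torsion7 -/w !torsion_extD !torsion_extZ tw td tb (wedgeDl (al *: w + la *: D 7)) (wedgeDl (al *: w)) !wedgeZl ww wd wb !scaler0 !add0r.
rewrite !(@hodgeZ _ 6 1) h7 !wedgeZl !scalerA; congr (_ *: _); ring.
Qed.

End Integrability.

(** * Adapted frames whose last vector spans the kernel *)

Section Frames.
Context {R : realType}.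

(** An index equal to the last one is moved by a transposition to the last slot, where the value is
    one of the contraction; a second occurrence makes the form vanish. *)
Lemma alternating_split0 n k (s : cov R (n + 1) (k + 1)) : alternating s ->
  pull (row_mx 1%:M 0 : 'M[R]_(n, n + 1)) s = 0 ->
  pull (row_mx 1%:M 0 : 'M[R]_(n, n + 1)) (ins s (bv (rshift n 0))) = 0 -> s = 0.
Proof.
move=> alt s1 s2; apply/ffunP => I; rewrite [RHS]ffunE.
have insE7 (J : midx k (n + 1)) : ins s (bv (rshift n 0)) J = s (join J [ffun=> rshift n 0]).
  rewrite insE (bigD1 (rshift n 0)) //= big1 => [|c nc]; last by rewrite mxE eqxx (negbTE nc) mul0r.
  by rewrite mxE !eqxx mul1r; exact: addr0.
have cover q (J : midx q (n + 1)) : (forall p, J p != rshift n 0) -> exists J' : midx q n, J = [ffun p => lshift 1 (J' p)].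
  move=> nJ; have ex p : exists a, J p = lshift 1 a.
    by case: (split_ordP (J p)) => a e; [exists a | move: (nJ p); rewrite e ord1 eqxx].
  exists [ffun p => projT1 (cid (ex p))]; apply/ffunP => p; rewrite !ffunE.
  exact: projT2 (cid (ex p)).
have [/existsP[p /eqP Ip]|nI] := boolP [exists p, I p == rshift n 0]; last first.
  have [|J' ->] := cover _ I; first by move=> p; apply: contra nI => h; apply/existsP; exists p.
  by rewrite -pull_row10 s1 ffunE.
pose l : 'I_(k + 1) := rshift k 0; pose I' : midx (k + 1) (n + 1) := [ffun q => I (tperm p l q)].
have I'l : I' l = rshift n 0 by rewrite ffunE tpermR.
suff : s I' = 0 by rewrite alt => /eqP; rewrite mulf_eq0 signr_eq0 /= => /eqP.
have [/existsP[q /andP[ql /eqP I'q]]|nI'] := boolP [exists q, (q != l) && (I' q == rshift n 0)].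
  by apply: (alternating_rep alt ql); rewrite I'q I'l.
pose J : midx k (n + 1) := [ffun a => I' (lshift 1 a)].
have -> : I' = join J [ffun=> rshift n 0].
  apply/ffunP => q; case: (split_ordP q) => a ->; first by rewrite tjoin_l [RHS]ffunE.
  by rewrite tjoin_r ord1 I'l ffunE.
have [|J' ->] := cover _ J.
  move=> a; rewrite ffunE; apply: contra nI' => h; apply/existsP; exists (lshift 1 a).
  by rewrite h andbT eq_lrshift.
by rewrite -insE7 -pull_row10 s2 ffunE.
Qed.

Lemma orth_inv (m E : 'M[R]_8) : E *m m *m E^T = 1%:M -> [/\ E \in unitmx, m \in unitmx & m = invmx E *m (invmx E)^T].
Proof.
move=> o; have [Eu _] := mulmx1_unit (etrans (mulmxA E m E^T) o).
have [_ Etu] := mulmx1_unit o.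
have mE : m = invmx E *m (invmx E)^T.
  by rewrite trmx_inv -[LHS](mulKmx Eu) -[E *m m](mulmxK Etu) o mul1mx.
by split => //; rewrite mE unitmx_mul unitmx_tr unitmx_inv Eu.
Qed.

(** The last row of [rot c s] is [s] e7 plus [c] e8, so the components of the unit vector [X] along
    the last two frame vectors serve as [s] and [c]. *)
Lemma rot_frame (m E : 'M[R]_8) (Phi : cov R 8 4) (X : 'rV[R]_8) :
  oriented_orthonormal m E -> pull E Phi = spin7_form -> X *m m *m X^T = 1%:M ->
  (forall j : 'I_8, (j < 6)%N -> (X *m invmx E) 0 j = 0) ->
  exists c s, [/\ c ^+ 2 + s ^+ 2 = 1, oriented_orthonormal m (rot c s *m E),
    pull (rot c s *m E) Phi = spin7_form & bv (rshift 7 0) *m (rot c s *m E) = X].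
Proof.
move=> [on dE] pE uX; pose v := X *m invmx E; rewrite -/v => v0; have [Eu mu mE] := orth_inv on.
have vv : v *m v^T = 1%:M by rewrite -uX mE /v trmx_mul !mulmxA.
have vE (a : ord8) : v 0 a = v 0 (j7) * (a == j7)%:R
    + v 0 j8 * (a == j8)%:R.
  case: (ord8_cases a) => [[i ->]|[->|[->|[->|->]]]]; rewrite ?eqxx ?eq_shift /= ?mulr0 ?mulr1 ?addr0 ?add0r //; apply: v0 => //.
  exact: ltn_trans (ltn_ord i) _.
set s := v 0 _ in vE; set c := v 0 j8 in vE.
have cs : c ^+ 2 + s ^+ 2 = 1.
  have := congr1 (fun A : 'M[R]_1 => A 0 0) vv; rewrite mxE [RHS]mxE eqxx => h; rewrite -[RHS]h.
  have sq (w : ord8 -> R) : \sum_a w a = \sum_(a < 4) w (lshift _ a)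
      + (w (rshift 4 (lshift (1 + 1) (lshift 1 0))) + w (rshift 4 (lshift (1 + 1) (rshift 1 0)))
      + (w (j7) + w j8)).
    by rewrite !big_split_ord /= !big_ord1.
  rewrite (sq (fun a => v 0 a * v^T a 0)) big1 => [|i _]; last by rewrite v0 ?mul0r //; exact: ltn_trans (ltn_ord i) _.
  have vt a : v^T a 0 = v 0 a by rewrite mxE.
  have z5 : v 0 j5 = 0 by exact: v0.
  have z6 : v 0 j6 = 0 by exact: v0.
  by rewrite !vt z5 z6 -/s -/c !mul0r !add0r addrC !expr2.
exists c, s; split=> //.
- split; last by rewrite det_mulmx det_rot // mul1r.
  by rewrite trmx_mul -!mulmxA (mulmxA E) (mulmxA (E *m m)) on mul1mx rot_orth.
- by rewrite -pull_comp pE rot_spin7.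
rewrite mulmxA; have -> : bv (rshift 7 0) *m rot c s = v.
  apply/rowP => a; rewrite -rowE mxE vE.
  have -> : rshift 7 0 = j8 :> ord8 by exact: val_inj.
  case: (rotE c s j8) => h1 h5 h6 h7 h8.
  case: (ord8_cases a) => [[i ->]|[->|[->|[->|->]]]]; rewrite ?h1 ?h5 ?h6 ?h7 ?h8 ?eqxx ?eq_shift /=; ring.
by rewrite /v mulmxKV.
Qed.

Lemma spin7_conj (K A : 'M[R]_8) : K *m K^T = 1%:M -> pull K spin7_form = spin7_form -> spin7 A ->
  spin7 (K *m A *m invmx K).
Proof.
move=> KK pK [sA aA]; have [Ku _] := mulmx1_unit KK.
have iK : invmx K = K^T by rewrite -[RHS](mulKmx Ku) KK mulmx1.
split; first by rewrite /so /= iK !trmx_mul trmxK sA mulNmx mulmxN mulmxA.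
by rewrite -{1}pK -(@pull_act _ _ _ _ K A) ?aA ?pull0 // mulmxKV.
Qed.

Section Point.
Variables (m : 'M[R]_8) (Phi : cov R 8 4) (T : cov R 8 3).
Hypothesis iso : exists2 E : 'M[R]_8, oriented_orthonormal m E /\ pull E Phi = spin7_form &
  [set A | spin7 A /\ act A (pull E T) = 0] = [set A | A \in u2 8].
Variables (a1 a2 b1 : R).
Hypothesis b1_gt0 : 0 < b1.
Hypothesis typ : exists2 E : 'M[R]_8, oriented_orthonormal m E /\ pull E Phi = spin7_form &
  pull E T = typeII_form a1 a2 b1.

Lemma kerT_neq0 al be : (al, be) != (0, 0) -> kerT al be != 0 :> 'rV[R]_8.
Proof.
apply: contraNneq => h.
have h6 := congr1 (fun w : 'rV[R]_8 => w 0 (inord 6)) h; have h7 := congr1 (fun w : 'rV[R]_8 => w 0 (inord 7)) h.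
have i67 : (inord 7 : 'I_8) == inord 6 = false by apply/negbTE; rewrite -val_eqE /= !inordK.
move: h6 h7; rewrite /kerT !mxE !eqxx /= i67 eq_sym i67 !mulr0 !mulr1 subr0 add0r => -> /eqP.
by rewrite oppr_eq0 => /eqP ->.
Qed.

(** With both coefficients zero the form would be a multiple of [D]. The frames of [iso] and [typ]
    may differ, so su(3) is brought into u(2) only up to conjugation by [K], which is the case that
    [su3_not_u2] excludes. *)
Lemma typeII_nondegenerate : (a2 + b1, a1) != (0, 0).
Proof.
apply/eqP => -[ab a0]; have [E1 [[on1 d1] p1] hi] := iso; have [E2 [[on2 d2] p2] t2] := typ.
have [E1u mu mE1] := orth_inv on1; have [E2u _ mE2] := orth_inv on2.
have a2n : a2 != 0 by apply: contraTneq b1_gt0 => a20; move: ab; rewrite a20 add0r => ->; rewrite ltxx.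
pose K := E1 *m invmx E2.
have KE : K *m E2 = E1 by rewrite /K mulmxKV.
have KK : K *m K^T = 1%:M.
  have -> : K *m K^T = E1 *m (invmx E2 *m (invmx E2)^T) *m E1^T by rewrite /K trmx_mul !mulmxA.
  by rewrite -mE2.
have pK : pull K spin7_form = spin7_form by rewrite -{1}p2 pull_comp KE.
have Ku : K \in unitmx by have [] := mulmx1_unit KK.
apply: (@su3_not_u2 R K Ku).
  by move=> A Au; have [] : [set A | spin7 A /\ act A (pull E1 T) = 0] A by rewrite hi.
move=> A sA aD; have : [set A | spin7 A /\ act A (pull E1 T) = 0] (K *m A *m invmx K); last by rewrite hi.
split; first exact: spin7_conj.
by rewrite -KE -pull_comp -(@pull_act _ _ _ _ K A) ?mulmxKV // t2 typeIIE ab a0 /torsion3 !scale0r !add0r mulr0 scale0r addr0 actZr aD scaler0 pull0.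
Qed.

Lemma torsion_kernel : exists v0 : 'rV[R]_8,
  [/\ v0 != 0, ins (T : cov R 8 (2 + 1)) v0 = 0 & forall v, ins (T : cov R 8 (2 + 1)) v = 0 -> exists c, v = c *: v0].
Proof.
have [E [[on d] p] t] := typ; have [Eu mu mE] := orth_inv on; have nd := typeII_nondegenerate.
have pT : pull (invmx E) (pull E T) = T by rewrite pull_comp mulVmx // pull1.
have tr (v : 'rV[R]_8) : ins (T : cov R 8 (2 + 1)) (v *m E) = 0 <-> ins (pull E T : cov R 8 (2 + 1)) v = 0.
  rewrite (@ins_pull _ _ _ 2); split=> [->|h]; first exact: pull0.
  have := congr1 (pull (invmx E)) h; rewrite pull_comp mulVmx // pull1 pull0; exact.
exists (kerT (a2 + b1) a1 *m E); split.
- apply: contra (kerT_neq0 nd) => /eqP h; apply/eqP.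
  by rewrite -[LHS](mulmxK Eu) h mul0mx.
- by apply/tr; rewrite t typeIIE ins_torsion3.
move=> v iv; have : ins (pull E T : cov R 8 (2 + 1)) (v *m invmx E) = 0 by apply/tr; rewrite mulmxKV.
rewrite t typeIIE => /(torsion3_kernel nd)[c h]; exists c.
by rewrite scalemxAl -h mulmxKV.
Qed.

Variable X : 'rV[R]_8.
Hypothesis X_unit : X *m m *m X^T = 1%:M.
Hypothesis X_ker : ins (T : cov R 8 (2 + 1)) X = 0.

(** In the frame of [typ] the kernel vector [X] is in the span of e7 and e8, so a rotation makes it
    the last vector. In the new frame e8 is in the kernel, which forces [be = 0]. *)
Lemma typeII_frame : exists E : 'M[R]_8,
  [/\ oriented_orthonormal m E, pull E Phi = spin7_form, bv (rshift 7 0) *m E = X &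
    exists al la mu, pull (row_mx 1%:M 0 : 'M[R]_(7, 7 + 1)) (pull E T : cov R (7 + 1) 3) = torsion7 al la mu].
Proof.
have [E [on p] t] := typ; have [Eu mu mE] := orth_inv on.1; have nd := typeII_nondegenerate.
have insT (F : 'M[R]_8) v : v *m F = X -> ins (pull F T : cov R 8 (2 + 1)) v = 0.
  by move=> h; rewrite (@ins_pull _ _ _ 2) h X_ker pull0.
have : ins (pull E T : cov R 8 (2 + 1)) (X *m invmx E) = 0 by apply: insT; rewrite mulmxKV.
rewrite t typeIIE => /(torsion3_kernel nd)[k hk].
have [|c [s [cs o' p' X']]] := rot_frame on p X_unit.
  move=> j j6; rewrite hk /kerT !mxE eqxx /=.
  have i6 : j == inord 6 = false by apply/negbTE; rewrite -val_eqE /= inordK // ltn_eqF.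
  have i7 : j == inord 7 = false by apply/negbTE; rewrite -val_eqE /= inordK // ltn_eqF // (ltn_trans j6).
  by rewrite i6 i7 !mulr0 subrr mulr0.
exists (rot c s *m E); split=> //.
have := insT _ _ X'; rewrite -pull_comp t typeIIE rot_torsion3 //.
move: (c * _ - s * _) (s * _ + c * _) (c * _ - s * _) (s * _ + c * _) => la mu' al be i0.
have be0 : be = 0.
  have [/eqP [_ ->]//|nd'] := boolP ((al, be) == (0, 0)).
  have [q hq] := torsion3_kernel nd' i0.
  have i67 : (inord 6 : 'I_8) == inord 7 = false by apply/negbTE; rewrite -val_eqE /= !inordK.
  have e7 : rshift 7 0 = inord 7 :> 'I_8 by apply: val_inj; rewrite /= inordK.
  have h6 := congr1 (fun w : 'rV[R]_8 => w 0 (inord 6)) hq; have h7 := congr1 (fun w : 'rV[R]_8 => w 0 (inord 7)) hq.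
  move: h6 h7; rewrite e7 /kerT !mxE !eqxx /= i67 eq_sym i67 !mulr0 !mulr1 subr0 add0r => h6 h7.
  have q0 : q != 0 by apply: contra_eq_neq h7 => ->; rewrite mul0r oner_eq0.
  by move/eqP: h6; rewrite eq_sym mulf_eq0 (negbTE q0) => /eqP.
exists al, la, mu'; rewrite be0 /torsion3 scale0r addr0 wedge_W //.
have w (x : 3.-tuple nat) : all (fun a => 0 < a <= 7)%N x -> pull (row_mx 1%:M 0 : 'M[R]_(7, 7 + 1)) (e 8 x) = e 7 x.
  move=> _; apply/ffunP => I; rewrite pull_row10 !ffunE; congr (\det _); apply/matrixP => a b.
  by rewrite !mxE ffunE.
by rewrite /torsion7 /D /Dbar !(pullD, pullZ, pullN) !w.
Qed.

(** Here the position of [X] is found from the isotropy. The generator [G] kills the torsion, so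
    [v *m G] is again on the kernel line, and skew-symmetry makes the factor 0; by [u2_kernel], [v]
    is in the span of e7 and e8. The rotation that makes [X] the last vector commutes with [u2 8],
    so the isotropy algebra is unchanged. *)
Lemma iso_frame : exists E : 'M[R]_8,
  [/\ oriented_orthonormal m E, pull E Phi = spin7_form, bv (rshift 7 0) *m E = X &
    forall A, spin7 A -> act A (pull E T) = 0 -> A \in u2 8].
Proof.
have [E [on p] hi] := iso; have [Eu mu mE] := orth_inv on.1.
pose v := X *m invmx E; pose G : 'M[R]_8 := so_of_form (P7 8 + 2 *: P8 8)%R.
have Gu : G \in u2 8 by apply: memv_span; rewrite inE eqxx.
have [sG aG] : [set A | spin7 A /\ act A (pull E T) = 0] G by rewrite hi.
have iv : ins (pull E T : cov R 8 (2 + 1)) v = 0.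
  by rewrite (@ins_pull _ _ _ 2) /v mulmxKV // X_ker pull0.
have ivG : ins (pull E T : cov R 8 (2 + 1)) (v *m G) = 0.
  have := ins_act (pull E T : cov R 8 (2 + 1)) G v; rewrite [X in ins X _]aG ins0t iv.
  have act0 : act G (0 : cov R 8 2) = 0 by have := actZr 0 G (0 : cov R 8 2); rewrite !scale0r.
  by rewrite act0 add0r => <-.
have vG : v *m G = 0.
  have [v0 [nv0 iv0 k0]] := torsion_kernel.
  have back (w : 'rV[R]_8) : ins (pull E T : cov R 8 (2 + 1)) w = 0 -> ins (T : cov R 8 (2 + 1)) (w *m E) = 0.
    rewrite (@ins_pull _ _ _ 2) => h.
    by have := congr1 (pull (invmx E)) h; rewrite pull_comp mulVmx // pull1 pull0.
  have [c1 h1] := k0 _ (back _ iv); have [c2 h2] := k0 _ (back _ ivG).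
  have vv : v *m v^T = 1%:M by rewrite -X_unit mE /v trmx_mul !mulmxA.
  have c10 : c1 != 0.
    apply: contraTneq (oner_neq0 R) => c10; rewrite negbK; move: h1; rewrite c10 scale0r => h1.
    have v00 : v = 0 by rewrite -[LHS](mulmxK Eu) h1 mul0mx.
    by have := congr1 (fun A : 'M[R]_1 => A 0 0) vv; rewrite v00 mul0mx !mxE eqxx => /esym/eqP.
  have vGv : v *m G = (c2 / c1) *: v.
    rewrite -[LHS](mulmxK Eu) h2 -[v in RHS](mulmxK Eu) h1 -scalemxAl -scalemxAl scalerA divfK //.
  have z : v *m G *m v^T = 0.
    have sG1 : G^T = - G := sG.1.
    have skg (w : 'rV[R]_8) (H : 'M[R]_8) : H^T = - H -> (w *m H *m w^T)^T = - (w *m H *m w^T).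
      by move=> sH; rewrite !trmx_mul trmxK sH mulNmx mulmxN mulmxA.
    have sk := skg v G sG1.
    apply/matrixP => i j; rewrite !ord1 [RHS]mxE; have := congr1 (fun A : 'M[R]_1 => A 0 0) sk.
    by rewrite mxE [RHS]mxE => /eqP; rewrite -subr_eq0 opprK -mulr2n mulrn_eq0 => /eqP.
  move: z; rewrite vGv -scalemxAl vv => /(congr1 (fun A : 'M[R]_1 => A 0 0)).
  by rewrite !mxE eqxx mulr1 => ->; rewrite scale0r.
have [|c [s [cs o' p' X']]] := rot_frame on p X_unit; first exact: u2_kernel.
exists (rot c s *m E); split=> // A sA aA.
have KK := rot_orth cs; have pK := rot_spin7 cs.
have [Ku _] := mulmx1_unit KK.
have iK : invmx (rot c s) = (rot c s)^T by rewrite -[RHS](mulKmx Ku) KK mulmx1.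
have iKK : invmx (rot c s) *m (invmx (rot c s))^T = 1%:M by rewrite iK trmxK -iK mulVmx.
have pi : pull (invmx (rot c s)) spin7_form = spin7_form by rewrite -{1}pK pull_comp mulVmx // pull1.
pose A1 := invmx (rot c s) *m A *m rot c s.
have A1u : A1 \in u2 8.
  have : [set A | spin7 A /\ act A (pull E T) = 0] A1; last by rewrite hi.
  split; first by rewrite /A1 -{2}[rot c s]invmxK; exact: spin7_conj.
  have -> : E = invmx (rot c s) *m (rot c s *m E) by rewrite mulKmx.
  by rewrite -pull_comp -(@pull_act _ _ _ _ _ A) ?aA ?pull0 // /A1 -!mulmxA mulmxV // mulmx1.
have h : rot c s *m A1 = A *m rot c s by rewrite /A1 !mulmxA mulmxV // mul1mx.
by rewrite -(mulmxK Ku A) -h (u2_rot c s A1u) mulmxK.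
Qed.

End Point.

End Frames.

(** * From frames of the manifold to frames of the slice *)

Section SliceFrame.
Context {R : realType} {n : nat} (M : atlas R (n + 1)) (sM : smooth_atlas M).
Context (g : metric M) (rg : riemannian g).
Context (f : M -> R) (fs : forall i : chart M, smooth_on (img i) (f \o cinv i : 'rV[R]_(n + 1) -> R)).
Context (fu : forall (i : chart M) x, img i x -> normal g f i x *m (gradf f i x)^T = 1%:M).
Context (p0 : slice f).
Context (frames : forall (i : chart M) x, img i x -> exists E : 'M[R]_(n + 1),
  0 < \det E /\ dsubmx E = normal g f i x).

Local Notation U10 := (row_mx 1%:M 0 : 'M[R]_(n, n + 1)).

(** The first [n] frame vectors are orthogonal to the normal, hence tangent, which defines [L] by
    [U = L *m Jemb]. Its determinant is positive because [E] is [L] bordered by 1 times the positive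
    basis of [det_Jemb]. *)
Lemma slice_frame (c : chart (slice_atlas p0)) y (E : 'M[R]_(n + 1)) : ball0 c y ->
  oriented_orthonormal (g (amb c) (embed c y)) E ->
  bv (rshift n 0) *m E = normal g f (amb c) (embed c y) ->
  exists2 L : 'M[R]_n, oriented_orthonormal (slice_metric g c y) L &
    forall k (S : tensor M k), pull L (slice_tensor S c y) = pull U10 (pull E (S (amb c) (embed c y))).
Proof.
move=> yb [oE dE] XE; set i := amb c in oE XE *; set x := embed c y in oE XE *.
have ix : img i x := embed_img yb.
have [U eU] : exists U : 'M[R]_(n, n + 1), U = U10 *m E by exists (U10 *m E).
have EU : E = col_mx U (normal g f i x).
  rewrite -[LHS]vsubmxK; congr col_mx.
    by rewrite eU -[in RHS](vsubmxK E) mul_row_col mul1mx mul0mx addr0.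
  by rewrite -XE -rowE; apply/rowP => b; rewrite !mxE.
have Ux : U *m (gradf f i x)^T = 0.
  have := oE; rewrite {1 2}EU mul_col_mx tr_col_mx mul_col_row scalar_mx_block => /eq_block_mx[_ u12 _ _].
  by rewrite (gradf_normal rg f ix) trmx_mul (metric_sym rg ix) mulmxA.
have ex a : exists u : 'rV[R]_n, row a U = u *m Jemb c y.
  apply: (Jemb_row sM fs fu yb); rewrite -row_mul Ux.
  by apply/rowP => b; rewrite !mxE.
pose L : 'M[R]_n := \matrix_(a, b) (projT1 (cid (ex a))) 0 b.
have UL : U = L *m Jemb c y.
  apply/row_matrixP => a; rewrite row_mul (projT2 (cid (ex a))); congr (_ *m _).
  by apply/rowP => b; rewrite !mxE.
exists L => [|k S]; last by rewrite /slice_tensor !pull_comp -eU UL.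
have EL : E = block_mx L 0 0 1%:M *m col_mx (Jemb c y) (normal g f i x).
  by rewrite mul_block_col !mul0mx mul1mx add0r addr0 -UL.
split.
  rewrite /slice_metric !mulmxA -UL -!mulmxA -trmx_mul -UL mulmxA.
  have := oE; rewrite {1 2}EU mul_col_mx tr_col_mx mul_col_row scalar_mx_block => /eq_block_mx[u11 _ _ _].
  exact: u11.
have := dE; rewrite EL det_mulmx det_ublock det1 mulr1 pmulr_lgt0 //.
exact: det_Jemb.
Qed.

(** The extended matrix kills the last vector and preserves the span of the others, so it acts
    separately on the restriction and on the contraction, which together determine the form. *)
Lemma act_extend k (A : 'M[R]_n) (t : cov R (n + 1) (k + 1)) : alternating t ->
  act A (pull U10 t) = 0 -> act A (pull U10 (ins t (bv (rshift n 0)))) = 0 ->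
  act (block_mx A 0 0 0) t = 0.
Proof.
move=> alt h1 h2; set B := block_mx A 0 0 0.
have UB : U10 *m B = A *m U10.
  by rewrite /B mul_row_block !mul1mx !mul0mx !addr0 mul_mx_row mulmx1 mulmx0.
have dB : bv (rshift n 0) *m B = 0 :> 'rV[R]_(n + 1).
  have -> : bv (rshift n 0) = row_mx 0 1%:M :> 'rV[R]_(n + 1).
    apply/rowP => j; case: (split_ordP j) => p ->; rewrite ?row_mxEl ?row_mxEr !mxE ?eq_shift ?andbF ?eqxx //= ?ord1 //.
  by rewrite /B mul_row_block !mul0mx !mulmx0 !addr0 row_mx0.
apply: alternating_split0; first exact: alternating_act.
  by rewrite (pull_act _ UB) h1.
have ins0 : ins t (0 : 'rV[R]_(n + 1)) = 0 by have := insZ t 0 0; rewrite !scale0r.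
by rewrite ins_act dB ins0 addr0 (pull_act _ UB) h2.
Qed.

Lemma skewc_split m (m0 : 'rV[R]_m -> 'M[R]_m) (T : 'rV[R]_m -> cov R m 3) x a :
  skewc m0 T x a = skewc m0 (fun=> 0) x a + 2^-1 *: tmx (T x) a *m invmx (m0 x).
Proof.
rewrite /skewc -mulmxDl; congr (_ *m _); apply/matrixP => b c; rewrite !mxE ffunE.
by rewrite mulr0 addr0.
Qed.

(** The torsion term contracts with [X] to 0, so a field parallel for the connection with torsion is
    so for the Levi-Civita connection, as geodesics and flow isometries demand. *)
Lemma kernel_levi_civita m (m0 : 'rV[R]_m -> 'M[R]_m) (T : 'rV[R]_m -> cov R m 3) x a (X : 'rV[R]_m) :
  alternating (T x) -> ins (T x : cov R m (2 + 1)) X = 0 ->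
  X *m skewc m0 T x a = X *m skewc m0 (fun=> 0) x a.
Proof.
move=> alt iX; rewrite skewc_split mulmxDr [X *m (_ *: _ *m _)]mulmxA; suff -> : X *m (2^-1 *: tmx (T x) a) = 0 by rewrite mul0mx addr0.
rewrite -scalemxAr; apply/eqP; rewrite scaler_eq0; apply/orP; right; apply/eqP/rowP => c.
rewrite !mxE; have := congr1 (fun t : cov R m 2 => t (finfun (fun p => tnth [tuple a; c] p))) iX.
rewrite insE [RHS]ffunE => h; apply/eqP; rewrite -oppr_eq0 -sumrN; apply/eqP; rewrite -[RHS]h.
by apply: eq_bigr => b _; rewrite mxE join_tri !ffunE /= (alt23 alt) mulrN opprK.
Qed.

End SliceFrame.

(** * The G2-structure on the slice and its properties *)

Section Assembly.
Context {R : realType} (M : atlas R 8) (g : metric M) (Phi : tensor M 4) (T : tensor M 3).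
Context (hM : spin7_manifold g Phi) (hcomplete : complete_metric g).
Context (hT : characteristic_torsion g Phi T) (hTp : parallel (skew_connection g T) T).
Context (hiso : iso_eq_u2 g Phi T) (a1 a2 b1 : R) (b1_gt0 : 0 < b1).
Context (htyp : forall i x, img i x -> exists2 E : 'M[R]_8,
      adapted_frame g Phi spin7_form i x E & pull E (T i x) = typeII_form a1 a2 b1).

Let om : oriented_manifold M. Proof. by case: hM. Qed.
Let sM : smooth_atlas M := oriented_smooth om.
Let rg : riemannian g. Proof. by case: hM. Qed.
Let fPhi : form_field Phi. Proof. by case: hM => _ _ []. Qed.
Let fT : form_field T := hT.1.
Let Phip : parallel (skew_connection g T) Phi := hT.2.

Lemma kernel_line (i : chart M) x : img i x -> exists v0 : 'rV[R]_8,
  [/\ v0 != 0, ins (T i x : cov R 8 (2 + 1)) v0 = 0 & forall v, ins (T i x : cov R 8 (2 + 1)) v = 0 -> exists c, v = c *: v0].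
Proof. move=> ix; exact: (torsion_kernel (hiso ix) b1_gt0 (htyp ix)). Qed.

Context (f : M -> R) (pf : potential_on g T setT f).

Lemma potential_smooth (i : chart M) : smooth_on (img i) (f \o cinv i : 'rV[R]_(7 + 1) -> R).
Proof. by have [h _] := pf i; rewrite preimage_setT setIT in h. Qed.
Let fs := potential_smooth.

Let X : chart M -> 'rV[R]_8 -> 'rV[R]_8 := @normal R 7 M g f.

Lemma normal_unit (i : chart M) x : img i x -> X i x *m (@gradf R 7 M f i x)^T = 1%:M.
Proof. by move=> ix; have [_ h] := pf i; have [u _] := h x ix I. Qed.
Let fu := normal_unit.

Lemma normal_ker (i : chart M) x : img i x -> ins (T i x : cov R 8 (2 + 1)) (X i x) = 0.
Proof. by move=> ix; have [_ h] := pf i; have [_ u] := h x ix I. Qed.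

Lemma normal_norm (i : chart M) x : img i x -> X i x *m g i x *m (X i x)^T = 1%:M.
Proof.
move=> ix; rewrite -(@gradf_normal R 7 M g rg f i x ix) -[LHS]trmxK trmx_mul trmxK.
by rewrite fu // trmx1.
Qed.

Lemma normal_frame (i : chart M) x : img i x -> exists E : 'M[R]_8,
  [/\ oriented_orthonormal (g i x) E, pull E (Phi i x) = spin7_form, bv (rshift 7 0) *m E = X i x &
    exists al la mu, pull (row_mx 1%:M 0 : 'M[R]_(7, 7 + 1)) (pull E (T i x) : cov R (7 + 1) 3) = torsion7 al la mu].
Proof. by move=> ix; apply: (typeII_frame (hiso ix) b1_gt0 (htyp ix)); [exact: normal_norm | exact: normal_ker]. Qed.

Lemma frames (i : chart M) x : img i x -> exists E : 'M[R]_(7 + 1), 0 < \det E /\ dsubmx E = X i x.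
Proof.
move=> ix; have [E [[_ dE] _ XE _]] := normal_frame ix; exists E; split => //.
by rewrite -XE -rowE; apply/rowP => b; rewrite !mxE.
Qed.

Lemma normal_parallel (i : chart M) x a : img i x ->
  'D_(bv a) (X i) x = - (X i x *m skewc (g i) (T i) x a).
Proof.
move=> ix; have oi := @sa_img _ _ _ sM i.
apply: (@kernel_parallel R 8 (img i) oi (g i) (T i) (metric_smooth rg i) (fun x ix => metric_sym rg ix)
  (fun x ix v => metric_pos rg ix (v := v)) (fT.2 i) (fT.1.1 i) _ (@kernel_line i) (img i) (X i) oi) => //.
- exact: ((parallelE g T T).1 hTp i).
- exact: (@Ck_normal R 7 M sM g rg f fs i 1%N).
- by move=> y iy; exact: normal_norm.
by move=> y iy; exact: normal_ker.
Qed.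

Lemma normal_levi_civita (i : chart M) x (a : 'I_(7 + 1)) : img i x ->
  'D_(bv a) (X i) x = - (X i x *m @lcc R 8 M g i x a).
Proof.
move=> ix; rewrite normal_parallel // /lcc.
by rewrite (kernel_levi_civita _ _ (fT.2 i x ix) (normal_ker ix)).
Qed.

Context (p0 : @slice R 7 M f).

Let N : atlas R 7 := slice_atlas p0.
Let h : metric N := @slice_metric R 7 M g f p0.
Let omega : tensor N 3 := @slice_tensor R 7 M f p0 3 (@contract R 7 M g f 3 Phi).
Let Psi : tensor N 4 := @slice_tensor R 7 M f p0 4 Phi.
Let T' : tensor N 3 := @slice_tensor R 7 M f p0 3 T.

Let oN : oriented_manifold N := @slice_oriented R 7 M sM g rg f fs fu p0 frames om.
Let sN : smooth_atlas N := oriented_smooth oN.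
Let rh : riemannian h := @slice_riemannian R 7 M sM g rg f fs fu p0 frames.
Let fT' : form_field T' := @slice_form_field R 7 M sM g f fs fu p0 frames 3 T fT.

Lemma contract_form : form_field (@contract R 7 M g f 3 Phi).
Proof.
split; first exact: (@contract_field R 7 M sM g rg f fs 3 Phi fPhi.1).
by move=> i x ix; apply: alternating_ins; exact: fPhi.2.
Qed.

Let fomega : form_field omega := @slice_form_field R 7 M sM g f fs fu p0 frames 3 _ contract_form.
Let fPsi : form_field Psi := @slice_form_field R 7 M sM g f fs fu p0 frames 4 Phi fPhi.
Let T'p : parallel (skew_connection h T') T' :=
  @slice_parallel R 7 M sM g rg f fs fu p0 frames T fT normal_parallel 3 T fT.1 hTp.
Let Psip : parallel (skew_connection h T') Psi :=
  @slice_parallel R 7 M sM g rg f fs fu p0 frames T fT normal_parallel 4 Phi fPhi.1 Phip.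
Let omegap : parallel (skew_connection h T') omega :=
  @slice_parallel R 7 M sM g rg f fs fu p0 frames T fT normal_parallel 3 _ contract_form.1
    (@contract_parallel R 7 M sM g rg f fs T normal_parallel 3 Phi fPhi.1 Phip).

Local Notation U10 := (row_mx 1%:M 0 : 'M[R]_(7, 7 + 1)).

Lemma adapted_slice (c : chart N) y (E : 'M[R]_8) : img c y ->
  oriented_orthonormal (g (amb c) (embed c y)) E -> pull E (Phi (amb c) (embed c y)) = spin7_form ->
  bv (rshift 7 0) *m E = X (amb c) (embed c y) ->
  exists2 L : 'M[R]_7, oriented_orthonormal (h c y) L &
    [/\ pull L (omega c y) = g2_form 7, pull L (Psi c y) = @hodge R 3 4 1%:M (g2_form 7) &
        pull L (T' c y) = pull U10 (pull E (T (amb c) (embed c y)) : cov R (7 + 1) 3)].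
Proof.
rewrite (@simg R 7 M sM f p0) => yb oE pE XE.
have [L oL pL] := @slice_frame R 7 M sM g rg f fs fu p0 c y E yb oE XE.
exists L => //; split.
- rewrite (pL 3%N) /contract -/(X _ _) -XE -(@ins_pull R 8 8 3 E) pE -g2_contraction.
  by congr (pull _ (ins _ (delta_mx _ _))); apply: val_inj.
- by rewrite (pL 4%N) pE g2_star.
exact: (pL 3%N).
Qed.

Lemma slice_adapted (c : chart N) y : img c y -> exists L : 'M[R]_7,
  [/\ oriented_orthonormal (h c y) L, pull L (omega c y) = g2_form 7, pull L (Psi c y) = @hodge R 3 4 1%:M (g2_form 7) &
      exists al la mu, pull L (T' c y) = torsion7 al la mu].
Proof.
move=> iy; have ix : img (amb c) (embed c y).
  by apply: (@embed_img R 7 M f c y); rewrite -(@simg R 7 M sM f p0).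
have [E [oE pE XE [al [la [mu tE]]]]] := normal_frame ix.
have [L oL [h1 h2 h3]] := adapted_slice iy oE pE XE; exists L; split => //.
by exists al, la, mu; rewrite h3.
Qed.

(** Both sides are natural under orientation-preserving frame changes, and in an adapted frame they
    agree by [g2_star]. *)
Lemma slice_star (c : chart N) y : img c y -> star3 h omega c y = Psi c y.
Proof.
move=> iy; have [L [[oL dL] h1 h2 _]] := slice_adapted iy.
have Lu : L \in unitmx by rewrite unitmxE unitfE gt_eqF.
have hu : h c y \in unitmx := metric_unit rh iy.
have e : pull L (star3 h omega c y) = pull L (Psi c y).
  by rewrite h2 /star3 (@hodge_pull R 3 4 L (h c y) (omega c y) hu dL) oL h1.
by rewrite -[LHS]pull1 -[RHS]pull1 -(mulVmx Lu) -!pull_comp e.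
Qed.

Lemma slice_g2 : g2_manifold h omega.
Proof. split=> //; split=> // c y iy; have [L [oL h1 _ _]] := slice_adapted iy; by exists L. Qed.

Lemma slice_characteristic : characteristic_torsion h omega T'.
Proof. by split. Qed.

Lemma slice_torsion_parallel : parallel (skew_connection h T') T'.
Proof. exact: T'p. Qed.

(** Skew-symmetry comes from the parallel metric. Restriction and contraction of [Phi] are [Psi] and
    [omega], those of [T] are [T'] and 0; all are killed, so [act_extend] applies to both forms. *)
Lemma slice_holonomy : holonomy_in_u2 h omega (skew_connection h T').
Proof.
move=> c y iy; have ix : img (amb c) (embed c y).
  by apply: (@embed_img R 7 M f c y); rewrite -(@simg R 7 M sM f p0).
have [E [oE pE XE uE]] := iso_frame (hiso ix) b1_gt0 (htyp ix) (normal_norm ix) (normal_ker ix).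
have [L oL [h1 h2 h3]] := adapted_slice iy oE pE XE; exists L => // B hB.
have Lu : L \in unitmx by rewrite unitmxE unitfE gt_eqF ?oL.2.
pose A := L *m B *m invmx L.
have LB : L *m B = A *m L by rewrite /A mulmxKV.
have kill k (S : tensor N k) : tensor_field S -> parallel (skew_connection h T') S -> act A (pull L (S c y)) = 0.
  move=> [s1 s2] Sp; have := @holonomy_act R 7 N h T' k S c y B s1 s2 Sp hB.
  by rewrite -(pull_act _ LB) => ->; rewrite pull0.
have At : A^T = - A.
  have mf : tensor_field (fun (i : chart N) x => gten (h i x)).
    split=> [i I k|i j x ov]; last exact: metric_tensor_law.
    have oi := @sa_img _ _ _ sN i.
    have := (Ck_mxP k (h i) oi).1 (metric_smooth rh i k) (I 0) (I 1).
    by apply: eq_Ck => // z iz; rewrite ffunE.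
  have := kill 2%N _ mf (metric_parallel (sa_img sN) rh fT'.2).
  rewrite pull_gten oL.1 act_gten mulmx1 mul1mx => /esym e0.
  have g0 : gten (0 : 'M[R]_7) = 0 by apply/ffunP => I; rewrite !ffunE mxE.
  by have := gten_inj (etrans (esym e0) (esym g0)); move/eqP; rewrite addrC addr_eq0 => /eqP.
have a0 k : act A (0 : cov R 7 k) = 0 by have := actZr 0 A (0 : cov R 7 k); rewrite !scale0r.
pose A8 : 'M[R]_(7 + 1) := block_mx A 0 0 0.
have sA : A8^T = - A8 by rewrite /A8 tr_block_mx !trmx0 At opp_block_mx !oppr0.
suff : A8 \in u2 8 by move=> /u2_ulsubmx; rewrite /A8 block_mxKul.
apply: uE.
  split; first exact: sA.
  apply: (@act_extend R 7 3 A (spin7_form : cov R (7 + 1) (3 + 1))).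
  - by rewrite spin7_formE; alt_tac.
  - by rewrite g2_star -h2; exact: kill fPsi.1 Psip.
  have -> : rshift 7 0 = ord_max :> 'I_8 by exact: val_inj.
  by rewrite g2_contraction -h1; exact: kill fomega.1 omegap.
apply: (@act_extend R 7 2 A (pull E (T (amb c) (embed c y)) : cov R (7 + 1) (2 + 1))).
- by apply: alternating_pull; exact: fT.2.
- by rewrite -h3; exact: kill fT'.1 T'p.
by rewrite (@ins_pull R 8 8 2 E) XE (normal_ker ix) !pull0.
Qed.

(** The formula of [g2_lee] written without frames, so that smoothness and the transformation law
    follow from those of the metric, [T'] and [omega]. *)
Definition lee : tensor N 1 := fun c y =>
  -1 *: @hodge R 6 1 (h c y) (wedge (T' c y) (omega c y) : cov R 7 6).

Lemma lee_form : form_field lee.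
Proof.
have det_h c y : img c y -> 0 < \det (h c y).
  move=> iy; have [L [[oL dL] _ _ _]] := slice_adapted iy.
  have := congr1 (fun A => \det A) oL; rewrite /= !det_mulmx det_tr det1 => e.
  by rewrite -(pmulr_lgt0 _ dL) -(pmulr_rgt0 _ dL) mulrA e.
split; last by move=> c y iy; apply: alternatingZ; exact: (@alternating_hodge _ 6 1).
split=> [c I k|i j y ov].
  have oi := @sa_img _ _ _ sN c; have hk := metric_smooth rh c k.
  have hu (y : 'rV[R]_7) : img c y -> h c y \in unitmx.
    move=> iy.
    have hh := metric_unit rh iy.
    exact: hh.
  have ck (z : R) : Ck k (img c) (cst z : 'rV[R]_7 -> R) := @Ck_cst _ _ _ k (img c) z.
  have sT := fT'.1.1 c; have so_ := fomega.1.1 c.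
  have wk (J : midx 6 7) : Ck k (img c) (fun y => (wedge (T' c y) (omega c y) : cov R 7 6) J : R).
    rewrite (_ : (fun y => _) = fun y => (3`! * 3`!)%:R^-1 * \sum_(s : 'S_(3 + 3)) (-1) ^+ s
      * T' c y [ffun p => J (s (lshift 3 p))] * omega c y [ffun q => J (s (rshift 3 q))]); last by apply/funext => y; exact: wedgeE.
    apply: CkM => //; first exact: Ck_cst.
    apply: Ck_sum => // s _; apply: CkM => //; last exact: so_.
    by apply: CkM => //; [exact: Ck_cst | exact: sT].
  have ik := Ck_invmx oi hu hk.
  have pk (J : midx 6 7) : Ck k (img c) (fun y => pull (invmx (h c y)) (wedge (T' c y) (omega c y) : cov R 7 6) J : R).
    rewrite (_ : (fun y => _) = fun y => \sum_(K : midx 6 7) (\prod_p invmx (h c y) (J p) (K p)) * (wedge (T' c y) (omega c y) : cov R 7 6) K); last by apply/funext => y; exact: pullE.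
    apply: Ck_sum => // K _; apply: CkM => //.
    by apply: Ck_prod => // p _; exact: ((Ck_mxP k _ oi).1 ik).
  rewrite (_ : (fun y => _) = fun y => -1 * (Num.sqrt (\det (h c y)) / 6`!%:R * \sum_(J : midx 6 7)
     eps 7 (join J I : midx (6 + 1) 7) * pull (invmx (h c y)) (wedge (T' c y) (omega c y) : cov R 7 6) J)); last first.
    by apply/funext => y; rewrite /lee ffunE (@hodgeE R 6 1).
  apply: CkM => //; first exact: Ck_cst.
  apply: CkM => //; last by apply: Ck_sum => // J _; apply: CkM => //; exact: Ck_cst.
  apply: CkM => //; last exact: Ck_cst.
  by apply: Ck_sqrt => //; [exact: det_h | exact: Ck_det].
have jy := trans_img sN ov.
have hu := metric_unit rh jy; have dj := trans_oriented oN ov.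
rewrite /lee pullZ (@hodge_pull R 6 1 _ _ _ hu dj) -(metric_trans rh ov) (@pull_wedge R 7 7 3 3).
by rewrite -(fT'.1.2 i j y ov) -(fomega.1.2 i j y ov).
Qed.

(** Once the exterior derivative has become [torsion_ext], both sides are natural, and in an adapted
    frame the equation is [g2_lee]. *)
Lemma slice_integrable : g2_integrable h omega.
Proof.
exists lee; first exact: lee_form.
move=> c y iy; have oi := @sa_img _ _ _ sN c; rewrite slice_star //.
have [L [[oL dL] h1 h2 [al [la [mu h3]]]]] := slice_adapted iy.
have Lu : L \in unitmx by rewrite unitmxE unitfE gt_eqF.
have hu : h c y \in unitmx := metric_unit rh iy.
have aP : alternating (Psi c y) := fPsi.2 c y iy.
have dE : ext_deriv (star3 h omega) c y = (\sum_a wedge (delta_form a) (act (skewc (h c) (T' c) y a) (Psi c y)) : cov R 7 (1 + 4)).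
  apply/ffunP => I; rewrite ffunE -ext_wedge => [|a]; last exact: alternating_act.
  apply: eq_bigr => p _; congr (_ * _); rewrite -((parallelE h T' Psi).1 Psip c y iy).
  by apply: near_eq_derive; apply: (open_near oi iy) => z iz; rewrite slice_star.
have -> : ext_deriv (star3 h omega) c y = torsion_ext (T' c y) (invmx (h c y)) (Psi c y) :> cov R 7 (1 + 4).
  rewrite dE; under eq_bigr do rewrite skewc_split actDl wedgeDr.
  rewrite big_split /= sym_wedge_act ?add0r // => a b d.
  apply: (koszul_sym _ _ _ oi iy) => z iz.
  have hh := metric_sym rh iz.
  exact: hh.
have pinj (s t : cov R 7 (1 + 4)) : pull L s = pull L t -> s = t.
  by move=> e; rewrite -[LHS]pull1 -[RHS]pull1 -(mulVmx Lu) -!pull_comp e.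
apply: pinj; rewrite (torsion_ext_pull _ _ hu oL) h3 h2 g2_lee.
rewrite (@pull_wedge R 7 7 1 4) h2 /lee pullZ (@hodge_pull R 6 1 L (h c y) _ hu dL) oL (@pull_wedge R 7 7 3 3) h3 h1.
by [].
Qed.

Lemma slice_isometric : isometric g (prod_metric line_metric h : metric (prod_atlas (line : atlas R 1) N)).
Proof.
have sL : smooth_atlas (prod_atlas (line : atlas R 1) N) := smooth_prod smooth_line sN.
have hd := manifold_hausdorff om.
exists (@split_map R 7 M sM g rg hcomplete f fs fu p0 normal_levi_civita), (@join_map R 7 M g f p0); split.
- exact: split_mapK.
- exact: join_mapK.
- by apply: (@smooth_mapP R 8 M (prod_atlas (line : atlas R 1) N)) => // k p; exact: (@split_smooth R 7 M sM hd g rg hcomplete f fs fu p0 frames normal_levi_civita k p).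
- by apply: (@smooth_mapP R 8 (prod_atlas (line : atlas R 1) N) M) => // k p; exact: (@join_smooth R 7 M sM hd g rg hcomplete f fs fu p0 frames normal_levi_civita k p).
move=> i j x [p [ip jp] <-].
have cp : cinv i (cmap i p) = p := sa_cmapK sM ip.
apply: (@split_metric R 7 M sM hd g rg hcomplete f fs fu p0 frames normal_levi_civita i j (cmap i p)); first by exists p.
by rewrite cp.
Qed.

End Assembly.

Theorem theorem6p8 (R : realType) (M : atlas R 8) (g : metric M)
    (Phi : tensor M 4) (T : tensor M 3)
    (hM : spin7_manifold g Phi)
    (hcomplete : complete_metric g)
    (hsc : @simply_connected R M)
    (hT : characteristic_torsion g Phi T)
    (hT_parallel : parallel (skew_connection g T) T)
    (hT_nonzero : exists i x, img i x /\ T i x <> 0)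
    (hiso : iso_eq_u2 g Phi T)
    (htype : torsion_typeII g Phi T) :
  exists (N : atlas R 7) (h : metric N) (omega : tensor N 3),
    [/\ g2_manifold h omega,
        g2_integrable h omega,
        (exists T' : tensor N 3,
           [/\ characteristic_torsion h omega T',
               parallel (skew_connection h T') T' &
               holonomy_in_u2 h omega (skew_connection h T')])
      & isometric g (prod_metric line_metric h : metric (prod_atlas line N))].
Proof.
(* The point where the torsion is non-zero serves as base point: the potential is normalised to 0
   there, which gives the slice a point. *)
have [a1 [a2 [b1 [b1_gt0 htyp]]]] := htype; have [i0 [x0 [_ _]]] := hT_nonzero.
have [om rg _] := hM; have sM := oriented_smooth om.
have [f [f0 pf]] := @global_potential R 8 M sM g rg T hT.1 hT_parallel
  (fun i x ix => kernel_line hiso b1_gt0 htyp ix) hsc (cinv i0 x0).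
pose p0 : @slice R 7 M f := SigSub (mem_set f0).
exists (slice_atlas p0), (@slice_metric R 7 M g f p0), (@slice_tensor R 7 M f p0 3 (@contract R 7 M g f 3 Phi)); split.
- exact: (slice_g2 hM hiso b1_gt0 htyp pf).
- exact: (slice_integrable hM hT hT_parallel hiso b1_gt0 htyp pf).
- exists (@slice_tensor R 7 M f p0 3 T); split.
  + exact: (slice_characteristic hM hT hT_parallel hiso b1_gt0 htyp pf).
  + exact: (slice_torsion_parallel hM hT hT_parallel hiso b1_gt0 htyp pf).
  exact: (slice_holonomy hM hT hT_parallel hiso b1_gt0 htyp pf).
exact: (slice_isometric hM hcomplete hT hT_parallel hiso b1_gt0 htyp pf).
Qed.
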